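(* The $\mathbb{Z}^2\times\mathbb{Z}/(q-1)\mathbb{Z}$-graded algebra $\widetilde{\mathcal{M}}$ has dimension five over $\mathbb{T}_{>0}$ and $$\widetilde{\mathcal{M}}=\mathcal{M}[E,\boldsymbol{E}].$$ Moreover, the following inclusions hold, implying that $\mathcal{M}$ has dimension three over $\mathbb{T}_{>0}$: $$\mathbb{T}_{>0}[g,h,\boldsymbol s_2]\subset\mathcal{M}\subset\mathbb{T}_{>0}[g,h,\boldsymbol s_2,\boldsymbol s_2^{-1}].$$
   Context: Basic setting. Let $q=p^e$ be a power of a prime $p$, $A=\mathbb{F}_q[\theta]$, $K=\mathbb{F}_q(\theta)$, $|x|=q^{\deg_\theta x}$ on $K$, $K_\infty=\mathbb{F}_q((1/\theta))$, $C$ the completion of an algebraic closure of $K_\infty$. Let $\Omega=C\setminus K_\infty$ and $\Gamma=\mathbf{GL}_2(A)$ (determinant in $\mathbb{F}_q^*$), acting on $\Omega$ by $\gamma(z)=\frac{az+b}{cz+d}$. Let $e_{\mathrm{Car}}(z)=\sum_{i\ge0}z^{q^i}/d_i$ with $d_0=1$, $d_i=[i][i-1]^q\cdots[1]^{q^{i-1}}$, $[i]=\theta^{q^i}-\theta$ (Carlitz exponential); fix $\tilde\pi$ with $\ker e_{\mathrm{Car}}=\tilde\pi A$; put $u=u(z)=1/e_{\mathrm{Car}}(\tilde\pi z)$. A Drinfeld modular form of weight $w\ge 0$ and type $m\in\mathbb{Z}/(q-1)\mathbb{Z}$ is a rigid analytic $f:\Omega\to C$ with $f(\gamma(z))=(cz+d)^w(\det\gamma)^{-m}f(z)$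 for all $\gamma=\begin{pmatrix}a&b\\c&d\end{pmatrix}\in\Gamma$, holomorphic at infinity (i.e. $A$-periodic and equal to a convergent series $\sum_{n\ge0}f_nu^n$ for $|u(z)|$ small). Classical forms. For $z\in\Omega$ let $\Lambda_z=A+zA$ and $e_z=e_{\Lambda_z}$ its exponential function, $e_z(\zeta)=\zeta\prod_{0\ne\lambda\in\Lambda_z}(1-\zeta/\lambda)$. The associated Drinfeld module satisfies $\Phi_z(\theta)=\theta\tau^0+\tilde\pi^{q-1}g(z)\tau+\tilde\pi^{q^2-1}\Delta(z)\tau^2$ ($\tau:x\mapsto x^q$), which defines $g,\Delta$. The function $h$ is the unique Drinfeld modular form of weight $q+1$ and type $1$ with $u$-expansion $-u+\cdots$; one has $\Delta=-h^{q-1}$, and $h$ has no zeros on $\Omega$. The false Eisenstein series is $E(z)=\sum_{a\in A\text{ monic}}a\,u(az)$. Series. Let $t$ be an indeterminate; $\mathbb{T}_{>0}\subset C[[t]]$ is the $C$-algebra of series with positive convergence radius. For $f=\sum_i f_it^i\in C[[t]]$ and $k\in\mathbb{Z}$, $f^{(k)}=\sum_i f_i^{q^k}t^i$; for $\boldsymbol f:\Omega\to C[[t]]$, $\boldsymbol f^{(k)}(z)=\boldsymbol f(z)^{(k)}$, and $\boldsymbol f(z)$ is also written $\boldsymbol f(z,t)$. Put $$\boldsymbol s_{\mathrm{Car}}=\sum_{i\ge0}e_{\mathrm{Car}}(\tilde\pi/\theta^{i+1})t^i,\quad \boldsymbol s_1(z)=\sum_{i\ge0}e_z(z/\theta^{i+1})t^i,\quad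 \boldsymbol s_2(z)=\sum_{i\ge0}e_z(1/\theta^{i+1})t^i,$$ which are units in $\mathbb{T}_{>0}$. For $a=a(\theta)\in A$ write $\overline a=a(t)\in\mathbb{F}_q[t]$. For $\gamma=\begin{pmatrix}a&b\\c&d\end{pmatrix}\in\Gamma$ and $z\in\Omega$ let $$J_\gamma=cz+d,\quad \boldsymbol J_\gamma=\overline c\,\frac{\boldsymbol s_1}{\boldsymbol s_2}+\overline d,\quad L_\gamma=\frac{c}{cz+d},\quad \boldsymbol L_\gamma=\frac{\overline c}{(\theta-t)(\overline c\,\boldsymbol s_1+\overline d\,\boldsymbol s_2)}.$$ Define $\boldsymbol h=\tilde\pi h\boldsymbol s_2/\boldsymbol s_{\mathrm{Car}}$ and $\boldsymbol E=\boldsymbol h^{(1)}/\Delta$. Regular functions. $\boldsymbol f:\Omega\to C[[t]]$ is regular if: (1) there is $r>0$ such that for all $z\in\Omega$ the series $\boldsymbol f(z,t)$ converges at all $t_0\in C$, $|t_0|<r$; (2) there is $\varepsilon>0$ such that for all $t_0\in C$ with $|t_0|<\varepsilon$, $z\mapsto\boldsymbol f(z,t_0)$ is holomorphic on $\Omega$; (3) $\boldsymbol f(z+a)=\boldsymbol f(z)$ for all $a\in A$, and there is $c>0$ such that for $|u(z)|<c$ and $|t|<c$ there is a convergent expansion $\boldsymbol f(z,t)=\sum_{n,m\ge0}c_{n,m}t^nu^m$, $c_{n,m}\in C$. The set $\boldsymbol{\mathcal O}$ of regular functions is a $\mathbb{T}_{>0}$-algebra. Almost-$A$-quasi-modular forms.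 A regular $\boldsymbol f$ is an almost-$A$-quasi-modular form of weight $(\mu,\nu)\in\mathbb{Z}^2$, type $m\in\mathbb{Z}/(q-1)\mathbb{Z}$ and depth $\le l$ ($l\geq 0$) if there are regular functions $\boldsymbol f_{i,j}$ ($i,j\ge 0$, $i+j\le l$) such that for all $\gamma\in\Gamma$, $z\in\Omega$, $$\boldsymbol f(\gamma(z),t)=\det(\gamma)^{-m}J_\gamma^\mu\boldsymbol J_\gamma^\nu\sum_{i+j\le l}\boldsymbol f_{i,j}L_\gamma^i\boldsymbol L_\gamma^j.$$ $\widetilde{\mathcal M}$ denotes the $\mathbb{T}_{>0}$-algebra generated by all almost-$A$-quasi-modular forms; it is graded by $\mathbb{Z}^2\times\mathbb{Z}/(q-1)\mathbb{Z}$ via weight and type. $\mathcal M$ is its $\mathbb{T}_{>0}$-subalgebra generated by the almost-$A$-quasi-modular forms of depth $\le 0$. The dimension of such a $\mathbb{T}_{>0}$-algebra is the maximal number of elements algebraically independent over $\mathbb{T}_{>0}$. The algebras $\mathbb{T}_{>0}[g,h,\boldsymbol s_2]$ and $\mathbb{T}_{>0}[g,h,\boldsymbol s_2,\boldsymbol s_2^{-1}]$ are the $\mathbb{T}_{>0}$-algebras of functions $\Omega\to C[[t]]$ generated by the indicated functions. *)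

(* Defs.v *)
From HB Require Import structures.
From mathcomp Require Import all_boot all_order all_algebra finmap.
From mathcomp Require Import mathcomp_extra boolp classical_sets functions.
From mathcomp Require Import reals topology normedtype sequences.
From mathcomp Require mpoly.

Set Implicit Arguments.
Unset Strict Implicit.
Unset Printing Implicit Defensive.

Import Order.TTheory GRing.Theory Num.Theory.
Import numFieldNormedType.Exports.

Local Open Scope classical_set_scope.
Local Open Scope ring_scope.

Record fps (K : Type) := Fps { coef : nat -> K }.

HB.instance Definition _ (K : Type) := [isNew for @coef K].
HB.instance Definition _ (K : choiceType) := [Choice of fps K by <:].

Section FpsRing.
Variable K : comNzRingType.
Implicit Types f g h : fps K.

Lemma fpsP f g : coef f =1 coef g -> f = g.
Proof. by case: f g => [f] [g] /= /funext ->. Qed.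

Definition fps_zero : fps K := Fps (fun=> 0).
Definition fps_opp f : fps K := Fps (fun i => - coef f i).
Definition fps_add f g : fps K := Fps (fun i => coef f i + coef g i).

Lemma fps_addA : associative fps_add.
Proof. by move=> f g h; apply: fpsP => i /=; rewrite addrA. Qed.
Lemma fps_addC : commutative fps_add.
Proof. by move=> f g; apply: fpsP => i /=; rewrite addrC. Qed.
Lemma fps_add0 : left_id fps_zero fps_add.
Proof. by move=> f; apply: fpsP => i /=; rewrite add0r. Qed.
Lemma fps_addN : left_inverse fps_zero fps_opp fps_add.
Proof. by move=> f; apply: fpsP => i /=; rewrite addNr. Qed.

HB.instance Definition _ :=
  GRing.isZmodule.Build (fps K) fps_addA fps_addC fps_add0 fps_addN.

Definition fps_of_poly (p : {poly K}) : fps K := Fps (fun i => p`_i).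
Definition fps_const (c : K) : fps K := fps_of_poly c%:P.
Definition fps_mul f g : fps K :=
  Fps (fun n => \sum_(i < n.+1) coef f i * coef g (n - i)).

Let trunc n f : {poly K} := \poly_(i < n) coef f i.

Let trunc_coef n f i : (i < n)%N -> (trunc n f)`_i = coef f i.
Proof. by move=> i_n; rewrite /trunc coef_poly i_n. Qed.

Let fps_mulE f g k n :
  (k < n)%N -> coef (fps_mul f g) k = (trunc n f * trunc n g)`_k.
Proof.
move=> kn; rewrite coefM; apply: eq_bigr => i _.
have ik : (i <= k)%N by rewrite -ltnS.
rewrite (trunc_coef f (leq_ltn_trans ik kn)).
by rewrite (trunc_coef g (leq_ltn_trans (leq_subr i k) kn)).
Qed.

Lemma fps_mulC : commutative fps_mul.
Proof. by move=> f g; apply: fpsP => n; rewrite !(fps_mulE _ _ (ltnSn n)) mulrC. Qed.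

Lemma fps_mulA : associative fps_mul.
Proof.
move=> f g h; apply: fpsP => n.
transitivity ((trunc n.+1 f * trunc n.+1 g * trunc n.+1 h)`_n).
  rewrite -mulrA coefM; apply: eq_bigr => i _.
  by rewrite (trunc_coef f (ltn_ord i)) -fps_mulE // ltnS leq_subr.
rewrite coefM; apply: eq_bigr => i _.
by rewrite -(fps_mulE f g (ltn_ord i)) trunc_coef // ltnS leq_subr.
Qed.

Lemma fps_mul1 : left_id (fps_const 1) fps_mul.
Proof.
move=> f; apply: fpsP => n /=; rewrite big_ord_recl /= coefC eqxx mul1r subn0.
by rewrite big1 ?addr0 // => i _; rewrite coefC /= mul0r.
Qed.

Lemma fps_mulDl : left_distributive fps_mul fps_add.
Proof.
move=> f g h; apply: fpsP => n /=; rewrite -big_split /=.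
by apply: eq_bigr => i _; rewrite mulrDl.
Qed.

Lemma fps_one_neq0 : fps_const 1 != 0 :> fps K.
Proof.
by apply/eqP => /(congr1 (fun f => coef f 0%N)) /= /eqP; rewrite coefC oner_eq0.
Qed.

HB.instance Definition _ := GRing.Zmodule_isComNzRing.Build (fps K)
  fps_mulA fps_mulC fps_mul1 fps_mulDl fps_one_neq0.

Definition fps_unit : pred (fps K) := fun f => `[< exists g, g * f = 1 >].
Definition fps_inv f : fps K := xget f [set g | g * f = 1].

Lemma fps_mulV : {in fps_unit, left_inverse 1 fps_inv *%R}.
Proof.
by move=> f /asboolP [g gf]; rewrite /fps_inv; case: xgetP => // /(_ g); case.
Qed.
Lemma fps_unitP f g : g * f = 1 -> fps_unit f.
Proof. by move=> gf; apply/asboolP; exists g. Qed.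
Lemma fps_inv_out : {in [predC fps_unit], fps_inv =1 id}.
Proof.
move=> f /= /negP nu; rewrite /fps_inv; case: xgetP => // g _ gf.
by exfalso; apply: nu; apply: fps_unitP gf.
Qed.

HB.instance Definition _ := GRing.ComNzRing_hasMulInverse.Build (fps K)
  fps_mulV fps_unitP fps_inv_out.

End FpsRing.

Section Convergence.
Variables (R : realType) (K : fieldType) (abs : K -> R).

Definition cvg_to (a : nat -> K) (l : K) : Prop :=
  abs (a n - l) @[n --> \oo] --> (0 : R).

Definition cauchy_seq (a : nat -> K) : Prop :=
  forall e : R, 0 < e ->
    exists N, forall m n, (N <= m)%N -> (N <= n)%N -> abs (a m - a n) < e.

Definition series_to (a : nat -> K) (s : K) : Prop :=
  cvg_to (fun n => \sum_(i < n) a i) s.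

(* convergence along the finite subsets of I ordered by inclusion *)
Definition net_to (I : choiceType) (a : {fset I} -> K) (l : K) : Prop :=
  forall e : R, 0 < e -> exists J0 : {fset I},
    forall J : {fset I}, (J0 `<=` J)%fset -> abs (a J - l) < e.

Definition usum_to (I : choiceType) (a : I -> K) : K -> Prop :=
  net_to (fun J : {fset I} => \sum_(i <- J) a i).
Definition uprod_to (I : choiceType) (a : I -> K) : K -> Prop :=
  net_to (fun J : {fset I} => \prod_(i <- J) a i).

(* These values are 0 when there is no limit. *)
Definition series_lim (a : nat -> K) : K := xget 0 [set s | series_to a s].
Definition usum (I : choiceType) (a : I -> K) : K := xget 0 [set s | usum_to a s].
Definition uprod (I : choiceType) (a : I -> K) : K := xget 0 [set s | uprod_to a s].

End Convergence.

Section LaurentSeries.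
Variables (F : finFieldType) (R : realType) (K : fieldType) (abs : K -> R).
Variable iota : {rmorphism {poly F} -> K}.

(* F((1/theta)), where theta is the image of 'X *)
Definition laurent : set K := [set x | exists (N : nat) (c : nat -> F),
  series_to abs (fun i => iota (c i)%:P * iota 'X ^+ N / iota 'X ^+ i) x].

Definition algebraic_laurent : set K := [set x |
  exists p : {poly K}, [/\ p != 0, forall i, laurent p`_i & root p x]].

End LaurentSeries.

(* The elements algebraic over F((1/theta)) form an algebraically closed     *)
(* dense subfield of the complete field C; this determines C up to isometric *)
(* isomorphism.                                                              *)
Record cinf (F : finFieldType) (R : realType) := Cinf {
  cinf_field :> fieldType;
  absC : cinf_field -> R;
  embA : {rmorphism {poly F} -> cinf_field};
  abs_ge0 : forall x, 0 <= absC x;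
  abs_eq0 : forall x, absC x = 0 -> x = 0;
  absM : forall x y, absC (x * y) = absC x * absC y;
  abs_ultra : forall x y, absC (x + y) <= Num.max (absC x) (absC y);
  abs_embA : forall a, a != 0 -> absC (embA a) = #|F|%:R ^+ (size a).-1;
  cinf_complete : forall a : nat -> cinf_field,
    cauchy_seq absC a -> exists l, cvg_to absC a l;
  cinf_alg_closed : forall p : {poly cinf_field},
    (forall i, algebraic_laurent absC embA p`_i) -> (1 < size p)%N ->
    exists2 x, root p x & algebraic_laurent absC embA x;
  cinf_alg_dense : forall (x : cinf_field) (e : R), 0 < e ->
    exists2 y, algebraic_laurent absC embA y & absC (x - y) < e
}.
Arguments absC {F R c} x.
Arguments embA {F R c}.

Section DrinfeldForms.
Variables (F : finFieldType) (R : realType) (C : cinf F R).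

Local Notation A := {poly F}.
Local Notation q := (#|F|).
Local Notation inA := (@embA F R C).

Definition theta : C := inA 'X.
Definition Kinf : set C := laurent absC inA.
Definition Omega : set C := ~` Kinf.

(* Z/(q-1)Z; 'Z_(q.-1) would be wrong for q = 2 *)
Definition typeZ := 'I_(q.-2.+1).

Definition GL2A : set 'M[A]_2 := [set gam | gam \in unitmx].
Definition J (gam : 'M[A]_2) (z : Omega) : C := inA (gam 1 0) * val z + inA (gam 1 1).

(* The default value of insubd is never used for gam in GL2A, *)
(* nor in the translations below.                              *)
Definition mob (gam : 'M[A]_2) (z : Omega) : Omega :=
  insubd z ((inA (gam 0 0) * val z + inA (gam 0 1)) / J gam z).
Definition translate (z : Omega) (a : A) : Omega := insubd z (val z + inA a).

(* The sets Omega_n form the usual admissible covering of Omega by affinoids: *)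
(* f is rigid analytic on Omega iff on each of them it is a uniform limit of  *)
(* rational functions without poles.                                          *)
Definition Omega_ (n : nat) : set C := [set z |
  absC z <= q%:R ^+ n /\ forall x, Kinf x -> q%:R ^- n <= absC (z - x)].
Definition rigid_analytic (f : Omega -> C) : Prop :=
  forall (n : nat) (e : R), 0 < e -> exists P Q : {poly C},
    (forall z, Omega_ n z -> Q.[z] != 0) /\
    (forall z : Omega, Omega_ n (val z) ->
       absC (f z - P.[val z] / Q.[val z]) < e).

Definition brk (i : nat) : C := theta ^+ (q ^ i) - theta.
Definition carlitz_d (i : nat) : C := \prod_(j < i) brk (i - j) ^+ (q ^ j).
Definition eCar (z : C) : C :=
  series_lim absC (fun i => z ^+ (q ^ i) / carlitz_d i).
Definition carlitz_period (pi : C) : Prop :=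
  [set z | eCar z = 0] = [set pi * inA a | a in [set: A]].

Definition lattice (z : C) : set C :=
  [set inA a + z * inA b | a in [set: A] & b in [set: A]].
Definition elat (z zeta : C) : C :=
  zeta * uprod absC (fun l : lattice z `\ 0 => 1 - zeta / val l).

Variable pi : C.

Definition u (z : C) : C := (eCar (pi * z))^-1.

Definition u_expansion (f : Omega -> C) (c : nat -> C) : Prop :=
  exists2 r : R, 0 < r & forall z : Omega, absC (u (val z)) < r ->
    series_to absC (fun n => c n * u (val z) ^+ n) (f z).

Definition drinfeld_modular_form (w : nat) (m : typeZ) (f : Omega -> C) : Prop :=
  [/\ rigid_analytic f,
      forall gam (z : Omega), GL2A gam ->
        f (mob gam z) = J gam z ^+ w * inA (\det gam) ^- m * f z,
      forall z a, f (translate z a) = f z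
    & exists c, u_expansion f c].

(* e_z(theta zeta) = Phi_z(theta)(e_z(zeta)) *)
Definition drinfeld_module_coeffs (g Delta : Omega -> C) : Prop :=
  forall (z : Omega) (zeta : C),
    elat (val z) (theta * zeta) =
    theta * elat (val z) zeta
    + pi ^+ q.-1 * g z * elat (val z) zeta ^+ q
    + pi ^+ (q ^ 2).-1 * Delta z * elat (val z) zeta ^+ (q ^ 2).

Definition is_h (h : Omega -> C) : Prop :=
  drinfeld_modular_form q.+1 (inZp 1) h /\
  exists c, [/\ u_expansion h c, c 0%N = 0 & c 1%N = -1].

Definition false_eisenstein (z : Omega) : C :=
  usum absC (fun a : [set a : A | a \is monic] =>
              inA (val a) * u (inA (val a) * val z)).

Definition Tpos : set (fps C) := [set f | exists2 r : R, 0 < r &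
  forall t0 : C, absC t0 < r -> exists s, series_to absC (fun i => coef f i * t0 ^+ i) s].
Definition fps_eval (f : fps C) (t0 : C) : C :=
  series_lim absC (fun i => coef f i * t0 ^+ i).
Definition twist (k : nat) (f : fps C) : fps C := Fps (fun i => coef f i ^+ (q ^ k)).

Definition sCar : fps C := Fps (fun i => eCar (pi / theta ^+ i.+1)).
Definition s1 (z : Omega) : fps C :=
  Fps (fun i => elat (val z) (val z / theta ^+ i.+1)).
Definition s2 (z : Omega) : fps C := Fps (fun i => elat (val z) (1 / theta ^+ i.+1)).

(* a(t) *)
Definition bar (a : A) : fps C := fps_of_poly (map_poly (inA \o polyC) a).

Definition bJ (gam : 'M[A]_2) (z : Omega) : fps C :=
  bar (gam 1 0) * (s1 z / s2 z) + bar (gam 1 1).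
Definition L (gam : 'M[A]_2) (z : Omega) : C := inA (gam 1 0) / J gam z.
Definition bL (gam : 'M[A]_2) (z : Omega) : fps C :=
  bar (gam 1 0) / (fps_of_poly (theta%:P - 'X)
                  * (bar (gam 1 0) * s1 z + bar (gam 1 1) * s2 z)).

Definition bh (h : Omega -> C) (z : Omega) : fps C :=
  fps_const (pi * h z) * s2 z / sCar.
Definition bE (h Delta : Omega -> C) (z : Omega) : fps C :=
  twist 1 (bh h z) / fps_const (Delta z).

Definition regular (f : Omega -> fps C) : Prop :=
  [/\ exists2 r : R, 0 < r & forall (z : Omega) (t0 : C), absC t0 < r ->
        exists s, series_to absC (fun i => coef (f z) i * t0 ^+ i) s,
      exists2 eps : R, 0 < eps & forall t0 : C, absC t0 < eps ->
        rigid_analytic (fun z => fps_eval (f z) t0),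
      forall z a, f (translate z a) = f z
    & exists2 r : R, 0 < r & exists c : nat -> nat -> C,
        forall (z : Omega) (t0 : C), absC (u (val z)) < r -> absC t0 < r ->
          usum_to absC (fun nm : nat * nat => c nm.1 nm.2 * t0 ^+ nm.1 * u (val z) ^+ nm.2)
            (fps_eval (f z) t0)].

Definition almost_A_quasi_modular (mu nu : int) (m : typeZ) (l : nat)
    (f : Omega -> fps C) : Prop :=
  regular f /\
  exists fij : nat -> nat -> Omega -> fps C,
    (forall i j, (i + j <= l)%N -> regular (fij i j)) /\
    forall gam (z : Omega), GL2A gam ->
      f (mob gam z) =
      fps_const (inA (\det gam) ^- m) * fps_const (J gam z ^ mu) * bJ gam z ^ nu
      * \sum_(i < l.+1) \sum_(j < l.+1 | (i + j <= l)%N)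
          fij i j z * fps_const (L gam z ^+ i) * bL gam z ^+ j.

Local Notation fct := (Omega -> fps C).

Definition subalgebra (B : set fct) : Prop :=
  [/\ forall c, Tpos c -> B (fun=> c),
      forall f g, B f -> B g -> B (f + g)
    & forall f g, B f -> B g -> B (f * g)].
Definition generated (S : set fct) : set fct := smallest subalgebra S.

Definition Mtilde : set fct := generated
  [set f | exists mu nu m l, almost_A_quasi_modular mu nu m l f].
Definition Mcal : set fct := generated
  [set f | exists mu nu m, almost_A_quasi_modular mu nu m 0 f].

Definition weight_type_piece (k : int * int * typeZ) : set fct :=
  [set f | exists l, almost_A_quasi_modular k.1.1 k.1.2 k.2 l f].

Definition graded_by (G : zmodType) (V : G -> set fct) (B : set fct) : Prop :=
  [/\ forall k, V k `<=` B,
      forall c, Tpos c -> V 0 (fun=> c),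
      forall k f g, V k f -> V k g -> V k (f + g),
      forall k k' f g, V k f -> V k' g -> V (k + k') (f * g)
    & (forall f, B f -> exists (s : seq G) (phi : G -> fct),
         (forall k, V k (phi k)) /\ f = \sum_(k <- s) phi k) /\
      (forall (s : seq G) (phi : G -> fct), uniq s ->
         (forall k, V k (phi k)) -> \sum_(k <- s) phi k = 0 ->
         forall k, k \in s -> phi k = 0)].

Definition alg_independent (n : nat) (f : 'I_n -> fct) : Prop :=
  forall P : mpoly.mpoly n (fps C),
    (forall m, Tpos (mpoly.mcoeff m P)) ->
    (forall z, mpoly.meval (fun i => f i z) P = 0) -> P = mpoly.mpolyC n 0.

Definition has_dimension (B : set fct) (d : nat) : Prop :=
  (exists f : 'I_d -> fct, (forall i, B (f i)) /\ alg_independent f) /\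
  (forall n (f : 'I_n -> fct),
     (forall i, B (f i)) -> alg_independent f -> (n <= d)%N).

End DrinfeldForms.

Arguments Omega {F R} C.
Arguments s2 {F R C} z.

(* Main.v *)
From HB Require Import structures.
From mathcomp Require Import all_boot all_order all_algebra all_field finmap.
From mathcomp Require Import mathcomp_extra boolp classical_sets functions.
From mathcomp Require Import reals topology normedtype sequences.
From mathcomp Require Import fingroup pgroup abelian.
From mathcomp Require Import separable.
From mathcomp Require mpoly.
From mathcomp Require Import zify ring lra.
Require Import Defs.

Set Implicit Arguments.
Unset Strict Implicit.
Unset Printing Implicit Defensive.

Import Order.TTheory GRing.Theory Num.Theory.
Import numFieldNormedType.Exports.

Local Open Scope classical_set_scope.
Local Open Scope ring_scope.

(** The core is a vanishing theorem in depth 0, which takes the place of the valence formula. The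
    set [vertex c s] is the affinoid over a vertex of the Bruhat-Tits tree, and the maximum of |f|
    on it is a norm. For a linear factor z - r the (q+1)-st power of this norm is at most the
    product of its norms at the q + 1 neighbours, with equality when r is a pole outside the region
    considered. Hence log |f| is subharmonic along the tree ([star_fun]). Modulo GL_2(A) the tree
    folds onto the half line of vertices |z| = q^n: all inner neighbours of a vertex are equivalent
    to the preceding vertex, and those of vertex 0 to vertex 1. For a form of weight w this yields a
    quantity that is nondecreasing along the half line. A zero of order k at infinity makes f decay
    like |u|^k, and if w < k(q+1) the monotone quantity tends to 0, so f = 0 ([vanishing]). For
    fixed small t, a depth 0 form of weight (mu, nu) divided by s_2^nu behaves like a form of weight
    mu + nu, because s_2 has weight (-1, 1) and |s_2| is constant at the points far from K_infinity
    ([vanish0]).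

    Depth 0 forms are then known. Diagonal and scalar matrices tie the order at infinity to the type
    and the weight to twice the type modulo q - 1. So for nu >= 0 the leading term of f can be
    cancelled by a multiple of s_2^nu g^a h^k, and [vanish0] stops the process ([elim]). For nu < 0
    one multiplies by a power of s_2. The same argument gives Delta = kappa h^(q-1) ([Delta_h]).

    The analytic input is the exponential e_z, a limit of polynomials of finite F_q-spaces, which is
    a product in the exponential of A and hence a power series in u ([elat_expansion]). It provides
    regularity and u-expansions of g, Delta and s_2. The law of E comes from exchanging the two
    summations in a finite double sum ([U2_inv]) and from generators of GL_2(A). The law of bE comes
    from a Legendre relation: h (s_1 tw(s_2) - tw(s_1) s_2) / s_Car, with tw the Frobenius twist, is
    invariant under GL_2(A), and each of its coefficients satisfies x^q = alpha x, so takes finitely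
    many values and is constant ([legendre_const]).

    In positive depth the tool is linear independence: for matrices with lower row (c, c e + 1) the
    values of c and e at theta and at t can be varied independently, so polynomials in L and bL
    times distinct automorphy factors have no relations ([indep]). This gives the directness of the
    grading and the uniqueness of the coefficients f_ij. Combined with the cocycle relations it
    shows that the coefficients of top degree are themselves of depth 0 ([top_law]). Subtracting
    them times E^i bE^j lowers the depth ([depth_reduce]), whence the generation by E and bE over M.

    For the dimensions, [indep] and [dens2] separate weights and the powers of E and bE, while
    orders at infinity separate the remaining monomials in g, h, s_2 ([mono_indep]). Conversely,
    with more functions than generators a count of monomials produces a relation ([dim_le]), the
    inverse of s_2 being absorbed in a common denominator. *)

(** * The ultrametric absolute value on C, and Frobenius *)

Section Ultrametric.
Variables (F : finFieldType) (R : realType) (C : cinf F R).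
Local Notation ab := (@absC F R C).
Local Notation q := (#|F|).
Local Notation inA := (@embA F R C).
Local Notation theta := (@theta F R C).
Implicit Types x y z : C.

Lemma card_F_gt1 : (1 < q)%N.
Proof. exact: finRing_gt1. Qed.

Lemma qR_gt1 : 1 < q%:R :> R.
Proof. by rewrite ltr1n card_F_gt1. Qed.

Lemma qR_gt0 : 0 < q%:R :> R.
Proof. exact: lt_trans ltr01 qR_gt1. Qed.

Lemma ab_theta : ab theta = q%:R.
Proof. by rewrite abs_embA ?polyX_eq0 // size_polyX. Qed.

(** The axioms only say that |x| = 0 forces x = 0. The converse comes from |0| |theta| = |0| and
    |theta| = q > 1. *)
Lemma ab0 : ab 0 = 0.
Proof.
have /eqP : ab 0 * (ab theta - 1) = 0.
  rewrite mulrBr mulr1 -absM mul0r subrr //.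
rewrite mulf_eq0 => /orP[/eqP//|].
by rewrite ab_theta subr_eq0 gt_eqF // qR_gt1.
Qed.

Lemma ab_eq0 x : (ab x == 0) = (x == 0).
Proof. by apply/eqP/eqP => [/abs_eq0|->]//; exact: ab0. Qed.

Lemma ab_gt0 x : (0 < ab x) = (x != 0).
Proof. by rewrite lt_def ab_eq0 abs_ge0 andbT. Qed.

Lemma ab1 : ab 1 = 1.
Proof.
have h : ab 1 != 0 by rewrite ab_eq0 oner_eq0.
by apply: (mulfI h); rewrite -absM !mulr1.
Qed.

Lemma abX x n : ab (x ^+ n) = ab x ^+ n.
Proof. by elim: n => [|n IH]; rewrite ?expr0 ?ab1 // !exprS absM IH. Qed.

Lemma abV x : ab x^-1 = (ab x)^-1.
Proof.
have [->|x0] := eqVneq x 0; first by rewrite invr0 ab0 invr0.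
have h : ab x != 0 by rewrite ab_eq0.
by apply: (mulfI h); rewrite -absM !divff // ab1.
Qed.

Lemma abf_div x y : ab (x / y) = ab x / ab y.
Proof. by rewrite absM abV. Qed.

Lemma abN x : ab (- x) = ab x.
Proof.
suff e : ab (-1) = 1 by rewrite -mulN1r absM e mul1r.
have /eqP : ab (-1) ^+ 2 = 1 by rewrite -abX sqrrN expr1n ab1.
rewrite sqrf_eq1 => /orP[/eqP//|/eqP e].
by have := abs_ge0 (-1 : C); rewrite e lerNr oppr0 ler10.
Qed.

Lemma ab_subC x y : ab (x - y) = ab (y - x).
Proof. by rewrite -abN opprB. Qed.

Lemma ab_prod I (r : seq I) (P : pred I) (f : I -> C) :
  ab (\prod_(i <- r | P i) f i) = \prod_(i <- r | P i) ab (f i).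
Proof. by elim/big_rec2: _ => [|i a b _ <-]; rewrite ?ab1 // absM. Qed.

Lemma abD_le M x y : ab x <= M -> ab y <= M -> ab (x + y) <= M.
Proof. by move=> hx hy; rewrite (le_trans (abs_ultra x y)) // ge_max hx. Qed.

Lemma abB_le M x y : ab x <= M -> ab y <= M -> ab (x - y) <= M.
Proof. by move=> hx hy; apply: abD_le; rewrite ?abN. Qed.

Lemma abD_lt M x y : ab x < M -> ab y < M -> ab (x + y) < M.
Proof. by move=> hx hy; rewrite (le_lt_trans (abs_ultra x y)) // gt_max hx. Qed.

Lemma abB_lt M x y : ab x < M -> ab y < M -> ab (x - y) < M.
Proof. by move=> hx hy; apply: abD_lt; rewrite ?abN. Qed.

Lemma abD_l x y : ab y < ab x -> ab (x + y) = ab x.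
Proof.
move=> xy; apply/eqP; rewrite eq_le; apply/andP; split.
  by apply: abD_le => //; exact: ltW.
rewrite leNgt; apply/negP => h.
have : ab x < ab x by rewrite -{1}(addrK y x); apply: abB_lt.
by rewrite ltxx.
Qed.

Lemma abD_r x y : ab x < ab y -> ab (x + y) = ab y.
Proof. by rewrite addrC; exact: abD_l. Qed.

Lemma abB_l x y : ab y < ab x -> ab (x - y) = ab x.
Proof. by move=> h; rewrite abD_l // abN. Qed.

Lemma abB_r x y : ab x < ab y -> ab (x - y) = ab y.
Proof. by move=> h; rewrite ab_subC abB_l. Qed.

(** The device by which approximations below transfer absolute values exactly and not only up to an
    error. *)
Lemma ab_near x y : ab (x - y) < ab x -> ab y = ab x.
Proof. by move=> h; rewrite -[in RHS](abB_l h) opprB addrC subrK. Qed.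

Lemma ab_sum_le M I (r : seq I) (P : pred I) (f : I -> C) : 0 <= M ->
  (forall i, P i -> ab (f i) <= M) -> ab (\sum_(i <- r | P i) f i) <= M.
Proof.
move=> M0 h; elim/big_rec: _ => [|i x Pi hx]; rewrite ?ab0 //.
by apply: abD_le => //; exact: h.
Qed.

Lemma ab_sum_lt M I (r : seq I) (P : pred I) (f : I -> C) : 0 < M ->
  (forall i, P i -> ab (f i) < M) -> ab (\sum_(i <- r | P i) f i) < M.
Proof.
move=> M0 h; elim/big_rec: _ => [|i x Pi hx]; rewrite ?ab0 //.
by apply: abD_lt => //; exact: h.
Qed.

Lemma ab_const (c : F) : c != 0 -> ab (inA c%:P) = 1.
Proof. by move=> c0; rewrite abs_embA ?polyC_eq0 // size_polyC c0 expr0. Qed.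

Lemma ab_const_le1 (c : F) : ab (inA c%:P) <= 1.
Proof.
have [->|c0] := eqVneq c 0; first by rewrite polyC0 rmorph0 ab0.
by rewrite ab_const.
Qed.

Lemma inA_eq0 (a : {poly F}) : (inA a == 0) = (a == 0).
Proof.
apply/eqP/eqP => [e|->]; last exact: rmorph0.
apply/eqP; apply/negPn/negP => a0.
by have := abs_embA C a0; rewrite e ab0 => /eqP; rewrite lt_eqF // exprn_gt0 ?qR_gt0.
Qed.

Lemma inA_inj : injective inA.
Proof.
by move=> a b e; apply/eqP; rewrite -subr_eq0 -inA_eq0 rmorphB /= e subrr.
Qed.

Lemma theta_neq0 : theta != 0.
Proof. by rewrite inA_eq0 polyX_eq0. Qed.

Lemma ab_inA_ge1 (a : {poly F}) : a != 0 -> 1 <= ab (inA a).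
Proof. by move=> a0; rewrite abs_embA // exprn_ege1 // ltW // qR_gt1. Qed.

Lemma ab_inA_lt (a : {poly F}) n : (ab (inA a) < q%:R ^+ n) = (size a <= n)%N.
Proof.
have [->|a0] := eqVneq a 0.
  by rewrite rmorph0 ab0 exprn_gt0 ?qR_gt0 // size_poly0.
rewrite abs_embA // ltr_eXn2l ?qR_gt1 // -ltnS prednK //.
by rewrite lt0n size_poly_eq0.
Qed.

Lemma ab_inA_lt1 (a : {poly F}) : ab (inA a) < 1 -> a = 0.
Proof.
by move=> h; apply/eqP; rewrite -size_poly_leq0 -ab_inA_lt expr0.
Qed.

Lemma ab_inA_leq (a : {poly F}) n : (ab (inA a) <= q%:R ^+ n) = (size a <= n.+1)%N.
Proof.
have [->|a0] := eqVneq a 0.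
  by rewrite rmorph0 ab0 exprn_ge0 ?size_poly0 // ltW // qR_gt0.
rewrite abs_embA // ler_eXn2l ?qR_gt1 // -ltnS prednK //.
by rewrite lt0n size_poly_eq0.
Qed.

(** The additive group of F is an elementary abelian p-group, so q is a power of p, and [embA]
    carries the characteristic to C. *)
Lemma q_pchar_nat : exists2 p, p \in [pchar C] & p.-nat q.
Proof.
have qgt1 := card_F_gt1; have pr_p : prime (pdiv q) by exact: pdiv_prime.
have := abelem_pgroup (finField_is_abelem F).
rewrite /pgroup cardsT => pq; exists (pdiv q) => //.
have [k qk] := p_natP pq.
have := card_finPcharP qk pr_p; rewrite !inE => /andP[-> /eqP e] /=.
have : inA ((pdiv q)%:R)%:P = 0 by rewrite e polyC0 rmorph0.
by rewrite !rmorph_nat => ->.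
Qed.

Lemma frobD n x y : (x + y) ^+ (q ^ n) = x ^+ (q ^ n) + y ^+ (q ^ n).
Proof.
have [p pC pq] := q_pchar_nat; apply: exprDn_pchar.
rewrite (eq_pnat _ (pcharf_eq pC)); by rewrite pnatX pq.
Qed.

End Ultrametric.

(** * Limits and series in a complete ultrametric field *)

Section Limits.
Variables (F : finFieldType) (R : realType) (C : cinf F R).
Local Notation ab := (@absC F R C).
Local Notation q := (#|F|).
Local Notation "a ~> l" := (cvg_to ab a l) (at level 70).
Implicit Types x y z l : C.
Implicit Types a b : nat -> C.

Lemma cvgP a l : a ~> l <->
  forall e : R, 0 < e -> exists N, forall n, (N <= n)%N -> ab (a n - l) < e.
Proof.
split => [h e e0 | h].
  have /cvgrPdist_lt /(_ e e0) := h => -[N _ hN].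
  by exists N => n /hN /=; rewrite sub0r normrN ger0_norm // abs_ge0.
apply/cvgrPdist_lt => e e0; have [N hN] := h e e0.
by exists N => // n /= /hN; rewrite sub0r normrN ger0_norm // abs_ge0.
Qed.

Lemma lim_cst x : (fun=> x) ~> x.
Proof. by apply/cvgP => e e0; exists 0%N => n _; rewrite subrr ab0. Qed.

Lemma lim_uniq a l l' : a ~> l -> a ~> l' -> l = l'.
Proof.
move=> /cvgP h /cvgP h'; apply/eqP; rewrite -subr_eq0; apply/negPn/negP.
rewrite -ab_gt0 => e0; have [N hN] := h _ e0; have [N' hN'] := h' _ e0.
have h1 := hN _ (leq_maxl N N'); have h2 := hN' _ (leq_maxr N N').
suff : ab (l - l') < ab (l - l') by rewrite ltxx.
rewrite -{1}(subrKA (a (maxn N N'))); apply: abD_lt => //.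
by rewrite [ab (l - a _)]ab_subC.
Qed.

Lemma lim_ext N a b l : (forall n, (N <= n)%N -> a n = b n) -> a ~> l -> b ~> l.
Proof.
move=> ab_ /cvgP h; apply/cvgP => e e0; have [N' hN] := h e e0.
exists (maxn N N') => n; rewrite geq_max => /andP[n1 n2].
by rewrite -ab_ //; exact: hN.
Qed.

Lemma limD a b l m : a ~> l -> b ~> m -> (fun n => a n + b n) ~> l + m.
Proof.
move=> /cvgP ha /cvgP hb; apply/cvgP => e e0.
have [N hN] := ha e e0; have [M hM] := hb e e0.
exists (maxn N M) => n; rewrite geq_max => /andP[n1 n2].
by rewrite opprD addrACA; apply: abD_lt; [exact: hN | exact: hM].
Qed.

Lemma lim_bounded a l : a ~> l ->
  exists2 M : R, 0 < M & exists N, forall n, (N <= n)%N -> ab (a n) <= M.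
Proof.
move=> /cvgP /(_ 1 ltr01) [N hN]; exists (Num.max 1 (ab l)).
  by rewrite lt_max ltr01.
exists N => n /hN h; rewrite -(subrK l (a n)); apply: abD_le.
  by rewrite le_max ltW.
by rewrite le_max lexx orbT.
Qed.

Lemma limM a b l m : a ~> l -> b ~> m -> (fun n => a n * b n) ~> l * m.
Proof.
move=> ha hb; have [M M0 [N1 h1]] := lim_bounded ha.
move/cvgP: ha => ha; move/cvgP: hb => hb; apply/cvgP => e e0.
pose M' := Num.max M (ab m); have M'0 : 0 < M' by rewrite lt_max M0.
have e'0 : 0 < e / M' by rewrite divr_gt0.
have [N hN] := ha _ e'0; have [N2 hM] := hb _ e'0.
exists (maxn N1 (maxn N N2)) => n; rewrite !geq_max => /and3P[n1 n2 n3].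
have -> : a n * b n - l * m = a n * (b n - m) + (a n - l) * m by ring.
have ea : ab (a n) <= M' by rewrite le_max h1.
apply: abD_lt; rewrite absM.
  apply: le_lt_trans (ler_wpM2r (abs_ge0 _) ea) _.
  by rewrite mulrC -ltr_pdivlMr // hM.
have em : ab m <= M' by rewrite le_max lexx orbT.
apply: le_lt_trans (ler_wpM2l (abs_ge0 _) em) _.
by rewrite -ltr_pdivlMr // hN.
Qed.

Lemma limZ c a l : a ~> l -> (fun n => c * a n) ~> c * l.
Proof. by move=> h; exact: limM (lim_cst c) h. Qed.

Lemma limN a l : a ~> l -> (fun n => - a n) ~> - l.
Proof.
move=> /cvgP h; apply/cvgP => e e0; have [N hN] := h e e0.
by exists N => n /hN; rewrite -opprD abN.
Qed.

Lemma limB a b l m : a ~> l -> b ~> m -> (fun n => a n - b n) ~> l - m.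
Proof. by move=> h h'; exact: limD h (limN h'). Qed.

Lemma limX k a l : a ~> l -> (fun n => a n ^+ k) ~> l ^+ k.
Proof.
move=> h; elim: k => [|k IH].
  by apply: lim_ext (lim_cst 1) => // n _; rewrite expr0.
rewrite exprS; apply: lim_ext (limM h IH) => // n _; rewrite exprS //.
Unshelve. all: exact: 0%N.
Qed.

Lemma lim_sum I (r : seq I) (f : I -> nat -> C) (l : I -> C) :
  (forall i, f i ~> l i) -> (fun n => \sum_(i <- r) f i n) ~> \sum_(i <- r) l i.
Proof.
move=> h; elim: r => [|i r IH].
  by rewrite big_nil; apply: (lim_ext (N := 0%N)) (lim_cst 0) => n _; rewrite big_nil.
rewrite big_cons; apply: (lim_ext (N := 0%N)) (limD (h i) IH) => n _.
by rewrite big_cons.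
Qed.

Lemma lim_prod I (r : seq I) (f : I -> nat -> C) (l : I -> C) :
  (forall i, f i ~> l i) -> (fun n => \prod_(i <- r) f i n) ~> \prod_(i <- r) l i.
Proof.
move=> h; elim: r => [|i r IH].
  by rewrite big_nil; apply: (lim_ext (N := 0%N)) (lim_cst 1) => n _; rewrite big_nil.
rewrite big_cons; apply: (lim_ext (N := 0%N)) (limM (h i) IH) => n _.
by rewrite big_cons.
Qed.

Lemma lim_ab a l : l != 0 -> a ~> l ->
  exists N, forall n, (N <= n)%N -> ab (a n) = ab l.
Proof.
rewrite -ab_gt0 => l0 /cvgP /(_ _ l0) [N hN]; exists N => n /hN h.
by apply: ab_near; rewrite ab_subC.
Qed.

Lemma limV a l : l != 0 -> a ~> l -> (fun n => (a n)^-1) ~> l^-1.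
Proof.
move=> l0 h; have [N hN] := lim_ab l0 h; have lp : 0 < ab l by rewrite ab_gt0.
move/cvgP: h => h; apply/cvgP => e e0.
have [|N' hN'] := h (e * (ab l * ab l)); first by rewrite !mulr_gt0.
exists (maxn N N') => n; rewrite geq_max => /andP[n1 n2].
have an0 : a n != 0 by rewrite -ab_gt0 hN.
have -> : (a n)^-1 - l^-1 = - (a n - l) / (a n * l) by field; rewrite an0 l0.
by rewrite abf_div abN absM hN // ltr_pdivrMr ?mulr_gt0 // hN'.
Qed.

Lemma lim_le_ab N (M : R) a l : (forall n, (N <= n)%N -> ab (a n) <= M) ->
  a ~> l -> ab l <= M.
Proof.
move=> h al; have [->|l0] := eqVneq l 0.
  by rewrite ab0 (le_trans (abs_ge0 _) (h _ (leqnn N))).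
have [N' hN'] := lim_ab l0 al.
by rewrite -(hN' _ (leq_maxr N N')) h // leq_maxl.
Qed.

Lemma lim_near_le N (M : R) a l x : (forall n, (N <= n)%N -> ab (a n - x) <= M) ->
  a ~> l -> ab (l - x) <= M.
Proof. by move=> h al; exact: lim_le_ab h (limB al (lim_cst x)). Qed.

Lemma lim_ge_ab N (M : R) a l : 0 < M ->
  (forall n, (N <= n)%N -> M <= ab (a n)) -> a ~> l -> M <= ab l.
Proof.
move=> M0 h al; have [e|l0] := eqVneq l 0.
  move/cvgP: al => /(_ M M0) [N' hN'].
  have := hN' _ (leq_maxr N N'); rewrite e subr0 ltNge h //; exact: leq_maxl.
have [N' hN'] := lim_ab l0 al.
by rewrite -(hN' _ (leq_maxr N N')) h // leq_maxl.
Qed.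

Lemma lim_subseq (k : nat -> nat) a l : (forall n, (n <= k n)%N) ->
  a ~> l -> (fun n => a (k n)) ~> l.
Proof.
move=> kn /cvgP h; apply/cvgP => e e0; have [N hN] := h e e0.
by exists N => n Nn; apply: hN; exact: leq_trans (kn n).
Qed.

(** Ultrametrically, small consecutive differences already make a sequence Cauchy. Hence a series
    converges as soon as its terms tend to 0 ([series_ex]). *)
Lemma lim_cauchy a :
  (forall e : R, 0 < e -> exists N, forall n, (N <= n)%N -> ab (a n.+1 - a n) < e) ->
  exists l, a ~> l.
Proof.
move=> h; apply: cinf_complete => e e0; have [N hN] := h e e0; exists N.
have H m : (N <= m)%N -> ab (a m - a N) < e.
  elim: m => [|m IH]; first by rewrite leqn0 => /eqP <-; rewrite subrr ab0.
  rewrite leq_eqVlt => /orP[/eqP <-|]; first by rewrite subrr ab0.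
  rewrite ltnS => Nm; rewrite -(subrKA (a m)); apply: abD_lt; first exact: hN.
  exact: IH.
move=> m n Nm Nn; rewrite -(subrKA (a N)); apply: abD_lt; first exact: H.
by rewrite ab_subC; exact: H.
Qed.

Lemma series_ex a : a ~> 0 -> exists s, series_to ab a s.
Proof.
move=> /cvgP h; apply: lim_cauchy => e e0; have [N hN] := h e e0.
by exists N => n /hN; rewrite subr0 big_ord_recr /= [_ + a n]addrC addrK.
Qed.

Lemma series_null a s : series_to ab a s -> a ~> 0.
Proof.
move=> h; have := limB (lim_subseq (k := S) leqnSn h) h; rewrite subrr.
by apply: (lim_ext (N := 0%N)) => n _; rewrite big_ord_recr /= [_ + a n]addrC addrK.
Qed.

Lemma series_uniq a s s' : series_to ab a s -> series_to ab a s' -> s = s'.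
Proof. exact: lim_uniq. Qed.

Lemma series_limE a s : series_to ab a s -> series_lim ab a = s.
Proof.
move=> h; rewrite /series_lim; case: xgetP => [x _ hx|/(_ s)//].
exact: series_uniq hx h.
Qed.

Lemma series_tail N (M : R) a s : 0 <= M -> (forall n, (N <= n)%N -> ab (a n) <= M) ->
  series_to ab a s -> ab (s - \sum_(i < N) a i) <= M.
Proof.
move=> M0 h; apply: (lim_near_le (N := N)) => n Nn.
rewrite -!(big_mkord xpredT a) (big_cat_nat _ (n := N)) //= [X in ab X]addrAC subrr add0r.
rewrite big_nat_cond; apply: ab_sum_le => // i /andP[/andP[]] /h //.
Qed.

Lemma series_le (M : R) a s : 0 <= M -> (forall n, ab (a n) <= M) ->
  series_to ab a s -> ab s <= M.
Proof.
move=> M0 h sa; have := @series_tail 0%N M a s M0 (fun n _ => h n) sa.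
by rewrite big_ord0 subr0.
Qed.

Lemma series_head a s : (forall n, (0 < n)%N -> a n = 0) -> s = a 0%N ->
  series_to ab a s.
Proof.
move=> h ->; apply: (lim_ext (N := 1%N)) (lim_cst (a 0%N)) => -[//|n] _.
by rewrite big_ord_recl /= big1 ?addr0 // => i _; exact: h.
Qed.

Lemma geo_null (r : R) : 0 <= r -> r < 1 -> forall e : R, 0 < e ->
  exists N, forall n, (N <= n)%N -> r ^+ n < e.
Proof.
move=> r0 r1 e e0; have := @cvg_expr R r; rewrite ger0_norm // => /(_ r1).
move=> /cvgrPdist_lt /(_ e e0) [N _ hN]; exists N => n /hN /=.
by rewrite sub0r normrN ger0_norm // exprn_ge0.
Qed.

Lemma lim0_geo (M r : R) a : 0 <= r -> r < 1 ->
  (forall n, ab (a n) <= M * r ^+ n) -> a ~> 0.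
Proof.
move=> r0 r1 h; apply/cvgP => e e0.
have M0 : 0 < Num.max 1 M by rewrite lt_max ltr01.
have [N hN] := geo_null r0 r1 (divr_gt0 e0 M0); exists N => n /hN lt.
rewrite subr0; apply: le_lt_trans (h n) _.
apply: (@le_lt_trans _ _ (Num.max 1 M * r ^+ n)).
  by apply: ler_wpM2r; rewrite ?exprn_ge0 // le_max lexx orbT.
by rewrite mulrC -ltr_pdivlMr.
Qed.

Lemma qpow_small (e : R) : 0 < e -> exists n, (q%:R ^+ n)^-1 < e.
Proof.
move=> e0; have q1 := qR_gt1 F R; have q0 := qR_gt0 F R.
have h1 : 0 <= (q%:R^-1 : R) by rewrite invr_ge0 ltW.
have h2 : (q%:R^-1 : R) < 1 by rewrite invf_lt1.
have [N hN] := geo_null h1 h2 e0.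
by exists N; rewrite -exprVn; exact: hN.
Qed.

Lemma qpow_large (M : R) : exists n, M < q%:R ^+ n.
Proof.
have q0 := qR_gt0 F R.
have M1 : 0 < Num.max 1 M by rewrite lt_max ltr01.
have [|n hn] := qpow_small (_ : 0 < (Num.max 1 M)^-1); first by rewrite invr_gt0.
exists n; move: hn; rewrite ltf_pV2 ?posrE ?exprn_gt0 //.
by apply: le_lt_trans; rewrite le_max lexx orbT.
Qed.

Lemma ab_ex_small (e : R) : 0 < e -> exists2 t : C, t != 0 & ab t < e.
Proof.
move=> /qpow_small [n hn]; exists ((theta C ^+ n)^-1).
  by rewrite invr_eq0 expf_eq0 (negbTE (theta_neq0 C)) andbF.
by rewrite abV abX ab_theta.
Qed.

Lemma ab_le_eps x : (forall e : R, 0 < e -> ab x <= e) -> x = 0.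
Proof.
move=> h; apply/eqP/negPn/negP; rewrite -ab_gt0 => x0.
have := h (ab x / 2); rewrite divr_gt0 // => /(_ isT); lra.
Qed.

End Limits.

(** * Formal power series over a ring and over a field *)

Section FpsRing.
Variable K : comNzRingType.
Implicit Types f g : fps K.

Lemma fcoefD f g n : coef (f + g) n = coef f n + coef g n. Proof. by []. Qed.
Lemma fcoefN f n : coef (- f) n = - coef f n. Proof. by []. Qed.
Lemma fcoefB f g n : coef (f - g) n = coef f n - coef g n. Proof. by []. Qed.
Lemma fcoef0 n : coef (0 : fps K) n = 0. Proof. by []. Qed.
Lemma fcoefM f g n : coef (f * g) n = \sum_(i < n.+1) coef f i * coef g (n - i).
Proof. by []. Qed.

Lemma fcoefM0 f g : coef (f * g) 0%N = coef f 0%N * coef g 0%N.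
Proof. by rewrite fcoefM big_ord1. Qed.

Lemma fcoef_sum I (r : seq I) (P : pred I) (f : I -> fps K) n :
  coef (\sum_(i <- r | P i) f i) n = \sum_(i <- r | P i) coef (f i) n.
Proof. by elim/big_rec2: _ => // i a b _ <-. Qed.

Lemma fps_of_poly_is_zmod_morphism : zmod_morphism (@fps_of_poly K).
Proof. by move=> p p'; apply: fpsP => i; rewrite fcoefB /= coefB. Qed.
Lemma fps_of_poly_is_monoid_morphism : monoid_morphism (@fps_of_poly K).
Proof. by split=> // p p'; apply: fpsP => i; rewrite fcoefM /= coefM. Qed.
HB.instance Definition _ := GRing.isZmodMorphism.Build {poly K} (fps K)
  (@fps_of_poly K) fps_of_poly_is_zmod_morphism.
HB.instance Definition _ := GRing.isMonoidMorphism.Build {poly K} (fps K)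
  (@fps_of_poly K) fps_of_poly_is_monoid_morphism.

Lemma fps_const_is_zmod_morphism : zmod_morphism (@fps_const K).
Proof. by move=> a b; rewrite /fps_const !rmorphB. Qed.
Lemma fps_const_is_monoid_morphism : monoid_morphism (@fps_const K).
Proof. by split=> [|a b]; rewrite /fps_const ?rmorph1 // !rmorphM. Qed.
HB.instance Definition _ := GRing.isZmodMorphism.Build K (fps K)
  (@fps_const K) fps_const_is_zmod_morphism.
HB.instance Definition _ := GRing.isMonoidMorphism.Build K (fps K)
  (@fps_const K) fps_const_is_monoid_morphism.

Lemma coef_const (c : K) n : coef (fps_const c) n = if n == 0%N then c else 0.
Proof. by rewrite /fps_const /= coefC. Qed.

Lemma coef_constM (c : K) f n : coef (fps_const c * f) n = c * coef f n.
Proof.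
rewrite fcoefM big_ord_recl /= coefC /= subn0 big1 ?addr0 // => i _.
by rewrite coefC mul0r.
Qed.

Lemma fps_const_inj : injective (@fps_const K).
Proof. by move=> a b /(congr1 (fun f => coef f 0%N)); rewrite !coef_const. Qed.

Definition fX : fps K := fps_of_poly 'X.

Lemma coefXnM k f n :
  coef (fX ^+ k * f) n = if (n < k)%N then 0 else coef f (n - k).
Proof.
have -> : fX ^+ k = fps_of_poly 'X^k by rewrite rmorphXn.
rewrite fcoefM; under eq_bigr => i _ do rewrite /= coefXn mulr_natl mulrb.
rewrite -big_mkcond /=; case: ltnP => nk.
  rewrite big_pred0 // => i; apply/negbTE; rewrite neq_ltn.
  by rewrite (leq_ltn_trans _ nk) // -ltnS.
have kn' : (k < n.+1)%N by [].
by rewrite (big_pred1 (Ordinal kn')).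
Qed.

Lemma fX_div k f : (forall i, (i < k)%N -> coef f i = 0) ->
  f = fX ^+ k * Fps (fun i => coef f (i + k)).
Proof.
move=> h; apply: fpsP => n; rewrite coefXnM /=.
by case: ltnP => [/h//|kn]; rewrite subnK.
Qed.

End FpsRing.

Section FpsField.
Variable K : fieldType.
Implicit Types f g : fps K.

(** Each coefficient of the inverse uses all previous ones, so a growing prefix is computed;
    [coef_recip] recovers the recursion. *)
Fixpoint inv_coefs f n : seq K := if n is m.+1 then
  let s := inv_coefs f m in
  rcons s ((coef f 0)^-1 * ((m == 0)%:R - \sum_(i < m) coef f (m - i) * s`_i))
  else [::].

Lemma size_inv_coefs f n : size (inv_coefs f n) = n.
Proof. by elim: n => //= n IH; rewrite size_rcons IH. Qed.

Lemma inv_coefs_nth f n m i : (i < n)%N -> (n <= m)%N ->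
  (inv_coefs f m)`_i = (inv_coefs f n)`_i.
Proof.
move=> i_n; elim: m => [|m IH]; first by rewrite leqn0 => /eqP n0; rewrite n0 in i_n.
rewrite leq_eqVlt => /orP[/eqP->//|]; rewrite ltnS => nm /=.
by rewrite nth_rcons size_inv_coefs (leq_trans i_n nm) IH.
Qed.

Definition fps_recip f : fps K := Fps (fun n => (inv_coefs f n.+1)`_n).

Lemma coef_recip f n : coef (fps_recip f) n =
  (coef f 0)^-1 * ((n == 0)%:R - \sum_(i < n) coef f (n - i) * coef (fps_recip f) i).
Proof.
rewrite /fps_recip /= nth_rcons size_inv_coefs ltnn eqxx; congr (_ * (_ - _)).
apply: eq_bigr => i _; congr (_ * _).
by rewrite (@inv_coefs_nth f i.+1 n i) //=.
Qed.

Lemma fps_recipP f : coef f 0%N != 0 -> fps_recip f * f = 1.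
Proof.
move=> f0; have := coef_recip f; move: (fps_recip f) => g gE.
apply: fpsP => n; rewrite fcoefM big_ord_recr /= subnn.
rewrite [coef g n]gE mulrAC mulVf // mul1r.
under eq_bigr => i _ do rewrite mulrC.
by rewrite addrC subrK coefC; case: eqP.
Qed.

Lemma fps_unitE f : (f \is a GRing.unit) = (coef f 0%N != 0).
Proof.
apply/idP/idP => [fu|/fps_recipP h]; last by apply/unitrPr; exists (fps_recip f); rewrite mulrC.
apply/eqP => f0; have := congr1 (fun f => coef f 0%N) (mulVr fu).
by rewrite /= big_ord1 subnn f0 mulr0 coefC /= => /eqP; rewrite eq_sym oner_eq0.
Qed.

Lemma fps_recipE f : coef f 0%N != 0 -> f^-1 = fps_recip f.
Proof.
move=> f0; have fu : f \is a GRing.unit by rewrite fps_unitE.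
by rewrite -[RHS](mulrK fu) fps_recipP // mul1r.
Qed.

Lemma coef0V f : coef f^-1 0%N = (coef f 0%N)^-1.
Proof.
have [f0|f0] := eqVneq (coef f 0%N) 0.
  by rewrite invr_out ?fps_unitE f0 ?invr0 // eqxx.
by rewrite fps_recipE // coef_recip /= big_ord0 subr0 mulr1.
Qed.

Lemma fps_neq0_lead f : f != 0 ->
  exists n, coef f n != 0 /\ forall i, (i < n)%N -> coef f i = 0.
Proof.
move=> f0; have ex : exists n, coef f n != 0.
  apply/not_existsP => h; move/eqP: f0; apply; apply: fpsP => n.
  by apply/eqP/negPn/negP; exact: h.
case: (ex_minnP ex) => n n0 hn; exists n; split=> // i i_n.
by apply/eqP/negPn/negP => /hn; rewrite leqNgt i_n.
Qed.

(** The lowest nonzero coefficients of two series multiply to a nonzero coefficient of the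
    product. *)
Lemma fps_mulf_eq0 f g : f * g = 0 -> (f == 0) || (g == 0).
Proof.
move=> fg; apply/orP; have [_|/fps_neq0_lead[n [fn hn]]] := eqVneq f 0; first by left.
have [_|/fps_neq0_lead[m [gm hm]]] := eqVneq g 0; [by right | exfalso].
have := congr1 (fun f => coef f (n + m)%N) fg; rewrite /=.
have nm : (n < (n + m).+1)%N by rewrite ltnS leq_addr.
rewrite (bigD1 (Ordinal nm)) //= addKn big1 ?addr0 => [/eqP|i].
  by rewrite mulf_eq0 (negbTE fn) (negbTE gm).
rewrite -val_eqE /= neq_ltn => /orP[i_n|n_i]; first by rewrite hn ?mul0r.
rewrite hm ?mulr0 //; have := ltn_ord i; lia.
Qed.

HB.instance Definition _ := GRing.ComUnitRing_isIntegral.Build (fps K) fps_mulf_eq0.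

Lemma fps_const_unit (c : K) : c != 0 -> fps_const c \is a GRing.unit.
Proof. by rewrite fps_unitE coef_const. Qed.

Lemma fps_constV (c : K) : fps_const c^-1 = (fps_const c)^-1.
Proof.
have [->|c0] := eqVneq c 0; first by rewrite invr0 !rmorph0 invr0.
by rewrite fmorphV.
Qed.

End FpsField.

(** * Geometric bounds and evaluation of convergent series *)

Section Tpos.
Variables (F : finFieldType) (R : realType) (C : cinf F R).
Local Notation ab := (@absC F R C).
Local Notation "a ~> l" := (cvg_to ab a l) (at level 70).
Implicit Types (f g : fps C) (t : C) (M r : R).

(** Here r is an inverse radius: the series converges where |t| r < 1, a larger r is a weaker
    condition, and domains are always written [ab t * r < 1]. *)
Definition bnd M r f := forall n, ab (coef f n) <= M * r ^+ n.
Definition cvf r f := exists2 M, 0 <= M & bnd M r f.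

Lemma bnd_le M M' r r' f : 0 <= r -> 0 <= M -> M <= M' -> r <= r' ->
  bnd M r f -> bnd M' r' f.
Proof.
move=> r0 M0 MM rr h n; apply: le_trans (h n) _.
apply: ler_pM => //; first exact: exprn_ge0.
by rewrite lerXn2r // nnegrE // (le_trans r0).
Qed.

Lemma bnd_leM M M' r f : 0 <= r -> M <= M' -> bnd M r f -> bnd M' r f.
Proof.
move=> r0 MM h n; apply: le_trans (h n) _.
by rewrite ler_wpM2r // exprn_ge0.
Qed.

Lemma bnd0 M r : 0 <= M -> 0 <= r -> bnd M r 0.
Proof. by move=> M0 r0 n; rewrite ab0 mulr_ge0 ?exprn_ge0. Qed.

Lemma bndD M r f g : bnd M r f -> bnd M r g -> bnd M r (f + g).
Proof. by move=> hf hg n; apply: abD_le. Qed.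

Lemma bndN M r f : bnd M r f -> bnd M r (- f).
Proof. by move=> hf n; rewrite fcoefN abN. Qed.

Lemma bndB M r f g : bnd M r f -> bnd M r g -> bnd M r (f - g).
Proof. by move=> hf hg; apply: bndD => //; exact: bndN. Qed.

Lemma bnd_sum M r I (s : seq I) (P : pred I) (f : I -> fps C) : 0 <= M -> 0 <= r ->
  (forall i, P i -> bnd M r (f i)) -> bnd M r (\sum_(i <- s | P i) f i).
Proof.
move=> M0 r0 h; elim/big_rec: _ => [|i x Pi hx]; first exact: bnd0.
by apply: bndD => //; exact: h.
Qed.

Lemma bndM M M' r f g : 0 <= M -> 0 <= M' -> 0 <= r ->
  bnd M r f -> bnd M' r g -> bnd (M * M') r (f * g).
Proof.
move=> M0 M'0 r0 hf hg n; rewrite fcoefM; apply: ab_sum_le.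
  by rewrite !mulr_ge0 ?exprn_ge0.
move=> i _; rewrite absM; have i_n : (i <= n)%N by rewrite -ltnS.
have -> : M * M' * r ^+ n = (M * r ^+ i) * (M' * r ^+ (n - i)).
  by rewrite mulrACA -exprD subnKC.
by apply: ler_pM; rewrite ?abs_ge0.
Qed.

Lemma bnd_const r c : 0 <= r -> bnd (ab c) r (fps_const c).
Proof.
move=> r0 n; rewrite coef_const; case: eqP => [->|_]; first by rewrite expr0 mulr1.
by rewrite ab0 mulr_ge0 ?abs_ge0 ?exprn_ge0.
Qed.

Lemma bnd1 r : 0 <= r -> bnd 1 r 1.
Proof. by move=> r0; rewrite -(ab1 C) -(rmorph1 (@fps_const C)); exact: bnd_const. Qed.

Lemma bndX r k f : 0 <= r -> bnd 1 r f -> bnd 1 r (f ^+ k).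
Proof.
move=> r0 h; elim: k => [|k IH]; first by rewrite expr0; exact: bnd1.
by rewrite exprS -(mulr1 (1 : R)); apply: bndM.
Qed.

Lemma bnd_prod r I (s : seq I) (P : pred I) (f : I -> fps C) : 0 <= r ->
  (forall i, P i -> bnd 1 r (f i)) -> bnd 1 r (\prod_(i <- s | P i) f i).
Proof.
move=> r0 h; elim/big_rec: _ => [|i x Pi hx]; first exact: bnd1.
by rewrite -(mulr1 (1 : R)); apply: bndM => //; exact: h.
Qed.

Lemma bnd_ge0 M r f : bnd M r f -> 0 <= M.
Proof. by move=> /(_ 0%N); rewrite expr0 mulr1; apply: le_trans; exact: abs_ge0. Qed.

Lemma cvf_bnd M r f : bnd M r f -> cvf r f.
Proof. by move=> h; exists M => //; exact: bnd_ge0 h. Qed.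

Lemma cvf_le r r' f : 0 <= r -> r <= r' -> cvf r f -> cvf r' f.
Proof. by move=> r0 rr [M M0 h]; exists M => //; exact: bnd_le h. Qed.

Lemma cvf_const r c : 0 <= r -> cvf r (fps_const c).
Proof. by move=> r0; exact: cvf_bnd (bnd_const _ r0). Qed.
Lemma cvf0 r : 0 <= r -> cvf r 0.
Proof. by move=> r0; exists 0 => //; exact: bnd0. Qed.
Lemma cvf1 r : 0 <= r -> cvf r 1.
Proof. by move=> r0; exact: cvf_bnd (bnd1 r0). Qed.
Lemma cvfN r f : cvf r f -> cvf r (- f).
Proof. by move=> [M M0 h]; exists M => //; exact: bndN. Qed.
Lemma cvfD r f g : 0 <= r -> cvf r f -> cvf r g -> cvf r (f + g).
Proof.
move=> r0 [M M0 h] [M' M'0 h']; apply: (@cvf_bnd (Num.max M M')).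
by apply: bndD; [apply: bnd_leM h | apply: bnd_leM h'] => //; rewrite le_max lexx ?orbT.
Qed.
Lemma cvfM r f g : 0 <= r -> cvf r f -> cvf r g -> cvf r (f * g).
Proof.
move=> r0 [M M0 h] [M' M'0 h']; apply: (@cvf_bnd (M * M')); exact: bndM.
Qed.
Lemma cvfX r k f : 0 <= r -> cvf r f -> cvf r (f ^+ k).
Proof.
move=> r0 h; elim: k => [|k IH]; first by rewrite expr0; exact: cvf1.
by rewrite exprS; exact: cvfM.
Qed.
Lemma cvf_sum r I (s : seq I) (P : pred I) (f : I -> fps C) : 0 <= r ->
  (forall i, P i -> cvf r (f i)) -> cvf r (\sum_(i <- s | P i) f i).
Proof.
move=> r0 h; elim/big_rec: _ => [|i x Pi hx]; first exact: cvf0.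
by apply: cvfD => //; exact: h.
Qed.

(** With this normalisation the constant term dominates, and the ultrametric recursion for the
    inverse keeps the same r. *)
Lemma bnd_recip r f : 0 <= r -> coef f 0%N != 0 ->
  (forall n, (0 < n)%N -> ab (coef f n) <= ab (coef f 0%N) * r ^+ n) ->
  bnd (ab (coef f 0%N))^-1 r f^-1.
Proof.
move=> r0 f0 h n; rewrite fps_recipE //; elim/ltn_ind: n => n IH.
have f0' : 0 < ab (coef f 0%N) by rewrite ab_gt0.
rewrite coef_recip absM abV; apply: ler_wpM2l; first by rewrite invr_ge0 abs_ge0.
apply: abB_le.
  by case: eqP => [->|_]; rewrite ?ab1 ?expr0 // ab0 exprn_ge0.
apply: ab_sum_le => [|i _]; first exact: exprn_ge0.
rewrite absM; apply: le_trans (ler_pM _ _ (h (n - i)%N _) (IH i _)) _;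
  rewrite ?abs_ge0 ?subn_gt0 //.
by rewrite mulrACA divff ?gt_eqF // mul1r -exprD subnK // ltnW.
Qed.

(** The constant M can be absorbed into r because the new bound concerns only n > 0. *)
Lemma cvf_scale r f : 0 <= r -> cvf r f -> coef f 0%N != 0 ->
  exists2 r', r <= r' &
  (forall n, (0 < n)%N -> ab (coef f n) <= ab (coef f 0%N) * r' ^+ n).
Proof.
move=> r0 [M M0 h] f0; have f0' : 0 < ab (coef f 0%N) by rewrite ab_gt0.
pose m := Num.max 1 (M / ab (coef f 0%N)); have m1 : 1 <= m by rewrite le_max lexx.
have m0 : 0 <= m by rewrite (le_trans ler01).
exists (m * r); first by rewrite ler_peMl.
move=> n n0; apply: le_trans (h n) _; rewrite exprMn mulrA.
apply: ler_wpM2r; first exact: exprn_ge0.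
rewrite mulrC -ler_pdivrMr // -[X in X <= _](expr1 _).
apply: (@le_trans _ _ (m ^+ 1)); first by rewrite !expr1 le_max lexx orbT.
exact: ler_weXn2l.
Qed.

Lemma cvfV r f : 0 <= r -> cvf r f -> coef f 0%N != 0 ->
  exists2 r', r <= r' & cvf r' f^-1.
Proof.
move=> r0 h f0; have [r' rr h'] := cvf_scale r0 h f0; exists r' => //.
have r'0 : 0 <= r' by exact: le_trans rr.
exact: cvf_bnd (bnd_recip r'0 f0 h').
Qed.

Lemma series_bnd M r f t : 0 <= r -> ab t * r < 1 -> bnd M r f ->
  series_to ab (fun i => coef f i * t ^+ i) (fps_eval f t).
Proof.
move=> r0 tr h.
have [s hs] : exists s, series_to ab (fun i => coef f i * t ^+ i) s.
  apply: series_ex; apply: (@lim0_geo _ _ C M (ab t * r)) => //.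
    by rewrite mulr_ge0 ?abs_ge0.
  move=> n; rewrite absM abX exprMn [M * _]mulrCA [ab (coef f n) * _]mulrC.
  by apply: ler_wpM2l (h n); rewrite exprn_ge0 ?abs_ge0.
by rewrite /fps_eval (series_limE hs).
Qed.

Lemma series_cvf r f t : 0 <= r -> ab t * r < 1 -> cvf r f ->
  series_to ab (fun i => coef f i * t ^+ i) (fps_eval f t).
Proof. by move=> r0 tr [M _ h]; exact: series_bnd h. Qed.

Lemma ab_eval M r f t : 0 <= r -> ab t * r < 1 -> bnd M r f -> ab (fps_eval f t) <= M.
Proof.
move=> r0 tr h; have M0 := bnd_ge0 h.
apply: series_le (series_bnd r0 tr h) => // n.
rewrite absM abX; apply: le_trans (ler_wpM2r (exprn_ge0 _ (abs_ge0 _)) (h n)) _.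
rewrite -mulrA -exprMn -[leRHS]mulr1 ler_wpM2l // exprn_ile1 //.
  by rewrite mulr_ge0 ?abs_ge0.
by rewrite mulrC ltW.
Qed.

Lemma evalD r f g t : 0 <= r -> ab t * r < 1 -> cvf r f -> cvf r g ->
  fps_eval (f + g) t = fps_eval f t + fps_eval g t.
Proof.
move=> r0 tr hf hg; apply: series_limE.
apply: (lim_ext (N := 0%N)) (limD (series_cvf r0 tr hf) (series_cvf r0 tr hg)) => n _.
by rewrite -big_split; apply: eq_bigr => i _; rewrite fcoefD mulrDl.
Qed.

Lemma eval_const c t : fps_eval (fps_const c) t = c.
Proof.
apply: series_limE; apply: series_head; last by rewrite coef_const expr0 mulr1.
by move=> n n0; rewrite coef_const gtn_eqF // mul0r.
Qed.

Lemma eval0 t : fps_eval 0 t = 0.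
Proof. by rewrite -(rmorph0 (@fps_const C)) eval_const. Qed.
Lemma eval1 t : fps_eval 1 t = 1.
Proof. by rewrite -(rmorph1 (@fps_const C)) eval_const. Qed.

Lemma eval_at0 f : fps_eval f 0 = coef f 0%N.
Proof.
apply: series_limE; apply: series_head; last by rewrite expr0 mulr1.
by move=> n n0; rewrite expr0n gtn_eqF // mulr0.
Qed.

Lemma evalM r f g t : 0 <= r -> ab t * r < 1 -> cvf r f -> cvf r g ->
  fps_eval (f * g) t = fps_eval f t * fps_eval g t.
Proof.
move=> r0 tr hf hg; have hfg := cvfM r0 hf hg.
have Lf := series_cvf r0 tr hf; have Lg := series_cvf r0 tr hg.
have Lfg := series_cvf r0 tr hfg.
apply: (lim_uniq Lfg); rewrite -[fps_eval f t * _]addr0.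
pose tr_ N (a : fps C) := \poly_(i < N) coef a i.
have trE N a : \sum_(i < N) coef a i * t ^+ i = (tr_ N a).[t] by rewrite horner_poly.
(* [d N] has no coefficient of index below N, so its value at t is at most Mf Mg (|t| r)^N. *)
pose d N := tr_ N (f * g) - tr_ N f * tr_ N g.
apply: (lim_ext (N := 0%N) (a := fun N => (tr_ N f).[t] * (tr_ N g).[t] + (d N).[t])).
  by move=> n _; rewrite /d hornerD hornerN hornerM addrC subrK trE.
apply: limD.
  by apply: (lim_ext (N := 0%N)) (limM Lf Lg) => n _; rewrite !trE.
have [Mf Mf0 bf] := hf; have [Mg Mg0 bg] := hg.
apply: (@lim0_geo _ _ C (Mf * Mg) (ab t * r)) => //; first by rewrite mulr_ge0 ?abs_ge0.
move=> N; rewrite horner_coef.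
have P0 : 0 <= Mf * Mg * (ab t * r) ^+ N.
  by apply: mulr_ge0; [exact: mulr_ge0 | rewrite exprn_ge0 // mulr_ge0 ?abs_ge0].
apply: ab_sum_le => // k _; have [kN|Nk] := ltnP k N.
  suff -> : (d N)`_k = 0 by rewrite mul0r ab0.
  rewrite /d coefB [in X in _ - X]coefM coef_poly kN fcoefM.
  apply/eqP; rewrite subr_eq0; apply/eqP; apply: eq_bigr => i _.
  have ik : (i <= k)%N by rewrite -ltnS.
  by rewrite !coef_poly (leq_ltn_trans (leq_subr _ _) kN) (leq_ltn_trans ik kN).
have dk : ab (d N)`_k <= Mf * Mg * r ^+ k.
  rewrite /d coefB [in X in _ - X]coefM coef_poly ltnNge Nk /= sub0r abN.
  apply: ab_sum_le => [|i _]; first by rewrite !mulr_ge0 ?exprn_ge0.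
  have e0 a (x : nat) (M : R) : 0 <= M -> bnd M r a -> ab (tr_ N a)`_x <= M * r ^+ x.
    move=> M0 ha; rewrite coef_poly; case: ifP => _ //.
    by rewrite ab0 mulr_ge0 ?exprn_ge0.
  have ik : (i <= k)%N by rewrite -ltnS.
  have -> : Mf * Mg * r ^+ k = (Mf * r ^+ i) * (Mg * r ^+ (k - i)).
    by rewrite mulrACA -exprD subnKC.
  rewrite absM.
  by apply: ler_pM; rewrite ?abs_ge0 //; exact: e0.
apply: (@le_trans _ _ (Mf * Mg * (ab t * r) ^+ k)).
  rewrite absM abX exprMn [_ ^+ k * r ^+ k]mulrC mulrA.
  by apply: ler_wpM2r => //; rewrite exprn_ge0 ?abs_ge0.
apply: ler_wpM2l; first by rewrite mulr_ge0.
by apply: ler_wiXn2l => //; rewrite ?mulr_ge0 ?abs_ge0 // ltW.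
Qed.

Lemma evalN r f t : 0 <= r -> ab t * r < 1 -> cvf r f ->
  fps_eval (- f) t = - fps_eval f t.
Proof.
move=> r0 tr hf; rewrite -mulN1r -(rmorph1 (@fps_const C)) -rmorphN.
by rewrite (evalM r0 tr (cvf_const _ r0) hf) eval_const mulN1r.
Qed.

Lemma evalB r f g t : 0 <= r -> ab t * r < 1 -> cvf r f -> cvf r g ->
  fps_eval (f - g) t = fps_eval f t - fps_eval g t.
Proof. by move=> r0 tr hf hg; rewrite (evalD r0 tr hf (cvfN hg)) (evalN r0). Qed.

Lemma evalX r f k t : 0 <= r -> ab t * r < 1 -> cvf r f ->
  fps_eval (f ^+ k) t = fps_eval f t ^+ k.
Proof.
move=> r0 tr hf; elim: k => [|k IH]; first by rewrite !expr0 eval1.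
by rewrite !exprS (evalM r0 tr hf (cvfX _ r0 hf)) IH.
Qed.

Lemma eval_sum r I (s : seq I) (P : pred I) (f : I -> fps C) t :
  0 <= r -> ab t * r < 1 -> (forall i, P i -> cvf r (f i)) ->
  fps_eval (\sum_(i <- s | P i) f i) t = \sum_(i <- s | P i) fps_eval (f i) t.
Proof.
move=> r0 tr h; elim: s => [|i s IH]; first by rewrite !big_nil eval0.
rewrite !big_cons; case: ifP => // Pi.
by rewrite (evalD r0 tr (h _ Pi) (cvf_sum _ r0 h)) IH.
Qed.

Lemma eval_prod r I (s : seq I) (f : I -> fps C) t :
  0 <= r -> ab t * r < 1 -> (forall i, cvf r (f i)) ->
  fps_eval (\prod_(i <- s) f i) t = \prod_(i <- s) fps_eval (f i) t /\
  cvf r (\prod_(i <- s) f i).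
Proof.
move=> r0 tr h; elim: s => [|i s [IH IH']].
  by rewrite !big_nil eval1; split=> //; exact: cvf1.
by rewrite !big_cons (evalM r0 tr (h i) IH') IH; split=> //; exact: cvfM.
Qed.

(** Close to 0 the lowest nonzero term strictly dominates the rest of the series. *)
Lemma eval_lead r f n : 0 <= r -> cvf r f -> (forall i, (i < n)%N -> coef f i = 0) ->
  coef f n != 0 -> exists2 e : R, 0 < e & forall t, ab t < e ->
    ab (fps_eval f t) = ab (coef f n) * ab t ^+ n.
Proof.
move=> r0 [M M0 h] hn fn; have fn' : 0 < ab (coef f n) by rewrite ab_gt0.
(* D is chosen so that |t| D < 1 implies both |t| (1 + r) < 1 and (1 + M) ((1 + r) |t|)^(n+1) <
   |f_n| |t|^n, the left side of which bounds the tail. *)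
pose D := (1 + r) + (1 + M) * (1 + r) ^+ n.+1 / ab (coef f n).
have r1 : 0 < 1 + r by rewrite ltr_wpDr.
have M1 : 0 < 1 + M by rewrite ltr_wpDr.
have D1 : 0 < (1 + M) * (1 + r) ^+ n.+1 / ab (coef f n).
  by rewrite divr_gt0 // mulr_gt0 // exprn_gt0.
have D0 : 0 < D by rewrite addr_gt0.
exists D^-1; first by rewrite invr_gt0.
move=> t td; have [->|t0] := eqVneq t 0.
  rewrite eval_at0 ab0; case: n hn fn fn' {D D0 D1 td} => [|n] hn _ _.
    by rewrite expr0 mulr1.
  by rewrite hn // ab0 expr0n mulr0.
have t0' : 0 < ab t by rewrite ab_gt0.
have tD : ab t * D < 1 by rewrite -ltr_pdivlMr // div1r.
have tr1 : ab t * (1 + r) < 1.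
  by apply: le_lt_trans tD; rewrite ler_pM2l // lerDl ltW.
have tr : ab t * r < 1 by apply: le_lt_trans tr1; rewrite ler_pM2l // lerDr.
have key : (1 + M) * ((1 + r) * ab t) ^+ n.+1 < ab (coef f n) * ab t ^+ n.
  rewrite exprMn [ab t ^+ n.+1]exprS !mulrA ltr_pM2r ?exprn_gt0 //.
  have tX : ab t * ((1 + M) * (1 + r) ^+ n.+1 / ab (coef f n)) < 1.
    by apply: le_lt_trans tD; rewrite ler_pM2l // lerDr ltW.
  by move: tX; rewrite mulrA ltr_pdivrMr // mul1r mulrC.
have headE : \sum_(i < n.+1) coef f i * t ^+ i = coef f n * t ^+ n.
  by rewrite big_ord_recr /= big1 ?add0r // => i _; rewrite hn // mul0r.
rewrite -abX -absM; apply: ab_near; rewrite ab_subC -headE.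
rewrite headE absM abX -headE.
apply: le_lt_trans key; apply: series_tail (series_bnd r0 tr h).
  by rewrite mulr_ge0 ?ltW // exprn_gt0 // mulr_gt0.
move=> m nm; rewrite absM abX.
apply: le_trans (ler_wpM2r (exprn_ge0 _ (abs_ge0 _)) (h m)) _.
rewrite -mulrA -exprMn; apply: ler_pM => //; rewrite ?lerDr //.
  by rewrite exprn_ge0 // mulr_ge0 // ltW.
apply: (@le_trans _ _ (((1 + r) * ab t) ^+ m)).
  by rewrite lerXn2r ?nnegrE ?mulr_ge0 ?ler_pM2r ?lerDr // ltW.
by apply: ler_wiXn2l => //; rewrite ?mulr_ge0 // ltW // mulrC.
Qed.

End Tpos.

(** * The ring of series of positive radius and the identity theorem *)

Section TposRing.
Variables (F : finFieldType) (R : realType) (C : cinf F R).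
Local Notation ab := (@absC F R C).
Local Notation "a ~> l" := (cvg_to ab a l) (at level 70).
Local Notation Tpos := (@Tpos F R C).
Implicit Types (f g : fps C) (t : C) (M r : R).

(** Convergence at a single nonzero t makes the terms bounded, and this is a geometric bound on the
    coefficients. *)
Lemma series_cvf_radius f t s : t != 0 ->
  series_to ab (fun i => coef f i * t ^+ i) s -> cvf (ab t)^-1 f.
Proof.
rewrite -ab_gt0 => t0' /series_null hs; have [M M0 [N hN]] := lim_bounded hs.
pose M' := M + \sum_(i < N) ab (coef f i * t ^+ i).
have S0 : 0 <= \sum_(i < N) ab (coef f i * t ^+ i).
  by apply: sumr_ge0 => i _; exact: abs_ge0.
apply: (@cvf_bnd _ _ _ M') => n; rewrite exprVn ler_pdivlMr ?exprn_gt0 //.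
rewrite -abX -absM; have [nN|Nn] := ltnP n N.
  rewrite /M' (bigD1 (Ordinal nN)) //=.
  have S1 : 0 <= \sum_(i < N | i != Ordinal nN) ab (coef f i * t ^+ i).
    by apply: sumr_ge0 => i _; exact: abs_ge0.
  lra.
by apply: le_trans (hN n Nn) _; rewrite lerDl.
Qed.

Lemma TposP f : Tpos f <-> exists2 r, 0 <= r & cvf r f.
Proof.
split=> [[r r0 h]|[r r0 h]].
  have [t t0 tr] := ab_ex_small C r0; have [s hs] := h t tr.
  by exists (ab t)^-1; [rewrite invr_ge0 abs_ge0 | exact: series_cvf_radius t0 hs].
exists (1 + r)^-1; first by rewrite invr_gt0 ltr_wpDr.
move=> t tr; exists (fps_eval f t).
have r1 : 0 < 1 + r by rewrite ltr_wpDr.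
apply: (@series_cvf _ _ _ (1 + r)); first exact: ltW.
  by rewrite -ltr_pdivlMr // div1r.
by apply: cvf_le h; rewrite // lerDr.
Qed.

Lemma Tpos_cvf r f : 0 <= r -> cvf r f -> Tpos f.
Proof. by move=> r0 h; apply/TposP; exists r. Qed.

Lemma Tpos2 f g : Tpos f -> Tpos g -> exists2 r, 0 <= r & cvf r f /\ cvf r g.
Proof.
move=> /TposP[r r0 hf] /TposP[r' r'0 hg]; exists (Num.max r r').
  by rewrite le_max r0.
by split; [apply: cvf_le hf | apply: cvf_le hg]; rewrite // le_max lexx ?orbT.
Qed.

Lemma Tpos_const c : Tpos (fps_const c).
Proof. exact: Tpos_cvf (cvf_const _ ler01). Qed.
Lemma Tpos0 : Tpos 0. Proof. by rewrite -(rmorph0 (@fps_const C)); exact: Tpos_const. Qed.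
Lemma Tpos1 : Tpos 1. Proof. by rewrite -(rmorph1 (@fps_const C)); exact: Tpos_const. Qed.
Lemma TposD f g : Tpos f -> Tpos g -> Tpos (f + g).
Proof. by move=> hf hg; have [r r0 [? ?]] := Tpos2 hf hg; apply: (Tpos_cvf r0); exact: cvfD. Qed.
Lemma TposM f g : Tpos f -> Tpos g -> Tpos (f * g).
Proof. by move=> hf hg; have [r r0 [? ?]] := Tpos2 hf hg; apply: (Tpos_cvf r0); exact: cvfM. Qed.
Lemma TposN f : Tpos f -> Tpos (- f).
Proof. by move/TposP => [r r0 h]; apply: (Tpos_cvf r0); exact: cvfN. Qed.
Lemma TposB f g : Tpos f -> Tpos g -> Tpos (f - g).
Proof. by move=> hf hg; apply: TposD => //; exact: TposN. Qed.
Lemma TposX f k : Tpos f -> Tpos (f ^+ k).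
Proof. by move/TposP => [r r0 h]; apply: (Tpos_cvf r0); exact: cvfX. Qed.
Lemma TposV f : Tpos f -> coef f 0%N != 0 -> Tpos f^-1.
Proof.
move=> /TposP[r r0 h] f0; have [r' rr h'] := cvfV r0 h f0.
by apply: Tpos_cvf h'; exact: le_trans rr.
Qed.
Lemma Tpos_sum I (s : seq I) (P : pred I) (f : I -> fps C) :
  (forall i, P i -> Tpos (f i)) -> Tpos (\sum_(i <- s | P i) f i).
Proof.
move=> h; elim/big_rec: _ => [|i x Pi hx]; first exact: Tpos0.
by apply: TposD => //; exact: h.
Qed.
Lemma Tpos_fX : Tpos (fX C).
Proof.
apply: (@Tpos_cvf 1) => //; apply: (@cvf_bnd _ _ _ 1) => n.
rewrite expr1n mulr1 /= coefX; by case: eqP => _ /=; rewrite ?ab1 ?ab0 ?lexx ?ler01.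
Qed.

(** By [eval_lead] a nonzero series has no zeros in some punctured disc around 0. *)
Lemma eval_ident r f : 0 <= r -> cvf r f ->
  (forall e, 0 < e -> exists t, [/\ t != 0, ab t < e & fps_eval f t = 0]) -> f = 0.
Proof.
move=> r0 h hz; apply/eqP/negPn/negP => /fps_neq0_lead[n [fn hn]].
have [e e0 he] := eval_lead r0 h hn fn; have [t [t0 te ft]] := hz e e0.
have /esym/eqP := he t te; rewrite ft ab0 mulf_eq0 expf_eq0 !ab_eq0.
by rewrite (negbTE fn) (negbTE t0) andbF.
Qed.

Lemma eval_ident_disc r f : 0 <= r -> cvf r f ->
  (exists2 e, 0 < e & forall t, ab t < e -> fps_eval f t = 0) -> f = 0.
Proof.
move=> r0 h [e e0 he]; apply: (eval_ident r0 h) => e' e'0.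
have [|t t0] := @ab_ex_small _ _ C (Num.min e e'); first by rewrite lt_min e0.
by rewrite lt_min => /andP[/he te te']; exists t.
Qed.

(** Completeness for a fixed inverse radius; it builds the infinite products and sums in u that give
    the expansions of e_z and E. *)
Lemma fps_lim r (G : nat -> fps C) : 0 <= r -> cvf r (G 0%N) ->
  (forall e, 0 < e -> exists N, forall n, (N <= n)%N -> bnd e r (G n.+1 - G n)) ->
  (forall n, cvf r (G n.+1 - G n)) ->
  exists2 H, cvf r H & forall e, 0 < e ->
    exists N, forall n, (N <= n)%N -> bnd e r (H - G n).
Proof.
move=> r0 G0 hG hc.
have hl' i : exists l, (fun n => coef (G n) i) ~> l.
  apply: lim_cauchy => e e0.
  have ri : 0 <= r ^+ i by rewrite exprn_ge0.
  have r1 : 0 < 1 + r ^+ i by rewrite ltr_wpDr.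
  have [N hN] := hG _ (divr_gt0 e0 r1); exists N => n /hN /(_ i) h.
  apply: le_lt_trans h _; rewrite mulrAC ltr_pdivrMr // ltr_pM2l //; lra.
have [l hl] := choice hl'.
have tele e N : 0 < e -> (forall n, (N <= n)%N -> bnd e r (G n.+1 - G n)) ->
    forall n, (N <= n)%N -> bnd e r (Fps l - G n).
  move=> e0 hN n Nn i; rewrite fcoefB; apply: (lim_near_le (N := n)) (hl i) => m.
  elim: m => [|m IH]; first by rewrite leqn0 => /eqP ->; rewrite subrr ab0 mulr_ge0 ?exprn_ge0 // ltW.
  rewrite leq_eqVlt => /orP[/eqP <-|]; first by rewrite subrr ab0 mulr_ge0 ?exprn_ge0 // ltW.
  rewrite ltnS => nm; rewrite -(subrKA (coef (G m) i)); apply: abD_le; last exact: IH.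
  by rewrite -fcoefB; apply: hN; exact: leq_trans nm.
exists (Fps l) => [|e e0]; last by have [N hN] := hG e e0; exists N; exact: tele.
have [N hN] := hG 1 ltr01.
have GN n : cvf r (G n).
  by elim: n => // n IH; rewrite -(subrK (G n) (G n.+1)); exact: cvfD.
rewrite -(subrK (G N) (Fps l)); apply: cvfD => //.
by apply: cvf_bnd (tele _ _ ltr01 hN N (leqnn N)).
Qed.

Lemma fps_lim_eval r (G : nat -> fps C) (H : fps C) t : 0 <= r -> ab t * r < 1 ->
  (forall n, cvf r (G n)) -> cvf r H ->
  (forall e, 0 < e -> exists N, forall n, (N <= n)%N -> bnd e r (H - G n)) ->
  (fun n => fps_eval (G n) t) ~> fps_eval H t.
Proof.
move=> r0 tr hG hH h; apply/cvgP => e e0.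
have e2 : 0 < e / 2 by rewrite divr_gt0.
have [N hN] := h _ e2; exists N => n /hN b.
rewrite ab_subC -(evalB r0 tr) //; apply: le_lt_trans (ab_eval r0 tr b) _; lra.
Qed.

End TposRing.

(** * Unconditional convergence and double series *)

Section Nets.
Variables (F : finFieldType) (R : realType) (C : cinf F R).
Local Notation ab := (@absC F R C).
Local Notation "a ~> l" := (cvg_to ab a l) (at level 70).

Lemma net_uniq (I : choiceType) (a : {fset I} -> C) l l' :
  net_to ab a l -> net_to ab a l' -> l = l'.
Proof.
move=> h h'; apply/eqP; rewrite -subr_eq0; apply/eqP/ab_le_eps => e e0.
have [J hJ] := h e e0; have [J' hJ'] := h' e e0.
have h1 := hJ _ (fsubsetUl J J'); have h2 := hJ' _ (fsubsetUr J J').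
rewrite -(subrKA (a (J `|` J')%fset)); apply/ltW/abD_lt => //.
by rewrite [ab (l - _)]ab_subC.
Qed.

Lemma net_seq (I : choiceType) (a : {fset I} -> C) (J : nat -> {fset I}) l :
  (forall i : I, exists N, forall n, (N <= n)%N -> i \in J n) ->
  net_to ab a l -> (fun n => a (J n)) ~> l.
Proof.
move=> hJ h; apply/cvgP => e e0; have [J0 h0] := h e e0.
suff [N hN] : exists N, forall n, (N <= n)%N -> (J0 `<=` J n)%fset.
  by exists N => n /hN; exact: h0.
suff [N hN] : exists N, forall n, (N <= n)%N -> {subset (enum_fset J0) <= J n}.
  by exists N => n /hN hn; apply/fsubsetP => i; exact: hn.
elim: (enum_fset J0) => [|i s [N IH]]; first by exists 0%N.
have [M hM] := hJ i; exists (maxn N M) => n; rewrite geq_max => /andP[n1 n2] j.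
by rewrite inE => /orP[/eqP->|]; [exact: hM | exact: IH].
Qed.

(** Once some chain of finite sets has the property that enlarging its members changes little, the
    whole net converges, and its limit can be computed along the chain. *)
Lemma net_ex (I : choiceType) (a : {fset I} -> C) (J : nat -> {fset I}) :
  (forall e : R, 0 < e -> exists N, forall n, (N <= n)%N ->
    forall K : {fset I}, (J n `<=` K)%fset -> ab (a K - a (J n)) < e) ->
  (forall n, (J n `<=` J n.+1)%fset) ->
  exists l, net_to ab a l /\ (fun n => a (J n)) ~> l.
Proof.
move=> h hJ; have [l hl] : exists l, (fun n => a (J n)) ~> l.
  by apply: lim_cauchy => e /h [N hN]; exists N => n Nn; exact: hN.
exists l; split=> // e e0; have [N hN] := h e e0.
move/cvgP: hl => /(_ e e0) [N' hN']; exists (J (maxn N N')) => K JK.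
rewrite -(subrKA (a (J (maxn N N')))); apply: abD_lt.
  by apply: hN JK; exact: leq_maxl.
by apply: hN'; exact: leq_maxr.
Qed.

Lemma sum_sub_uniq (I : eqType) (V : nmodType) (s r : seq I) (f : I -> V) :
  uniq s -> uniq r -> {subset s <= r} ->
  \sum_(i <- r) f i = \sum_(i <- s) f i + \sum_(i <- r | i \notin s) f i.
Proof.
move=> us ur sr; rewrite (bigID (mem s)) /=; congr (_ + _).
rewrite -big_filter; apply: perm_big; apply: uniq_perm => //; first exact: filter_uniq.
by move=> i; rewrite mem_filter andb_idr //; exact: sr.
Qed.

Lemma usum_null (I : choiceType) (a : I -> C) l (e : R) : 0 < e -> usum_to ab a l ->
  exists J0 : {fset I}, forall i, i \notin J0 -> ab (a i) < e.
Proof.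
move=> e0 /(_ e e0) [J0 h0]; exists J0 => i iJ.
have := h0 _ (fsubset_refl J0).
have : (J0 `<=` (i |` J0))%fset by exact: fsubsetU1.
move/h0; rewrite big_fsetU1 //= => h1 h2.
have -> : a i = (a i + \sum_(j <- J0) a j - l) - (\sum_(j <- J0) a j - l).
  by rewrite opprB addrA subrK addrK.
exact: abB_lt.
Qed.

Lemma usum_bounded (I : choiceType) (a : I -> C) l : usum_to ab a l ->
  exists2 M : R, 0 < M & forall i, ab (a i) <= M.
Proof.
move=> /(usum_null ltr01) [J0 h0]; exists (1 + \sum_(i <- J0) ab (a i)).
  by rewrite ltr_wpDr // sumr_ge0 // => i _; exact: abs_ge0.
move=> i; have [iJ|iJ] := boolP (i \in J0).
  have h : 0 <= \sum_(j <- (J0 `\ i)%fset) ab (a j).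
    by apply: sumr_ge0 => j _; exact: abs_ge0.
  by rewrite (big_fsetD1 i) //=; have := abs_ge0 (a i); lra.
apply: le_trans (ltW (h0 i iJ)) _; rewrite lerDl.
by apply: sumr_ge0 => j _; exact: abs_ge0.
Qed.

Definition dfun (c : nat -> fps C) (t u : C) :=
  fps_eval (Fps (fun m => fps_eval (c m) t)) u.

(** Relates iterated evaluation to the unordered double sum in [regular]. Uniqueness of net limits
    then allows the roles of the two variables to be exchanged. *)
Lemma dfun_usum (M r : R) (c : nat -> fps C) t u : 0 <= r ->
  ab t * r < 1 -> ab u * r < 1 -> (forall m, bnd (M * r ^+ m) r (c m)) ->
  usum_to ab (fun nm : nat * nat => coef (c nm.2) nm.1 * t ^+ nm.1 * u ^+ nm.2)
    (dfun c t u).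
Proof.
move=> r0 tr ur hc e e0.
have M0 : 0 <= M by have /bnd_ge0 := hc 0%N; rewrite expr0 mulr1.
pose rho := Num.max (ab t * r) (ab u * r).
have rho0 : 0 <= rho by rewrite le_max mulr_ge0 ?abs_ge0.
have rho1 : rho < 1 by rewrite gt_max tr.
have hx n m : ab (coef (c m) n * t ^+ n * u ^+ m) <= M * rho ^+ (n + m).
  rewrite !absM !abX exprD.
  apply: (@le_trans _ _ (M * r ^+ m * r ^+ n * ab t ^+ n * ab u ^+ m)).
    by rewrite !ler_wpM2r ?exprn_ge0 ?abs_ge0 //; exact: hc.
  have -> : M * r ^+ m * r ^+ n * ab t ^+ n * ab u ^+ m =
    M * ((ab t * r) ^+ n * (ab u * r) ^+ m) by rewrite !exprMn; ring.
  apply: ler_wpM2l => //; apply: ler_pM;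
    rewrite ?exprn_ge0 ?mulr_ge0 ?abs_ge0 // lerXn2r ?nnegrE ?mulr_ge0 ?abs_ge0 //.
    by rewrite le_max lexx.
  by rewrite le_max lexx orbT.
have [N hN] : exists N, M * rho ^+ N < e.
  have [N hN] := geo_null rho0 rho1 (divr_gt0 e0 (ltr_wpDr M0 ltr01)).
  exists N; have := hN N (leqnn N); rewrite ltr_pdivlMr ?ltr_wpDr // => h.
  apply: le_lt_trans h; rewrite mulrC; apply: ler_wpM2l; rewrite ?exprn_ge0 //; lra.
have hbig n m : (N <= n + m)%N -> ab (coef (c m) n * t ^+ n * u ^+ m) < e.
  move=> Nnm; apply: le_lt_trans (hx n m) (le_lt_trans _ hN).
  by apply: ler_wpM2l => //; apply: ler_wiXn2l => //; exact: ltW.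
(* Outside this box of indices n + m >= N, so every omitted term is smaller than e. *)
pose s := [seq (n, m) | n <- index_iota 0 N, m <- index_iota 0 N].
have us : uniq s by rewrite allpairs_uniq ?iota_uniq // => -[? ?] [? ?].
have ins n m : ((n, m) \in s) = (n < N)%N && (m < N)%N.
  apply/allpairsP/andP => [[[a b] /= [ha hb [-> ->]]]|[hn hm]].
    by move: ha hb; rewrite !mem_index_iota.
  by exists (n, m); rewrite !mem_index_iota.
pose J0 : {fset nat * nat} := [fset x in s]%fset.
have inJ x : (x \in J0) = (x \in s) by rewrite in_fset.
exists J0 => J /fsubsetP JJ.
rewrite (sum_sub_uniq (s := s)) ?fset_uniq //; last by move=> x; rewrite -inJ; exact: JJ.
rewrite addrAC; apply: abD_lt; last first.
  apply: ab_sum_lt => // -[n m]; rewrite ins negb_and -!leqNgt /= => h.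
  by apply: hbig; case/orP: h => h; rewrite (leq_trans h) ?leq_addr ?leq_addl.
pose A m := fps_eval (c m) t.
have hA : bnd M r (Fps A) by move=> m /=; apply: ab_eval (hc m).
have -> : \sum_(i <- s) coef (c i.2) i.1 * t ^+ i.1 * u ^+ i.2 =
    \sum_(m < N) (\sum_(n < N) coef (c m) n * t ^+ n) * u ^+ m.
  rewrite big_allpairs_dep /= exchange_big /=.
  rewrite -[in RHS](big_mkord xpredT (fun m => (\sum_(n < N) coef (c m) n * t ^+ n) * u ^+ m)).
  apply: eq_bigr => m _; rewrite mulr_suml.
  by rewrite -(big_mkord xpredT (fun n => coef (c m) n * t ^+ n * u ^+ m)).
have tl := series_tail (N := N) _ _ (series_bnd r0 ur hA).
rewrite ab_subC; have e2 : M * rho ^+ N < e by [].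
have -> : dfun c t u - \sum_(m < N) (\sum_(n < N) coef (c m) n * t ^+ n) * u ^+ m =
  (dfun c t u - \sum_(m < N) A m * u ^+ m) +
  \sum_(m < N) (A m - \sum_(n < N) coef (c m) n * t ^+ n) * u ^+ m.
  under [X in _ = _ + X]eq_bigr => m _ do rewrite mulrBl.
  by rewrite sumrB addrA subrK.
have P0 : 0 <= M * rho ^+ N by rewrite mulr_ge0 ?exprn_ge0.
have dec k (x : R) : 0 <= x -> x <= rho -> (N <= k)%N -> x ^+ k <= rho ^+ N.
  move=> x0 xr Nk; apply: (@le_trans _ _ (rho ^+ k)); first by rewrite lerXn2r.
  by apply: ler_wiXn2l => //; exact: ltW.
apply: le_lt_trans e2; apply: abD_le.
  apply: tl => // k Nk; rewrite absM abX.
  apply: le_trans (ler_wpM2r (exprn_ge0 _ (abs_ge0 _)) (hA k)) _.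
  have -> : M * r ^+ k * ab u ^+ k = M * (ab u * r) ^+ k by rewrite exprMn; ring.
  apply: ler_wpM2l => //.
  by apply: dec; rewrite ?mulr_ge0 ?abs_ge0 // le_max lexx orbT.
apply: ab_sum_le => // m _; rewrite absM.
have h1 : ab (A m - \sum_(n < N) coef (c m) n * t ^+ n) <= M * r ^+ m * rho ^+ N.
  apply: series_tail (series_bnd r0 tr (hc m)).
    by rewrite !mulr_ge0 ?exprn_ge0.
  move=> k Nk; rewrite absM abX.
  apply: le_trans (ler_wpM2r (exprn_ge0 _ (abs_ge0 _)) (hc m k)) _.
  have -> : M * r ^+ m * r ^+ k * ab t ^+ k = M * r ^+ m * (ab t * r) ^+ k.
    by rewrite exprMn; ring.
  apply: ler_wpM2l; first by rewrite mulr_ge0 ?exprn_ge0.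
  by apply: dec; rewrite ?mulr_ge0 ?abs_ge0 // le_max lexx.
rewrite abX; apply: le_trans (ler_wpM2r (exprn_ge0 _ (abs_ge0 _)) h1) _.
have -> : M * r ^+ m * rho ^+ N * ab u ^+ m = M * rho ^+ N * (ab u * r) ^+ m.
  by rewrite exprMn; ring.
by rewrite ler_piMr // exprn_ile1 ?mulr_ge0 ?abs_ge0 // ltW.
Qed.

End Nets.

(** * Subfields, splitting, and the local field K_infinity *)

(** Packs a subfield predicate as a field type, so that the theory of [algebraicOver] applies to
    elements algebraic over K_infinity. *)
Record subf (K : fieldType) (S : divringClosed K) := Subf { subf_val : K; subf_valP : subf_val \in S }.

Section SubfInstances.
Variables (K : fieldType) (S : divringClosed K).
HB.instance Definition _ := [isSub for @subf_val K S].
HB.instance Definition _ := [Choice of subf S by <:].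
HB.instance Definition _ := [SubChoice_isSubIntegralDomain of subf S by <:].
HB.instance Definition _ := [SubIntegralDomain_isSubField of subf S by <:].
End SubfInstances.

Lemma split_of_roots (K : fieldType) :
  (forall p : {poly K}, (1 < size p)%N -> exists x, root p x) ->
  forall p : {poly K}, exists rs : seq K, p = lead_coef p *: \prod_(r <- rs) ('X - r%:P).
Proof.
move=> hroot p; have [n] := ubnP (size p); elim: n p => // n IH p pn.
have [p1|p1] := leqP (size p) 1.
  by exists [::]; rewrite big_nil alg_polyC (size1_polyC p1) lead_coefC.
have [x /factor_theorem [p' pE]] := hroot p p1.
have p'0 : p' != 0 by apply: contraTneq p1 => e; rewrite pE e mul0r size_poly0.
have [|rs rsE] := IH p'.
  by move: pn; rewrite pE size_Mmonic ?monicXsubC // size_XsubC addn2.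
exists (x :: rs); rewrite big_cons pE lead_coefM lead_coefXsubC mulr1.
by rewrite mulrC {1}rsE scalerAr.
Qed.

Section Kinf.
Variables (F : finFieldType) (R : realType) (C : cinf F R).
Local Notation ab := (@absC F R C).
Local Notation q := (#|F|).
Local Notation inA := (@embA F R C).
Local Notation theta := (@theta F R C).
Local Notation Kinf := (@Kinf F R C).
Implicit Types x y z : C.
Implicit Types a b : {poly F}.

Lemma ab_thetaX n : ab (theta ^+ n) = q%:R ^+ n.
Proof. by rewrite abX ab_theta. Qed.

Lemma thetaX_neq0 n : theta ^+ n != 0.
Proof. by rewrite expf_neq0 // theta_neq0. Qed.

Lemma q_gt0 : 0 < q%:R :> R. Proof. exact: qR_gt0. Qed.
Lemma qX_gt0 n : 0 < q%:R ^+ n :> R. Proof. by rewrite exprn_gt0 // q_gt0. Qed.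

Lemma frac_truncate a b (m : nat) : b != 0 ->
  exists d, ab (inA a / inA b - inA d / theta ^+ m) < q%:R ^- m.
Proof.
move=> b0; exists ((a * 'X^m) %/ b).
have ib : inA b != 0 by rewrite inA_eq0.
have -> : inA a / inA b - inA ((a * 'X^m) %/ b) / theta ^+ m =
    inA ((a * 'X^m) %% b) / inA b / theta ^+ m.
  have -> : inA a = inA (a * 'X^m) / theta ^+ m.
    by rewrite rmorphM rmorphXn mulfK // thetaX_neq0.
  rewrite [in inA (a * _)](divp_eq (a * 'X^m) b) rmorphD rmorphM.
  by field; rewrite ib thetaX_neq0.
rewrite !abf_div ab_thetaX ltr_pdivrMr ?qX_gt0 // mulVf ?gt_eqF ?qX_gt0 //.
rewrite ltr_pdivrMr ?ab_gt0 // mul1r [ab (inA b)]abs_embA // ab_inA_lt.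
by rewrite -ltnS prednK ?size_poly_gt0 // ltn_modp.
Qed.

(** Truncating a Laurent expansion at theta^-m leaves a fraction with denominator theta^m. This form
    turns membership in K_infinity into approximability by K ([KinfP]), from which the field
    operations follow. *)
Definition lfrac x := forall m : nat, exists a, ab (x - inA a / theta ^+ m) < q%:R ^- m.

Lemma Kinf_lfrac x : Kinf x -> lfrac x.
Proof.
move=> [N [c hx]] m.
exists (\sum_(i < (N + m).+1) c i *: 'X^(N + m - i)).
have -> : inA (\sum_(i < (N + m).+1) c i *: 'X^(N + m - i)) / theta ^+ m =
    \sum_(i < (N + m).+1) inA (c i)%:P * theta ^+ N / theta ^+ i.
  rewrite rmorph_sum mulr_suml; apply: eq_bigr => i _ /=.
  rewrite -mul_polyC rmorphM rmorphXn -!mulrA; congr (_ * _).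
  have iN : (i <= N + m)%N by rewrite -ltnS.
  apply: (mulIf (thetaX_neq0 i)); rewrite -mulrA [_ * theta ^+ i]mulrC mulrA.
  rewrite divfK ?thetaX_neq0 // -exprD subnK // exprD mulfK ?thetaX_neq0 //.
have : 0 <= q%:R ^- m.+1 :> R by rewrite invr_ge0 ltW // qX_gt0.
move=> /(series_tail (N := (N + m).+1)) /(_ _ hx) h.
apply: le_lt_trans (h _) _; last first.
  by rewrite ltf_pV2 ?posrE ?qX_gt0 // ltr_eXn2l // qR_gt1.
move=> n nN; rewrite abf_div absM !ab_thetaX.
rewrite ler_pdivrMr ?qX_gt0 // ler_pdivlMl ?qX_gt0 //.
apply: (@le_trans _ _ (q%:R ^+ m.+1 * q%:R ^+ N)).
  apply: ler_wpM2l; first by rewrite ltW // qX_gt0.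
  by rewrite ler_piMl ?ab_const_le1 // ltW // qX_gt0.
rewrite -exprD ler_weXn2l ?ltW ?qR_gt1 //; lia.
Qed.

(** Numerators at successive precisions satisfy a_(m+1) = a_m X + constant, and these constants are
    the digits of the Laurent series. *)
Lemma lfrac_Kinf x : lfrac x -> Kinf x.
Proof.
move=> /choice [a ha]; pose N := size (a 0%N).
pose c i := if (i <= N)%N then (a 0%N)`_(N - i) else (a (i - N)%N)`_0.
exists N; exists c.
have q1 : 1 <= q%:R :> R by rewrite ltW // qR_gt1.
have step m : a m.+1 = a m * 'X + ((a m.+1)`_0)%:P.
  have h : (size (a m.+1 - a m * 'X)%R <= 1)%N.
    rewrite -(ab_inA_lt C) expr1.
    have -> : inA (a m.+1 - a m * 'X) = theta ^+ m.+1 *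
       ((x - inA (a m) / theta ^+ m) - (x - inA (a m.+1) / theta ^+ m.+1)).
      rewrite rmorphB rmorphM /= -[inA 'X]/theta exprS; field.
      by rewrite thetaX_neq0 theta_neq0.
    have lt : ab ((x - inA (a m) / theta ^+ m) - (x - inA (a m.+1) / theta ^+ m.+1)) < q%:R ^- m.
      apply: abB_lt; first exact: ha; apply: lt_le_trans (ha _) _.
      by rewrite lef_pV2 ?posrE ?qX_gt0 // ler_weXn2l.
    rewrite absM ab_thetaX -ltr_pdivlMl ?qX_gt0 //; apply: lt_le_trans lt _.
    by rewrite ler_pdivlMl ?qX_gt0 // exprS mulfK // gt_eqF // qX_gt0.
  have e : (a m.+1 - a m * 'X)`_0 = (a m.+1)`_0 by rewrite coefB coefMX /= subr0.
  by have /eqP := size1_polyC h; rewrite e subr_eq addrC => /eqP.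
have sums m : \sum_(i < (N + m).+1) inA (c i)%:P * theta ^+ N / theta ^+ i =
    inA (a m) / theta ^+ m.
  elim: m => [|m IH].
    have -> : a 0%N = \sum_(j < N.+1) (a 0%N)`_j *: 'X^j.
      rewrite -poly_def; apply/polyP => j; rewrite coef_poly; case: ltnP => // Nj.
      by rewrite nth_default // ltnW.
    rewrite addn0 expr0 divr1 rmorph_sum [RHS](reindex_inj rev_ord_inj).
    apply: eq_bigr => i _; have iN : (i <= N)%N by rewrite -ltnS.
    rewrite /= subSS /c iN -mul_polyC rmorphM rmorphXn -mulrA; congr (_ * _).
    have -> : theta ^+ N = theta ^+ (N - i) * theta ^+ i by rewrite -exprD subnK.
    by rewrite mulfK // thetaX_neq0.
  rewrite addnS big_ord_recr /= IH.
  have -> : c (N + m).+1 = (a m.+1)`_0.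
    by rewrite /c ifN -?ltnNge ?ltnS ?leq_addr // -addnS addKn.
  rewrite [in RHS](step m) rmorphD rmorphM /= -[inA 'X]/theta -addnS exprD exprS.
  by field; rewrite !thetaX_neq0 theta_neq0.
apply/cvgP => e e0; have [m0 hm0] := qpow_small F e0.
exists (N + m0).+1 => n nm; have -> : n = (N + (n - N.+1)).+1 by lia.
rewrite sums ab_subC; apply: lt_trans (ha _) (le_lt_trans _ hm0).
rewrite lef_pV2 ?posrE ?qX_gt0 // ler_weXn2l //; lia.
Qed.

Lemma KinfP x : Kinf x <->
  forall e : R, 0 < e -> exists a b, b != 0 /\ ab (x - inA a / inA b) < e.
Proof.
split=> [/Kinf_lfrac h e e0|h].
  have [m hm] := qpow_small F e0; have [a ha] := h m.
  exists a, 'X^m; rewrite -size_poly_eq0 size_polyXn rmorphXn; split=> //.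
  exact: lt_trans ha hm.
apply: lfrac_Kinf => m; have e0 : 0 < q%:R ^- m :> R by rewrite invr_gt0 qX_gt0.
have [a [b [b0 hab]]] := h _ e0; have [d hd] := frac_truncate a m b0.
by exists d; rewrite -(subrKA (inA a / inA b)); exact: abD_lt.
Qed.

Lemma Kinf_closed x : (forall e : R, 0 < e -> exists2 y, Kinf y & ab (x - y) < e) -> Kinf x.
Proof.
move=> h; apply/KinfP => e e0; have [y /KinfP /(_ e e0) [a [b [b0 yab]]] xy] := h e e0.
by exists a, b; split=> //; rewrite -(subrKA y); exact: abD_lt.
Qed.

Lemma Kinf_frac a b : Kinf (inA a / inA b).
Proof.
apply/KinfP => e e0; have [->|b0] := eqVneq b 0.
  exists 0, 1; rewrite oner_eq0; split=> //.
  by rewrite !rmorph0 rmorph1 invr0 mulr0 mul0r subrr ab0.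
by exists a, b; rewrite subrr ab0.
Qed.

Lemma Kinf_inA a : Kinf (inA a).
Proof. by rewrite -[inA a]divr1 -(rmorph1 inA); exact: Kinf_frac. Qed.

Lemma KinfB x y : Kinf x -> Kinf y -> Kinf (x - y).
Proof.
move=> /KinfP hx /KinfP hy; apply/KinfP => e e0.
have [a [b [b0 xab]]] := hx e e0; have [c [d [d0 ycd]]] := hy e e0.
exists (a * d - b * c), (b * d); rewrite mulf_neq0 //; split=> //.
have -> : x - y - inA (a * d - b * c) / inA (b * d) =
  (x - inA a / inA b) - (y - inA c / inA d).
  by rewrite rmorphB !rmorphM; field; rewrite !inA_eq0 b0 d0.
exact: abB_lt.
Qed.

Lemma KinfM x y : Kinf x -> Kinf y -> Kinf (x * y).
Proof.
move=> hx hy; apply: Kinf_closed => e e0.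
move/KinfP: hx => hx; move/KinfP: hy => hy.
pose B := 1 + ab x + ab y.
have B0 : 0 < B by have := abs_ge0 x; have := abs_ge0 y; rewrite /B; lra.
have B1 : 1 <= B by have := abs_ge0 x; have := abs_ge0 y; rewrite /B; lra.
have e'0 : 0 < Num.min 1 (e / B) by rewrite lt_min ltr01 divr_gt0.
have [a [b [b0 xab]]] := hx _ e'0; have [c [d [d0 ycd]]] := hy _ e'0.
exists (inA (a * c) / inA (b * d)); first exact: Kinf_frac.
set x' := inA a / inA b in xab; set y' := inA c / inA d in ycd.
have -> : x * y - inA (a * c) / inA (b * d) = (x - x') * y + x' * (y - y').
  rewrite !rmorphM /x' /y'; field; by rewrite !inA_eq0 b0 d0.
have small z w : ab z < Num.min 1 (e / B) -> ab w <= B -> ab (z * w) < e.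
  rewrite lt_min => /andP[_ hz] hw; rewrite absM.
  apply: le_lt_trans (ler_wpM2l (abs_ge0 _) hw) _.
  by rewrite -ltr_pdivlMr.
apply: abD_lt; first by apply: small => //; have := abs_ge0 x; rewrite /B; lra.
rewrite mulrC; apply: small => //; rewrite -(subrK x x'); apply: abD_le.
  rewrite ab_subC; apply: le_trans (ltW xab) _; rewrite ge_min B1 //.
by have := abs_ge0 y; rewrite /B; lra.
Qed.

Lemma KinfV x : Kinf x -> Kinf x^-1.
Proof.
have [->|x0] := eqVneq x 0; first by rewrite invr0.
move=> /KinfP h; apply: Kinf_closed => e e0.
have ax : 0 < ab x by rewrite ab_gt0.
have e'0 : 0 < Num.min (ab x) (e * (ab x * ab x)) by rewrite lt_min ax !mulr_gt0.
have [a [b [b0]]] := h _ e'0; set y := _ / _; rewrite lt_min => /andP[h1 h2].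
have yx : ab y = ab x by exact: ab_near h1.
have y0 : y != 0 by rewrite -ab_gt0 yx.
exists y^-1; first by rewrite /y invf_div; exact: Kinf_frac.
have -> : x^-1 - y^-1 = - (x - y) / (x * y) by field; rewrite x0 y0.
by rewrite abf_div abN absM yx ltr_pdivrMr // mulr_gt0.
Qed.

Definition inKinf : C -> bool := fun x => `[< Kinf x >].
Lemma inKinfP x : reflect (Kinf x) (x \in inKinf).
Proof. exact: asboolP. Qed.
Lemma inKinf_divring : divring_closed inKinf.
Proof.
split=> [|x y /inKinfP hx /inKinfP hy|x y /inKinfP hx /inKinfP hy]; apply/inKinfP.
- by rewrite -(rmorph1 inA); exact: Kinf_inA.
- exact: KinfB.
- by apply: KinfM => //; exact: KinfV.
Qed.
HB.instance Definition _ := GRing.isDivringClosed.Build C inKinf inKinf_divring.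

Lemma KinfD x y : Kinf x -> Kinf y -> Kinf (x + y).
Proof. by move=> /inKinfP hx /inKinfP hy; apply/inKinfP; rewrite rpredD. Qed.
Lemma KinfX x n : Kinf x -> Kinf (x ^+ n).
Proof. by move=> /inKinfP hx; apply/inKinfP; rewrite rpredX. Qed.
Lemma Kinf_thetaX n : Kinf (theta ^+ n).
Proof. by rewrite -rmorphXn; exact: Kinf_inA. Qed.

Lemma Kinf_near x : Kinf x -> exists a, ab (x - inA a) < 1.
Proof. by move=> /Kinf_lfrac /(_ 0%N) [a]; rewrite !expr0 divr1 invr1; exists a. Qed.

(** The value group is discrete: theta x lies within distance 1 of a polynomial of absolute value
    below q, which is a constant, so |theta x| <= 1. *)
Lemma Kinf_lt1 x : Kinf x -> ab x < 1 -> ab x <= q%:R^-1.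
Proof.
move=> hx x1; have hx' := KinfM (Kinf_inA 'X) hx.
have xq : ab (theta * x) < q%:R by rewrite absM ab_theta gtr_pMr // q_gt0.
have [a ha] := Kinf_near hx'.
have h1 : ab (inA a) <= 1.
  rewrite -(expr0 (q%:R : R)) ab_inA_leq -(ab_inA_lt C) expr1.
  rewrite -[inA a](subrK (theta * x)); apply: abD_lt => //.
  by rewrite ab_subC (lt_trans ha) // qR_gt1.
have : ab (theta * x) <= 1.
  by rewrite -(subrK (inA a) (theta * x)); apply: abD_le => //; exact: ltW.
by rewrite absM ab_theta -ler_pdivlMl ?q_gt0 // mulr1.
Qed.

(** The digit c of x at theta^n decides which inner neighbour of the vertex q^n has x in its
    disc. *)
Lemma Kinf_digit x n : Kinf x -> ab x < q%:R ^+ n.+1 ->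
  exists c : F, ab (x - inA c%:P * theta ^+ n) <= q%:R ^+ n / q%:R.
Proof.
move=> hx xn; pose y := x / theta ^+ n.
have hy : Kinf y by apply: KinfM => //; apply: KinfV; exact: Kinf_thetaX.
have yq : ab y < q%:R by rewrite abf_div ab_thetaX ltr_pdivrMr ?qX_gt0 // -exprS.
have [a ha] := Kinf_near hy; have sa : (size a <= 1)%N.
  rewrite -(ab_inA_lt C) expr1 -[inA a](subrK y); apply: abD_lt => //.
  by rewrite ab_subC (lt_trans ha) // qR_gt1.
exists a`_0; rewrite -(size1_polyC sa).
have -> : x - inA a * theta ^+ n = theta ^+ n * (y - inA a).
  by rewrite /y; field; rewrite thetaX_neq0.
rewrite absM ab_thetaX; apply: ler_wpM2l; first by rewrite ltW ?qX_gt0.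
by apply: Kinf_lt1 => //; apply: KinfB => //; exact: Kinf_inA.
Qed.

End Kinf.

(** * Algebraic closedness of C *)

Section AlgClosed.
Variables (F : finFieldType) (R : realType) (C : cinf F R).
Local Notation ab := (@absC F R C).
Local Notation q := (#|F|).
Local Notation inA := (@embA F R C).
Local Notation alg := (algebraic_laurent (@absC F R C) inA).
Local Notation "a ~> l" := (cvg_to ab a l) (at level 70).
Implicit Types x y z : C.

Local Notation kinf := (@subf C (GRing.DivringClosed.clone C (@inKinf F R C) _)).
Local Notation kval := (\val : kinf -> C).

Lemma algP x : alg x <-> algebraicOver kval x.
Proof.
split=> [[p [p0 hp px]]|[p p0 px]].
  pose p' : {poly kinf} := \poly_(i < size p) insubd 0 p`_i.
  have pE : map_poly kval p' = p.
    apply/polyP => i; rewrite coef_map coef_poly; case: ltnP => ip.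
      by rewrite /= insubdK //; apply/inKinfP; exact: hp.
    by rewrite nth_default //; exact: (rmorph0 kval).
  exists p'; last by rewrite pE.
  by apply: contraNneq p0 => e; rewrite -pE e rmorph0.
exists (map_poly kval p); split=> //; first by rewrite map_poly_eq0.
by move=> i; rewrite coef_map; apply/inKinfP; exact: valP.
Qed.

Definition inAlg : C -> bool := fun x => `[< alg x >].
Lemma inAlgP x : reflect (alg x) (x \in inAlg).
Proof. exact: asboolP. Qed.
Lemma inAlg_divring : divring_closed inAlg.
Proof.
split=> [|x y /inAlgP/algP hx /inAlgP/algP hy|x y /inAlgP/algP hx /inAlgP/algP hy];
  apply/inAlgP/algP.
- exact: algebraic1.
- exact: algebraic_sub.
- exact: algebraic_div.
Qed.
HB.instance Definition _ := GRing.isDivringClosed.Build C inAlg inAlg_divring.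

Local Notation kbar := (@subf C (GRing.DivringClosed.clone C inAlg _)).
Local Notation bval := (\val : kbar -> C).

Lemma kbar_root (p : {poly kbar}) : (1 < size p)%N -> exists w, root p w.
Proof.
move=> p1; have [||x px /inAlgP hx] := @cinf_alg_closed _ _ C (map_poly bval p).
- by move=> i; rewrite coef_map; apply/inAlgP; exact: valP.
- by rewrite size_map_poly.
exists (insubd (0 : kbar) x); move: px; rewrite -{1}(insubdK (0 : kbar) hx).
by rewrite fmorph_root.
Qed.

Lemma monic_root_bound (p : {poly C}) (B : R) x : p \is monic -> 1 <= B ->
  (forall i, ab p`_i <= B) -> root p x -> ab x <= B.
Proof.
move=> mp B1 hB /rootP px; rewrite leNgt; apply/negP => Bx.
have x1 : 1 < ab x by exact: le_lt_trans Bx.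
have p0 : (0 < size p)%N by rewrite size_poly_gt0 monic_neq0.
move: px; rewrite horner_coef -(prednK p0) big_ord_recr /=.
have -> : p`_(size p).-1 = 1 by exact/eqP.
rewrite mul1r => /eqP; rewrite addr_eq0 => /eqP e.
have : ab (x ^+ (size p).-1) < ab (x ^+ (size p).-1).
  rewrite -{1}abN -e; apply: ab_sum_lt => [|i _]; first by rewrite abX exprn_gt0 // (lt_trans ltr01).
  rewrite absM !abX; have x0 : 0 < ab x by exact: lt_trans x1.
  apply: le_lt_trans (ler_wpM2r (exprn_ge0 _ (abs_ge0 _)) (hB i)) _.
  apply: (@lt_le_trans _ _ (ab x ^+ i.+1)).
    by rewrite exprS ltr_pM2r // exprn_gt0.
  by apply: ler_weXn2l => //; exact: ltW.
by rewrite ltxx.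
Qed.

Lemma kbar_poly_approx (p : {poly C}) (e : R) : p \is monic -> 0 < e -> e <= 1 ->
  exists p' : {poly kbar}, [/\ p' \is monic, size p' = size p &
    forall i, ab (p`_i - (map_poly bval p')`_i) < e].
Proof.
move=> mp e0 e1.
have /choice [c hc] i : exists c : kbar, ab (p`_i - bval c) < e.
  have [y /inAlgP hy xy] := cinf_alg_dense p`_i e0.
  by exists (insubd 0 y); rewrite insubdK.
have p0 : (0 < size p)%N by rewrite size_poly_gt0 monic_neq0.
pose n := (size p).-1.
pose p' := 'X^n + \poly_(i < n) c i.
have sl : (size (\poly_(i < n) c i) < size ('X^n : {poly kbar}))%N.
  by rewrite size_polyXn ltnS size_poly.
exists p'; split.
- by rewrite monicE lead_coefDl // lead_coefXn.
- by rewrite size_polyDl // size_polyXn /n prednK.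
move=> i; rewrite coef_map coefD coefXn coef_poly.
have [->|i_n] := eqVneq i n.
  rewrite ltnn addr0 rmorph1.
  have -> : p`_n = 1 by exact/eqP.
  by rewrite subrr ab0.
case: ltnP => ni; first by rewrite add0r.
rewrite addr0 rmorph0 subr0 nth_default ?ab0 //.
by rewrite -(prednK p0) ltn_neqAle eq_sym i_n.
Qed.

Lemma horner_near (p p' : {poly C}) (B e : R) x : 1 <= B -> 0 <= e -> ab x <= B ->
  size p' = size p -> (forall i, ab (p`_i - p'`_i) <= e) ->
  ab (p.[x] - p'.[x]) <= e * B ^+ (size p).
Proof.
move=> B1 e0 xB sp h; have B0 : 0 <= B by rewrite (le_trans ler01).
rewrite !horner_coef sp -sumrB; apply: ab_sum_le.
  by rewrite mulr_ge0 ?exprn_ge0.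
move=> i _; rewrite -mulrBl absM abX.
apply: ler_pM; rewrite ?abs_ge0 ?exprn_ge0 ?abs_ge0 //.
apply: (@le_trans _ _ (B ^+ i)); first by rewrite lerXn2r ?nnegrE ?abs_ge0.
by apply: ler_weXn2l => //; exact: ltnW.
Qed.

Lemma ab_horner_prod (rs : seq C) x :
  ab (\prod_(r <- rs) ('X - r%:P)).[x] = \prod_(r <- rs) ab (x - r).
Proof.
rewrite horner_prod ab_prod; apply: eq_bigr => r _.
by rewrite hornerXsubC.
Qed.

Lemma prod_lt_ex (rs : seq C) x (d : R) : 0 <= d ->
  \prod_(r <- rs) ab (x - r) < d ^+ (size rs) -> exists2 r, r \in rs & ab (x - r) < d.
Proof.
move=> d0; elim: rs => [|r rs IH]; first by rewrite big_nil expr0 ltxx.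
rewrite big_cons exprS => h; have [rd|dr] := ltP (ab (x - r)) d.
  by exists r; rewrite ?inE ?eqxx.
have [|r' r'rs h'] := IH; last by exists r'; rewrite // inE r'rs orbT.
rewrite ltNge; apply/negP => h2.
have := ler_pM d0 (exprn_ge0 (size rs) d0) dr h2.
by rewrite leNgt h.
Qed.

(** Approximate p by monic polynomials Q_n over the algebraic elements, where they split. A root of
    Q_n makes Q_(n+1) small, so some root of Q_(n+1) is near it; the resulting sequence is Cauchy
    and its limit is a root of p. *)
Lemma C_root (p : {poly C}) : (1 < size p)%N -> exists x, root p x.
Proof.
move=> sp; have p0 : p != 0 by rewrite -size_poly_gt0 (leq_trans _ sp).
wlog mp : p sp p0 / p \is monic.
  move=> h; have l0 : (lead_coef p)^-1 != 0 by rewrite invr_eq0 lead_coef_eq0.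
  have [|||x] := h ((lead_coef p)^-1 *: p).
  - by rewrite size_scale.
  - by rewrite scaler_eq0 negb_or l0.
  - by rewrite monicE lead_coefZ mulVf // lead_coef_eq0.
  by rewrite rootZ //; exists x.
pose B := 1 + \sum_(i < size p) ab p`_i.
have S0 : 0 <= \sum_(i < size p) ab p`_i by apply: sumr_ge0 => i _; exact: abs_ge0.
have B1 : 1 <= B by rewrite /B; lra.
have B0 : 0 < B by exact: lt_le_trans B1.
have pB i : ab p`_i <= B.
  have [ip|ip] := ltnP i (size p); last by rewrite nth_default // ab0 ltW.
  rewrite /B (bigD1 (Ordinal ip)) //=.
  have : 0 <= \sum_(j < size p | j != Ordinal ip) ab p`_j.
    by apply: sumr_ge0 => j _; exact: abs_ge0.
  by lra.
pose d := (size p).-1.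
(* With this precision |p(x) - Q_n(x)| <= (q^-n)^d for |x| <= B, where B bounds all roots; a product
   of d distances of that size has a factor below 2 q^-n. *)
pose eps n : R := (q%:R ^- n) ^+ d / B ^+ size p.
have qn n : 0 < q%:R ^- n :> R by rewrite invr_gt0 qX_gt0.
have qn1 n : q%:R ^- n <= 1 :> R by rewrite invf_le1 ?qX_gt0 // exprn_ege1 // ltW // qR_gt1.
have eps0 n : 0 < eps n by rewrite divr_gt0 // exprn_gt0.
have eps1 n : eps n <= 1.
  rewrite ler_pdivrMr ?exprn_gt0 // mul1r (le_trans (exprn_ile1 _ (ltW (qn n)) (qn1 n))) //.
  by rewrite exprn_ege1.
have /choice [P hP] n : exists p' : {poly kbar}, [/\ p' \is monic, size p' = size p &
    forall i, ab (p`_i - (map_poly bval p')`_i) < eps n].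
  exact: kbar_poly_approx.
pose Q n := map_poly bval (P n).
have mQ n : Q n \is monic by rewrite map_monic; case: (hP n).
have sQ n : size (Q n) = size p by rewrite size_map_poly; case: (hP n).
have aQ n i : ab (p`_i - (Q n)`_i) < eps n by case: (hP n).
have QB n i : ab (Q n)`_i <= B.
  rewrite -(subrK p`_i (Q n)`_i); apply: abD_le => //.
  by rewrite ab_subC (le_trans (ltW (aQ n i))) // (le_trans (eps1 n)).
have splitQ n : exists2 rs : seq C, size rs = d & Q n = \prod_(r <- rs) ('X - r%:P).
  have [rs rsE] := split_of_roots kbar_root (P n).
  have mP : P n \is monic by case: (hP n).
  exists (map bval rs).
    rewrite size_map /d; have [_ <- _] := hP n.
    by rewrite rsE (monicP mP) scale1r size_prod_XsubC.
  rewrite /Q rsE (monicP mP) scale1r rmorph_prod big_map.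
  by apply: eq_bigr => r _; exact: map_polyXsubC.
have step n x : exists y, root (Q n) x -> root (Q n.+1) y /\ ab (y - x) < 2 * q%:R ^- n.
  have [rx|nx] := boolP (root (Q n) x); last by exists x.
  have xB := monic_root_bound (mQ n) B1 (QB n) rx.
  have [rs srs QE] := splitQ n.+1.
  have small : ab (Q n.+1).[x] <= q%:R ^- n ^+ d.
    have -> : (Q n.+1).[x] = (p.[x] - (Q n).[x]) - (p.[x] - (Q n.+1).[x]).
      by rewrite (rootP rx); ring.
    have he m : (n <= m)%N -> ab (p.[x] - (Q m).[x]) <= q%:R ^- n ^+ d.
      move=> nm; apply: (@le_trans _ _ (eps n * B ^+ size p)).
        apply: (@horner_near p (Q m)) => //; first exact: ltW.
        move=> i; apply: le_trans (ltW (aQ m i)) _.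
        rewrite ler_pM2r ?invr_gt0 ?exprn_gt0 // lerXn2r ?nnegrE ?(ltW (qn _)) //.
        by rewrite lef_pV2 ?posrE ?qX_gt0 // ler_weXn2l // ltW // qR_gt1.
      by rewrite /eps divfK // gt_eqF // exprn_gt0.
    by apply: abB_le; exact: he.
  have d0 : (0 < d)%N by rewrite /d -ltnS prednK // ltnW.
  have [||y yrs hy] := @prod_lt_ex rs x (2 * q%:R ^- n); first by rewrite mulr_ge0 // ltW.
    rewrite -ab_horner_prod -QE; apply: le_lt_trans small _.
    by rewrite srs exprMn ltr_pMl ?exprn_gt0 // exprn_egt1 ?ltr1n // -lt0n.
  exists y => _; split; last by rewrite ab_subC.
  by rewrite QE root_prod_XsubC.
have /choice [nxt hnxt] nx : exists y, root (Q nx.1) nx.2 -> root (Q nx.1.+1) y /\ ab (y - nx.2) < 2 * q%:R ^- nx.1.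
  exact: step.
have [x0 hx0] : exists x0, root (Q 0%N) x0.
  have [rs srs QE] := splitQ 0%N; case: rs srs QE => [|r rs] srs QE.
    by move: srs sp; rewrite /d /=; case: (size p) => [|[]].
  by exists r; rewrite QE root_prod_XsubC inE eqxx.
pose X := fix X n := if n is m.+1 then nxt (m, X m) else x0.
have XQ n : root (Q n) (X n).
  by elim: n => //= n IH; case: (hnxt (n, X n)).
have XX n : ab (X n.+1 - X n) < 2 * q%:R ^- n by case: (hnxt (n, X n)) => //=.
have [x hx] : exists x, X ~> x.
  apply: lim_cauchy => e e0; have e2 : 0 < e / 2 by rewrite divr_gt0.
  have [N hN] := qpow_small F e2; exists N => n Nn.
  apply: lt_trans (XX n) _; rewrite -ltr_pdivlMl // mulrC; apply: le_lt_trans hN.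
  by rewrite lef_pV2 ?posrE ?qX_gt0 // ler_weXn2l // ltW // qR_gt1.
exists x; apply/rootP; apply: (@lim_uniq _ _ C (fun n => p.[X n])).
  apply: (lim_ext (N := 0%N) (a := fun n => \sum_(i < size p) p`_i * X n ^+ i)).
    by move=> n _; rewrite horner_coef.
  by rewrite horner_coef; apply: lim_sum => i; apply: limZ; exact: limX.
apply/cvgP => e e0; have e2 : 0 < e / 1 by rewrite divr_gt0.
have d0 : (0 < d)%N by rewrite /d -ltnS prednK // ltnW.
have [N hN] := qpow_small F e0; exists N => n Nn; rewrite subr0.
have XB := monic_root_bound (mQ n) B1 (QB n) (XQ n).
have -> : p.[X n] = p.[X n] - (Q n).[X n] by rewrite (rootP (XQ n)) subr0.
apply: (@le_lt_trans _ _ (eps n * B ^+ size p)).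
  apply: (@horner_near p (Q n)) => //; first exact: ltW.
  by move=> i; exact: ltW.
rewrite /eps divfK ?gt_eqF ?exprn_gt0 //; apply: le_lt_trans hN.
apply: (@le_trans _ _ (q%:R ^- n)).
  by rewrite -[leRHS]expr1; apply: ler_wiXn2l; rewrite ?qn1 // ltW.
by rewrite lef_pV2 ?posrE ?qX_gt0 // ler_weXn2l // ltW // qR_gt1.
Qed.

Lemma C_split (p : {poly C}) :
  exists rs : seq C, p = lead_coef p *: \prod_(r <- rs) ('X - r%:P).
Proof. exact: split_of_roots C_root p. Qed.

End AlgClosed.

(** * Affinoids of Omega and uniform rational approximation *)

Section Approx.
Variables (F : finFieldType) (R : realType) (C : cinf F R).
Local Notation ab := (@absC F R C).
Local Notation q := (#|F|).
Local Notation Kinf := (@Kinf F R C).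
Local Notation Om := (Omega C).
Implicit Types (f g : Om -> C) (e : R).

(** The usual covering has N = M. Separating the bound on |z| from the distance to K_infinity
    permits M = 1 with N arbitrary, a region containing the vertices of the half line and their
    inner neighbours. *)
Definition Sreg (N M : nat) : set C := [set z |
  ab z <= q%:R ^+ N /\ forall x, Kinf x -> q%:R ^- M <= ab (z - x)].

Lemma qV_gt0 n : 0 < q%:R ^- n :> R. Proof. by rewrite invr_gt0 qX_gt0. Qed.
Lemma qX_ge1 n : 1 <= q%:R ^+ n :> R.
Proof. by rewrite exprn_ege1 // ltW // qR_gt1. Qed.
Lemma qV_le1 n : q%:R ^- n <= 1 :> R.
Proof. by rewrite invf_le1 ?qX_gt0 // qX_ge1. Qed.
Lemma qX_le m n : (m <= n)%N -> q%:R ^+ m <= q%:R ^+ n :> R.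
Proof. by move=> mn; rewrite ler_weXn2l // ltW // qR_gt1. Qed.
Lemma qV_le m n : (m <= n)%N -> q%:R ^- n <= q%:R ^- m :> R.
Proof. by move=> mn; rewrite lef_pV2 ?posrE ?qX_gt0 // qX_le. Qed.

Lemma Sreg_sub N M N' M' : (N <= N')%N -> (M <= M')%N -> Sreg N M `<=` Sreg N' M'.
Proof.
move=> NN MM z [h1 h2]; split; first by apply: le_trans h1 (qX_le NN).
by move=> x /h2; apply: le_trans (qV_le MM).
Qed.

Lemma Sreg_Omega N M z : Sreg N M z -> Om z.
Proof.
move=> [_ h] zK; have := h z zK; rewrite subrr ab0 leNgt qV_gt0 //.
Qed.

Lemma not_Kinf_dist (z : Om) : exists M, forall x, Kinf x -> q%:R ^- M <= ab (val z - x).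
Proof.
apply: contrapT => h; have := set_mem (valP z); apply; apply: Kinf_closed => e e0.
have [M hM] := qpow_small F e0; apply: contrapT => h2; apply: h; exists M => x xK.
rewrite leNgt; apply/negP => lt; apply: h2; exists x => //.
exact: lt_trans lt hM.
Qed.

Lemma Sreg_ex (z : Om) : exists N, exists M, Sreg N M (val z).
Proof.
have [N hN] := qpow_large F (ab (val z)); have [M hM] := not_Kinf_dist z.
by exists N, M; split=> //; exact: ltW.
Qed.

Lemma not_Sreg N M r : ~ Sreg N M r ->
  q%:R ^+ N < ab r \/ exists2 x, Kinf x & ab (r - x) < q%:R ^- M.
Proof.
move=> h; have [rN|] := ltP (q%:R ^+ N) (ab r); first by left.
move=> rN; right; apply: contrapT => h2; apply: h; split=> // x xK.
by rewrite leNgt; apply/negP => lt; apply: h2; exists x.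
Qed.

Lemma Sreg_sub_root N M r z : ~ Sreg N M r -> Sreg N M z -> q%:R ^- M <= ab (z - r).
Proof.
move=> /not_Sreg h [zN hz]; case: h => [rN|[x xK rx]].
  rewrite abB_r ?(le_lt_trans zN) //; apply: le_trans (qV_le1 M) _.
  by apply: le_trans (qX_ge1 N) (ltW _).
have zx := hz x xK; rewrite -(subrKA x) abD_l //.
by rewrite ab_subC; exact: lt_le_trans rx zx.
Qed.

(** Q splits over C, and a root outside the affinoid keeps distance at least q^-M from all its
    points ([Sreg_sub_root]). *)
Lemma pole_free_lower N M (Q : {poly C}) : (forall z, Sreg N M z -> Q.[z] != 0) ->
  exists2 d : R, 0 < d & forall z, Sreg N M z -> d <= ab Q.[z].
Proof.
move=> hQ; have [Q0|Q0] := eqVneq Q 0.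
  by exists 1 => // z /hQ; rewrite Q0 horner0 eqxx.
have [rs QE] := C_split Q; exists (ab (lead_coef Q) * (q%:R ^- M) ^+ size rs).
  by rewrite mulr_gt0 ?exprn_gt0 ?qV_gt0 // ab_gt0 lead_coef_eq0.
move=> z Sz; rewrite {2}QE hornerZ absM ab_horner_prod.
apply: ler_wpM2l; first exact: abs_ge0.
have : forall r, r \in rs -> q%:R ^- M <= ab (z - r).
  move=> r rrs; apply: (@Sreg_sub_root N M) => // Sr; move: (hQ r Sr).
  by rewrite -rootE QE rootZ ?lead_coef_eq0 // root_prod_XsubC rrs.
elim: rs {QE} => [|r rs IH] h; first by rewrite big_nil expr0.
rewrite big_cons exprS ler_pM //; first by rewrite ltW ?qV_gt0.
- by rewrite exprn_ge0 // ltW ?qV_gt0.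
- by apply: h; rewrite mem_head.
- by apply: IH => r' hr'; apply: h; rewrite inE hr' orbT.
Qed.

Lemma poly_bounded (P : {poly C}) (B : R) :
  exists2 D : R, 0 < D & forall z, ab z <= B -> ab P.[z] <= D.
Proof.
have B0 : 0 <= Num.max 0 B by rewrite le_max lexx.
have S0 : 0 <= \sum_(i < size P) ab P`_i * Num.max 0 B ^+ i.
  by apply: sumr_ge0 => i _; rewrite mulr_ge0 ?abs_ge0 ?exprn_ge0.
exists (1 + \sum_(i < size P) ab P`_i * Num.max 0 B ^+ i); first by rewrite ltr_wpDr.
move=> z zB; rewrite horner_coef; apply: ab_sum_le; first lra.
move=> i _; rewrite (bigD1 i) //=.
have h1 : ab (P`_i * z ^+ i) <= ab P`_i * Num.max 0 B ^+ i.
  rewrite absM abX ler_wpM2l ?abs_ge0 // lerXn2r ?nnegrE ?abs_ge0 //.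
  by rewrite le_max zB orbT.
have : 0 <= \sum_(j < size P | j != i) ab P`_j * Num.max 0 B ^+ j.
  by apply: sumr_ge0 => j _; rewrite mulr_ge0 ?abs_ge0 ?exprn_ge0.
lra.
Qed.

Definition appr (S : set C) f := forall e, 0 < e -> exists P Q : {poly C},
  (forall z, S z -> Q.[z] != 0) /\
  (forall z : Om, S (val z) -> ab (f z - P.[val z] / Q.[val z]) < e).

Lemma rigidP f : rigid_analytic f <-> forall N M, appr (Sreg N M) f.
Proof.
split=> [h N M e e0|h n]; last exact: h.
have [P [Q [h1 h2]]] := h (maxn N M) e e0.
have sub := Sreg_sub (leq_maxl N M) (leq_maxr N M).
by exists P, Q; split=> [z /sub|z /sub]; [exact: h1 | exact: h2].
Qed.

Section Fixed.
Variables N M : nat.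
Local Notation S := (Sreg N M).

Lemma appr_bounded f : appr S f -> exists2 B : R, 0 < B & forall z : Om, S (val z) -> ab (f z) <= B.
Proof.
move=> /(_ 1 ltr01) [P [Q [hQ hf]]]; have [d d0 hd] := pole_free_lower hQ.
have [D D0 hD] := poly_bounded P (q%:R ^+ N).
exists (Num.max 1 (D / d)); first by rewrite lt_max ltr01.
move=> z Sz; rewrite -(subrK (P.[val z] / Q.[val z]) (f z)); apply: abD_le.
  by rewrite le_max ltW ?hf.
rewrite le_max; apply/orP; right; rewrite abf_div.
apply: ler_pM; rewrite ?abs_ge0 ?invr_ge0 ?abs_ge0 //.
  by apply: hD; case: Sz.
by rewrite lef_pV2 ?posrE ?hd // ab_gt0 hQ.
Qed.

Lemma appr_ext f g : (forall z : Om, S (val z) -> f z = g z) -> appr S f -> appr S g.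
Proof.
move=> fg h e e0; have [P [Q [hQ hf]]] := h e e0; exists P, Q; split=> // z Sz.
by rewrite -fg //; exact: hf.
Qed.

Lemma appr_poly (P : {poly C}) : appr S (fun z => P.[val z]).
Proof.
move=> e e0; exists P, 1; split=> [z _|z _]; first by rewrite hornerC oner_eq0.
by rewrite hornerC divr1 subrr ab0.
Qed.

Lemma appr_cst (c : C) : appr S (fun=> c).
Proof. by apply: appr_ext (appr_poly c%:P) => z _; rewrite hornerC. Qed.

Lemma appr_val : appr S (fun z => val z).
Proof. by apply: appr_ext (appr_poly 'X) => z _; rewrite hornerX. Qed.

Lemma apprD f g : appr S f -> appr S g -> appr S (fun z => f z + g z).
Proof.
move=> hf hg e e0; have [P [Q [hQ h1]]] := hf e e0; have [P' [Q' [hQ' h2]]] := hg e e0.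
exists (P * Q' + P' * Q), (Q * Q'); split=> [z Sz|z Sz].
  by rewrite hornerM mulf_neq0 ?hQ ?hQ'.
rewrite hornerD !hornerM; set z' := val z.
have -> : f z + g z - (P.[z'] * Q'.[z'] + P'.[z'] * Q.[z']) / (Q.[z'] * Q'.[z']) =
  (f z - P.[z'] / Q.[z']) + (g z - P'.[z'] / Q'.[z']).
  by field; rewrite hQ ?hQ'.
by apply: abD_lt; [exact: h1 | exact: h2].
Qed.

Lemma apprM f g : appr S f -> appr S g -> appr S (fun z => f z * g z).
Proof.
move=> hf hg e e0; have [B B0 hB] := appr_bounded hf; have [D D0 hD] := appr_bounded hg.
pose m := 1 + B + D; have m0 : 0 < m by rewrite /m; lra.
have e'0 : 0 < Num.min 1 (e / m) by rewrite lt_min ltr01 divr_gt0.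
have [P [Q [hQ h1]]] := hf _ e'0; have [P' [Q' [hQ' h2]]] := hg _ e'0.
exists (P * P'), (Q * Q'); split=> [z Sz|z Sz].
  by rewrite hornerM mulf_neq0 ?hQ ?hQ'.
rewrite !hornerM; set z' := val z.
have -> : f z * g z - P.[z'] * P'.[z'] / (Q.[z'] * Q'.[z']) =
  (f z - P.[z'] / Q.[z']) * g z + (g z - P'.[z'] / Q'.[z']) * (P.[z'] / Q.[z']).
  by field; rewrite hQ ?hQ'.
have small x y : ab x < Num.min 1 (e / m) -> ab y <= m -> ab (x * y) < e.
  rewrite lt_min => /andP[_ hx] hy; rewrite absM.
  apply: le_lt_trans (ler_wpM2l (abs_ge0 _) hy) _.
  by rewrite -ltr_pdivlMr.
apply: abD_lt; apply: small; [exact: h1| |exact: h2|].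
  by apply: le_trans (hD z Sz) _; rewrite /m; lra.
rewrite -[P.[z'] / _](subrK (f z)); apply: abD_le; last first.
  by apply: le_trans (hB z Sz) _; rewrite /m; lra.
rewrite ab_subC; apply: le_trans (ltW (h1 z Sz)) _; rewrite ge_min /m.
by apply/orP; left; lra.
Qed.

Lemma appr_scale (c : C) f : appr S f -> appr S (fun z => c * f z).
Proof. by move=> h; apply: apprM => //; exact: appr_cst. Qed.

Lemma apprN f : appr S f -> appr S (fun z => - f z).
Proof. by move=> /(appr_scale (-1)); apply: appr_ext => z _; rewrite mulN1r. Qed.

Lemma apprB f g : appr S f -> appr S g -> appr S (fun z => f z - g z).
Proof. by move=> hf hg; apply: apprD => //; exact: apprN. Qed.

Lemma apprX f k : appr S f -> appr S (fun z => f z ^+ k).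
Proof.
move=> h; elim: k => [|k IH].
  by apply: appr_ext (appr_cst 1) => z _; rewrite expr0.
by apply: appr_ext (apprM h IH) => z _; rewrite exprS.
Qed.

(** An approximant P/Q closer to f than d satisfies |P/Q| = |f|, so P has no zero on the region and
    Q/P approximates the inverse. *)
Lemma apprV f d : 0 < d -> (forall z : Om, S (val z) -> d <= ab (f z)) ->
  appr S f -> appr S (fun z => (f z)^-1).
Proof.
move=> d0 hd hf e e0.
have e'0 : 0 < Num.min d (e * (d * d)) by rewrite lt_min d0 !mulr_gt0.
have [P [Q [hQ h1]]] := hf _ e'0; exists Q, P.
have H (z : Om) : S (val z) -> P.[val z] != 0 /\ ab (P.[val z] / Q.[val z]) = ab (f z).
  move=> Sz; have := h1 z Sz; rewrite lt_min => /andP[lt _].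
  have e1 : ab (P.[val z] / Q.[val z]) = ab (f z).
    by apply: ab_near; apply: lt_le_trans lt (hd z Sz).
  split=> //; apply/eqP => P0; move: e1; rewrite P0 mul0r ab0 => e1.
  by have := hd z Sz; rewrite -e1 leNgt d0.
split=> [z Sz|z Sz].
  have zO : z \in Om by apply/mem_set; exact: Sreg_Omega Sz.
  by have [] := H (exist _ z zO) Sz.
have [P0 eq] := H z Sz; have fz : f z != 0 by rewrite -ab_gt0 (lt_le_trans d0) ?hd.
have Q0 := hQ _ Sz; set p := P.[val z] in P0 eq *; set r := Q.[val z] in Q0 eq *.
have -> : (f z)^-1 - r / p = - (f z - p / r) / (f z * (p / r)).
  by field; rewrite fz P0 Q0.
rewrite abf_div abN absM eq ltr_pdivrMr; last first.
  by rewrite mulr_gt0 // (lt_le_trans d0) ?hd.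
have := h1 z Sz; rewrite lt_min => /andP[_ lt]; apply: lt_le_trans lt _.
by rewrite ler_pM2l // ler_pM ?hd // ltW.
Qed.

Lemma appr_lim f : (forall e, 0 < e -> exists g, appr S g /\
    forall z : Om, S (val z) -> ab (f z - g z) < e) -> appr S f.
Proof.
move=> h e e0; have [g [hg fg]] := h e e0; have [P [Q [hQ h1]]] := hg e e0.
exists P, Q; split=> // z Sz; rewrite -(subrKA (g z)).
by apply: abD_lt; [exact: fg | exact: h1].
Qed.

Lemma appr_sum I (r : seq I) (P : pred I) (f : I -> Om -> C) :
  (forall i, P i -> appr S (f i)) -> appr S (fun z => \sum_(i <- r | P i) f i z).
Proof.
move=> h; elim: r => [|i r IH].
  by apply: appr_ext (appr_cst 0) => z _; rewrite big_nil.
case Pi : (P i).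
  by apply: appr_ext (apprD (h i Pi) IH) => z _; rewrite big_cons Pi.
by apply: appr_ext IH => z _; rewrite big_cons Pi.
Qed.

Lemma appr_prod I (r : seq I) (P : pred I) (f : I -> Om -> C) :
  (forall i, P i -> appr S (f i)) -> appr S (fun z => \prod_(i <- r | P i) f i z).
Proof.
move=> h; elim: r => [|i r IH].
  by apply: appr_ext (appr_cst 1) => z _; rewrite big_nil.
case Pi : (P i).
  by apply: appr_ext (apprM (h i Pi) IH) => z _; rewrite big_cons Pi.
by apply: appr_ext IH => z _; rewrite big_cons Pi.
Qed.

End Fixed.
End Approx.

(** * The action of GL_2(A) on Omega *)

Section Mobius.
Variables (F : finFieldType) (R : realType) (C : cinf F R).
Local Notation ab := (@absC F R C).
Local Notation A := {poly F}.
Local Notation inA := (@embA F R C).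
Local Notation Kinf := (@Kinf F R C).
Local Notation Om := (Omega C).
Local Notation GL := (@GL2A F).
Implicit Types (z : Om) (g d : 'M[A]_2).

Lemma sum_I2 (V : nmodType) (f : 'I_2 -> V) : \sum_i f i = f 0 + f 1.
Proof. by rewrite big_ord_recl big_ord1; congr (_ + f _); exact: val_inj. Qed.

Lemma mulmx22 (K : pzSemiRingType) (M N : 'M[K]_2) i j :
  (M *m N) i j = M i 0 * N 0 j + M i 1 * N 1 j.
Proof. by rewrite mxE sum_I2. Qed.

Lemma det_mx22 (K : comPzRingType) (M : 'M[K]_2) : \det M = M 0 0 * M 1 1 - M 0 1 * M 1 0.
Proof.
rewrite (expand_det_row _ 0) sum_I2 /cofactor !det_mx11 !mxE /= expr0 expr1.
have -> : lift 0 0 = 1 :> 'I_2 by apply: val_inj.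
have -> : lift 1 0 = 0 :> 'I_2 by apply: val_inj.
by rewrite mul1r mulN1r mulrN.
Qed.

Lemma GL_det g : GL g -> exists2 c : F, c != 0 & \det g = c%:P.
Proof.
rewrite /GL2A /= unitmxE poly_unitE => /andP[/eqP s1 u].
by exists (\det g)`_0; [rewrite -unitfE | rewrite -size1_polyC // s1].
Qed.

Lemma det_GL g (c : F) : c != 0 -> \det g = c%:P -> GL g.
Proof. by move=> c0 e; rewrite /GL2A /= unitmxE e poly_unitE size_polyC c0 coefC unitfE. Qed.

Lemma GL_mul g d : GL g -> GL d -> GL (g *m d).
Proof. by rewrite /GL2A /= unitmx_mul => -> ->. Qed.

Lemma GL_inv g : GL g -> GL (invmx g).
Proof. by rewrite /GL2A /= unitmx_inv. Qed.

Lemma inA_det_neq0 g : GL g -> inA (\det g) != 0.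
Proof. by move=> /GL_det [c c0 ->]; rewrite inA_eq0 polyC_eq0. Qed.

Lemma ab_inA_det g : GL g -> ab (inA (\det g)) = 1.
Proof. by move=> /GL_det [c c0 ->]; exact: ab_const. Qed.

Lemma row_neq0 g : GL g -> (g 1 0, g 1 1) != (0, 0).
Proof.
move=> gG; apply/negP => /eqP[e1 e2]; have := inA_det_neq0 gG.
by rewrite det_mx22 e1 e2 !mulr0 subr0 rmorph0 eqxx.
Qed.

Lemma lin_neq0 (a b : A) z : (a, b) != (0, 0) -> inA a * val z + inA b != 0.
Proof.
move=> ab0; apply/eqP => e; have [a0|a0] := eqVneq a 0.
  move: ab0 e; rewrite a0 rmorph0 mul0r add0r => h /eqP.
  by rewrite inA_eq0 => /eqP b0; rewrite b0 eqxx in h.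
have := set_mem (valP z); apply.
have -> : \val z = inA (- b) / inA a.
  apply: (canRL (mulfK _)); rewrite ?inA_eq0 //.
  by rewrite rmorphN mulrC; apply/eqP; rewrite -addr_eq0 e.
exact: Kinf_frac.
Qed.

Lemma J_neq0 g z : GL g -> J g z != 0.
Proof. by move=> gG; apply: lin_neq0; exact: row_neq0. Qed.

Lemma mob_Omega g z : GL g ->
  (inA (g 0 0) * val z + inA (g 0 1)) / J g z \in Om.
Proof.
move=> gG; apply/mem_set => xK; have := set_mem (valP z); apply.
have Jn := J_neq0 z gG; set x := _ / _ in xK.
have e : x * J g z = inA (g 0 0) * val z + inA (g 0 1) by rewrite /x divfK.
have D : inA (g 0 0) * inA (g 1 1) - inA (g 0 1) * inA (g 1 0) != 0.
  by rewrite -!rmorphM -rmorphB -det_mx22 inA_det_neq0.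
have e2 : val z * (inA (g 0 0) - x * inA (g 1 0)) = x * inA (g 1 1) - inA (g 0 1).
  apply/eqP; rewrite -subr_eq0; apply/eqP.
  transitivity (inA (g 0 0) * val z + inA (g 0 1) - x * J g z); last by rewrite e subrr.
  by rewrite /J; ring.
have den : inA (g 0 0) - x * inA (g 1 0) != 0.
  apply/eqP => e3; move: e2; rewrite e3 mulr0 => /esym e4.
  have [c0|c0] := eqVneq (inA (g 1 0)) 0.
    move: e3 D; rewrite c0 !mulr0 !subr0 => ->; by rewrite mul0r eqxx.
  move/eqP: D; apply.
  have xE : x = inA (g 0 0) / inA (g 1 0) by rewrite (subr0_eq e3) mulfK.
  have /eqP := e4; rewrite subr_eq0 xE => /eqP e5.
  by rewrite -e5; field.
have -> : \val z = (x * inA (g 1 1) - inA (g 0 1)) / (inA (g 0 0) - x * inA (g 1 0)).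
  by rewrite -e2 mulfK.
apply: KinfM; last apply: KinfV; apply: KinfB; rewrite ?KinfM //;
  first [exact: Kinf_inA | by apply: KinfM => //; exact: Kinf_inA].
Qed.

Lemma Om_inj z w : val z = val w -> z = w.
Proof. exact: val_inj. Qed.

Lemma mobE g z : GL g -> val (mob g z) = (inA (g 0 0) * val z + inA (g 0 1)) / J g z.
Proof. by move=> gG; rewrite /mob insubdK //; exact: mob_Omega. Qed.

Lemma J_cocycle g d z : GL g -> GL d -> J (g *m d) z = J g (mob d z) * J d z.
Proof.
move=> gG dG; rewrite /J mobE // !mulmx22 !rmorphD !rmorphM.
have := J_neq0 z dG; rewrite /J => h.
by field.
Qed.

Lemma mob_mul g d z : GL g -> GL d -> mob (g *m d) z = mob g (mob d z).
Proof.
move=> gG dG; apply: Om_inj; rewrite !mobE //; last exact: GL_mul.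
rewrite J_cocycle // !mulmx22 !rmorphD !rmorphM.
have h1 := J_neq0 (mob d z) gG; have h2 := J_neq0 z dG.
by rewrite [J d z]/J in h2 *; field; rewrite h1 h2.
Qed.

Lemma GL1 : GL 1%:M. Proof. exact: unitmx1. Qed.

Lemma J1 z : J 1%:M z = 1.
Proof. by rewrite /J !mxE /= rmorph0 rmorph1 mul0r add0r. Qed.

Lemma mob1 z : mob 1%:M z = z.
Proof.
apply: Om_inj; rewrite mobE ?J1 ?divr1; last exact: GL1.
by rewrite !mxE /= rmorph0 rmorph1 mul1r addr0.
Qed.

Lemma mobK g z : GL g -> mob (invmx g) (mob g z) = z.
Proof. by move=> gG; rewrite -mob_mul ?mulVmx ?mob1 //; exact: GL_inv. Qed.

Definition mx2 (a b c d : A) : 'M[A]_2 :=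
  \matrix_(i, j) if i == 0 then (if j == 0 then a else b) else (if j == 0 then c else d).

Lemma mx2E (a b c d : A) : (mx2 a b c d 0 0 = a) * (mx2 a b c d 0 1 = b) *
  (mx2 a b c d 1 0 = c) * (mx2 a b c d 1 1 = d).
Proof. by rewrite /mx2; do !split; rewrite mxE. Qed.

Lemma det_mx2 (a b c d : A) : \det (mx2 a b c d) = a * d - b * c.
Proof. by rewrite det_mx22 !mx2E. Qed.

Definition Tmx (a : A) := mx2 1 a 0 1.
Definition Smx := mx2 0 1 1 0.
Definition Dmx (c d : F) := mx2 c%:P 0 0 d%:P.

Lemma det_Tmx a : \det (Tmx a) = 1. Proof. by rewrite det_mx2 mulr0 subr0 mulr1. Qed.
Lemma det_Smx : \det Smx = -1. Proof. by rewrite det_mx2 mul0r mulr1 sub0r. Qed.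
Lemma det_Dmx (c d : F) : \det (Dmx c d) = (c * d)%:P.
Proof. by rewrite det_mx2 mulr0 subr0 polyCM. Qed.

Lemma GL_T a : GL (Tmx a).
Proof. by apply: (@det_GL _ 1); rewrite ?oner_eq0 // det_Tmx. Qed.
Lemma GL_S : GL Smx.
Proof. by apply: (@det_GL _ (-1)); rewrite ?oppr_eq0 ?oner_eq0 // det_Smx polyCN. Qed.
Lemma GL_D (c d : F) : c != 0 -> d != 0 -> GL (Dmx c d).
Proof. by move=> c0 d0; apply: (@det_GL _ (c * d)); rewrite ?mulf_neq0 // det_Dmx. Qed.

Lemma J_T a z : J (Tmx a) z = 1.
Proof. by rewrite /J !mx2E rmorph0 rmorph1 mul0r add0r. Qed.
Lemma J_S z : J Smx z = val z.
Proof. by rewrite /J !mx2E rmorph0 rmorph1 mul1r addr0. Qed.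
Lemma J_D (c d : F) z : J (Dmx c d) z = inA d%:P.
Proof. by rewrite /J !mx2E rmorph0 mul0r add0r. Qed.

Lemma val_T a z : val (mob (Tmx a) z) = val z + inA a.
Proof. by rewrite mobE ?J_T ?divr1; [rewrite !mx2E rmorph1 mul1r | exact: GL_T]. Qed.
Lemma val_S z : val (mob Smx z) = (val z)^-1.
Proof. by rewrite mobE ?J_S; [rewrite !mx2E rmorph0 rmorph1 mul0r add0r mul1r | exact: GL_S]. Qed.
Lemma val_D (c d : F) z : c != 0 -> d != 0 -> val (mob (Dmx c d) z) = inA c%:P * val z / inA d%:P.
Proof. by move=> c0 d0; rewrite mobE ?J_D; [rewrite !mx2E rmorph0 addr0 | exact: GL_D]. Qed.

Lemma val_neq0 z : val z != 0.
Proof.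
apply/eqP => z0; have := set_mem (valP z); apply.
by rewrite -[\val z]/(val z) z0 -(rmorph0 inA); exact: Kinf_inA.
Qed.

Lemma translateE z a : translate z a = mob (Tmx a) z.
Proof.
apply: Om_inj; rewrite val_T /translate insubdK // -val_T.
exact: valP.
Qed.

Lemma ab_lin_ge (e : R) (a b : A) z : (forall x, Kinf x -> e <= ab (val z - x)) ->
  ab (inA a) * e <= ab (inA a * val z + inA b).
Proof.
move=> h; have [->|a0] := eqVneq a 0; first by rewrite rmorph0 ab0 mul0r abs_ge0.
have a0' : inA a != 0 by rewrite inA_eq0.
have -> : inA a * val z + inA b = inA a * (val z - inA (- b) / inA a).
  by rewrite rmorphN; field.
rewrite absM ler_wpM2l ?abs_ge0 //; apply: h; exact: Kinf_frac.
Qed.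

End Mobius.
Arguments Smx {F}.
Arguments GL_S {F}.

From mathcomp Require Import separable.

(** * Vertices of the tree and harmonicity of linear factors *)

Section Star.
Variables (F : finFieldType) (R : realType) (C : cinf F R).
Local Notation ab := (@absC F R C).
Local Notation q := (#|F|).
Local Notation inA := (@embA F R C).
Local Notation Kinf := (@Kinf F R C).
Local Notation theta := (@theta F R C).
Local Notation Sreg := (@Sreg F R C).

Lemma frobB n (x y : C) : (x - y) ^+ (q ^ n) = x ^+ (q ^ n) - y ^+ (q ^ n).
Proof. by have := frobD n (x - y) y; rewrite subrK => ->; rewrite addrK. Qed.

Lemma frob_fixed_ab n (x : C) : (0 < n)%N -> x ^+ (q ^ n) = x -> x != 0 -> ab x = 1.
Proof.
move=> n0 /(congr1 ab); rewrite abX => e x0.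
have ax : 0 < ab x by rewrite ab_gt0.
have qn : (1 < q ^ n)%N by rewrite -(exp1n n) ltn_exp2r // card_F_gt1.
have [lt|gt|//] := ltgtP (ab x) 1; exfalso.
  have : ab x ^+ (q ^ n) < ab x ^+ 1 by rewrite ltr_iXn2l.
  by rewrite e expr1 ltxx.
have : ab x ^+ 1 < ab x ^+ (q ^ n) by rewrite ltr_eXn2l.
by rewrite e expr1 ltxx.
Qed.

Lemma roots_frob n : (0 < n)%N -> exists ws : seq C,
  [/\ uniq ws, size ws = (q ^ n)%N & forall w, w \in ws -> w ^+ (q ^ n) = w].
Proof.
move=> n0; have qn : (1 < q ^ n)%N by rewrite -(exp1n n) ltn_exp2r // card_F_gt1.
pose P : {poly C} := 'X^(q ^ n) - 'X.
have sz : size P = (q ^ n).+1 by rewrite size_polyDl ?size_polyXn // size_polyN size_polyX.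
have lP : lead_coef P = 1 by rewrite lead_coefDl ?lead_coefXn // size_polyXn size_polyN size_polyX.
have [ws wsE] := C_split P; rewrite lP scale1r in wsE.
have q0 : (q ^ n)%:R = 0 :> C.
  have [p pC pq] := q_pchar_nat C; apply/eqP.
  have [k kE] := p_natP pq; have p1 := prime_gt1 (pcharf_prime pC).
  rewrite -(dvdn_pcharf pC) kE -expnM dvdn_exp // muln_gt0 n0 andbT lt0n.
  by apply/eqP => k0; have := card_F_gt1 F; rewrite kE k0.
exists ws; split.
- rewrite -separable_prod_XsubC -wsE unlock /P derivB derivXn derivX -mulr_natr.
  rewrite -polyC_natr q0 polyC0 mulr0 sub0r.
  by rewrite -[-1]scaleN1r coprimepZr ?oppr_eq0 ?oner_eq0 // coprimep1.
- by have := sz; rewrite {1}wsE size_prod_XsubC => -[].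
- move=> w wws; apply/eqP; rewrite -subr_eq0.
  have : root P w by rewrite wsE root_prod_XsubC.
  by rewrite rootE /P hornerD hornerN hornerX hornerXn.
Qed.

(** The q^n roots of X^(q^n) - X are pairwise at distance 1, so for large n one of them is at
    distance at least 1 from every element of ts and of F; avoiding F keeps it at distance 1 from
    K_infinity. *)
Lemma generic_unit (ts : seq C) : exists w : C,
  [/\ ab w = 1, forall x, Kinf x -> 1 <= ab (w - x) & forall t, t \in ts -> 1 <= ab (w - t)].
Proof.
pose ts' := ts ++ [seq inA c%:P | c <- enum F].
have [n hn] : exists n, (size ts' < q ^ n)%N.
  by exists (size ts'); apply: ltn_expl; exact: card_F_gt1.
have n0 : (0 < n)%N.
  case: n hn => // h; rewrite expn0 ltnS leqn0 size_eq0 in h.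
  have : inA 0%:P \in ts'.
    by rewrite mem_cat; apply/orP; right; apply/mapP; exists 0; rewrite ?mem_enum.
  by rewrite (eqP h).
have [ws [uws sws hws]] := roots_frob n0.
have ab1w w : w \in ws -> w != 0 -> ab w = 1 by move=> /hws; exact: frob_fixed_ab.
have dist w w' : w \in ws -> w' \in ws -> w != w' -> ab (w - w') = 1.
  move=> h h' ne; apply: (frob_fixed_ab n0); last by rewrite subr_eq0.
  by rewrite frobB !hws.
have [w wws hw] : exists2 w, w \in ws & forall t, t \in ts' -> 1 <= ab (w - t).
  apply: contrapT => h; have h' w : exists t, w \in ws -> t \in ts' /\ ab (w - t) < 1.
    have [ww|] := boolP (w \in ws); last by exists 0.
    apply: contrapT => h2; apply: h; exists w => // t tt; rewrite leNgt; apply/negP => lt.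
    by apply: h2; exists t.
  have [t ht] := choice h'.
  have : (size (map t ws) <= size ts')%N.
    apply: uniq_leq_size; last by move=> x /mapP[w ww ->]; case: (ht w ww).
    rewrite map_inj_in_uniq // => w w' ww ww' e; apply/eqP/negPn/negP => ne.
    have := dist w w' ww ww' ne; have [_ h1] := ht w ww; have [_ h2] := ht w' ww'.
    move=> e1; have : ab (w - w') < 1.
      by rewrite -(subrKA (t w)); apply: abD_lt => //; rewrite e ab_subC.
    by rewrite e1 ltxx.
  by rewrite size_map sws leqNgt hn.
have wc (c : F) : 1 <= ab (w - inA c%:P).
  by apply: hw; rewrite mem_cat; apply/orP; right; apply/mapP; exists c; rewrite ?mem_enum.
have aw : ab w = 1.
  apply: ab1w => //; rewrite -ab_gt0; have := wc 0; rewrite polyC0 rmorph0 subr0.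
  exact: lt_le_trans.
exists w; split=> //; last by move=> t tt; apply: hw; rewrite mem_cat tt.
move=> x xK; have [h|h] := ltP 1 (ab x); first by rewrite abB_r ?aw ?ltW.
rewrite leNgt; apply/negP => lt.
have xq : ab x < q%:R ^+ 1 by rewrite expr1; exact: le_lt_trans (qR_gt1 F R).
have [c] := Kinf_digit xK xq; rewrite !expr0 mulr1 div1r => hc; have := wc c; rewrite leNgt => /negP; apply.
rewrite -(subrKA x); apply: abD_lt => //; apply: le_lt_trans hc _.
by rewrite invf_lt1 ?qR_gt0 // qR_gt1.
Qed.

(** For c and s in K_infinity, the affinoid of Omega over the tree vertex given by the disc of
    centre c and radius |s|; it reduces to a line without its F-rational points. *)
Definition vertex (c s : C) : set C := [set z |
  ab (z - c) = ab s /\ forall x, Kinf x -> ab s <= ab (z - x)].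

(** The largest value of |z - r| on the vertex, attained at points generic for r ([vertex_le],
    [generic_point]), which is why it is multiplicative in products of linear factors. *)
Definition mv (c s r : C) : R := Num.max (ab s) (ab (c - r)).

Lemma mv_gt0 c s r : s != 0 -> 0 < mv c s r.
Proof. by move=> s0; rewrite lt_max ab_gt0 s0. Qed.

Lemma generic_point (c s : C) (ts : seq C) : Kinf c -> Kinf s -> s != 0 ->
  exists2 z, vertex c s z & forall t, t \in ts -> ab (z - t) = mv c s t.
Proof.
move=> cK sK s0; have [w [aw wK wt]] := generic_unit [seq (t - c) / s | t <- ts].
have zE t : c + s * w - t = s * (w - (t - c) / s) by field.
exists (c + s * w).
  split; first by rewrite addrC addKr absM aw mulr1.
  move=> x xK; rewrite zE absM ler_peMr ?abs_ge0 //; apply: wK.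
  by apply: KinfM; [exact: KinfB | exact: KinfV].
move=> t tt; rewrite zE absM /mv.
have h := wt _ (map_f (fun t => (t - c) / s) tt).
have e : ab (c - t) = ab s * ab ((t - c) / s).
  by rewrite -absM mulrCA divff // mulr1 ab_subC.
have s0' : 0 < ab s by rewrite ab_gt0.
rewrite e -{2}[ab s]mulr1 -maxr_pMr ?abs_ge0 //; congr (_ * _).
have [lt|le] := ltP 1 (ab ((t - c) / s)); first by rewrite abB_r ?aw.
apply/eqP; rewrite eq_le; apply/andP; split; last by [].
by apply: abB_le; rewrite ?aw.
Qed.

Lemma vertex_le c s z r : vertex c s z -> ab (z - r) <= mv c s r.
Proof.
move=> [h _]; rewrite -(subrKA c) /mv; apply: abD_le.
  by rewrite h le_max lexx.
by rewrite le_max lexx orbT.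
Qed.

Section AtN.
Variables n N : nat.
Hypothesis nN : (n < N)%N.
Local Notation m0 := (mv 0 (theta ^+ n)).
Local Notation m1 := (mv 0 (theta ^+ n.+1)).
Local Notation mi c := (mv (inA c%:P * theta ^+ n) (theta ^+ n / theta)).

Lemma ab_thV : ab (theta ^+ n / theta) = q%:R ^+ n / q%:R.
Proof. by rewrite abf_div ab_thetaX ab_theta. Qed.

Lemma m0E r : m0 r = Num.max (q%:R ^+ n) (ab r).
Proof. by rewrite /mv ab_thetaX sub0r abN. Qed.
Lemma m1E r : m1 r = Num.max (q%:R ^+ n.+1) (ab r).
Proof. by rewrite /mv ab_thetaX sub0r abN. Qed.
Lemma miE c r : mi c r = Num.max (q%:R ^+ n / q%:R) (ab (r - inA c%:P * theta ^+ n)).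
Proof. by rewrite /mv ab_thV ab_subC. Qed.

Lemma ab_digit (c : F) : c != 0 -> ab (inA c%:P * theta ^+ n) = q%:R ^+ n.
Proof. by move=> c0; rewrite absM ab_const // mul1r ab_thetaX. Qed.
Lemma ab_digit_le (c : F) : ab (inA c%:P * theta ^+ n) <= q%:R ^+ n.
Proof. by rewrite absM ab_thetaX ler_piMl ?ab_const_le1 // ltW // qX_gt0. Qed.

Lemma qn_div_lt : q%:R ^+ n / q%:R < q%:R ^+ n :> R.
Proof. by rewrite ltr_pdivrMr ?qR_gt0 // ltr_pMr ?qX_gt0 // qR_gt1. Qed.

Lemma near_digit r (c c' : F) : ab (r - inA c%:P * theta ^+ n) < q%:R ^+ n ->
  c' != c -> ab (r - inA c'%:P * theta ^+ n) = q%:R ^+ n.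
Proof.
move=> h ne; have -> : r - inA c'%:P * theta ^+ n =
   (r - inA c%:P * theta ^+ n) + inA (c - c')%:P * theta ^+ n.
  by rewrite polyCB rmorphB; ring.
have e : ab (inA (c - c')%:P * theta ^+ n) = q%:R ^+ n.
  by rewrite ab_digit // subr_eq0 eq_sym.
by rewrite abD_r e.
Qed.

Lemma qpos : (0 < q)%N. Proof. exact: ltnW (card_F_gt1 F). Qed.

Lemma star_prod_near r (c : F) (x : R) : ab (r - inA c%:P * theta ^+ n) < q%:R ^+ n ->
  mi c r = x -> \prod_(b : F) mi b r = x * (q%:R ^+ n) ^+ q.-1.
Proof.
move=> h mx; rewrite (bigD1 c) //= mx; congr (_ * _).
rewrite (eq_bigr (fun=> q%:R ^+ n)) => [|b bc]; first by rewrite prodr_const cardC1.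
by rewrite miE (near_digit h bc); apply/max_idPr/ltW/qn_div_lt.
Qed.

Lemma qn_id : q%:R ^+ n.+1 * (q%:R ^+ n / q%:R * (q%:R ^+ n) ^+ q.-1) = (q%:R ^+ n) ^+ q.+1 :> R.
Proof.
have -> : (q%:R ^+ n) ^+ q.+1 = q%:R ^+ n * (q%:R ^+ n * (q%:R ^+ n) ^+ q.-1) :> R.
  by rewrite -exprS prednK ?qpos // exprS.
rewrite exprS; by field; rewrite gt_eqF // qR_gt0.
Qed.

(** Subharmonicity of log |z - r| at the vertex of radius q^n, whose neighbours are the disc of
    radius q^(n+1) and the q discs of radius q^(n-1) around the c theta^n. If |r| > q^n, each inner
    norm is |r|. If r is close to some c theta^n, that norm may drop to q^(n-1), which the outer
    one, at least q^(n+1), compensates. Otherwise no inner norm is below q^n. *)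
Lemma star_factor r : m0 r ^+ q.+1 <= m1 r * \prod_(c : F) mi c r.
Proof.
have qn0 := qX_gt0 F R n; have q0 := qR_gt0 F R.
rewrite m0E m1E; have [lt|le] := ltP (q%:R ^+ n) (ab r).
  have -> : \prod_(c : F) mi c r = ab r ^+ q.
    rewrite (eq_bigr (fun=> ab r)) => [|c _]; first by rewrite prodr_const.
    rewrite miE abB_l; last exact: le_lt_trans (ab_digit_le c) lt.
    by apply/max_idPr/ltW/(lt_trans qn_div_lt).
  rewrite exprS ler_wpM2r ?exprn_ge0 ?abs_ge0 //.
  by rewrite le_max lexx orbT.
have h1 : q%:R ^+ n.+1 <= Num.max (q%:R ^+ n.+1) (ab r) :> R by rewrite le_max lexx.
have [[c hc]|h] := pselect (exists c : F, ab (r - inA c%:P * theta ^+ n) < q%:R ^+ n).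
  rewrite (star_prod_near hc erefl) -qn_id; apply: ler_pM => //.
  - by rewrite ltW ?qX_gt0.
  - by rewrite mulr_ge0 ?divr_ge0 ?exprn_ge0 // ltW.
  - by apply: ler_wpM2r; [rewrite exprn_ge0 // ltW | rewrite miE le_max lexx].
have hmi c : q%:R ^+ n <= mi c r.
  rewrite miE le_max leNgt; apply/orP; right; rewrite leNgt; apply/negP => lt.
  by apply: h; exists c.
rewrite [_ ^+ q.+1]exprS; apply: ler_pM.
- exact: ltW.
- by rewrite exprn_ge0 // ltW.
- by apply: le_trans h1; exact: qX_le.
have -> : (q%:R ^+ n) ^+ q = \prod_(c : F) q%:R ^+ n :> R by rewrite prodr_const.
by apply: ler_prod => c _; rewrite hmi ltW.
Qed.

Definition pole_out r := q%:R ^+ n.+1 <= ab r.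
Definition pole_in r := exists c : F, ab (r - inA c%:P * theta ^+ n) <= q%:R ^+ n / q%:R.

(** Outside [Sreg N 1] a point is large or very close to K_infinity, so it lies beyond the outer
    neighbour or inside an inner disc, never strictly between vertices of the star. *)
Lemma pole_class r : ~ Sreg N 1 r -> pole_out r \/ pole_in r.
Proof.
have q0 := qR_gt0 F R.
have i1 : q%:R^-1 <= q%:R ^+ n / q%:R :> R by rewrite ler_peMl ?invr_ge0 ?qX_ge1 // ltW.
move=> /not_Sreg[lt|[x xK]]; first by left; apply: le_trans (qX_le F R nN) (ltW lt).
rewrite expr1 => rx; have rx1 : ab (r - x) < 1.
  by apply: lt_trans rx _; rewrite invf_lt1 // qR_gt1.
have [h|h] := leP (q%:R ^+ n.+1) (ab x).
  left; rewrite /pole_out (@ab_near _ _ _ x r) // ab_subC; apply: lt_le_trans rx1 _.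
  exact: le_trans (qX_ge1 F R _) h.
right; have [c hc] := Kinf_digit xK h; exists c; rewrite -(subrKA x).
by apply: abD_le => //; apply: ltW; apply: lt_le_trans rx i1.
Qed.

Lemma pole_in_lt r : pole_in r -> ab r <= q%:R ^+ n.
Proof.
move=> [c hc]; rewrite -(subrK (inA c%:P * theta ^+ n) r); apply: abD_le.
  exact: le_trans hc (ltW qn_div_lt).
exact: ab_digit_le.
Qed.

(** Equality for poles is what lets the inequality of [star_factor] survive division by a
    denominator. *)
Lemma star_pole r : ~ Sreg N 1 r -> m0 r ^+ q.+1 = m1 r * \prod_(c : F) mi c r.
Proof.
have qn0 := qX_gt0 F R n; have q0 := qR_gt0 F R.
have lt1 : q%:R ^+ n < q%:R ^+ n.+1 :> R by rewrite exprS ltr_pMl // qR_gt1.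
move=> /pole_class[h|[c hc]]; rewrite m0E m1E.
  rewrite (max_idPr h) (max_idPr (ltW (lt_le_trans lt1 h))) exprS; congr (_ * _).
  rewrite (eq_bigr (fun=> ab r)) => [|c _]; first by rewrite prodr_const.
  have lt : q%:R ^+ n < ab r by exact: lt_le_trans h.
  rewrite miE abB_l; last exact: le_lt_trans (ab_digit_le c) lt.
  by apply/max_idPr/ltW/(lt_trans qn_div_lt).
have rn : ab r <= q%:R ^+ n by apply: pole_in_lt; exists c.
rewrite (max_idPl rn) (max_idPl (le_trans rn (ltW lt1))).
rewrite (star_prod_near (le_lt_trans hc qn_div_lt) (x := q%:R ^+ n / q%:R)).
  by rewrite qn_id.
by rewrite miE (max_idPl hc).
Qed.

(** Hence a pole-free denominator has constant absolute value on the vertex, and the size of P/Q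
    there is governed by P. *)
Lemma vertex0_pole z r : vertex 0 (theta ^+ n) z -> ~ Sreg N 1 r -> ab (z - r) = m0 r.
Proof.
rewrite m0E => -[]; rewrite subr0 ab_thetaX => zn zK /pole_class[h|[c hc]].
  have lt : q%:R ^+ n < ab r.
    by apply: lt_le_trans h; rewrite exprS ltr_pMl ?qX_gt0 // qR_gt1.
  by rewrite abB_r ?zn // (max_idPr (ltW lt)).
have rn : ab r <= q%:R ^+ n by apply: pole_in_lt; exists c.
rewrite (max_idPl rn); apply/eqP; rewrite eq_le; apply/andP; split.
  by apply: abB_le => //; rewrite zn.
rewrite -(subrKA (inA c%:P * theta ^+ n)).
have h2 : q%:R ^+ n <= ab (z - inA c%:P * theta ^+ n).
  by apply: zK; apply: KinfM; [exact: Kinf_inA | exact: Kinf_thetaX].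
rewrite abD_l //; apply: lt_le_trans h2; apply: le_lt_trans qn_div_lt.
by rewrite ab_subC.
Qed.

End AtN.
End Star.

(** * Subharmonicity of analytic functions on the tree *)

Section Key.
Variables (F : finFieldType) (R : realType) (C : cinf F R).
Local Notation ab := (@absC F R C).
Local Notation q := (#|F|).
Local Notation inA := (@embA F R C).
Local Notation theta := (@theta F R C).
Local Notation Om := (Omega C).
Local Notation Sreg := (@Sreg F R C).
Local Notation vtx n := (vertex 0 (theta ^+ n)).
Local Notation vin n c := (vertex (inA c%:P * theta ^+ n) (theta ^+ n / theta)).
Local Notation m0 n := (mv 0 (theta ^+ n)).
Local Notation mi n c := (mv (inA c%:P * theta ^+ n) (theta ^+ n / theta)).

Lemma thetaV_neq0 n : theta ^+ n / theta != 0.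
Proof. by rewrite mulf_neq0 ?invr_eq0 ?theta_neq0 ?thetaX_neq0. Qed.

Lemma vtx_Sreg n N z : (n <= N)%N -> vtx n z -> Sreg N 1 z.
Proof.
move=> nN [zn zK]; rewrite subr0 in zn; rewrite ab_thetaX in zn zK; split.
  by rewrite zn qX_le.
move=> x /zK; apply: le_trans; exact: le_trans (qV_le1 F R 1) (qX_ge1 F R n).
Qed.

Lemma vin_Sreg n N c z : (n <= N)%N -> vin n c z -> Sreg N 1 z.
Proof.
move=> nN [zn zK]; rewrite ab_thV in zn zK; split.
  apply: (@le_trans _ _ (q%:R ^+ n)); last exact: qX_le.
  rewrite -(subrK (inA c%:P * theta ^+ n) z); apply: abD_le; last exact: ab_digit_le.
  by rewrite zn ltW // qn_div_lt.
move=> x /zK; apply: le_trans; rewrite expr1 ler_peMl ?qX_ge1 //.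
by rewrite invr_ge0 ltW // qR_gt0.
Qed.

Lemma vtx_ex n (ts : seq C) :
  exists2 z, vtx n z & forall t, t \in ts -> ab (z - t) = m0 n t.
Proof.
apply: generic_point; [| exact: Kinf_thetaX | exact: thetaX_neq0].
by rewrite -(rmorph0 inA); exact: Kinf_inA.
Qed.

Lemma vin_ex n c (ts : seq C) :
  exists2 z, vin n c z & forall t, t \in ts -> ab (z - t) = mi n c t.
Proof.
apply: generic_point; last exact: thetaV_neq0.
  by apply: KinfM; [exact: Kinf_inA | exact: Kinf_thetaX].
by apply: KinfM; [exact: Kinf_thetaX | apply: KinfV; exact: Kinf_inA].
Qed.

Lemma pole_free_neq0 N (Q : {poly C}) : (forall z, Sreg N 1 z -> Q.[z] != 0) -> Q != 0.
Proof.
move=> hQ; have [z zn _] := vtx_ex 0 [::]; apply/eqP => Q0.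
by have := hQ z (vtx_Sreg (leq0n _) zn); rewrite Q0 horner0 eqxx.
Qed.

Lemma pole_out_of N (Q : {poly C}) ss : (forall z, Sreg N 1 z -> Q.[z] != 0) ->
  Q = lead_coef Q *: \prod_(r <- ss) ('X - r%:P) -> forall s, s \in ss -> ~ Sreg N 1 s.
Proof.
move=> hQ QE s sss Ss; have := hQ s Ss; rewrite -rootE QE.
by rewrite rootZ ?lead_coef_eq0 ?(pole_free_neq0 hQ) // root_prod_XsubC sss.
Qed.

Lemma rat_ab (P Q : {poly C}) rs ss z :
  P = lead_coef P *: \prod_(r <- rs) ('X - r%:P) ->
  Q = lead_coef Q *: \prod_(r <- ss) ('X - r%:P) ->
  ab (P.[z] / Q.[z]) = ab (lead_coef P / lead_coef Q) *
    (\prod_(r <- rs) ab (z - r) / \prod_(s <- ss) ab (z - s)).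
Proof.
move=> PE QE; rewrite {1}PE {1}QE !hornerZ !abf_div !absM !ab_horner_prod invfM.
by rewrite mulrACA.
Qed.

Lemma ratio_le (a X X' Y Y' : R) : 0 <= a -> 0 <= X -> X <= X' -> Y = Y' -> 0 < Y ->
  a * (X / Y) <= a * (X' / Y').
Proof. by move=> a0 X0 XX <- Y0; rewrite ler_wpM2l // ler_pM2r ?invr_gt0. Qed.

Lemma le_prod_seq (I : eqType) (r : seq I) (f g : I -> R) :
  (forall i, i \in r -> 0 <= f i <= g i) -> \prod_(i <- r) f i <= \prod_(i <- r) g i.
Proof. by move=> h; rewrite !big_seq; apply: ler_prod => i ir; exact: h. Qed.

(** A point generic for the roots of all the polynomials involved maximises every |P/Q| at once.
    Several numerators are allowed so that the family P - r Q, for finitely many r, can be treated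
    with one point. *)
Lemma generic_max n N (Q : {poly C}) (Ps : seq {poly C}) : (n < N)%N ->
  (forall z, Sreg N 1 z -> Q.[z] != 0) ->
  exists2 z', vtx n z' & forall P, P \in Ps -> forall z, vtx n z ->
    ab (P.[z] / Q.[z]) <= ab (P.[z'] / Q.[z']).
Proof.
move=> nN hQ; have [zs zsE] := choice (@C_split F R C).
have [z' z'n z'E] := vtx_ex n (zs Q ++ flatten [seq zs P | P <- Ps]).
exists z' => // P PPs z zn.
rewrite !(rat_ab _ (zsE P) (zsE Q)); apply: ratio_le; rewrite ?abs_ge0 //.
- by apply: prodr_ge0 => r _; exact: abs_ge0.
- apply: le_prod_seq => r rP; rewrite abs_ge0 z'E ?(vertex_le _ zn) //.
  by rewrite mem_cat; apply/orP; right; apply/flatten_mapP; exists P.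
- apply: eq_big_seq => s sQ; rewrite z'E ?mem_cat ?sQ //.
  by rewrite (vertex0_pole nN zn) //; exact: pole_out_of hQ (zsE Q) _ sQ.
rewrite big_seq; apply: prodr_gt0 => s sQ.
rewrite (vertex0_pole nN zn); first by apply: mv_gt0; exact: thetaX_neq0.
exact: pole_out_of hQ (zsE Q) _ sQ.
Qed.

(** Choose points generic for all roots on each neighbour: the numerator obeys [star_factor] root by
    root, and the denominator obeys the equality [star_pole]. *)
Lemma rat_star n N (P Q : {poly C}) : (n < N)%N ->
  (forall z, Sreg N 1 z -> Q.[z] != 0) ->
  exists z1, exists zi : F -> C, [/\ vtx n.+1 z1, forall c, vin n c (zi c) &
    forall z0, vtx n z0 -> ab (P.[z0] / Q.[z0]) ^+ q.+1 <=
      ab (P.[z1] / Q.[z1]) * \prod_(c : F) ab (P.[zi c] / Q.[zi c])].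
Proof.
move=> nN hQ; have [rs PE] := C_split P; have [ss QE] := C_split Q.
have [z1 z1n z1E] := vtx_ex n.+1 (rs ++ ss).
have hzi c : exists z, vin n c z /\ forall t, t \in rs ++ ss -> ab (z - t) = mi n c t.
  by have [z h1 h2] := vin_ex n c (rs ++ ss); exists z.
have [zi hi] := choice hzi.
exists z1, zi; split=> // [c|z0 z0n]; first by case: (hi c).
have Sss := pole_out_of hQ QE.
rewrite !(rat_ab _ PE QE); set a := ab (lead_coef P / _).
have a0 : 0 <= a by exact: abs_ge0.
under [X in _ <= _ * X]eq_bigr => c _ do rewrite (rat_ab _ PE QE) -/a.
rewrite big_split /= prodr_const big_split /= prodfV.
rewrite exprMn exprMn.
have -> : a * (\prod_(r <- rs) ab (z1 - r) / \prod_(s <- ss) ab (z1 - s)) *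
    (a ^+ q * ((\prod_(c : F) \prod_(r <- rs) ab (zi c - r)) *
      (\prod_(c : F) \prod_(s <- ss) ab (zi c - s))^-1)) =
  a ^+ q.+1 * ((\prod_(r <- rs) ab (z1 - r) * \prod_(c : F) \prod_(r <- rs) ab (zi c - r)) /
    (\prod_(s <- ss) ab (z1 - s) * \prod_(c : F) \prod_(s <- ss) ab (zi c - s))).
  by rewrite exprS invfM; ring.
rewrite [\prod_(c : F) \prod_(r <- rs) _]exchange_big [\prod_(c : F) \prod_(r <- ss) _]exchange_big /=.
rewrite -!big_split /= exprVn -!prodrXl.
apply: ratio_le; first exact: exprn_ge0.
- by apply: prodr_ge0 => r _; rewrite exprn_ge0 ?abs_ge0.
- apply: le_prod_seq => r rrs; rewrite exprn_ge0 ?abs_ge0 //=.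
  rewrite z1E ?mem_cat ?rrs //.
  rewrite (eq_bigr (fun c => mi n c r)); last first.
    by move=> c _; case: (hi c) => _ -> //; rewrite mem_cat rrs.
  apply: le_trans (star_factor n r); rewrite lerXn2r ?nnegrE ?abs_ge0 //.
    by rewrite ltW // mv_gt0 // thetaX_neq0.
  exact: vertex_le.
- apply: eq_big_seq => s sss; rewrite z1E ?mem_cat ?sss ?orbT //.
  rewrite (eq_bigr (fun c => mi n c s)); last first.
    by move=> c _; case: (hi c) => _ -> //; rewrite mem_cat sss orbT.
  by rewrite (vertex0_pole nN z0n (Sss s sss)) (star_pole nN (Sss s sss)).
rewrite big_seq; apply: prodr_gt0 => s sss.
by rewrite exprn_gt0 // (vertex0_pole nN z0n (Sss s sss)) mv_gt0 // thetaX_neq0.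
Qed.

(** The approximation error in [star_fun] must lie below each bound, so bounds equal to 0 are
    replaced by positive ones without losing the strict inequality. *)
Lemma slack (X Y B : R) k : (0 < k)%N -> 0 <= X -> 0 <= Y -> X * Y ^+ k < B ->
  exists X', exists Y', [/\ 0 < X', 0 < Y', X <= X', Y <= Y' & X' * Y' ^+ k < B].
Proof.
move=> k0 X0 Y0 h; have [X00|Xn] := eqVneq X 0.
  have B0 : 0 < B by move: h; rewrite X00 mul0r.
  have Y1 : 0 < Y + 1 by lra.
  exists (B / 2 / (Y + 1) ^+ k), (Y + 1); split; rewrite ?divr_gt0 ?exprn_gt0 //.
  - by rewrite X00 ltW // !divr_gt0 ?exprn_gt0.
  - lra.
  - by rewrite divfK ?gt_eqF ?exprn_gt0 //; lra.
have Xp : 0 < X by rewrite lt_def Xn.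
have [Y00|Yn] := eqVneq Y 0.
  have B0 : 0 < B by move: h; rewrite Y00 expr0n gtn_eqF // mulr0.
  pose Y' := Num.min 1 (B / 2 / X).
  have Y'0 : 0 < Y' by rewrite lt_min ltr01 !divr_gt0.
  exists X, Y'; split=> //; first by rewrite Y00 ltW.
  have Y'1 : Y' <= 1 by rewrite ge_min lexx.
  apply: (@le_lt_trans _ _ (X * Y')).
    by rewrite ler_pM2l // -[leRHS]expr1 ler_wiXn2l // ltW.
  apply: (@le_lt_trans _ _ (X * (B / 2 / X))); first by rewrite ler_pM2l // ge_min lexx orbT.
  by rewrite mulrC divfK //; lra.
by exists X, Y; split=> //; rewrite lt_def Yn.
Qed.

Lemma approx_bound (f : Om -> C) (phi : C -> C) (X e : R) (z : Om) : ab (f z) <= X ->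
  e <= X -> ab (f z - phi (val z)) < e -> ab (phi (val z)) <= X.
Proof.
move=> fX eX h; rewrite -(subrK (f z) (phi (val z))); apply: abD_le => //.
by rewrite ab_subC; apply: le_trans (ltW h) eX.
Qed.

Definition toOm N z (Sz : Sreg N 1 z) : Om :=
  exist _ z (mem_set (Sreg_Omega Sz)).

(** If the inequality failed, it would fail for a rational approximant P/Q close enough to have
    |P/Q| = |f| at z0, against [rat_star]. *)
Lemma star_fun n N (f : Om -> C) (X Y : R) : (n < N)%N -> appr (Sreg N 1) f ->
  0 <= X -> 0 <= Y ->
  (forall z : Om, vtx n.+1 (val z) -> ab (f z) <= X) ->
  (forall c (z : Om), vin n c (val z) -> ab (f z) <= Y) ->
  forall z0 : Om, vtx n (val z0) -> ab (f z0) ^+ q.+1 <= X * Y ^+ q.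
Proof.
move=> nN hf X0 Y0 hX hY z0 z0n; rewrite leNgt; apply/negP => lt.
have [X' [Y' [X'0 Y'0 XX YY lt']]] := slack (qpos F) X0 Y0 lt.
have f0 : 0 < ab (f z0).
  rewrite ab_gt0; apply/eqP => f0; move: lt'; rewrite f0 ab0 expr0n /= => h.
  by have := lt_trans (mulr_gt0 X'0 (exprn_gt0 q Y'0)) h; rewrite ltxx.
pose e := Num.min (ab (f z0)) (Num.min X' Y').
have e0 : 0 < e by rewrite !lt_min f0 X'0.
have [ef eX eY] : [/\ e <= ab (f z0), e <= X' & e <= Y'].
  by rewrite /e !ge_min !lexx !orbT.
have [P [Q [hQ hPQ]]] := hf e e0.
have [z1 [zi [z1n zin hz]]] := rat_star P nN hQ.
have S0 : Sreg N 1 (val z0) by apply: vtx_Sreg z0n; exact: ltnW.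
have e1 : ab (P.[val z0] / Q.[val z0]) = ab (f z0).
  by apply: ab_near; apply: lt_le_trans (hPQ _ S0) ef.
have := hz _ z0n; rewrite e1 leNgt => /negP; apply; apply: le_lt_trans lt'.
have S1 : Sreg N 1 z1 by exact: vtx_Sreg z1n.
have Si c : Sreg N 1 (zi c) by apply: vin_Sreg (zin c); exact: ltnW.
have -> : Y' ^+ q = \prod_(c : F) Y' by rewrite prodr_const.
apply: ler_pM; rewrite ?abs_ge0 //.
- by apply: prodr_ge0 => c _; exact: abs_ge0.
- apply: (@approx_bound f (fun z => P.[z] / Q.[z]) X' e (toOm S1)) => //.
    by apply: le_trans (hX _ _) XX.
  exact: (hPQ (toOm S1) S1).
- apply: ler_prod => c _; rewrite abs_ge0 /=.
  apply: (@approx_bound f (fun z => P.[z] / Q.[z]) Y' e (toOm (Si c))) => //.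
    by apply: le_trans (hY c _ _) YY.
  exact: (hPQ (toOm (Si c)) (Si c)).
Qed.

Lemma vtx_max n N (f : Om -> C) : (n < N)%N -> appr (Sreg N 1) f ->
  exists2 z' : Om, vtx n (val z') & forall z : Om, vtx n (val z) -> ab (f z) <= ab (f z').
Proof.
move=> nN hf.
have [[z0 [z0n f0]]|h] := pselect (exists z0 : Om, vtx n (val z0) /\ f z0 != 0); last first.
  have [z zn _] := vtx_ex n [::].
  have Sz : Sreg N 1 z by apply: vtx_Sreg zn; exact: ltnW.
  exists (toOm Sz) => // w wn; suff -> : f w = 0 by rewrite ab0 abs_ge0.
  by apply/eqP/negPn/negP => fw; apply: h; exists w.
have e0 : 0 < ab (f z0) by rewrite ab_gt0.
have [P [Q [hQ hPQ]]] := hf _ e0.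
have [z' z'n hz'] := generic_max [:: P] nN hQ.
have Sz' : Sreg N 1 z' by apply: vtx_Sreg z'n; exact: ltnW.
have Sv (z : Om) : vtx n (val z) -> Sreg N 1 (val z) by apply: vtx_Sreg; exact: ltnW.
exists (toOm Sz') => // z zn.
have H := hz' P (mem_head _ _).
have h0 : ab (P.[val z0] / Q.[val z0]) = ab (f z0).
  by apply: ab_near; exact: hPQ (Sv _ z0n).
have h1 : ab (f z0) <= ab (P.[z'] / Q.[z']) by rewrite -h0; exact: H.
have h2 : ab (f (toOm Sz')) = ab (P.[z'] / Q.[z']).
  by apply: ab_near; rewrite ab_subC; apply: lt_le_trans h1; exact: (hPQ (toOm Sz')).
rewrite h2 -(subrK (P.[val z] / Q.[val z]) (f z)); apply: abD_le; last exact: H.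
exact: le_trans (ltW (hPQ _ (Sv _ zn))) h1.
Qed.

End Key.

(** * Enumeration of polynomials of bounded degree *)

Section Enum.
Variable F : finFieldType.

Fixpoint polys n : seq {poly F} :=
  if n is m.+1 then [seq p + c *: 'X^m | p <- polys m, c <- enum F] else [:: 0].

Lemma mem_polys n p : (p \in polys n) = (size p <= n)%N.
Proof.
elim: n p => [|n IH] p; first by rewrite inE size_poly_leq0.
apply/allpairsP/idP => [[[p' c] /= [hp' _ ->]]|hp].
  rewrite (leq_trans (size_polyD _ _)) // geq_max; rewrite IH in hp'.
  by rewrite (leq_trans hp') //= (leq_trans (size_scale_leq _ _)) // size_polyXn.
exists (p - p`_n *: 'X^n, p`_n); rewrite mem_enum subrK; split=> //.
rewrite IH; apply/leq_sizeP => j nj; rewrite coefB coefZ coefXn.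
have [->|jn] := eqVneq j n; first by rewrite mulr1 subrr.
rewrite mulr0 subr0; move/leq_sizeP: hp; apply.
by rewrite ltn_neqAle eq_sym jn.
Qed.

Lemma polys_uniq n : uniq (polys n).
Proof.
elim: n => //= n IH; rewrite allpairs_uniq ?enum_uniq //.
move=> [p c] [p' c'] /allpairsP[[x d] [/= hx _ [-> ->]]] /allpairsP[[y d'] [/= hy _ [-> ->]]] /= e.
have cc : d = d'.
  have := congr1 (fun p : {poly F} => p`_n) e.
  rewrite !coefD !coefZ coefXn eqxx !mulr1.
  by rewrite !nth_default ?add0r // -mem_polys.
by move: e; rewrite cc => /addIr ->.
Qed.

End Enum.

Lemma seq_argmin (R : realType) (T : eqType) (s : seq T) (f : T -> R) : s != [::] ->
  exists2 x, x \in s & forall y, y \in s -> f x <= f y.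
Proof.
elim: s => // a [|b s] IH _; first by exists a; rewrite ?mem_head // => y; rewrite inE => /eqP ->.
have [//|x xs hx] := IH.
have [le|lt] := leP (f a) (f x).
  exists a; rewrite ?mem_head // => y; rewrite inE => /orP[/eqP ->//|ys].
  exact: le_trans le (hx y ys).
exists x; first by rewrite inE xs orbT.
by move=> y; rewrite inE => /orP[/eqP ->|/hx //]; exact: ltW.
Qed.

(** * The fundamental domain and the vanishing theorem *)

Section Key2.
Variables (F : finFieldType) (R : realType) (C : cinf F R).
Local Notation ab := (@absC F R C).
Local Notation q := (#|F|).
Local Notation A := {poly F}.
Local Notation inA := (@embA F R C).
Local Notation Kinf := (@Kinf F R C).
Local Notation theta := (@theta F R C).
Local Notation Om := (Omega C).
Local Notation Sreg := (@Sreg F R C).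
Local Notation vtx n := (vertex 0 (theta ^+ n)).
Local Notation vin n c := (vertex (inA c%:P * theta ^+ n) (theta ^+ n / theta)).
Local Notation m0 n := (mv 0 (theta ^+ n)).
Local Notation GL := (@GL2A F).

(** A maximum principle on an open edge: |P/Q| at z is at most a constant times |z|^(j-k), where j
    and k count the roots of P and Q of absolute value at most |z|, and a power of |z| is largest at
    an end of the edge. *)
Lemma rat_edge n N (P Q : {poly C}) : (n < N)%N ->
  (forall z, Sreg N 1 z -> Q.[z] != 0) ->
  exists z0, exists z1, [/\ vtx n z0, vtx n.+1 z1 &
   forall z, q%:R ^+ n < ab z < q%:R ^+ n.+1 ->
     ab (P.[z] / Q.[z]) <= Num.max (ab (P.[z0] / Q.[z0])) (ab (P.[z1] / Q.[z1]))].
Proof.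
move=> nN hQ; have [rs PE] := C_split P; have [ss QE] := C_split Q.
have [z0 z0n z0E] := vtx_ex n (rs ++ ss).
have [z1 z1n z1E] := vtx_ex n.+1 (rs ++ ss).
exists z0, z1; split=> // z /andP[zn zn1].
have Sss := pole_out_of hQ QE.
rewrite !(rat_ab _ PE QE) -maxr_pMr ?abs_ge0 //; apply: ler_wpM2l; first exact: abs_ge0.
set t := ab z in zn zn1; have qn0 := qX_gt0 F R n; have qn1 := qX_gt0 F R n.+1.
have t0 : 0 < t by exact: lt_trans zn.
(* [b r] records whether r lies inside the circle through z. The same [b] and [o] then describe the
   factor of r seen from z and, up to an inequality in the right direction, from the two end
   vertices. *)
pose b r : nat := (ab r <= t); pose o r : R := if ab r <= t then 1 else ab r.
have o0 r : 0 < o r by rewrite /o; case: (leP (ab r) t) => // h; exact: lt_trans t0 h.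
have zr r : ab (z - r) <= t ^+ b r * o r.
  rewrite /b /o; case: (leP (ab r) t) => h /=.
    by rewrite expr1 mulr1; apply: abB_le.
  by rewrite expr0 mul1r abB_r.
have m0r r : (q%:R ^+ n) ^+ b r * o r <= m0 n r.
  rewrite m0E /b /o; case: (leP (ab r) t) => h /=.
    by rewrite expr1 mulr1 le_max lexx.
  by rewrite expr0 mul1r le_max lexx orbT.
have m1r r : (q%:R ^+ n.+1) ^+ b r * o r <= m0 n.+1 r.
  rewrite m0E /b /o; case: (leP (ab r) t) => h /=.
    by rewrite expr1 mulr1 le_max lexx.
  by rewrite expr0 mul1r le_max lexx orbT.
have pole s : s \in ss -> [/\ ab (z - s) = t ^+ b s * o s,
   m0 n s = (q%:R ^+ n) ^+ b s * o s & m0 n.+1 s = (q%:R ^+ n.+1) ^+ b s * o s].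
  move=> /Sss /(pole_class nN); rewrite !m0E /b /o => -[h|h].
    have lt : t < ab s by exact: lt_le_trans zn1 h.
    rewrite leNgt lt /= !expr0 !mul1r abB_r //; split=> //.
      by apply/max_idPr/ltW/(lt_trans zn).
    by apply/max_idPr.
  have sn := pole_in_lt h; have st : ab s < t by exact: le_lt_trans sn zn.
  rewrite (ltW st) /= !expr1 !mulr1 abB_l //; split=> //; apply/max_idPl => //.
  by apply: le_trans sn _; exact: qX_le.
pose j := (\sum_(r <- rs) b r)%N; pose k := (\sum_(s <- ss) b s)%N.
have prodE (x : R) (l : seq C) : \prod_(r <- l) (x ^+ b r * o r) =
    x ^+ (\sum_(r <- l) b r)%N * \prod_(r <- l) o r.
  by rewrite big_split /= prodrXr.
pose X := \prod_(r <- rs) o r; pose W := \prod_(s <- ss) o s.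
have X0 : 0 < X by apply: prodr_gt0 => r _.
have W0 : 0 < W by apply: prodr_gt0 => r _.
have eqz : \prod_(s <- ss) ab (z - s) = t ^+ k * W.
  by rewrite -prodE; apply: eq_big_seq => s /pole[].
have eq0 : \prod_(s <- ss) ab (z0 - s) = (q%:R ^+ n) ^+ k * W.
  rewrite -prodE; apply: eq_big_seq => s sss.
  by rewrite z0E ?mem_cat ?sss ?orbT //; case: (pole s sss).
have eq1 : \prod_(s <- ss) ab (z1 - s) = (q%:R ^+ n.+1) ^+ k * W.
  rewrite -prodE; apply: eq_big_seq => s sss.
  by rewrite z1E ?mem_cat ?sss ?orbT //; case: (pole s sss).
have lez : \prod_(r <- rs) ab (z - r) <= t ^+ j * X.
  by rewrite -prodE; apply: le_prod_seq => r _; rewrite abs_ge0 zr.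
have le0 : (q%:R ^+ n) ^+ j * X <= \prod_(r <- rs) ab (z0 - r).
  rewrite -prodE; apply: le_prod_seq => r rrs; rewrite z0E ?mem_cat ?rrs // m0r.
  by rewrite mulr_ge0 ?exprn_ge0 // ltW.
have le1 : (q%:R ^+ n.+1) ^+ j * X <= \prod_(r <- rs) ab (z1 - r).
  rewrite -prodE; apply: le_prod_seq => r rrs; rewrite z1E ?mem_cat ?rrs // m1r.
  by rewrite mulr_ge0 ?exprn_ge0 // ltW.
rewrite eqz eq0 eq1.
have step (a Y : R) : 0 < a -> a ^+ j * X <= Y -> t ^+ j / t ^+ k <= a ^+ j / a ^+ k ->
    \prod_(r <- rs) ab (z - r) / (t ^+ k * W) <= Y / (a ^+ k * W).
  move=> a0 aY ta; apply: (@le_trans _ _ (t ^+ j / t ^+ k * (X / W))).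
    rewrite mulrACA -invfM; apply: ler_wpM2r lez.
    by rewrite invr_ge0 mulr_ge0 ?exprn_ge0 // ltW.
  apply: (@le_trans _ _ (a ^+ j / a ^+ k * (X / W))).
    by apply: ler_wpM2r ta; rewrite divr_ge0 // ltW.
  rewrite mulrACA -invfM; apply: ler_wpM2r aY.
  by rewrite invr_ge0 mulr_ge0 ?exprn_ge0 // ltW.
(* The quotient |z|^j / |z|^k grows with |z| when k <= j and decreases otherwise: compare with the
   outer or the inner end. *)
rewrite le_max; have [kj|jk] := leqP k j; apply/orP; [right|left].
  apply: step le1 _ => //.
  have E (x : R) : 0 < x -> x ^+ j / x ^+ k = x ^+ (j - k).
    by move=> x0; rewrite -{1}(subnK kj) exprD mulfK // expf_neq0 // gt_eqF.
  by rewrite !E // lerXn2r ?nnegrE ?ltW.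
apply: step le0 _ => //.
have E (x : R) : 0 < x -> x ^+ j / x ^+ k = x ^- (k - j).
  move=> x0; rewrite -{1}(subnK (ltnW jk)) exprD invfM mulrCA mulfV ?mulr1 //.
  by rewrite expf_neq0 // gt_eqF.
by rewrite !E // lef_pV2 ?posrE ?exprn_gt0 ?qR_gt0 // lerXn2r ?nnegrE ?ltW ?exprn_gt0 ?qR_gt0.
Qed.

(** The classical fundamental set of GL_2(A), where |w| is at least 1 and equals the distance from w
    to K_infinity; it lies over the half line ([fund_cases]). *)
Definition fund (w : C) := 1 <= ab w /\ forall x, Kinf x -> ab w <= ab (w - x).

Lemma fund_cases w : fund w -> exists n,
  vtx n w \/ q%:R ^+ n < ab w < q%:R ^+ n.+1.
Proof.
move=> [w1 wK]; have [m hm] := qpow_large F (ab w).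
have ex : exists m, ab w < q%:R ^+ m by exists m.
case: (ex_minnP ex) => -[|n] hn hmin; first by move: hn; rewrite expr0 ltNge w1.
exists n; have : ~~ (ab w < q%:R ^+ n) by apply/negP => /hmin; rewrite ltnn.
rewrite -leNgt le_eqVlt => /orP[/eqP e|lt]; last by right; rewrite lt.
by left; split; rewrite ?subr0 ab_thetaX e.
Qed.

Lemma fund_edge w n : q%:R ^+ n < ab w < q%:R ^+ n.+1 -> Sreg n.+1 1 w.
Proof.
move=> /andP[wn wn1]; split; first exact: ltW.
move=> x xK; apply: le_trans (qV_le1 F R 1) _.
have [h|h] := ltP (ab x) (q%:R ^+ n.+1).
  have xn : ab x <= q%:R ^+ n.
    have [c hc] := Kinf_digit xK h; rewrite -(subrK (inA c%:P * theta ^+ n) x).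
    apply: abD_le; [exact: le_trans hc (ltW (qn_div_lt F R n)) | exact: ab_digit_le].
  by rewrite abB_l ?(le_lt_trans xn) // ltW // (le_lt_trans (qX_ge1 F R n)).
by rewrite abB_r ?(lt_le_trans wn1) // (le_trans _ h) // qX_ge1.
Qed.

(** Vectors c z + d of norm at most 1 have coefficients of bounded degree, so the first minimum of
    the lattice is sought in a finite set containing (0, 1). *)
Lemma min_vector (z : Om) : exists c, exists d : A, (c, d) != (0, 0) /\
  forall c' d' : A, (c', d') != (0, 0) ->
    ab (inA c * val z + inA d) <= ab (inA c' * val z + inA d').
Proof.
have [M hM] := not_Kinf_dist z; have [N hN] := qpow_large F (ab (val z)).
pose K := (M + N).+1.
pose s := [seq x <- [seq (c, d) | c <- polys F K, d <- polys F K] | x != (0, 0)].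
have ins c d : ((c, d) \in s) = ((c, d) != (0, 0)) && ((size c <= K)%N && (size d <= K)%N).
  rewrite mem_filter; congr (_ && _); apply/allpairsP/andP => [[[x y] /= [hx hy [-> ->]]]|[hc hd]].
    by rewrite -!mem_polys.
  by exists (c, d); rewrite !mem_polys.
pose f x := ab (inA x.1 * val z + inA x.2).
have in01 : (0, 1) \in s.
  by rewrite ins size_poly0 size_poly1 andbT; apply/eqP => -[] /eqP; rewrite oner_eq0.
have [|[c d]] := @seq_argmin R _ s f; first by apply/eqP => e; rewrite e in in01.
rewrite ins => /andP[cd0 _] hmin; exists c, d; split=> // c' d' cd'.
have f1 : f (c, d) <= 1 by apply: le_trans (hmin _ in01) _; rewrite /f rmorph0 mul0r add0r rmorph1 ab1.
have [h|h] := leP (ab (inA c' * val z + inA d')) 1; last exact: le_trans f1 (ltW h).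
apply: (hmin (c', d')); rewrite ins cd' /=.
have hc : ab (inA c') <= q%:R ^+ M.
  have := le_trans (ab_lin_ge c' d' hM) h.
  by rewrite ler_pdivrMr ?qX_gt0 // mul1r.
have hd : ab (inA d') <= q%:R ^+ (M + N).
  have -> : inA d' = (inA c' * val z + inA d') - inA c' * val z by rewrite addrC addKr.
  apply: abB_le; first by apply: le_trans h (qX_ge1 F R _).
  by rewrite absM exprD; apply: ler_pM; rewrite ?abs_ge0 // ltW.
rewrite -(ab_inA_leq C) -(ab_inA_leq C) hd andbT; apply: le_trans hc _.
by apply: qX_le; exact: leq_addr.
Qed.

Lemma min_translate (y : C) : exists a : A, forall b : A, ab (y - inA a) <= ab (y - inA b).
Proof.
have [N hN] := qpow_large F (ab y).
have [|a ha hmin] := @seq_argmin R _ (polys F N) (fun a => ab (y - inA a)).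
  by apply/eqP => e; have := mem_polys N (0 : A); rewrite e size_poly0.
exists a => b; have [hb|hb] := leqP (size b) N; first by apply: hmin; rewrite mem_polys.
have lt : ab y < ab (inA b).
  by rewrite ltNge; apply/negP => h; move: hb; rewrite ltnNge -(ab_inA_lt C) (le_lt_trans h hN).
rewrite [leRHS]abB_r //; apply: le_trans (ltW lt).
have := hmin 0; rewrite rmorph0 subr0; apply.
by rewrite mem_polys size_poly0.
Qed.

(** Lattice reduction: a shortest vector c z + d is primitive, hence the lower row of a matrix of
    GL_2(A), and subtracting the nearest polynomial makes |z| minimal. *)
Lemma fund_reduce (z : Om) : exists2 g, GL g & fund (val (mob g z)).
Proof.
have [c [d [cd hmin]]] := min_vector z.
have nz c' d' (h : (c', d') != (0, 0)) := lin_neq0 z h.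
(* Dividing by a common factor r would shorten the vector by |r|, so r is constant. *)
have cop : coprimep c d.
  rewrite /coprimep; set r := gcdp c d.
  have r0 : r != 0 by apply: contra cd; rewrite gcdp_eq0 => /andP[/eqP-> /eqP->].
  have cE := divpK (dvdp_gcdl c d); have dE := divpK (dvdp_gcdr c d).
  rewrite -/r in cE dE.
  have cd' : (c %/ r, d %/ r) != (0, 0).
    by apply: contra cd => /eqP[e1 e2]; rewrite -cE -dE e1 e2 !mul0r.
  have e : inA c * val z + inA d = inA r * (inA (c %/ r) * val z + inA (d %/ r)).
    by rewrite -{1}cE -{1}dE !rmorphM; ring.
  have := hmin _ _ cd'; rewrite e absM.
  rewrite ger_pMl ?ab_gt0 ?nz // -(expr0 (q%:R : R)) ab_inA_leq => h.
  by rewrite eqn_leq h lt0n size_poly_eq0.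
have [[u v] /= uv] := Bezout_coprimepP _ _ cop.
pose g0 := mx2 v (- u) c d.
have g0G : GL g0.
  have /size_poly1P [e e0 eE] : size (u * c + v * d)%R == 1%N by rewrite (eqp_size uv) size_poly1.
  by apply: (det_GL e0); rewrite det_mx2 mulNr opprK addrC.
have [a ha] := min_translate (val (mob g0 z)).
pose g := Tmx (- a) *m g0; have gG : GL g by exact: GL_mul (GL_T _) g0G.
have wE : val (mob g z) = val (mob g0 z) - inA a.
  by rewrite /g (mob_mul _ (GL_T _) g0G) val_T rmorphN.
exists g => //; rewrite wE; set w := _ - _.
have hw (b : A) : ab w <= ab (w - inA b).
  by have := ha (a + b); rewrite rmorphD opprD addrA.
have w1 : 1 <= ab w.
  have Jz : J g0 z = inA c * val z + inA d by rewrite /J !mx2E.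
  have J0 : J g0 z != 0 by exact: J_neq0.
  have Jp : 0 < ab (J g0 z) by rewrite ab_gt0.
  have h : w * J g0 z = inA (v - a * c) * val z + inA (- u - a * d).
    rewrite /w mobE // mulrBl divfK // /J !mx2E !rmorphB !rmorphM; ring.
  rewrite -(ler_pM2r Jp) mul1r -absM h Jz; apply: hmin.
  apply/eqP => -[e1 e2]; have := inA_det_neq0 C g0G; rewrite det_mx2.
  move/eqP: e1; rewrite subr_eq0 => /eqP ->; move/eqP: e2; rewrite subr_eq0 => /eqP ->.
  by rewrite mulrAC subrr rmorph0 eqxx.
split=> // x /Kinf_near[b hb].
apply: le_trans (hw b) _; rewrite -[w - x](subrKA (inA b)) [leRHS]abD_l //.
by rewrite [ab (inA b - x)]ab_subC; exact: lt_le_trans hb (le_trans w1 (hw b)).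
Qed.

(** Inner neighbours of vertex n + 1 are translates of vertex n, and those of vertex 0 are brought
    to vertex 1 by an inversion ([vin_inv]): each star folds onto the half line. *)
Lemma vin_vtx n c (z : Om) : vin n.+1 c (val z) ->
  vtx n (val (mob (Tmx (- (c%:P * 'X^(n.+1)))%R) z)).
Proof.
rewrite val_T rmorphN rmorphM rmorphXn => -[]; rewrite exprSr mulfK ?theta_neq0 //.
move=> zn zK; split; first by rewrite subr0.
move=> x xK; rewrite -exprSr -addrA -opprD; apply: zK.
apply: KinfD => //; apply: KinfM; [exact: Kinf_inA | exact: Kinf_thetaX].
Qed.

Lemma vin_inv c (z : Om) : vin 0 c (val z) ->
  vtx 1 (val (mob Smx (mob (Tmx (- c%:P)) z))).
Proof.
rewrite val_S val_T rmorphN expr0 mulr1 expr1 div1r => -[].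
set w := val z - _; rewrite abV ab_theta => wq zK.
have q0 := qR_gt0 F R; have q1 := qR_gt1 F R.
have w0 : w != 0 by rewrite -ab_gt0 wq invr_gt0.
have aw : ab w^-1 = q%:R by rewrite abV wq invrK.
split; first by rewrite subr0 aw ab_theta.
move=> x xK; rewrite ab_theta.
have [h|h] := ltP (ab x) q%:R; first by rewrite abB_l aw.
have x0 : x != 0 by rewrite -ab_gt0 (lt_le_trans q0).
have -> : w^-1 - x = - (x / w) * (w - x^-1) by field; rewrite x0 w0.
rewrite absM abN abf_div wq invrK -mulrA; apply: le_trans h _.
rewrite ler_peMr ?abs_ge0 //.
have /zK : Kinf (x^-1 + inA c%:P) by apply: KinfD; [exact: KinfV | exact: Kinf_inA].
rewrite -ler_pdivrMl // mulr1 => h2.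
by rewrite /w -addrA -opprD [inA _ + _]addrC.
Qed.

(** The union of the regions [Sreg N 1]. On it |s_2| is constant for small t ([s2_far]), so
    quotients by powers of s_2 are available there. *)
Definition far (z : Om) := forall x, Kinf x -> q%:R^-1 <= ab (val z - x).

Lemma far_Sreg N (z : Om) : Sreg N 1 (val z) -> far z.
Proof. by case=> _ h x /h; rewrite expr1. Qed.

Lemma far_T a (z : Om) : far z -> far (mob (Tmx a) z).
Proof.
move=> h x xK; rewrite val_T; have -> : val z + inA a - x = val z - (x - inA a) by ring.
apply: h.
by apply: KinfB => //; exact: Kinf_inA.
Qed.

Lemma fund_far (z : Om) : fund (val z) -> far z.
Proof.
case=> z1 h x /h; apply: le_trans; apply: le_trans z1.
by rewrite invf_le1 ?qR_gt0 // ltW // qR_gt1.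
Qed.

(* Restricted to points far from Kinf, so that it applies to quotients by functions with zeros. *)
Definition ab_modular (w : int) (f : Om -> C) :=
  forall g z, GL g -> far z -> far (mob g z) -> ab (f (mob g z)) = ab (J g z) ^ w * ab (f z).

Section Modular.
Variables (w : int) (f : Om -> C).
Hypothesis fM : ab_modular w f.
Hypothesis fA : forall N, appr (Sreg N 1) f.
Local Notation Q := (q%:R ^ w : R).

Lemma Qw_gt0 : 0 < Q. Proof. by rewrite exprz_gt0 // qR_gt0. Qed.

Lemma ab_vin n c (z : Om) (B : R) : (forall y : Om, vtx n (val y) -> ab (f y) <= B) ->
  vin n.+1 c (val z) -> ab (f z) <= B.
Proof.
move=> hB zc; have fz := far_Sreg (vin_Sreg (leqnn n.+1) zc).
move: zc => /vin_vtx /hB; rewrite fM ?J_T; [|exact: GL_T|exact: fz|exact: far_T].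
by rewrite ab1 exp1rz mul1r.
Qed.

Lemma ab_vin0 c (z : Om) (B : R) : (forall y : Om, vtx 1 (val y) -> ab (f y) <= B) ->
  vin 0 c (val z) -> ab (f z) <= Q * B.
Proof.
move=> hB zc; have := hB _ (vin_inv zc).
set y := mob (Tmx (- c%:P)) z.
have yq : ab (val y) = q%:R^-1.
  case: zc; rewrite expr0 mulr1 div1r abV ab_theta => h _.
  by rewrite /y val_T rmorphN.
have fz := far_Sreg (vin_Sreg (leqnn 0) zc).
have fy : far y by exact: far_T.
have fS := far_Sreg (vtx_Sreg (leqnn 1) (vin_inv zc)).
rewrite fM ?J_S; [|exact: GL_S|exact: fy|exact: fS].
rewrite fM ?J_T; [|exact: GL_T|exact: fz|exact: fy].
rewrite ab1 exp1rz mul1r yq exprz_inv -invr_expz mulrC ler_pdivrMr ?Qw_gt0 //.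
by rewrite mulrC.
Qed.

(** If f is 0 on vertex n, it is 0 on the inner neighbours of vertex n + 1, and the star inequality
    forces 0 on vertex n + 1. Open edges follow from [rat_edge]. *)
Lemma zero_propagate : (forall z : Om, vtx 0 (val z) -> f z = 0) -> forall z, fund (val z) -> f z = 0.
Proof.
move=> h0; have hn n : forall z : Om, vtx n (val z) -> f z = 0.
  elim: n => // n IH z zn.
  have [B B0 hB] := appr_bounded (fA n.+3).
  have := @star_fun _ _ _ n.+1 n.+3 f B 0 (leqnSn _) (fA _) (ltW B0) (lexx _) _ _ z zn.
  rewrite expr0n gtn_eqF ?qpos // mulr0 => h.
  have : ab (f z) ^+ q.+1 = 0.
    apply/eqP; rewrite eq_le exprn_ge0 ?abs_ge0 // andbT; apply: h.
      move=> y yn; apply: hB; exact: vtx_Sreg yn.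
    by move=> c y yc; apply: ab_vin yc => x /IH ->; rewrite ab0.
  by move/eqP; rewrite expf_eq0 /= ab_eq0 => /eqP.
have he n (z : Om) : q%:R ^+ n < ab (val z) < q%:R ^+ n.+1 -> f z = 0.
  move=> zn; apply: ab_le_eps => e e0.
  have [P [W [hW hPW]]] := fA n.+1 e0.
  have [z0 [z1 [z0n z1n hz]]] := rat_edge P (leqnn n.+1) hW.
  have S0 : Sreg n.+1 1 z0 by exact: vtx_Sreg z0n.
  have S1 : Sreg n.+1 1 z1 by exact: vtx_Sreg z1n.
  have Sz := fund_edge zn.
  rewrite -(subrK (P.[val z] / W.[val z]) (f z)); apply: abD_le; first exact: ltW (hPW z Sz).
  apply: le_trans (hz _ zn) _; rewrite ge_max; apply/andP; split; apply: ltW.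
    by have := hPW (toOm S0) S0; rewrite (hn n) // sub0r abN.
  by have := hPW (toOm S1) S1; rewrite (hn n.+1) // sub0r abN.
by move=> z /fund_cases[n [/hn|/he]].
Qed.

(** This is q + q^2 + ... + q^n, the exponent for which |u| <= q^(-sq n) on vertex n ([u_vtx]). *)
Fixpoint sq n : nat := if n is m.+1 then (q * (sq m).+1)%N else 0%N.

Lemma sq_ge n : (n <= sq n)%N.
Proof. by elim: n => //= n IH; rewrite (leq_trans (_ : n < (sq n).+1)%N) // leq_pmull // qpos. Qed.

(** With X_n the maximum of |f| on vertex n, the star inequalities are X_0^(q+1) <= X_1 (q^w X_1)^q
    and X_(n+1)^(q+1) <= X_(n+2) X_n^q. They make Y_n = X_n^(q+1) q^(w sq n) nondecreasing if X_0 >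
    0, whereas the growth hypothesis with w < k (q+1) makes Y_n tend to 0. So X_0 = 0 and the zero
    propagates. *)
Theorem vanishing (k : nat) (M : R) (N0 : nat) : w < (k * q.+1)%:Z ->
  (forall n, (N0 <= n)%N -> forall z : Om, vtx n (val z) -> ab (f z) <= M / q%:R ^+ (k * sq n)) ->
  forall z, fund (val z) -> f z = 0.
Proof.
move=> wk growth.
have hx' n : exists z : Om, vtx n (val z) /\ forall y : Om, vtx n (val y) -> ab (f y) <= ab (f z).
  by have [z h1 h2] := vtx_max (leqnn n.+1) (fA n.+1); exists z.
have [x hx] := choice hx'.
pose X n := ab (f (x n)).
have X0 n : 0 <= X n by exact: abs_ge0.
have Xmax n (y : Om) : vtx n (val y) -> ab (f y) <= X n by case: (hx n) => _; apply.
have Q0 := Qw_gt0; have q0 := qR_gt0 F R.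
have st0 : X 0%N ^+ q.+1 <= X 1%N * (Q * X 1%N) ^+ q.
  apply: (@star_fun _ _ _ 0 1 f) => //.
  - by rewrite mulr_ge0 ?(ltW Q0).
  - exact: Xmax.
  - by move=> c z; apply: ab_vin0 => y; exact: Xmax.
  - by case: (hx 0%N).
have st n : X n.+1 ^+ q.+1 <= X n.+2 * X n ^+ q.
  apply: (@star_fun _ _ _ n.+1 n.+2 f) => //.
  - exact: Xmax.
  - by move=> c z; apply: ab_vin => y; exact: Xmax.
  - by case: (hx n.+1).
apply: zero_propagate => z0 z0n; apply/eqP; rewrite -ab_eq0 eq_le abs_ge0 andbT.
apply: le_trans (Xmax _ _ z0n) _; rewrite leNgt; apply/negP => Xp.
pose Y n := X n ^+ q.+1 * Q ^+ sq n.
have Y0p : 0 < Y 0%N by rewrite /Y mulr_gt0 ?exprn_gt0.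
have step n : Y n <= Y n.+1 /\ 0 < Y n.
  elim: n => [|n [IH IH0]].
    split=> //; rewrite /Y /= expr0 mulr1 muln1; apply: le_trans st0 _.
    by rewrite exprMn mulrCA -exprS mulrC.
  have Y1 : 0 < Y n.+1 by exact: lt_le_trans IH.
  split=> //.
  have Yk : 0 < Y n ^+ q by rewrite exprn_gt0.
  (* Multiplied by Y_n^q, the claim Y_(n+1) <= Y_(n+2) follows from Y_n <= Y_(n+1) and the (q+1)-st
     power of the star inequality. *)
  rewrite -(ler_pM2r Yk); apply: (@le_trans _ _ (Y n.+1 * Y n.+1 ^+ q)).
    rewrite ler_pM2l //; by apply: lerXn2r => //; rewrite nnegrE ltW.
  rewrite -exprS.
  have -> : Y n.+1 ^+ q.+1 = (X n.+1 ^+ q.+1) ^+ q.+1 * Q ^+ (sq n.+1 * q.+1).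
    by rewrite /Y; move: (sq n.+1) => s1; rewrite exprMn (exprM Q).
  have -> : Y n.+2 * Y n ^+ q = (X n.+2 * X n ^+ q) ^+ q.+1 * Q ^+ (sq n.+1 * q.+1).
    have -> : (sq n.+1 * q.+1 = sq n.+2 + sq n * q)%N by rewrite /=; nia.
    rewrite /Y; move: (sq n.+2) (sq n) => s2 s0.
    have hX : (X n ^+ q.+1) ^+ q = (X n ^+ q) ^+ q.+1 by rewrite -!exprM mulnC.
    rewrite exprD (exprM Q s0) [(X n ^+ q.+1 * _) ^+ q]exprMn hX.
    by rewrite [(X n.+2 * _) ^+ q.+1]exprMn; ring.
  apply: ler_wpM2r; first by rewrite exprn_ge0 // ltW.
  by rewrite lerXn2r ?nnegrE ?mulr_ge0 ?exprn_ge0.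
have Yle n : Y 0%N <= Y n.
  by elim: n => // n IH; apply: le_trans IH _; case: (step n).
(* Integrality turns w < k (q+1) into a spare factor q, which yields the decay q^(-sq n) of Y_n. *)
have Qq : Q <= (q%:R ^+ (k * q.+1)) / q%:R.
  have -> : q%:R ^+ (k * q.+1) = q%:R ^ (k * q.+1)%:Z :> R by [].
  rewrite ler_pdivlMr // -[X in _ * X]expr1z -expfzDr ?gt_eqF //.
  by rewrite ler_eXz2l ?qR_gt1 //; lia.
have Yup n : (N0 <= n)%N -> Y n <= M ^+ q.+1 / q%:R ^+ sq n.
  move=> Nn; have h : X n <= M / q%:R ^+ (k * sq n) by apply: growth => //; case: (hx n).
  have M0 : 0 <= M.
    by have := le_trans (X0 n) h; rewrite pmulr_lge0 // invr_gt0; exact: qX_gt0.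
  apply: (@le_trans _ _ ((M / q%:R ^+ (k * sq n)) ^+ q.+1 * ((q%:R ^+ (k * q.+1)) / q%:R) ^+ sq n)).
    apply: ler_pM; rewrite ?exprn_ge0 ?(ltW Q0) //.
      by rewrite lerXn2r ?nnegrE // (le_trans (X0 n) h).
    by rewrite lerXn2r ?nnegrE ?(ltW Q0) // divr_ge0 ?exprn_ge0 // ltW.
  rewrite !exprMn !exprVn -!exprM.
  have -> : (k * sq n * q.+1 = k * q.+1 * sq n)%N by ring.
  by rewrite -mulrA mulKf // gt_eqF // exprn_gt0.
have e0 : 0 < Y 0%N / (1 + `|M ^+ q.+1|) by rewrite divr_gt0 // ltr_wpDr.
have [N hN] := qpow_small F e0.
have := Yup (maxn N0 N) (leq_maxl _ _); rewrite leNgt => /negP; apply.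
apply: lt_le_trans (Yle _); rewrite ltr_pdivlMr ?ltr_wpDr // in hN.
apply: le_lt_trans hN; apply: (@le_trans _ _ ((1 + `|M ^+ q.+1|) / q%:R ^+ sq (maxn N0 N))).
  by apply: ler_wpM2r; [rewrite invr_ge0 exprn_ge0 // ltW | rewrite ler_wpDl // ler_norm].
rewrite mulrC; apply: ler_wpM2r; first by rewrite addr_ge0.
by apply: qV_le; rewrite (leq_trans _ (sq_ge _)) // leq_maxr.
Qed.

End Modular.
End Key2.

(** * Finite F_q-spaces and their linear polynomials *)

Section FiniteSpaces.
Variables (F : finFieldType) (R : realType) (C : cinf F R).
Local Notation q := (#|F|).
Local Notation A := {poly F}.
Local Notation inA := (@embA F R C).
Local Notation theta := (@theta F R C).
Local Notation "c '%:K'" := (inA c%:P) (at level 2, format "c '%:K'").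
Implicit Types (s : seq C) (e : C -> C) (x y w v : C).

Lemma constX (c : F) : c%:K ^+ q = c%:K.
Proof. by rewrite -rmorphXn -polyC_exp /= expf_card. Qed.

Lemma q1_gt0 : (0 < q.-1)%N.
Proof. by rewrite -ltnS prednK ?qpos // card_F_gt1. Qed.

Lemma prod_units y : \prod_(c : F | c != 0) (1 - y / c%:K) = 1 - y ^+ q.-1.
Proof.
have genP : \prod_(c : F | c != 0) ('X - c%:P) = 'X^(q.-1) - 1 :> {poly F}.
  apply: (mulfI (negbT (polyX_eq0 F))).
  rewrite mulrBr mulr1 -exprS prednK ?qpos // finField_genPoly [RHS](bigD1 0) //=.
  by rewrite polyC0 subr0.
have ev x : \prod_(c : F | c != 0) (x - c%:K) = x ^+ q.-1 - 1.
  have := congr1 (fun p : {poly F} => (map_poly (inA \o polyC) p).[x]) genP.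
  rewrite rmorphB rmorph1 /= map_polyXn hornerD hornerN hornerXn hornerC => <-.
  rewrite rmorph_prod horner_prod; apply: eq_bigr => c _.
  by rewrite rmorphB /= map_polyX map_polyC hornerXsubC.
have m1 : \prod_(c : F | c != 0) (- c%:K) = -1.
  have := ev 0; rewrite expr0n gtn_eqF ?q1_gt0 // sub0r => <-.
  by apply: eq_bigr => c _; rewrite sub0r.
have -> : \prod_(c : F | c != 0) (1 - y / c%:K) =
    (\prod_(c : F | c != 0) (y - c%:K)) / \prod_(c : F | c != 0) (- c%:K).
  rewrite -prodf_div; apply: eq_bigr => c c0; field.
  by rewrite oppr_eq0 andbb inA_eq0 polyC_eq0.
by rewrite ev m1 invrN invr1 mulrN1 opprB.
Qed.

(** The finite space s together with its exponential polynomial: F-linear, with simple zeros exactly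
    on s and linear coefficient 1. *)
Definition fspace s e := [/\ uniq s, forall x y, e (x + y) = e x + e y,
  forall (c : F) x, e (c%:K * x) = c%:K * e x,
  forall x, e x = x * \prod_(v <- s | v != 0) (1 - x / v)
  & forall x, (x \in s) = (e x == 0)].

Section Facts.
Variables (s : seq C) (e : C -> C).
Hypothesis h : fspace s e.

Lemma fspace0 : 0 \in s.
Proof. by case: h => _ _ _ E ->; rewrite E mul0r eqxx. Qed.

Lemma fspaceN x : e (- x) = - e x.
Proof.
have [_ _ L _ _] := h; have := L (-1) x.
by rewrite polyCN rmorphN polyC1 rmorph1 !mulN1r.
Qed.

(** The product of the v - X over s is a constant multiple of e; compare its values at x - y and at
    - y. *)
Lemma fspace_shift x y : y \notin s ->
  \prod_(v <- s) (1 - x / (v + y)) = 1 - e x / e y.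
Proof.
have [us D L E K] := h => ys; pose p x := \prod_(v <- s) (v - x).
have vy v : v \in s -> v + y != 0.
  move=> vs; apply/eqP => vy0; move: ys; rewrite K.
  by have -> : y = - v; [apply/eqP; rewrite -addr_eq0 addrC vy0 | rewrite fspaceN oppr_eq0 -K vs].
have pE : exists2 k, k != 0 & forall x, p x = - (k * e x).
  exists (\prod_(v <- s | v != 0) v).
    by rewrite prodf_seq_neq0; apply/allP => v _; apply/implyP.
  move=> x'; rewrite /p (bigD1_seq 0) ?fspace0 //= sub0r E mulrCA -big_split /= mulNr; congr (- (_ * _)).
  by apply: eq_bigr => v v0; field.
have [k k0 hk] := pE; have ey : e y != 0 by rewrite -K.
have -> : \prod_(v <- s) (1 - x / (v + y)) = p (x - y) / p (- y).
  rewrite -prodf_div; apply: eq_big_seq => v vs; have := vy v vs => v0.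
  by rewrite opprK; field; rewrite addrC in v0 *; rewrite ?v0 // addrC.
rewrite !hk D fspaceN; field.
by rewrite ey oppr_eq0 mulf_neq0 ?oppr_eq0.
Qed.

Definition ext_list w := [seq v + c%:K * w | v <- s, c <- enum F].
Definition ext_fun w x := e x - e x ^+ q / e w ^+ q.-1.

(** The product over the larger space splits into cosets of s, evaluated by [fspace_shift]; the
    factors 1 - (e x / e w) / c over the nonzero c multiply to 1 - (e x / e w)^(q-1). *)
Lemma fspace_ext w : w \notin s -> fspace (ext_list w) (ext_fun w).
Proof.
have [us D L E K] := h => ws; have ew : e w != 0 by rewrite -K.
have cw (c : F) : c != 0 -> c%:K * w \notin s.
  by move=> c0; rewrite K L mulf_neq0 // inA_eq0 polyC_eq0.
have inj v c v' c' : v \in s -> v' \in s -> v + c%:K * w = v' + c'%:K * w -> c = c' /\ v = v'.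
  move=> vs v's eq; suff cc : c = c' by split=> //; move: eq; rewrite cc => /addIr.
  apply/eqP; rewrite -subr_eq0; apply/negPn/negP => /cw; apply/negP/negPn.
  have -> : (c - c')%:K * w = v' - v.
    apply/eqP; rewrite -subr_eq0 polyCB rmorphB; apply/eqP.
    by transitivity ((v + c%:K * w) - (v' + c'%:K * w)); [ring | rewrite eq subrr].
  by rewrite K D fspaceN; move: vs v's; rewrite !K => /eqP -> /eqP ->; rewrite subrr.
have us' : uniq (ext_list w).
  rewrite allpairs_uniq ?enum_uniq // => -[v c] [v' c'].
  move=> /allpairsP[[v1 c1] [/= hv _ [-> ->]]] /allpairsP[[v2 c2] [/= hv' _ [-> ->]]] /= eq.
  by have [-> ->] := inj _ _ _ _ hv hv' eq.
have q1 : (0 < q.-1)%N by rewrite -ltnS prednK ?qpos // card_F_gt1.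
have E' x : ext_fun w x = x * \prod_(v <- ext_list w | v != 0) (1 - x / v).
  rewrite big_mkcond big_allpairs_dep exchange_big big_enum /= (bigD1 0) //=.
  under eq_bigr => v _ do rewrite polyC0 rmorph0 mul0r addr0.
  rewrite -big_mkcond mulrA -E.
  rewrite (eq_bigr (fun c : F => 1 - (e x / e w) / c%:K)); last first.
    move=> c c0; have c0' : c%:K != 0 by rewrite inA_eq0 polyC_eq0.
    have <- : e x / e (c%:K * w) = e x / e w / c%:K by rewrite L; field; rewrite c0' ew.
    rewrite -fspace_shift; last exact: cw.
    apply: eq_big_seq => v vs; case: eqP => // v0; exfalso; move: (cw c c0).
    have -> : c%:K * w = - v by apply/eqP; rewrite -addr_eq0 addrC v0.
    by rewrite K fspaceN oppr_eq0 -K vs.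
  rewrite prod_units /ext_fun mulrBr mulr1 expr_div_n mulrA -exprS prednK ?qpos //.
split=> //.
- move=> x y; rewrite /ext_fun D; have := frobD 1 (e x) (e y); rewrite expn1 => ->; ring.
- by move=> c x; rewrite /ext_fun L exprMn constX; ring.
move=> x; apply/idP/eqP => [/allpairsP[[v c] [/= vs _ ->]]|].
  rewrite /ext_fun D L; move: vs; rewrite K => /eqP ->; rewrite add0r exprMn constX.
  have -> : e w ^+ q = e w * e w ^+ q.-1 by rewrite -exprS prednK ?qpos.
  by rewrite mulrA mulfK ?expf_neq0 // subrr.
rewrite E' => /eqP; rewrite mulf_eq0 => /orP[/eqP ->|].
  apply/allpairsP; exists (0, 0); rewrite /= fspace0 mem_enum polyC0 rmorph0 mul0r addr0.
  by split.
rewrite prodf_seq_eq0 => /hasP[v vl /andP[v0]]; rewrite subr_eq0 => /eqP xv.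
by rewrite -[x](divfK v0) -xv mul1r.
Qed.
End Facts.

Lemma fspace_base : fspace [:: 0] id.
Proof.
split=> [||||x] //; last by rewrite inE.
by move=> x; rewrite big_cons big_nil ifN ?eqxx ?mulr1.
Qed.

(** List and polynomial are built together by adjoining 1, theta, theta^2, ... one at a time, which
    supplies linearity and the kernel by induction. *)
Fixpoint Abox n : seq C * (C -> C) :=
  if n is m.+1 then (ext_list (Abox m).1 (theta ^+ m), ext_fun (Abox m).2 (theta ^+ m))
  else ([:: 0], id).

Lemma Abox_list n : (Abox n).1 = map inA (polys F n).
Proof.
elim: n => [|n IH] /=; first by rewrite rmorph0.
rewrite IH /ext_list map_allpairs allpairs_mapl; apply: eq_allpairs => a c.
by rewrite rmorphD -mul_polyC rmorphM rmorphXn.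
Qed.

Lemma mem_Abox n x : (x \in (Abox n).1) <-> exists2 a : A, (size a <= n)%N & x = inA a.
Proof.
rewrite Abox_list; split=> [/mapP[a]|[a an ->]]; first by rewrite mem_polys; exists a.
by rewrite map_f // mem_polys.
Qed.

Lemma fspace_A n : fspace (Abox n).1 (Abox n).2.
Proof.
elim: n => [|n IH]; first exact: fspace_base.
apply: fspace_ext => //; apply/negP => /mem_Abox[a an].
rewrite -rmorphXn => /inA_inj e; move: an; rewrite -e size_polyXn.
by rewrite ltnn.
Qed.

Section Lattice.
Variable z : C.
Hypothesis hz : forall a b : A, (a, b) != (0, 0) -> inA a * z + inA b != 0.

Fixpoint Lbox n m : seq C * (C -> C) :=
  if m is k.+1 then (ext_list (Lbox n k).1 (z * theta ^+ k),
    ext_fun (Lbox n k).2 (z * theta ^+ k))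
  else Abox n.

Lemma mem_Lbox n m x : (x \in (Lbox n m).1) <->
  exists a b : A, [/\ (size a <= n)%N, (size b <= m)%N & x = inA a + inA b * z].
Proof.
elim: m x => [|m IH] x.
  split=> [/mem_Abox[a an ->]|[a [b [an]]]].
    by exists a, 0; rewrite size_poly0 rmorph0 mul0r addr0.
  by rewrite size_poly_leq0 => /eqP -> ->; apply/mem_Abox; exists a; rewrite // rmorph0 mul0r addr0.
have m1 p : (p \in polys F m.+1) = (size p <= m.+1)%N := mem_polys _ _.
split=> [/allpairsP[[v c] [/= /IH[a [b [an bm ->]]] _ ->]]|[a [b [an bm ->]]]].
  exists a, (b + c *: 'X^m); split=> //.
    rewrite -m1; apply/allpairsP; exists (b, c); rewrite mem_polys mem_enum; by split.
  by rewrite rmorphD -mul_polyC rmorphM rmorphXn -[inA 'X]/theta; ring.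
move: bm; rewrite -m1 => /allpairsP[[b' c] [/= hb _ ->]].
apply/allpairsP; exists (inA a + inA b' * z, c); split; rewrite /= ?mem_enum //.
  by apply/IH; exists a, b'; split=> //; rewrite -mem_polys.
by rewrite rmorphD -mul_polyC rmorphM rmorphXn -[inA 'X]/theta; ring.
Qed.

Lemma lat_inj (a b a' b' : A) : inA a + inA b * z = inA a' + inA b' * z -> a = a' /\ b = b'.
Proof.
move=> e; suff : (b - b', a - a') == (0, 0).
  by move=> /eqP[/eqP + /eqP]; rewrite !subr_eq0 => /eqP -> /eqP ->.
apply/negPn/negP => /hz /eqP; apply.
rewrite !rmorphB; apply/eqP.
have -> : (inA b - inA b') * z + (inA a - inA a') =
  (inA a + inA b * z) - (inA a' + inA b' * z) by ring.
by rewrite e subrr.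
Qed.

Lemma fspace_L n m : fspace (Lbox n m).1 (Lbox n m).2.
Proof.
elim: m => [|m IH]; first exact: fspace_A.
apply: fspace_ext => //; apply/negP => /mem_Lbox[a [b [an bm]]].
have -> : z * theta ^+ m = inA 0 + inA 'X^m * z.
  by rewrite rmorph0 add0r rmorphXn mulrC.
by move=> /lat_inj[_ e]; move: bm; rewrite -e size_polyXn ltnn.
Qed.

Definition EA n := (Abox n).2.
Definition EL n m := (Lbox n m).2.

(** Group the points a + b z by b: each coset of the a's contributes one factor by [fspace_shift].
    This expresses the rank 2 exponential through the rank 1 exponential and is the source of the
    u-expansions. *)
Lemma EL_EA n m x : EL n m x =
  EA n x * \prod_(b <- polys F m | b != 0) (1 - EA n x / EA n (inA b * z)).
Proof.
have [_ _ _ E _] := fspace_L n m; rewrite /EL E.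
have [us _ _ EA_E _] := fspace_A n; rewrite {1}/EA EA_E -mulrA; congr (_ * _).
have [uL _ _ _ _] := fspace_L n m.
pose l := [seq inA a + inA b * z | b <- polys F m, a <- polys F n].
have ul : uniq l.
  rewrite allpairs_uniq ?polys_uniq // => -[b a] [b' a'] _ _ /= /lat_inj[-> ->] //.
rewrite (perm_big l) /=; last first.
  apply: uniq_perm => // y; apply/idP/allpairsP => [/mem_Lbox[a [b [an bm ->]]]|[[b a] /= [hb ha ->]]].
    by exists (b, a); rewrite !mem_polys.
  by apply/mem_Lbox; exists a, b; split=> //; rewrite -mem_polys.
rewrite big_mkcond big_allpairs_dep /= (bigD1_seq 0) ?polys_uniq ?mem_polys ?size_poly0 //=.
congr (_ * _).
  rewrite Abox_list big_map [RHS]big_mkcond; apply: eq_bigr => a _.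
  by rewrite rmorph0 mul0r addr0.
apply: eq_bigr => b b0.
have nin : inA b * z \notin (Abox n).1.
  apply/negP => /mem_Abox[a _ e]; move: b0.
  have e' : inA 0 + inA b * z = inA a + inA 0 * z by rewrite !rmorph0 mul0r addr0 add0r.
  by have [_ ->] := lat_inj e'; rewrite eqxx.
rewrite -(fspace_shift (fspace_A n) _ nin) Abox_list big_map; apply: eq_bigr => a _.
case: eqP => // e; exfalso; move/eqP: b0; apply.
have e' : inA a + inA b * z = inA 0 + inA 0 * z by rewrite e !rmorph0 mul0r addr0.
by have [_ ->] := lat_inj e'.
Qed.

End Lattice.
End FiniteSpaces.

(** * The exponential functions of A and of A + Az *)

Section Exponentials.
Variables (F : finFieldType) (R : realType) (C : cinf F R).
Local Notation ab := (@absC F R C).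
Local Notation q := (#|F|).
Local Notation A := {poly F}.
Local Notation inA := (@embA F R C).
Local Notation theta := (@theta F R C).
Local Notation Sreg := (@Sreg F R C).
Local Notation EA := (@EA F R C).
Local Notation EL := (@EL F R C).
Local Notation Lbox := (@Lbox F R C).
Local Notation "c '%:K'" := (inA c%:P) (at level 2, format "c '%:K'").
Local Notation "a ~> l" := (cvg_to ab a l) (at level 70).
Implicit Types (x y w v z zeta : C).

Lemma prod_sub_uniq (I : eqType) (s r : seq I) (f : I -> C) :
  uniq s -> uniq r -> {subset s <= r} ->
  \prod_(i <- r) f i = \prod_(i <- s) f i * \prod_(i <- r | i \notin s) f i.
Proof.
move=> us ur sr; rewrite (bigID (mem s)) /=; congr (_ * _).
rewrite -big_filter; apply: perm_big; apply: uniq_perm => //; first exact: filter_uniq.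
by move=> i; rewrite mem_filter andb_idr //; exact: sr.
Qed.

Lemma prod_near1 (I : eqType) (r : seq I) (P : pred I) (x : I -> C) (e : R) : 0 <= e -> e < 1 ->
  (forall i, i \in r -> P i -> ab (x i) <= e) ->
  ab (\prod_(i <- r | P i) (1 - x i) - 1) <= e.
Proof.
move=> e0 e1; elim: r => [|i r IH] h; first by rewrite big_nil subrr ab0.
have {}IH : ab (\prod_(i <- r | P i) (1 - x i) - 1) <= e.
  by apply: IH => j jr; apply: h; rewrite inE jr orbT.
rewrite big_cons; case Pi: (P i) => //; set p := \prod_(_ <- _ | _) _ in IH *.
have -> : (1 - x i) * p - 1 = (p - 1) - x i * p by ring.
apply: abB_le => //; rewrite absM -[leRHS]mulr1; apply: ler_pM; rewrite ?abs_ge0 //.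
  by apply: h => //; rewrite mem_head.
rewrite -(subrK 1 p); apply: abD_le; last by rewrite ab1.
exact: le_trans IH (ltW e1).
Qed.

Lemma prod_near (I : eqType) (s r : seq I) (x : I -> C) (e : R) : 0 <= e -> e < 1 ->
  uniq s -> uniq r -> {subset s <= r} ->
  (forall i, i \in r -> i \notin s -> ab (x i) <= e) ->
  ab (\prod_(i <- r) (1 - x i) - \prod_(i <- s) (1 - x i)) <=
    ab (\prod_(i <- s) (1 - x i)) * e.
Proof.
move=> e0 e1 us ur sr h; rewrite (prod_sub_uniq _ us ur sr).
rewrite -[X in _ - X]mulr1 -mulrBr absM ler_wpM2l ?abs_ge0 //.
by apply: prod_near1 => // i ir ins; exact: h.
Qed.

(** Every additional factor is 1 - x/v with |x/v| <= eps, so the product changes by a relative error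
    of at most eps. *)
Lemma fspace_near s e s' e' (eps : R) x : fspace s e -> fspace s' e' -> {subset s <= s'} ->
  0 <= eps -> eps < 1 -> (forall v, v \in s' -> v \notin s -> ab (x / v) <= eps) ->
  ab (e' x - e x) <= ab (e x) * eps.
Proof.
move=> h h' ss e0 e1 hv; have [us _ _ E _] := h; have [us' _ _ E' _] := h'.
rewrite E E' -mulrBr !absM -mulrA ler_wpM2l ?abs_ge0 // -!(big_filter _ (fun v => v != 0)).
apply: prod_near => //; rewrite ?filter_uniq //.
  by move=> v; rewrite !mem_filter => /andP[-> /ss].
move=> v; rewrite !mem_filter => /andP[v0 vs']; rewrite v0 /= => vs.
exact: hv.
Qed.

Lemma near_ab x y (e : R) : e < 1 -> ab (x - y) <= ab y * e -> ab x = ab y.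
Proof.
have [->|y0] := eqVneq y 0.
  move=> _; rewrite subr0 ab0 mul0r => h; apply/eqP; rewrite eq_le h abs_ge0 //.
move=> e1 h; apply: ab_near; rewrite ab_subC; apply: le_lt_trans h _.
by rewrite gtr_pMr ?ab_gt0.
Qed.

(** * The exponential of [A] *)

Lemma subset_EA n m : (n <= m)%N -> {subset (Abox C n).1 <= (Abox C m).1}.
Proof.
move=> nm x /mem_Abox[a an ->]; apply/mem_Abox; exists a => //; exact: leq_trans nm.
Qed.

Lemma EA_near n m x : (n <= m)%N -> ab x < q%:R ^+ n ->
  ab (EA m x - EA n x) <= ab (EA n x) * (ab x / q%:R ^+ n).
Proof.
move=> nm xn; apply: fspace_near (fspace_A C n) (fspace_A C m) (subset_EA nm) _ _ _.
- by rewrite divr_ge0 ?abs_ge0 // exprn_ge0 // ltW // qR_gt0.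
- by rewrite ltr_pdivrMr ?qX_gt0 // mul1r.
move=> v /mem_Abox[a am ->] va; rewrite abf_div ler_wpM2l ?abs_ge0 //.
have an : (n < size a)%N.
  by rewrite ltnNge; apply: contra va => an; apply/mem_Abox; exists a.
have h : q%:R ^+ n <= ab (inA a) by rewrite leNgt ab_inA_lt -ltnNge.
by rewrite lef_pV2 ?posrE ?qX_gt0 // (lt_le_trans _ h) // qX_gt0.
Qed.

Lemma EA_ab n m x : (n <= m)%N -> ab x < q%:R ^+ n -> ab (EA m x) = ab (EA n x).
Proof.
move=> nm xn; apply: near_ab (EA_near nm xn).
by rewrite ltr_pdivrMr ?qX_gt0 // mul1r.
Qed.

Lemma EA_cvg x : exists l, EA^~ x ~> l.
Proof.
have [n0 hn0] := qpow_large F (ab x); apply: lim_cauchy => e e0.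
pose B := 1 + ab (EA n0 x) * ab x.
have B0 : 0 < B by rewrite ltr_wpDr // mulr_ge0 ?abs_ge0.
have [N hN] := qpow_small F (divr_gt0 e0 B0).
exists (maxn n0 N) => n; rewrite geq_max => /andP[n0n Nn].
have xn : ab x < q%:R ^+ n by apply: lt_le_trans hn0 (qX_le F R n0n).
apply: le_lt_trans (EA_near (leqnSn n) xn) _.
rewrite (EA_ab n0n hn0) mulrA; apply: (@le_lt_trans _ _ (B * q%:R ^- N)).
  apply: ler_pM; rewrite ?mulr_ge0 ?abs_ge0 ?invr_ge0 ?exprn_ge0 ?(ltW (qR_gt0 _ _)) //.
    by rewrite /B lerDr.
  exact: qV_le.
by rewrite mulrC -ltr_pdivlMr.
Qed.

Definition eA x := xget 0 [set l | EA^~ x ~> l].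

Lemma eA_lim x : EA^~ x ~> eA x.
Proof.
by have [l hl] := EA_cvg x; rewrite /eA; case: xgetP => [y _ //|/(_ l)].
Qed.

Lemma eA_unique x l : EA^~ x ~> l -> eA x = l.
Proof. exact: lim_uniq (eA_lim x). Qed.

Lemma EA_D n x y : EA n (x + y) = EA n x + EA n y.
Proof. by have [_ D _ _ _] := fspace_A C n; exact: D. Qed.
Lemma EA_Z n (c : F) x : EA n (c%:K * x) = c%:K * EA n x.
Proof. by have [_ _ L _ _] := fspace_A C n; exact: L. Qed.
Lemma EA_N n x : EA n (- x) = - EA n x.
Proof. exact: fspaceN (fspace_A C n) _. Qed.

Lemma eA_D x y : eA (x + y) = eA x + eA y.
Proof.
by apply: eA_unique; apply: (lim_ext (N := 0%N)) (limD (eA_lim x) (eA_lim y)) => n _; rewrite EA_D.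
Qed.
Lemma eA_Z (c : F) x : eA (c%:K * x) = c%:K * eA x.
Proof.
by apply: eA_unique; apply: (lim_ext (N := 0%N)) (limZ c%:K (eA_lim x)) => n _; rewrite EA_Z.
Qed.
Lemma eA_N x : eA (- x) = - eA x.
Proof.
by apply: eA_unique; apply: (lim_ext (N := 0%N)) (limN (eA_lim x)) => n _; rewrite EA_N.
Qed.
Lemma eA_B x y : eA (x - y) = eA x - eA y. Proof. by rewrite eA_D eA_N. Qed.

Lemma eA_ab n x : ab x < q%:R ^+ n -> ab (eA x) = ab (EA n x).
Proof.
move=> xn; apply: (@near_ab _ _ (ab x / q%:R ^+ n)).
  by rewrite ltr_pdivrMr ?qX_gt0 // mul1r.
apply: (@lim_near_le _ _ C n _ (EA^~ x)) (eA_lim x) => m nm; exact: EA_near.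
Qed.

Lemma eA_small x : ab x < 1 -> ab (eA x) = ab x.
Proof. by move=> x1; rewrite (@eA_ab 0) ?expr0. Qed.

Lemma EA_eq0 n x : (EA n x == 0) <-> exists2 a : A, (size a <= n)%N & x = inA a.
Proof. by have [_ _ _ _ <-] := fspace_A C n; exact: mem_Abox. Qed.

Lemma eA_eq0 x : eA x = 0 <-> exists a : A, x = inA a.
Proof.
have [n hn] := qpow_large F (ab x); split=> [e|[a xa]].
  have /eqP := eA_ab hn; rewrite e ab0 eq_sym ab_eq0 => /EA_eq0[a _ ->].
  by exists a.
apply: abs_eq0; rewrite (eA_ab hn).
have -> : EA n x = 0 by apply/eqP/EA_eq0; exists a => //; rewrite -(ab_inA_lt C) -xa.
exact: ab0.
Qed.

Lemma eA_inA a : eA (inA a) = 0. Proof. by apply/eA_eq0; exists a. Qed.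

Lemma eA_near_id x n : ab x < q%:R ^+ n -> ab (eA x - EA n x) <= ab (EA n x) * (ab x / q%:R ^+ n).
Proof.
by move=> xn; apply: (@lim_near_le _ _ C n _ (EA^~ x)) (eA_lim x) => m nm; exact: EA_near.
Qed.

Lemma fspace_eq (s : seq C) (e : C -> C) (s' : seq C) (e' : C -> C) : fspace s e -> fspace s' e' -> s =i s' -> e =1 e'.
Proof.
move=> [us _ _ E _] [us' _ _ E' _] ss x; rewrite E E'; congr (_ * _).
by apply: perm_big; apply: uniq_perm.
Qed.

Lemma fspace_mul (s : seq C) (e : C -> C) (c : C) : c != 0 -> fspace s e ->
  fspace (map ( *%R c) s) (fun x => c * e (x / c)).
Proof.
move=> c0 [us D L E K]; split.
- by rewrite map_inj_uniq // => x y; exact: mulfI.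
- by move=> x y; rewrite mulrDl D mulrDr.
- by move=> d x; rewrite -mulrA L mulrCA.
- move=> x; rewrite E mulrA [c * _]mulrC divfK // big_map; congr (_ * _).
  apply: eq_big => [v|v v0]; first by rewrite mulf_eq0 (negbTE c0).
  by rewrite invfM mulrA.
move=> x; rewrite mulf_eq0 (negbTE c0) /= -K; apply/mapP/idP => [[v vs ->]|h].
  by rewrite mulrAC mulfV // mul1r.
by exists (x / c); rewrite // mulrCA mulfV // mulr1.
Qed.

(** The polynomials of degree at most n are theta times those of degree below n, plus the constants:
    rescale the space by theta and adjoin 1. In the limit this is the Carlitz equation up to
    normalisation ([eA_scale]). *)
Lemma EA_scale n x : EA n.+1 (theta * x) =
  theta * (EA n x - EA n x ^+ q / EA n theta^-1 ^+ q.-1).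
Proof.
have t0 := theta_neq0 C; have h := fspace_mul t0 (fspace_A C n).
have w1 : 1 \notin map ( *%R theta) (Abox C n).1.
  apply/negP => /mapP[v /mem_Abox[a _ ->] /eqP].
  rewrite -rmorphM -(rmorph1 inA) (inj_eq (@inA_inj _ _ C)) => /eqP /(congr1 (fun p : A => size p)).
  have [->|a0] := eqVneq a 0; first by rewrite mulr0 size_poly0 size_poly1.
  by rewrite mulrC size_mulX // size_poly1 => -[] /esym/eqP; rewrite size_poly_eq0 (negbTE a0).
have h' := fspace_ext h w1.
rewrite /EA (fspace_eq (fspace_A C n.+1) h') => [|v]; last first.
  apply/idP/idP => [/mem_Abox[a an ->]|].
    apply/allpairsP; exists (theta * inA (\poly_(i < n) a`_i.+1), a`_0).
    split; rewrite /= ?mem_enum //.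
      by apply: map_f; apply/mem_Abox; eexists; rewrite ?size_poly.
    rewrite mulr1 -rmorphM -rmorphD; congr (inA _); apply/polyP => i; rewrite coefD coefXM coefC coef_poly.
    case: i => [|i] /=; first by rewrite add0r.
    rewrite addr0; case: ltnP => // ni; rewrite nth_default //.
    exact: leq_trans an _.
  move=> /allpairsP[[w c] [/= /mapP[w' /mem_Abox[a an ->] ->] _ ->]].
  apply/(@mem_Abox _ _ C n.+1); exists ('X * a + c%:P); last by rewrite mulr1 rmorphD rmorphM.
  rewrite mulrC (leq_trans (size_polyD _ _)) // geq_max.
  rewrite (leq_trans (size_polyMleq _ _)) ?size_polyX ?addn2 //=.
  by rewrite (leq_trans (size_polyC_leq1 _)).
rewrite /ext_fun [theta * x]mulrC mulfK // mul1r exprMn [X in _ / X]exprMn invfM.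
have -> : theta ^+ q = theta * theta ^+ q.-1 by rewrite -exprS prednK ?qpos.
have alg (t a Y W y : C) : a != 0 -> t * y - t * a * Y * (a^-1 * W) = t * (y - Y * W).
  by move=> a0; field.
by apply: alg; rewrite expf_neq0.
Qed.

Lemma thetaV_notin : forall a : A, theta^-1 != inA a.
Proof.
move=> a; apply/eqP => e; have : ab (inA a) < 1.
  by rewrite -e abV ab_theta invf_lt1 ?qR_gt0 // qR_gt1.
by move=> /ab_inA_lt1 a0; move/eqP: e; rewrite a0 rmorph0 invr_eq0 (negbTE (theta_neq0 C)).
Qed.

Lemma eA_scale x : eA (theta * x) = theta * (eA x - eA x ^+ q / eA theta^-1 ^+ q.-1).
Proof.
apply: eA_unique; have L := lim_subseq (k := S) leqnSn.
have n0 : eA theta^-1 ^+ q.-1 != 0.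
  rewrite expf_neq0 //; apply/eqP => /eA_eq0[a /eqP].
  by rewrite (negbTE (thetaV_notin a)).
have lim2 := limZ theta (limB (eA_lim x) (limM (limX q (eA_lim x)) (limV n0 (limX q.-1 (eA_lim theta^-1))))).
apply/cvgP => e e0; move/cvgP: lim2 => /(_ e e0) [N hN].
by exists N.+1 => -[//|n] Nn; rewrite EA_scale; exact: hN.
Qed.

(** * The exponential of a rank two lattice *)

(** On an affinoid |a + b z| controls max(|a|, |b|) uniformly in z; the convergence estimates for
    e_z rest on this. *)
Lemma lat_lower N M z (a b : A) : Sreg N M z ->
  Num.max (ab (inA a)) (ab (inA b)) <= ab (inA a + inA b * z) * q%:R ^+ (N + M).
Proof.
move=> [zN zM]; have hb : ab (inA b) <= ab (inA a + inA b * z) * q%:R ^+ M.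
  have [->|b0] := eqVneq b 0.
    by rewrite rmorph0 ab0 mulr_ge0 ?abs_ge0 // exprn_ge0 // ltW // qR_gt0.
  have b0' : inA b != 0 by rewrite inA_eq0.
  have -> : inA a + inA b * z = inA b * (z - inA (- a) / inA b).
    by rewrite rmorphN; field.
  rewrite absM -mulrA ler_peMr ?abs_ge0 //.
  rewrite -ler_pdivrMr ?qX_gt0 // div1r; apply: zM; exact: Kinf_frac.
rewrite ge_max exprD mulrCA; apply/andP; split; last first.
  apply: le_trans hb _; rewrite ler_peMl ?qX_ge1 //.
  by rewrite mulr_ge0 ?abs_ge0 // exprn_ge0 // ltW // qR_gt0.
have P0 : 0 <= ab (inA a + inA b * z) by exact: abs_ge0.
have [h|h] := leP (ab (inA a)) (ab (inA b * z)).
  apply: le_trans h _; rewrite absM mulrC; apply: ler_pM; rewrite ?abs_ge0 //.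
have -> : ab (inA a + inA b * z) = ab (inA a) by exact: abD_l.
rewrite mulrCA ler_peMr ?abs_ge0 // -exprD; exact: qX_ge1.
Qed.

Lemma Sreg_lin N M z : Sreg N M z ->
  forall a b : A, (a, b) != (0, 0) -> inA a * z + inA b != 0.
Proof.
move=> Sz a b nz; apply/eqP => e.
have := lat_lower b a Sz; rewrite addrC e ab0 mul0r ge_max.
move=> /andP[]; rewrite !leNgt !ab_gt0 !negbK !inA_eq0 => /eqP b0 /eqP a0.
by move/eqP: nz; rewrite a0 b0.
Qed.

Section Elat.
Variables (N M : nat) (z : C).
Hypothesis Sz : Sreg N M z.
Local Notation K := (N + M)%N.
Let hz := Sreg_lin Sz.

Lemma lat_outside k n m (a b : A) : (k <= n)%N -> (k <= m)%N ->
  inA a + inA b * z \notin (Lbox z n m).1 -> q%:R ^+ k <= ab (inA a + inA b * z) * q%:R ^+ K.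
Proof.
move=> kn km nin; apply: le_trans (lat_lower a b Sz); rewrite le_max.
rewrite !(leNgt (q%:R ^+ k)) !ab_inA_lt -!ltnNge -[_ || _]negbK negb_or -!leqNgt.
apply/negP => /andP[ak bk]; move/negP: nin; apply; apply/mem_Lbox.
by exists a, b; rewrite (leq_trans ak) // (leq_trans bk).
Qed.

Lemma EL_near k n m n' m' zeta : (k <= n)%N -> (k <= m)%N -> (n <= n')%N -> (m <= m')%N ->
  ab zeta * q%:R ^+ K < q%:R ^+ k ->
  ab (EL z n' m' zeta - EL z n m zeta) <= ab (EL z n m zeta) * (ab zeta * q%:R ^+ K / q%:R ^+ k).
Proof.
move=> kn km nn mm hk; apply: fspace_near (fspace_L hz n m) (fspace_L hz n' m') _ _ _ _.
- move=> v /mem_Lbox[a [b [an bm ->]]]; apply/mem_Lbox; exists a, b.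
  by rewrite (leq_trans an) // (leq_trans bm).
- by rewrite divr_ge0 ?mulr_ge0 ?abs_ge0 // exprn_ge0 // ltW // qR_gt0.
- by rewrite ltr_pdivrMr ?qX_gt0 // mul1r.
move=> v /mem_Lbox[a [b [_ _ ->]]] nin; rewrite abf_div.
have h := lat_outside kn km nin; have v0 : 0 < ab (inA a + inA b * z).
  by rewrite -(pmulr_lgt0 _ (qX_gt0 F R K)) (lt_le_trans _ h) // qX_gt0.
rewrite ler_pdivrMr // mulrAC ler_pdivlMr ?qX_gt0 //.
by rewrite -mulrA ler_wpM2l ?abs_ge0 // mulrC.
Qed.

Local Notation Lat := (lattice z `\ 0).

Definition Jbox n : {fset Lat} := [fset l in pmap insub (Lbox z n n).1]%fset.

Lemma mem_Jbox n (l : Lat) : (l \in Jbox n) = (val l \in (Lbox z n n).1).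
Proof. by rewrite in_fset mem_pmap_sub. Qed.

Lemma Lat_ex (l : Lat) : exists a b : A, val l = inA a + inA b * z.
Proof.
by have [[a _ [b _ <-]] _] := set_mem (valP l); exists a, b; rewrite mulrC.
Qed.

Lemma Lbox_Lat n v : v \in (Lbox z n n).1 -> v != 0 -> v \in Lat.
Proof.
move=> /mem_Lbox[a [b [_ _ ->]]] v0; apply/mem_set; split; last by apply/eqP.
by exists a => //; exists b => //; rewrite mulrC.
Qed.

Lemma prod_Jbox n (f : C -> C) :
  \prod_(l <- Jbox n) f (val l) = \prod_(v <- (Lbox z n n).1 | v != 0) f v.
Proof.
rewrite -(big_map (fun l : Lat => val l) xpredT f) -[RHS]big_filter.
have [ub _ _ _ _] := fspace_L hz n n.
apply: perm_big; apply: uniq_perm.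
- rewrite map_inj_uniq ?fset_uniq //; exact: val_inj.
- exact: filter_uniq.
move=> v; rewrite mem_filter; apply/mapP/andP => [[l lJ ->]|[v0 vb]].
  split; last by rewrite -mem_Jbox.
  by have [_ /eqP] := set_mem (valP l).
exists (exist _ v (Lbox_Lat vb v0)) => //.
by rewrite mem_Jbox.
Qed.

Lemma elat_net zeta : exists2 l, net_to ab (fun J : {fset Lat} => \prod_(i <- J) (1 - zeta / val i)) l &
  (fun n => \prod_(i <- Jbox n) (1 - zeta / val i)) ~> l.
Proof.
have [k0 hk0] := qpow_large F (ab zeta * q%:R ^+ K).
have near k n (J : {fset Lat}) : (k0 <= k)%N -> (k <= n)%N -> (Jbox n `<=` J)%fset ->
    ab (\prod_(i <- J) (1 - zeta / val i) - \prod_(i <- Jbox n) (1 - zeta / val i)) <=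
    ab (\prod_(i <- Jbox n) (1 - zeta / val i)) * (ab zeta * q%:R ^+ K / q%:R ^+ k).
  move=> k0k kn /fsubsetP sub; apply: prod_near; rewrite ?fset_uniq //.
  - by rewrite divr_ge0 ?mulr_ge0 ?abs_ge0 // exprn_ge0 // ltW // qR_gt0.
  - by rewrite ltr_pdivrMr ?qX_gt0 // mul1r; apply: lt_le_trans hk0 (qX_le _ _ _).
  move=> l _; rewrite mem_Jbox abf_div; have [a [b ->]] := Lat_ex l => nin.
  have h := lat_outside kn kn nin; have v0 : 0 < ab (inA a + inA b * z).
    by rewrite -(pmulr_lgt0 _ (qX_gt0 F R K)) (lt_le_trans _ h) // qX_gt0.
  rewrite ler_pdivrMr // mulrAC ler_pdivlMr ?qX_gt0 //.
  by rewrite -mulrA ler_wpM2l ?abs_ge0 // mulrC.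
have Jsub n m : (n <= m)%N -> (Jbox n `<=` Jbox m)%fset.
  move=> nm; apply/fsubsetP => l; rewrite !mem_Jbox => /mem_Lbox[a [b [an bn ->]]].
  by apply/mem_Lbox; exists a, b; rewrite (leq_trans an) // (leq_trans bn).
have [|n|l [h1 h2]] := @net_ex _ _ C Lat (fun J => \prod_(i <- J) (1 - zeta / val i)) Jbox; last by exists l.
- move=> e e0.
  pose B := 1 + ab (\prod_(i <- Jbox k0) (1 - zeta / val i)) * (ab zeta * q%:R ^+ K).
  have B0 : 0 < B.
    by rewrite ltr_wpDr // !mulr_ge0 ?abs_ge0 // exprn_ge0 // ltW // qR_gt0.
  have [k1 hk1] := qpow_small F (divr_gt0 e0 B0).
  exists (maxn k0 k1) => n; rewrite geq_max => /andP[k0n k1n] J JJ.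
  apply: le_lt_trans (near n n J k0n (leqnn n) JJ) _.
  have -> : ab (\prod_(i <- Jbox n) (1 - zeta / val i)) = ab (\prod_(i <- Jbox k0) (1 - zeta / val i)).
    apply: near_ab (near k0 k0 _ (leqnn _) (leqnn _) (Jsub _ _ k0n)).
    by rewrite ltr_pdivrMr ?qX_gt0 // mul1r.
  apply: (@le_lt_trans _ _ (B * q%:R ^- k1)); last by rewrite mulrC -ltr_pdivlMr.
  rewrite mulrA; apply: ler_pM; rewrite ?invr_ge0 ?exprn_ge0 ?(ltW (qR_gt0 _ _)) //.
  - by rewrite !mulr_ge0 ?abs_ge0 // exprn_ge0 // ltW // qR_gt0.
  - by rewrite /B lerDr.
  - exact: qV_le.
- exact: Jsub.
Qed.

(** The product over the net of finite subsets of the lattice may be computed along boxes, where the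
    polynomials of finite spaces apply. *)
Lemma elat_lim zeta : (fun n => EL z n n zeta) ~> elat z zeta.
Proof.
have [l hl hs] := elat_net zeta.
have -> : elat z zeta = zeta * l.
  rewrite /elat /uprod; congr (_ * _); case: xgetP => [y _ hy|/(_ l)//].
  exact: net_uniq hy hl.
apply: (lim_ext (N := 0%N)) (limZ zeta hs) => n _.
have [_ _ _ E _] := fspace_L hz n n; rewrite /EL E; congr (_ * _).
exact: prod_Jbox.
Qed.

Lemma elat_near k n m zeta : (k <= n)%N -> (k <= m)%N -> ab zeta * q%:R ^+ K < q%:R ^+ k ->
  ab (elat z zeta - EL z n m zeta) <= ab (EL z n m zeta) * (ab zeta * q%:R ^+ K / q%:R ^+ k).
Proof.
move=> kn km hk; apply: (@lim_near_le _ _ C (maxn n m) _ (fun n => EL z n n zeta)) (elat_lim zeta) => j.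
by rewrite geq_max => /andP[nj mj]; exact: EL_near.
Qed.

Lemma elat_ab k n m zeta : (k <= n)%N -> (k <= m)%N -> ab zeta * q%:R ^+ K < q%:R ^+ k ->
  ab (elat z zeta) = ab (EL z n m zeta).
Proof.
move=> kn km hk; apply: near_ab (elat_near kn km hk).
by rewrite ltr_pdivrMr ?qX_gt0 // mul1r.
Qed.

Lemma elat_D x y : elat z (x + y) = elat z x + elat z y.
Proof.
apply: lim_uniq (elat_lim _) _.
apply: (lim_ext (N := 0%N)) (limD (elat_lim x) (elat_lim y)) => n _.
by have [_ D _ _ _] := fspace_L hz n n; rewrite /EL D.
Qed.

Lemma elat_Z (c : F) x : elat z (c%:K * x) = c%:K * elat z x.
Proof.
apply: lim_uniq (elat_lim _) _.
apply: (lim_ext (N := 0%N)) (limZ c%:K (elat_lim x)) => n _.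
by have [_ _ L _ _] := fspace_L hz n n; rewrite /EL L.
Qed.

Lemma elat_eq0 zeta : elat z zeta = 0 <-> exists a b : A, zeta = inA a + inA b * z.
Proof.
have [k hk] := qpow_large F (ab zeta * q%:R ^+ K).
have h0 n : EL z n n zeta = 0 <-> exists a b : A, [/\ (size a <= n)%N, (size b <= n)%N & zeta = inA a + inA b * z].
  rewrite -mem_Lbox; have [_ _ _ _ E] := fspace_L hz n n; rewrite E.
  by split=> /eqP.
split=> [e|[a [b e]]].
  have := elat_ab (leqnn k) (leqnn k) hk; rewrite e ab0 => /esym/abs_eq0/h0[a [b [_ _ ->]]].
  by exists a, b.
pose n := maxn k (maxn (size a) (size b)).
have kn : (k <= n)%N by rewrite leq_maxl.
apply: abs_eq0; rewrite (elat_ab kn kn hk) -(ab0 C); congr ab; apply/h0.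
by exists a, b; rewrite !leq_max !leqnn !orbT.
Qed.

(** Let the box grow to infinity in the direction of A alone. What remains is a finite product over
    b, with a relative error depending on z only through the affinoid. *)
Lemma elat_eA n zeta : ab zeta * q%:R ^+ K < q%:R ^+ n -> 
  ab (elat z zeta - eA zeta * \prod_(b <- polys F n | b != 0) (1 - eA zeta / eA (inA b * z)))
    <= ab (elat z zeta) * (ab zeta * q%:R ^+ K / q%:R ^+ n).
Proof.
move=> hn; rewrite ab_subC.
have nz b : b != 0 -> eA (inA b * z) != 0.
  move=> b0; apply/eqP => /eA_eq0[a e].
  have := @hz b (- a); rewrite rmorphN e subrr eqxx => h.
  by suff : false by []; apply: h; apply: contra b0 => /eqP[->].
apply: (@lim_near_le _ _ C n _ (fun m => EL z m n zeta)).
  move=> m nm; rewrite ab_subC (@elat_ab n m n) //; exact: elat_near.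
have L := limM (eA_lim zeta) (@lim_prod _ _ C _ [seq b <- polys F n | b != 0]
  (fun b m => 1 - EA m zeta / EA m (inA b * z)) (fun b => 1 - eA zeta / eA (inA b * z)) _).
rewrite -[X in eA zeta * X]big_filter; apply: (lim_ext (N := 0%N)) (L _) => [m _|b].
  by rewrite (EL_EA hz) big_filter.
apply: limB; first exact: lim_cst.
have [->|b0] := eqVneq b 0.
  apply/cvgP => e e0; exists 0%N => m _; rewrite rmorph0 mul0r.
  have -> : eA 0 = 0 by have := eA_inA 0; rewrite rmorph0.
  have -> : EA m 0 = 0 by have [_ _ _ E _] := fspace_A C m; rewrite -[EA m 0]/((Abox C m).2 0) E mul0r.
  by rewrite !invr0 !mulr0 subrr ab0.
by apply: limM (eA_lim _) (limV (nz b b0) (eA_lim _)).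
Qed.

End Elat.
End Exponentials.

(** * The Carlitz exponential and its period *)

Section Carlitz.
Variables (F : finFieldType) (R : realType) (C : cinf F R).
Local Notation ab := (@absC F R C).
Local Notation q := (#|F|).
Local Notation A := {poly F}.
Local Notation inA := (@embA F R C).
Local Notation theta := (@theta F R C).
Local Notation eCar := (@eCar F R C).
Local Notation brk := (@brk F R C).
Local Notation dC := (@carlitz_d F R C).
Local Notation eA := (@eA F R C).
Local Notation "c '%:K'" := (inA c%:P) (at level 2, format "c '%:K'").
Local Notation "a ~> l" := (cvg_to ab a l) (at level 70).
Implicit Types (x y z : C).

Lemma ab_brk i : (0 < i)%N -> ab (brk i) = q%:R ^+ (q ^ i).
Proof.
move=> i0; rewrite abB_l !abX ab_theta // -[ltLHS]expr1 ltr_eXn2l ?qR_gt1 //.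
by rewrite -(exp1n i) ltn_exp2r // card_F_gt1.
Qed.

Lemma brk_neq0 i : (0 < i)%N -> brk i != 0.
Proof. by move=> i0; rewrite -ab_gt0 ab_brk // qX_gt0. Qed.

Lemma dC_S i : dC i.+1 = brk i.+1 * dC i ^+ q.
Proof.
rewrite /carlitz_d big_ord_recl subn0 expn0 expr1 -prodrXl; congr (_ * _).
by apply: eq_bigr => j _; rewrite -exprM lift0 subSS expnS mulnC.
Qed.

Lemma ab_dC_ge i : q%:R ^+ i <= ab (dC i).
Proof.
have q1 : 1 <= q%:R :> R by rewrite ltW // qR_gt1.
elim: i => [|i IH]; first by rewrite /carlitz_d big_ord0 ab1 expr0.
rewrite dC_S absM abX ab_brk // exprS; apply: ler_pM; rewrite ?ler0n ?exprn_ge0 ?ler0n //.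
  rewrite -[leLHS]expr1; apply: ler_weXn2l => //; by rewrite expn_gt0 qpos.
apply: (le_trans (IH)); rewrite -[leLHS]expr1; apply: ler_weXn2l; last exact: qpos.
exact: le_trans (qX_ge1 F R i) IH.
Qed.

Lemma dC_neq0 i : dC i != 0.
Proof. by rewrite -ab_gt0 (lt_le_trans _ (ab_dC_ge i)) // qX_gt0. Qed.

Definition car_term z i := z ^+ (q ^ i) / dC i.

Lemma car_term_S z i : car_term z i.+1 = car_term z i ^+ q / brk i.+1.
Proof.
rewrite /car_term dC_S expr_div_n -exprM -expnSr invfM; ring.
Qed.

Lemma car_term_small z i : ab z <= 1 -> (0 < i)%N -> ab (car_term z i) <= ab z ^+ 2.
Proof.
move=> z1; rewrite /car_term abf_div abX => i0.
apply: (@le_trans _ _ (ab z ^+ (q ^ i))).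
  rewrite ler_piMr ?exprn_ge0 ?abs_ge0 // invf_le1 ?ab_gt0 ?dC_neq0 //.
  exact: le_trans (qX_ge1 F R i) (ab_dC_ge i).
apply: ler_wiXn2l; rewrite ?abs_ge0 // (leq_trans (card_F_gt1 F)) //.
by rewrite -[X in (X <= _)%N]expn1 leq_exp2l // card_F_gt1.
Qed.

(** If |z| <= q^N, the recursion for d_i bounds the i-th term by q^((N - i) q^i). *)
Lemma car_term_null z : car_term z ~> 0.
Proof.
have q1 : 1 < q%:R :> R by exact: qR_gt1.
have [N hN] := qpow_large F (ab z).
have NN : exists n, forall i, (n <= i)%N -> ab (car_term z i) <= q%:R ^- i.
  have step i : ab (car_term z i.+1) = ab (car_term z i) ^+ q / q%:R ^+ (q ^ i.+1).
    by rewrite car_term_S abf_div abX ab_brk.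
  have b i : ab (car_term z i) <= q%:R ^+ (N * q ^ i) / q%:R ^+ (i * q ^ i).
    elim: i => [|i IH].
      rewrite /car_term /carlitz_d big_ord0 divr1 !expn0 mul0n expr0 divr1 muln1 expr1.
      exact: ltW.
    rewrite step expnSr !mulnA; apply: (@le_trans _ _ ((q%:R ^+ (N * q ^ i) / q%:R ^+ (i * q ^ i)) ^+ q / q%:R ^+ (q ^ i * q))).
      rewrite ler_pM2r ?invr_gt0 ?qX_gt0 // lerXn2r ?nnegrE ?abs_ge0 //.
      by rewrite divr_ge0 // exprn_ge0 // ler0n.
    rewrite expr_div_n -!exprM -mulrA -invfM -exprD.
    have -> : (i * q ^ i * q + q ^ i * q = i.+1 * q ^ i * q)%N by ring.
    by [].
  exists (2 * N).+1 => i hi; apply: le_trans (b i) _.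
  have -> : q%:R ^+ (i * q ^ i) = q%:R ^+ (N * q ^ i) * q%:R ^+ ((i - N) * q ^ i) :> R.
    rewrite -exprD -mulnDl subnKC //; lia.
  rewrite invfM mulrA divff ?mul1r; last by rewrite gt_eqF // qX_gt0.
  apply: qV_le; have : (i <= q ^ i)%N by rewrite ltnW // ltn_expl // card_F_gt1.
  by move=> h; rewrite (leq_trans h) // leq_pmull //; lia.
have [n hn] := NN; apply/cvgP => e e0; have [m hm] := qpow_small F e0.
exists (maxn n m) => i; rewrite geq_max => /andP[ni mi]; rewrite subr0.
exact: le_lt_trans (hn i ni) (le_lt_trans (qV_le F R mi) hm).
Qed.

Lemma eCar_series z : series_to ab (car_term z) (eCar z).
Proof.
have [s hs] := series_ex (car_term_null z).
by rewrite /eCar (series_limE hs).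
Qed.

Lemma eCar_scale z : eCar (theta * z) = theta * eCar z + eCar z ^+ q.
Proof.
apply: (series_uniq (eCar_series _)).
have L := limD (limZ theta (lim_subseq (k := S) leqnSn (eCar_series z))) (limX q (eCar_series z)).
apply/cvgP => e e0; move/cvgP: L => /(_ e e0) [N hN]; exists N.+1 => -[//|n] Nn.
suff -> : \sum_(i < n.+1) car_term (theta * z) i =
  theta * (\sum_(i < n.+1) car_term z i) + (\sum_(i < n) car_term z i) ^+ q by exact: hN.
have -> : (\sum_(i < n) car_term z i) ^+ q = \sum_(i < n) car_term z i ^+ q.
  elim: n {Nn} => [|n IH]; first by rewrite !big_ord0 expr0n gtn_eqF ?qpos.
  by rewrite !big_ord_recr /= -IH -(expn1 q) frobD.
rewrite mulr_sumr !big_ord_recl /= -addrA -big_split /=; congr (_ + _).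
  by rewrite /car_term !expn0 !expr1 mulrA.
apply: eq_bigr => i _; rewrite /bump leq0n add1n.
have -> : car_term z i ^+ q = car_term z i.+1 * brk i.+1 by rewrite car_term_S divfK // brk_neq0.
rewrite /car_term /brk exprMn; ring.
Qed.

Lemma eCar_near z : ab z <= 1 -> ab (eCar z - z) <= ab z ^+ 2.
Proof.
move=> z1; have := @series_tail _ _ C 1 (ab z ^+ 2) _ _ (exprn_ge0 _ (abs_ge0 _)) _ (eCar_series z).
rewrite big_ord1 /car_term /carlitz_d big_ord0 divr1 expn0 expr1; apply => i i0.
exact: car_term_small.
Qed.

(** Near 0 the equation gives |d x| <= q^n |d (x / theta^n)|, and the quadratic bound makes the
    right side of order q^-n. So d vanishes near 0, and then everywhere by multiplying with
    theta. *)
Lemma carlitz_uniq (d : C -> C) (c : R) : (forall x, d (theta * x) = theta * d x + d x ^+ q) ->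
  (exists2 r : R, 0 < r & forall x, ab x < r -> ab (d x) <= c * ab x ^+ 2) ->
  forall x, d x = 0.
Proof.
move=> hd [r r0 hr]; have q0 := qR_gt0 F R; have q1 := qR_gt1 F R.
have c1 : 0 < 1 + `|c| by rewrite ltr_wpDr.
pose rho := Num.min (Num.min r 1) (1 + `|c|)^-1.
have rho0 : 0 < rho by rewrite !lt_min r0 ltr01 invr_gt0.
have small x : ab x < rho -> ab (d x) <= (1 + `|c|) * ab x ^+ 2 /\ ab (d x) <= 1.
  rewrite !lt_min => /andP[/andP[xr x1] xc].
  have h : ab (d x) <= (1 + `|c|) * ab x ^+ 2.
    apply: le_trans (hr x xr) _; apply: ler_wpM2r; first by rewrite exprn_ge0 ?abs_ge0.
    by rewrite ler_wpDl // ler_norm.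
  split=> //; apply: le_trans h _; rewrite expr2 mulrA.
  apply: (@le_trans _ _ (1 * 1)); last by rewrite mulr1.
  apply: ler_pM; rewrite ?abs_ge0 ?mulr_ge0 ?abs_ge0 // ltW //.
  by rewrite mulrC -ltr_pdivlMr // div1r.
have step x : ab x < rho -> ab (d (theta * x)) <= q%:R * ab (d x).
  move=> xr; have [_ h1] := small x xr; rewrite hd; apply: abD_le.
    by rewrite absM ab_theta.
  rewrite abX -(prednK (qpos F)) exprS mulrC ler_wpM2r ?abs_ge0 //.
  by apply: le_trans (exprn_ile1 _ (abs_ge0 _) h1) _; rewrite prednK ?qpos // ltW.
have iter n x : ab x < rho -> ab (d x) <= q%:R ^+ n * ab (d (x / theta ^+ n)).
  elim: n x => [|n IH] x xr; first by rewrite !expr0 mul1r divr1.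
  have le : ab (x / theta ^+ n.+1) < rho.
    rewrite abf_div ab_thetaX; apply: le_lt_trans xr; rewrite ler_pdivrMr ?qX_gt0 //.
    by rewrite ler_peMr ?abs_ge0 // qX_ge1.
  apply: le_trans (IH x xr) _; have -> : x / theta ^+ n = theta * (x / theta ^+ n.+1).
    by rewrite exprS; field; rewrite thetaX_neq0 theta_neq0.
  rewrite [q%:R ^+ n.+1]exprSr -mulrA; apply: ler_wpM2l; first by rewrite exprn_ge0 // ltW.
  exact: step.
have z0 x : ab x < rho -> d x = 0.
  move=> xr; apply: ab_le_eps => e e0.
  have e1 : 0 < e / (1 + `|c|) by rewrite divr_gt0.
  have [n hn] := qpow_small F e1; apply: le_trans (iter n x xr) _.
  have x1 : ab x <= 1 by move: xr; rewrite !lt_min => /andP[/andP[_ /ltW]].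
  have le : ab (x / theta ^+ n) < rho.
    rewrite abf_div ab_thetaX; apply: le_lt_trans xr; rewrite ler_pdivrMr ?qX_gt0 //.
    by rewrite ler_peMr ?abs_ge0 // qX_ge1.
  have [h _] := small _ le; apply: le_trans (ler_wpM2l (exprn_ge0 _ (ltW q0)) h) _.
  rewrite abf_div ab_thetaX.
  have -> : q%:R ^+ n * ((1 + `|c|) * (ab x / q%:R ^+ n) ^+ 2) =
     ((1 + `|c|) * q%:R ^- n) * ab x ^+ 2.
    by field; rewrite gt_eqF // qX_gt0.
  apply: (@le_trans _ _ (e * 1)); last by rewrite mulr1.
  apply: ler_pM; rewrite ?mulr_ge0 ?exprn_ge0 ?abs_ge0 ?invr_ge0 ?exprn_ge0 ?(ltW q0) ?(ltW c1) //.
    by rewrite mulrC -ler_pdivlMr // ltW.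
  by rewrite exprn_ile1 ?abs_ge0.
have up n x : ab x < rho -> d (theta ^+ n * x) = 0.
  move=> xr; elim: n => [|n IH]; first by rewrite expr0 mul1r z0.
  by rewrite exprS -mulrA hd IH mulr0 expr0n gtn_eqF ?qpos // addr0.
move=> x; have [n hn] := qpow_large F (ab x / rho).
have := up n (x / theta ^+ n); rewrite (mulrC (theta ^+ n)) divfK ?thetaX_neq0 //; apply.
by rewrite abf_div ab_thetaX ltr_pdivrMr ?qX_gt0 // mulrC -ltr_pdivrMr.
Qed.

(** Choose p0^(q-1) so that p0 e_A(x) obeys the Carlitz equation in the variable p0 x. It agrees
    with the Carlitz exponential to first order, and their difference obeys the same equation by
    additivity of Frobenius. *)
Lemma carlitz_period0 : exists2 p0 : C, p0 != 0 & forall x, eCar (p0 * x) = p0 * eA x.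
Proof.
have n0 : eA theta^-1 ^+ q.-1 != 0.
  rewrite expf_neq0 //; apply/eqP => /eA_eq0[a /eqP].
  by move=> e; have := @thetaV_notin _ _ C a; rewrite e ?eqxx.
pose k := - theta / eA theta^-1 ^+ q.-1.
have k0 : k != 0 by rewrite mulf_neq0 ?invr_eq0 // oppr_eq0 theta_neq0.
have [|p0 /rootP] := @C_root _ _ C ('X^(q.-1) - k%:P).
  by rewrite size_XnsubC ?q1_gt0 // ltnS q1_gt0.
rewrite hornerD hornerN hornerXn hornerC => /eqP; rewrite subr_eq0 => /eqP pk.
have p00 : p0 != 0.
  by apply: contra k0 => /eqP e; rewrite -pk e expr0n gtn_eqF ?q1_gt0.
exists p0 => // x; apply/eqP; rewrite -subr_eq0; apply/eqP.
pose d y := eCar (p0 * y) - p0 * eA y.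
have D y : d (theta * y) = theta * d y + d y ^+ q.
  rewrite /d mulrCA eCar_scale eA_scale -(expn1 q) frobB expn1 exprMn.
  have -> : p0 ^+ q = p0 * k by rewrite -pk -exprS prednK ?qpos.
  by rewrite /k; field.
pose B := 1 + ab p0; have B0 : 0 < B by rewrite ltr_wpDr ?abs_ge0.
apply: (@carlitz_uniq d (B ^+ 2) D); exists B^-1; first by rewrite invr_gt0.
move=> y yB; have pB : ab p0 <= B by rewrite /B; lra.
have B1 : 1 <= B by have := abs_ge0 p0; rewrite /B; lra.
have y1 : ab y < 1 by apply: lt_le_trans yB _; rewrite invf_le1.
have py : ab (p0 * y) <= 1.
  rewrite absM; apply: (@le_trans _ _ (B * B^-1)); last by rewrite mulfV // gt_eqF.
  by apply: ler_pM; rewrite ?abs_ge0 // ltW.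
have -> : d y = (eCar (p0 * y) - p0 * y) - p0 * (eA y - y) by rewrite /d; ring.
apply: abB_le.
  apply: le_trans (eCar_near py) _; rewrite absM exprMn ler_wpM2r ?exprn_ge0 ?abs_ge0 //.
  by rewrite lerXn2r ?nnegrE ?abs_ge0 ?(ltW B0).
have y10 : ab y < q%:R ^+ 0 by rewrite expr0.
have := eA_near_id y10; rewrite expr0 divr1 -expr2 => h.
rewrite absM; apply: ler_pM; rewrite ?abs_ge0 //.
by apply: le_trans pB _; rewrite expr2 ler_peMr // ltW.
Qed.

Variable pi : C.
Hypothesis hpi : carlitz_period pi.

(** [pi] and p0 generate the same kernel over A, so they differ by a nonzero constant of F, and e_A
    is F-linear. *)
Lemma eCar_pi x : eCar (pi * x) = pi * eA x.
Proof.
have [p0 p00 h] := carlitz_period0.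
have ker y : eCar y = 0 <-> exists a : A, y = pi * inA a.
  have := hpi; rewrite /carlitz_period predeqE => /(_ y) /= [h1 h2].
  split=> [/h1[a _ <-]|[a e]]; first by exists a.
  by apply: h2; exists a.
have [a ea] : exists a : A, p0 = pi * inA a.
  by apply/ker; rewrite -[p0]mulr1 h -(rmorph1 inA) eA_inA mulr0.
have [b eb] : exists b : A, pi = p0 * inA b.
  have : eCar pi = 0 by apply/ker; exists 1; rewrite rmorph1 mulr1.
  rewrite -[pi](divfK p00) mulrC h => /eqP; rewrite mulf_eq0 (negbTE p00) /= => /eqP/eA_eq0[b e].
  by exists b; rewrite -e mulrC divfK.
have ab1' : a * b = 1.
  apply: (@inA_inj _ _ C); apply: (mulfI p00).
  by rewrite rmorphM rmorph1 mulr1 mulrCA -eb mulrC -ea.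
have sb : size b == 1%N.
  have := congr1 (fun p : A => size p) ab1'; rewrite size_poly1.
  have [->|an] := eqVneq a 0; first by rewrite mul0r size_poly0.
  have [->|bn] := eqVneq b 0; first by rewrite mulr0 size_poly0.
  rewrite size_mul // => e; move: an bn e; rewrite -!size_poly_gt0.
  by case: (size a) => // -[|m]; case: (size b) => // -[|k] // _ _; rewrite ?addSn ?addnS.
have /size_poly1P[c c0 bE] := sb.
by rewrite eb bE -mulrA h eA_Z mulrA.
Qed.

Lemma pi_neq0 : pi != 0.
Proof.
apply/eqP => p0; have [p00 p00n h] := carlitz_period0.
have := eCar_pi (p00 * 1 / 1).
have : eCar (p00 * 1) = 0 by rewrite h -(rmorph1 inA) eA_inA mulr0.
have := hpi; rewrite /carlitz_period predeqE => /(_ (p00 * 1)) /= [h1 _] /h1[a _].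
by rewrite p0 mul0r mulr1 => e; rewrite -e eqxx in p00n.
Qed.

Lemma eA_carlitz x : eA (theta * x) = theta * eA x + pi ^+ q.-1 * eA x ^+ q.
Proof.
apply: (mulfI pi_neq0); rewrite -eCar_pi mulrCA eCar_scale eCar_pi exprMn.
by rewrite -{1}(prednK (qpos F)) exprS; ring.
Qed.

End Carlitz.

(** * The variable as a convergent power series *)

Section EvalPoly.
Variables (F : finFieldType) (R : realType) (C : cinf F R).
Local Notation ab := (@absC F R C).

Lemma coef_fXn k n : coef (fX C ^+ k) n = if n == k then 1 else 0.
Proof.
rewrite -[fX C ^+ k]mulr1 coefXnM -(rmorph1 (@fps_const C)) coef_const.
case: ltngtP => // [kn|->]; rewrite ?subnn //.
by rewrite subn_eq0 leqNgt kn.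
Qed.

Lemma bnd_fXM (M r : R) k f : 0 < r -> bnd M r f -> bnd (M / r ^+ k) r (fX C ^+ k * f).
Proof.
move=> r0 hf n; rewrite coefXnM; case: ltnP => kn.
  by rewrite ab0 !mulr_ge0 ?invr_ge0 ?exprn_ge0 ?(ltW r0) // (bnd_ge0 hf).
rewrite -{2}(subnK kn) exprD [leRHS](_ : _ = M * r ^+ (n - k)); first exact: hf.
by field; rewrite expf_neq0 // gt_eqF.
Qed.

Lemma cvf_fX (r : R) : 0 < r -> cvf r (fX C).
Proof.
move=> r0; rewrite -[fX C]mulr1 -[fX C]expr1.
exact: cvf_bnd (bnd_fXM 1 r0 (bnd1 C (ltW r0))).
Qed.

Lemma eval_fX t : fps_eval (fX C) t = t.
Proof.
rewrite /fps_eval; apply: series_limE.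
apply: (lim_ext (N := 2%N)) (lim_cst t) => -[|[|n]] // _.
rewrite big_ord_recl big_ord_recl big1 ?addr0 => [|i _].
  by rewrite -[fX C]expr1 !coef_fXn /= mul0r add0r mul1r expr1.
by rewrite -[fX C]expr1 coef_fXn mul0r.
Qed.

Lemma eval_fXM (r : R) k f t : 0 < r -> ab t * r < 1 -> cvf r f ->
  fps_eval (fX C ^+ k * f) t = t ^+ k * fps_eval f t.
Proof.
move=> r0 tr hf; have hX := cvf_fX r0.
by rewrite (evalM (ltW r0) tr (cvfX k (ltW r0) hX) hf) (evalX k (ltW r0) tr hX) eval_fX.
Qed.

End EvalPoly.

(** * The parameter u at infinity *)

Section Uniformizer.
Variables (F : finFieldType) (R : realType) (C : cinf F R).
Local Notation ab := (@absC F R C).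
Local Notation q := (#|F|).
Local Notation A := {poly F}.
Local Notation inA := (@embA F R C).
Local Notation theta := (@theta F R C).
Local Notation Kinf := (@Kinf F R C).
Local Notation Om := (Omega C).
Local Notation EA := (@EA F R C).
Local Notation eA := (@eA F R C).
Local Notation eCar := (@eCar F R C).
Local Notation vtx n := (vertex 0 (theta ^+ n)).
Local Notation "c '%:K'" := (inA c%:P) (at level 2, format "c '%:K'").
Local Notation "a ~> l" := (cvg_to ab a l) (at level 70).
Implicit Types (x y z : C).

Lemma EA_prod n x : EA n x = x * \prod_(a <- polys F n | a != 0) (1 - x / inA a).
Proof.
have [_ _ _ E _] := fspace_A C n; rewrite -[EA n x]/((Abox C n).2 x) E Abox_list big_map; congr (_ * _).
by apply: eq_bigl => a; rewrite inA_eq0.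
Qed.

(** Subtracting the nearest polynomial of degree below n does not change the value, so 0 may be
    taken nearest; each factor 1 - y/a then has absolute value at least 1 ([factor_ge]). *)
Lemma EA_nmin n x (rho : R) : (forall a : A, rho <= ab (x - inA a)) ->
  exists y, [/\ EA n y = EA n x, rho <= ab y &
    forall a : A, (size a <= n)%N -> ab y <= ab (y - inA a)].
Proof.
move=> h; have n0 : polys F n != [::].
  by apply/eqP => e; have := mem_polys n (0 : A); rewrite e size_poly0.
have [a am amin] := seq_argmin (fun a : A => ab (x - inA a)) n0.
exists (x - inA a); split => // [|b sb].
  have e0 : EA n (inA a) = 0 by apply/eqP/EA_eq0; exists a => //; rewrite -mem_polys.
  by rewrite EA_D EA_N e0 subr0.
rewrite -addrA -opprD -rmorphD; apply: amin.
by move: am; rewrite !mem_polys => sa; rewrite (leq_trans (size_polyD _ _)) // geq_max sa.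
Qed.

Lemma factor_ge y (a : A) : a != 0 -> ab y <= ab (y - inA a) ->
  1 <= ab (1 - y / inA a) /\ ab y <= ab (1 - y / inA a) * ab (inA a).
Proof.
move=> a0 h; have an : inA a != 0 by rewrite inA_eq0.
have -> : ab (1 - y / inA a) = ab (y - inA a) / ab (inA a).
  by rewrite -abf_div -abN; congr ab; field.
have e : ab (inA a) <= ab (y - inA a).
  by rewrite -[leLHS](_ : ab (y - (y - inA a)) = _); [exact: abB_le | congr ab; ring].
by rewrite ler_pdivlMr ?ab_gt0 // mul1r divfK // ab_eq0.
Qed.

Lemma prodr_ge1 (I : eqType) (s : seq I) (P : pred I) (f : I -> R) :
  (forall i, i \in s -> P i -> 1 <= f i) -> 1 <= \prod_(i <- s | P i) f i.
Proof.
move=> h; rewrite big_seq_cond; elim/big_rec: _ => // i x /andP[si Pi] x1.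
by rewrite -[leLHS]mulr1; apply: ler_pM => //; exact: h.
Qed.

Lemma EA_nmin_ge n y : (forall a : A, (size a <= n)%N -> ab y <= ab (y - inA a)) ->
  ab y <= ab (EA n y).
Proof.
move=> h; rewrite EA_prod absM ab_prod ler_peMr ?abs_ge0 //.
by apply: prodr_ge1 => a; rewrite mem_polys => sa a0; have [] := factor_ge a0 (h a sa).
Qed.

Lemma EA1 y : EA 1 y = y * \prod_(c : F | c != 0) (1 - y / c%:K).
Proof.
rewrite prod_units -[EA 1 y]/(y - y ^+ q / (theta ^+ 0) ^+ q.-1) expr0 expr1n divr1.
by rewrite mulrBr mulr1 -exprS prednK // qpos.
Qed.

(** The q - 1 factors with a constant contribute |y|^(q-1). This q-th power is what makes the series
    of the false Eisenstein series converge uniformly. *)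
Lemma EA_nmin_geX n y : (0 < n)%N ->
  (forall a : A, (size a <= n)%N -> ab y <= ab (y - inA a)) -> ab y ^+ q <= ab (EA n y).
Proof.
move=> n0 h.
have step : ab (EA 1 y) <= ab (EA n y).
  rewrite !EA_prod !absM ler_wpM2l ?abs_ge0 // big_mkcond [X in _ <= ab X]big_mkcond.
  have sub : {subset polys F 1 <= polys F n}.
    by move=> a; rewrite !mem_polys => /leq_trans -> //.
  rewrite [X in _ <= ab X](prod_sub_uniq _ (polys_uniq F 1) (polys_uniq F n) sub) absM ler_peMr ?abs_ge0 //.
  rewrite ab_prod; apply: prodr_ge1 => a; rewrite mem_polys => sa _.
  by case: ifP => a0; [have [] := factor_ge a0 (h a sa) | rewrite ab1].
apply: le_trans step; rewrite EA1 absM ab_prod -{1}(prednK (qpos F)) exprS.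
apply: ler_wpM2l; rewrite ?abs_ge0 //.
have -> : ab y ^+ q.-1 = \prod_(c : F | c != 0) ab y.
  by rewrite prodr_const -(cardC1 (0 : F)); congr (_ ^+ _); apply: eq_card => c; rewrite !inE.
apply: ler_prod => c c0; rewrite abs_ge0 /=.
have cn : c%:P != 0 :> A by rewrite polyC_eq0.
have sc : (size (c%:P : A) <= n)%N by rewrite (leq_trans (size_polyC_leq1 _)).
by have [_] := factor_ge cn (h _ sc); rewrite ab_const // mulr1.
Qed.

Lemma EA_ge n x (rho : R) : (forall a : A, rho <= ab (x - inA a)) -> rho <= ab (EA n x).
Proof.
by move=> /(EA_nmin n)[y [<- ry h]]; exact: le_trans ry (EA_nmin_ge h).
Qed.

Lemma EA_geX n x (rho : R) : (0 < n)%N -> 0 <= rho -> (forall a : A, rho <= ab (x - inA a)) ->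
  rho ^+ q <= ab (EA n x).
Proof.
move=> n0 r0 /(EA_nmin n)[y [<- ry h]]; apply: le_trans (EA_nmin_geX n0 h).
by rewrite lerXn2r ?nnegrE ?abs_ge0.
Qed.

Lemma eA_ge x (rho : R) : 0 < rho -> (forall a : A, rho <= ab (x - inA a)) -> rho <= ab (eA x).
Proof. by move=> r0 h; apply: (lim_ge_ab (N := 0%N) r0) (eA_lim x) => n _; exact: EA_ge. Qed.

Variable pi : C.
Hypothesis hpi : carlitz_period pi.
Local Notation u := (@u F R C pi).

Lemma uE x : u x = (pi * eA x)^-1. Proof. by rewrite -[u x]/((eCar (pi * x))^-1) eCar_pi. Qed.

Lemma ab_eA_theta : ab (eA theta^-1) = q%:R^-1.
Proof. by rewrite eA_small abV ab_theta // invf_lt1 ?qR_gt0 // qR_gt1. Qed.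

(** In the Carlitz equation at 1/theta the left side is e_A(1) = 0, so the two terms on the right
    have equal absolute value. *)
Lemma ab_piX : ab pi ^+ q.-1 = q%:R ^+ q.
Proof.
have := eA_carlitz hpi theta^-1; rewrite mulfV ?theta_neq0 // -(rmorph1 inA) eA_inA => /eqP.
rewrite eq_sym addrC addr_eq0 => /eqP /(congr1 ab).
have q0 : (q%:R : R) != 0 by rewrite gt_eqF // qR_gt0.
rewrite abN !absM !abX ab_theta ab_eA_theta mulfV // exprVn => e.
by rewrite -[LHS](divfK (x := q%:R ^+ q)) ?expf_neq0 // e mul1r.
Qed.

Lemma ab_pi_gt1 : 1 < ab pi.
Proof.
rewrite ltNge; apply/negP => h; have := exprn_ile1 q.-1 (abs_ge0 pi) h.
by rewrite ab_piX leNgt exprn_egt1 ?qR_gt1 // -lt0n qpos.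
Qed.

(** In e_A(theta x) = theta e_A(x) + pi^(q-1) e_A(x)^q the last term dominates and has absolute
    value q^q |e_A(x)|^q; [sq] satisfies the same recursion. *)
Lemma vtx_eA n z : vtx n z -> q%:R ^+ sq F n <= ab (eA z).
Proof.
elim: n z => [|n IH] z [zn zK].
  rewrite expr0; apply: eA_ge => // a; have := zK _ (Kinf_inA C a).
  by rewrite expr0 ab1.
have q0 := qR_gt0 F R; have q1 := qR_gt1 F R.
have ez : z = theta * (z / theta) by rewrite mulrC divfK ?theta_neq0.
have vz : vtx n (z / theta).
  split; first by move: zn; rewrite !subr0 abf_div !ab_thetaX ab_theta exprS => ->; rewrite mulrC mulKf // gt_eqF.
  move=> x Kx; have tK : Kinf (theta * x) by apply: KinfM => //; rewrite -[theta]expr1; exact: Kinf_thetaX.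
  have := zK _ tK; have -> : z - theta * x = theta * (z / theta - x) by rewrite mulrBr -ez.
  by rewrite absM ab_thetaX ab_theta exprS ab_thetaX ler_pM2l.
have IHz := IH _ vz; have e1 : 1 <= ab (eA (z / theta)) by apply: le_trans IHz; exact: qX_ge1.
have e0 : 0 < ab (eA (z / theta)) by exact: lt_le_trans ltr01 e1.
rewrite [in leRHS]ez (eA_carlitz hpi) abD_r.
  rewrite absM !abX ab_piX /= mulnS exprD ler_pM2l ?qX_gt0 // mulnC exprM.
  by rewrite lerXn2r ?nnegrE ?exprn_ge0 ?abs_ge0 ?ler0n.
rewrite !absM !abX ab_piX ab_theta; apply: (@lt_le_trans _ _ (q%:R ^+ q * ab (eA (z / theta)))).
  by rewrite ltr_pM2r // -[ltLHS]expr1 ltr_eXn2l // card_F_gt1.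
rewrite ler_pM2l ?qX_gt0 // -[leLHS]expr1; apply: ler_weXn2l => //; exact: qpos.
Qed.

Lemma u_neq0 (z : Om) : u (val z) != 0.
Proof.
rewrite uE invr_eq0 mulf_neq0 ?(pi_neq0 hpi) //; apply/eqP => /eA_eq0[a e].
by have : Om (val z) := set_mem (valP z); apply; rewrite e; exact: Kinf_inA.
Qed.

Lemma u_vtx n (z : Om) : vtx n (val z) -> ab (u (val z)) <= q%:R ^- sq F n.
Proof.
move=> h; have e0 : 0 < ab (pi * eA (val z)) by rewrite ab_gt0 -invr_eq0 -uE u_neq0.
rewrite uE abV lef_pV2 ?posrE ?qX_gt0 //.
rewrite absM; apply: le_trans (vtx_eA h) _; rewrite ler_peMl ?abs_ge0 // ltW //.
exact: ab_pi_gt1.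
Qed.

Lemma u_small (e : R) : 0 < e -> exists z : Om, ab (u (val z)) < e.
Proof.
move=> e0; have [n hn] := qpow_small F e0; have [z vz _] := @vtx_ex _ _ C n [::].
exists (toOm (vtx_Sreg (leqnn n) vz)); apply: le_lt_trans (u_vtx (n := n) _) _ => //.
exact: le_lt_trans (qV_le F R (sq_ge F n)) hn.
Qed.

(** D is the Carlitz polynomial of b in the variable 1/u with the order of its coefficients
    reversed; its constant term, the leading coefficient of b, has absolute value 1. *)
Lemma carlitz_poly (b : A) : b != 0 -> exists2 D : fps C, bnd 1 q%:R D &
  coef D 0 = (lead_coef b)%:K /\ forall x, eA x != 0 -> ab (u x) * q%:R < 1 ->
    pi * eA (inA b * x) = fps_eval D (u x) / u x ^+ (q ^ (size b).-1).
Proof.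
have q0 := qR_gt0 F R; have q1 := qR_gt1 F R.
elim/poly_ind: b => [|p c IH] b0; first by rewrite eqxx in b0.
have [p0|p0] := eqVneq p 0.
  move: b0; rewrite p0 mul0r add0r => b0; exists (fps_const c%:K).
    by apply: (bnd_leM (ltW q0) (ab_const_le1 C c)); exact: bnd_const (ltW q0).
  rewrite coef_const lead_coefC; split=> // x ex xq.
  rewrite polyC_eq0 in b0.
  by rewrite eval_const size_polyC b0 expn0 expr1 uE invrK eA_Z mulrCA.
have [D bD [D0 hD]] := IH p0.
have sb : (size (p * 'X + c%:P)).-1 = (size p).-1.+1.
  by rewrite size_MXaddC (negbTE p0) /= prednK // size_poly_gt0.
set d := (size p).-1 in hD sb.
have k1 : (0 < q ^ d.+1 - q ^ d)%N by rewrite subn_gt0 ltn_exp2l // card_F_gt1.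
have k2 : (0 < (q ^ d.+1).-1)%N by rewrite -subn1 subn_gt0 -{1}(expn0 q) ltn_exp2l // card_F_gt1.
exists (D ^+ q + fps_const theta * (fX C ^+ (q ^ d.+1 - q ^ d) * D) +
    fps_const c%:K * (fX C ^+ (q ^ d.+1).-1 * 1)).
  apply: bndD; first apply: bndD; first exact: bndX (ltW q0) bD.
    have := bndM (abs_ge0 theta) _ (ltW q0) (bnd_const theta (ltW q0)) (bnd_fXM (q ^ d.+1 - q ^ d) q0 bD).
    rewrite ab_theta => h; apply: (bnd_leM (ltW q0)) (h _); last by rewrite mulr_ge0 // invr_ge0 exprn_ge0 // ltW.
    rewrite mul1r ler_pdivrMr ?qX_gt0 // mul1r -[leLHS]expr1.
    by apply: ler_weXn2l => //; exact: ltW.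
  have := bndM (abs_ge0 c%:K) _ (ltW q0) (bnd_const c%:K (ltW q0)) (bnd_fXM (q ^ d.+1).-1 q0 (bnd1 C (ltW q0))).
  move=> h; apply: (bnd_leM (ltW q0)) (h _); last by rewrite mulr_ge0 // invr_ge0 exprn_ge0 // ltW.
  rewrite mul1r -[leRHS]mulr1; apply: ler_pM; rewrite ?abs_ge0 ?ab_const_le1 //.
    by rewrite invr_ge0 exprn_ge0 // ltW.
  exact: qV_le1.
split.
  rewrite !fcoefD !coef_constM !coefXnM k1 k2 !mulr0 !addr0.
  have -> : coef (D ^+ q) 0 = coef D 0 ^+ q.
    by elim: (q) => [|m IHm]; rewrite ?expr0 ?exprS ?fcoefM0 ?IHm // -(rmorph1 (@fps_const C)) coef_const.
  by rewrite D0 constX lead_coefDl ?lead_coefMX // size_polyC size_mulX //; case: (c != 0) => //; rewrite ltnS size_poly_gt0.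
move=> x ex xq; have cD := cvf_bnd bD; have un : u x != 0.
  by rewrite uE invr_eq0 mulf_neq0 ?(pi_neq0 hpi).
have q0' := ltW q0.
rewrite (evalD q0' xq) ?(evalD q0' xq) ?(evalM q0' xq) ?(evalX _ q0' xq) ?(eval_fXM _ q0 xq) ?eval_const ?eval1 //;
  try (by repeat first [apply: cvfD | apply: cvfM | apply: cvfX | apply: cvf_const | apply: cvf1 | apply: cvf_fX | exact: cD | exact: q0 | exact: q0']).
have -> : inA (p * 'X + c%:P) * x = theta * (inA p * x) + c%:K * x.
  by rewrite rmorphD rmorphM -[inA 'X]/theta; ring.
rewrite eA_D (eA_carlitz hpi) eA_Z !mulrDr sb.
have -> : pi * (pi ^+ q.-1 * eA (inA p * x) ^+ q) = (pi * eA (inA p * x)) ^+ q.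
  by rewrite exprMn mulrA -exprS prednK ?qpos.
rewrite [pi * (theta * _)]mulrCA [pi * (c%:K * _)]mulrCA (hD x ex xq).
have -> : pi * eA x = (u x)^-1 by rewrite uE invrK.
have e1 : u x ^+ (q ^ d.+1) = u x ^+ (q ^ d) * u x ^+ (q ^ d.+1 - q ^ d).
  by rewrite -exprD subnKC // leq_exp2l // card_F_gt1.
have e2 : u x ^+ (q ^ d.+1) = u x * u x ^+ (q ^ d.+1).-1.
  by rewrite -exprS prednK // expn_gt0 qpos.
rewrite !eval_fX expr_div_n -exprM -expnSr.
have un1 k : u x ^+ k != 0 by rewrite expf_neq0.
have -> : theta * (fps_eval D (u x) / u x ^+ (q ^ d)) =
    theta * (u x ^+ (q ^ d.+1 - q ^ d) * fps_eval D (u x)) / u x ^+ (q ^ d.+1).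
  by rewrite e1; field; rewrite !un1.
have -> : c%:K * (u x)^-1 = c%:K * (u x ^+ (q ^ d.+1).-1 * 1) / u x ^+ (q ^ d.+1).
  by rewrite e2; field; rewrite un un1.
move: (u x ^+ (q ^ d.+1)) (u x ^+ (q ^ d.+1 - q ^ d)) (u x ^+ (q ^ d.+1).-1) => w1 w2 w3.
move: (fps_eval D (u x)) => y; move: (y ^+ q) => yq; rewrite !mulr1.
by rewrite -!mulrDl; congr (_ / _); ring.
Qed.

(** u(b x) is u^(q^deg b) / D(u), and the inverse keeps the bound 1 because |D(0)| = 1. The gain
    q^(-q^deg b) makes sums and products over b converge. *)
Lemma u_poly : exists U : A -> fps C, forall b : A, b != 0 ->
  [/\ bnd (q%:R ^- (q ^ (size b).-1)) q%:R (U b), coef (U b) 0 = 0 &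
  forall x, eA x != 0 -> ab (u x) * q%:R < 1 -> u (inA b * x) = fps_eval (U b) (u x)].
Proof.
have q0 := qR_gt0 F R.
suff h (b : A) : exists V : fps C, b != 0 -> [/\ bnd (q%:R ^- (q ^ (size b).-1)) q%:R V, coef V 0 = 0 &
  forall x, eA x != 0 -> ab (u x) * q%:R < 1 -> u (inA b * x) = fps_eval V (u x)].
  by have [U hU] := choice h; exists U.
have [->|b0] := eqVneq b 0; first by exists 0.
have [D bD [D0 hD]] := carlitz_poly b0.
have lc : lead_coef b != 0 by rewrite lead_coef_eq0.
have aD : ab (coef D 0) = 1 by rewrite D0 ab_const.
have Dn : coef D 0 != 0 by rewrite -ab_gt0 aD.
have bV : bnd 1 q%:R D^-1.
  have := bnd_recip (ltW q0) Dn; rewrite aD invr1; apply => n _; exact: bD.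
exists (fX C ^+ (q ^ (size b).-1) * D^-1) => _; split.
- by have := bnd_fXM (q ^ (size b).-1) q0 bV; rewrite div1r.
- by rewrite coefXnM expn_gt0 qpos.
move=> x ex xq; rewrite (eval_fXM _ q0 xq (cvf_bnd bV)).
have DV : fps_eval D (u x) * fps_eval D^-1 (u x) = 1.
  by rewrite -(evalM (ltW q0) xq (cvf_bnd bD) (cvf_bnd bV)) divrr ?eval1 // fps_unitE.
rewrite uE (hD x ex xq) invf_div; congr (_ * _).
have Dv : fps_eval D (u x) != 0 by apply: contra_eq_neq DV => ->; rewrite mul0r eq_sym oner_eq0.
by apply: (mulfI Dv); rewrite DV mulfV.
Qed.

End Uniformizer.

(** * The exponential e_z as a function of z *)

Section LatticeFunctions.
Variables (F : finFieldType) (R : realType) (C : cinf F R).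
Local Notation ab := (@absC F R C).
Local Notation q := (#|F|).
Local Notation A := {poly F}.
Local Notation inA := (@embA F R C).
Local Notation theta := (@theta F R C).
Local Notation Kinf := (@Kinf F R C).
Local Notation Om := (Omega C).
Local Notation Sreg := (@Sreg F R C).
Local Notation EA := (@EA F R C).
Local Notation EL := (@EL F R C).
Local Notation Lbox := (@Lbox F R C).
Local Notation GL := (@GL2A F).
Local Notation "c '%:K'" := (inA c%:P) (at level 2, format "c '%:K'").
Local Notation "a ~> l" := (cvg_to ab a l) (at level 70).
Implicit Types (z : Om).

Lemma Om_elat_D z x y : elat (val z) (x + y) = elat (val z) x + elat (val z) y.
Proof. by have [N [M Sz]] := Sreg_ex z; exact: elat_D Sz _ _. Qed.

Lemma Om_elat_Z z (c : F) x : elat (val z) (c%:K * x) = c%:K * elat (val z) x.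
Proof. by have [N [M Sz]] := Sreg_ex z; exact: elat_Z Sz _ _. Qed.

Lemma Om_elat_eq0 z x : elat (val z) x = 0 <-> exists a b : A, x = inA a + inA b * val z.
Proof. by have [N [M Sz]] := Sreg_ex z; exact: elat_eq0 Sz _. Qed.

Lemma lin_inj (a b a' b' : A) z : inA a + inA b * val z = inA a' + inA b' * val z ->
  a = a' /\ b = b'.
Proof.
have [N [M Sz]] := Sreg_ex z; apply: lat_inj; exact: Sreg_lin Sz.
Qed.

Lemma elat_Kinf_neq0 z x : Kinf x -> x != 0 -> ab x < 1 -> elat (val z) x != 0.
Proof.
move=> xK x0 x1; apply/eqP => /Om_elat_eq0[a [b e]].
have [b0|b0] := eqVneq b 0.
  move: x1 x0; rewrite e b0 rmorph0 mul0r addr0 => /ab_inA_lt1 ->.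
  by rewrite rmorph0 eqxx.
have : Om (val z) := set_mem (valP z); apply.
have -> : val z = (x - inA a) / inA b.
  by rewrite e addrC addKr mulrC mulKf // inA_eq0.
by apply: KinfM; [apply: KinfB => //; exact: Kinf_inA | apply: KinfV; exact: Kinf_inA].
Qed.

(** Here c and d are constants; if (c z + d)/theta were a lattice point, both would be divisible by
    X. *)
Lemma elat_div_neq0 z (c d : A) : (c, d) != (0, 0) -> (size c <= 1)%N -> (size d <= 1)%N ->
  elat (val z) ((inA c * val z + inA d) / theta) != 0.
Proof.
move=> cd sc sd; apply/eqP => /Om_elat_eq0[a [b e]].
have /lin_inj[ed ec] : inA d + inA c * val z = inA (a * 'X) + inA (b * 'X) * val z.
  rewrite !rmorphM -[inA 'X]/theta addrC -[LHS](divfK (theta_neq0 C)) e; ring.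
have X0 (p : A) : (size (p * 'X)%R <= 1)%N -> p = 0.
  have [//|p0] := eqVneq p 0; rewrite size_mulX // ltnS leqn0 size_poly_eq0 => /eqP //.
move: cd; rewrite ec ed.
have -> : a = 0 by apply: X0; rewrite -ed.
have -> : b = 0 by apply: X0; rewrite -ec.
by rewrite mul0r eqxx.
Qed.

Section Scale.
Variables (z z' : Om) (c : C).
Hypothesis c0 : c != 0.
Hypothesis sub : forall a b : A, exists a' b' : A,
  inA a + inA b * val z' = c * (inA a' + inA b' * val z).
Hypothesis sub' : forall a b : A, exists a' b' : A,
  c * (inA a + inA b * val z) = inA a' + inA b' * val z'.
Local Notation Lat' := (lattice (val z') `\ 0).

Lemma scale_Lat n v : v \in (Lbox (val z) n n).1 -> v != 0 -> c * v \in Lat'.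
Proof.
move=> /mem_Lbox[a [b [_ _ ->]]] v0; apply/mem_set.
split; last by apply/eqP; rewrite mulf_neq0.
by have [a' [b' ->]] := sub' a b; exists a' => //; exists b' => //; rewrite mulrC.
Qed.

(** The points of the two lattices correspond under v -> c v, so the net for the second is evaluated
    along the images of the boxes of the first. *)
Lemma elat_scale zeta : elat (val z') (c * zeta) = c * elat (val z) zeta.
Proof.
have [N [M Sz]] := Sreg_ex z; have hz := Sreg_lin Sz.
have [N' [M' Sz']] := Sreg_ex z'.
have [l hl hs] := elat_net Sz' (c * zeta).
have -> : elat (val z') (c * zeta) = c * zeta * l.
  rewrite /elat /uprod; congr (_ * _); case: xgetP => [y _ hy|/(_ l)//].
  exact: net_uniq hy hl.
pose Kb n : {fset Lat'} := [fset l in pmap insub (map ( *%R c) (Lbox (val z) n n).1)]%fset.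
have mK n (i : Lat') : (i \in Kb n) = (val i \in map ( *%R c) (Lbox (val z) n n).1).
  by rewrite in_fset mem_pmap_sub.
have cov (i : Lat') : exists N, forall n, (N <= n)%N -> i \in Kb n.
  have [a [b e]] := Lat_ex i; have [a' [b' e']] := sub a b.
  exists (maxn (size a') (size b')) => n; rewrite geq_max => /andP[na nb].
  rewrite mK e e'; apply: map_f; apply/mem_Lbox; by exists a', b'.
have lim := net_seq cov hl.
rewrite -mulrA; congr (_ * _); apply: (lim_uniq (limZ zeta lim)).
apply: (lim_ext (N := 0%N)) (elat_lim Sz zeta) => n _.
have [us _ _ E _] := fspace_L hz n n; rewrite -[EL _ _ _ _]/((Lbox (val z) n n).2 zeta) E.
congr (_ * _).
rewrite -(big_map (fun l : Lat' => val l) xpredT (fun v => 1 - c * zeta / v)) -[LHS]big_filter.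
rewrite (eq_bigr (fun v => 1 - c * zeta / (c * v))); last first.
  by move=> v _; rewrite -mulf_div divff // mul1r.
rewrite -(big_map ( *%R c) xpredT (fun v => 1 - c * zeta / v)).
apply: perm_big; apply: uniq_perm.
- rewrite map_inj_uniq ?filter_uniq //; exact: mulfI.
- rewrite map_inj_uniq ?fset_uniq //; exact: val_inj.
move=> v; apply/mapP/mapP => [[w]|[i iK ->]].
  rewrite mem_filter => /andP[w0 wb] ->.
  exists (exist _ (c * w) (scale_Lat wb w0)) => //.
  by rewrite mK; apply: map_f.
have /mapP[w wb e] : val i \in map ( *%R c) (Lbox (val z) n n).1 by rewrite -mK.
exists w; rewrite ?mem_filter ?wb ?andbT //; apply: contra_notN (set_mem (valP i)).2.
by move/eqP => w0; rewrite e w0 mulr0.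
Qed.

End Scale.

Lemma lat_mob g z : GL g -> forall a b : A, exists a' b' : A,
  inA a + inA b * val (mob g z) = (J g z)^-1 * (inA a' + inA b' * val z).
Proof.
move=> gG a b; exists (a * g 1 1 + b * g 0 1), (a * g 1 0 + b * g 0 0).
rewrite mobE //; have := J_neq0 z gG; rewrite !rmorphD !rmorphM /J.
move: (inA a) (inA b) (val z) (inA (g 0 0)) (inA (g 0 1)) (inA (g 1 0)) (inA (g 1 1)) => *.
by field.
Qed.

Lemma J_inv g z : GL g -> J (invmx g) (mob g z) = (J g z)^-1.
Proof.
move=> gG; have J0 := J_neq0 z gG.
by apply: (mulIf J0); rewrite mulVf // -J_cocycle ?mulVmx ?J1 //; exact: GL_inv.
Qed.

Lemma elat_mob g z zeta : GL g ->
  elat (val (mob g z)) zeta = (J g z)^-1 * elat (val z) (J g z * zeta).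
Proof.
move=> gG; have J0 := J_neq0 z gG.
have gV := GL_inv gG.
rewrite -(@elat_scale z (mob g z) (J g z)^-1) ?invr_eq0 //.
- by rewrite mulKf.
- exact: lat_mob.
move=> a b; have [a' [b']] := lat_mob (mob g z) gV a b.
rewrite mobK // J_inv // invrK => ->; exists a', b'.
by rewrite mulKf.
Qed.

Section Appr.
Variables N M : nat.
Local Notation S := (Sreg N M).
Local Notation K := (N + M)%N.

Lemma appr_EA n (f : Om -> C) : appr S f -> appr S (fun z => EA n (f z)).
Proof.
move=> hf; apply: (@appr_ext _ _ _ _ _ (fun z => f z * \prod_(a <- polys F n | a != 0) (1 - f z / inA a))).
  by move=> z _; rewrite EA_prod.
apply: apprM => //; apply: appr_prod => a _; apply: apprB; first exact: appr_cst.
by apply: apprM => //; exact: appr_cst.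
Qed.

Lemma Sreg_mul_ge (b a : A) z : S (val z) -> b != 0 ->
  q%:R ^- K * ab (inA b) <= ab (inA b * val z - inA a).
Proof.
move=> Sz b0; have := lat_lower (- a) b Sz; rewrite rmorphN addrC => h.
rewrite mulrC ler_pdivrMr ?qX_gt0 //; apply: le_trans h.
by rewrite le_max lexx orbT.
Qed.

Lemma EA_lower n (b : A) z : S (val z) -> b != 0 -> q%:R ^- K <= ab (EA n (inA b * val z)).
Proof.
move=> Sz b0; apply: EA_ge => a; apply: le_trans (Sreg_mul_ge a Sz b0).
by rewrite ler_peMr ?(ltW (qV_gt0 _ _ _)) // ab_inA_ge1.
Qed.

Lemma appr_EAV n (b : A) : b != 0 -> appr S (fun z => (EA n (inA b * val z))^-1).
Proof.
move=> b0; apply: (apprV (qV_gt0 F R K)) => [z Sz|]; first exact: EA_lower.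
apply: appr_EA; apply: apprM; [exact: appr_cst | exact: appr_val].
Qed.

Lemma appr_EL n (f : Om -> C) : appr S f -> appr S (fun z => EL (val z) n n (f z)).
Proof.
move=> hf; apply: (@appr_ext _ _ _ _ _ (fun z => EA n (f z) *
    \prod_(b <- polys F n | b != 0) (1 - EA n (f z) / EA n (inA b * val z)))).
  by move=> z Sz; rewrite (EL_EA (Sreg_lin Sz)).
have hE := appr_EA n hf; apply: apprM => //; apply: appr_prod => b b0.
apply: apprB; first exact: appr_cst.
by apply: apprM => //; exact: appr_EAV.
Qed.

(** On an affinoid the box products converge uniformly once f is bounded, and each is a rational
    expression whose denominators are bounded below by [EA_lower]. *)
Lemma appr_elat (f : Om -> C) : appr S f -> appr S (fun z => elat (val z) (f z)).
Proof.
move=> hf; have [B B0 hB] := appr_bounded hf.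
have [k0 hk0] := qpow_large F (B * q%:R ^+ K).
have [D D0 hD] := appr_bounded (appr_EL k0 hf).
apply: appr_lim => e e0.
have [k1 hk1] := qpow_small F (divr_gt0 e0 (mulr_gt0 D0 (mulr_gt0 B0 (qX_gt0 F R K)))).
pose k := maxn k0 k1; exists (fun z => EL (val z) k k (f z)); split; first exact: appr_EL.
move=> z Sz; have fB : ab (f z) * q%:R ^+ K <= B * q%:R ^+ K.
  by rewrite ler_wpM2r ?(ltW (qX_gt0 _ _ _)) // hB.
have lt m : (k0 <= m)%N -> ab (f z) * q%:R ^+ K < q%:R ^+ m.
  by move=> km; apply: le_lt_trans fB (lt_le_trans hk0 (qX_le _ _ km)).
apply: le_lt_trans (elat_near Sz (leqnn k) (leqnn k) (lt _ (leq_maxl _ _))) _.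
rewrite -(elat_ab Sz (leqnn k) (leqnn k) (lt _ (leq_maxl _ _))).
rewrite (elat_ab Sz (leqnn k0) (leqnn k0) (lt _ (leqnn _))).
apply: (@le_lt_trans _ _ (D * (B * q%:R ^+ K) * q%:R ^- k1)).
  rewrite mulrA; apply: ler_pM; rewrite ?mulr_ge0 ?abs_ge0 ?invr_ge0 ?exprn_ge0 ?(ltW (qR_gt0 F R)) //.
    by rewrite ler_pM ?mulr_ge0 ?abs_ge0 ?exprn_ge0 ?(ltW (qR_gt0 F R)) // hD.
  exact/qV_le/leq_maxr.
by rewrite mulrC -ltr_pdivlMr // mulr_gt0 // mulr_gt0 // qX_gt0.
Qed.

Lemma elat_ab_small z zeta : S (val z) -> ab zeta * q%:R ^+ K < 1 ->
  ab (elat (val z) zeta) = ab zeta.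
Proof.
by move=> Sz h; rewrite (elat_ab (k := 0%N) Sz (leqnn 0) (leqnn 0)) ?expr0.
Qed.

End Appr.

(** All factors have absolute value 1, that is |v - x| = |v| for nonzero lattice points v. If |v| <=
    |x| <= 1/q, then v involves z, so |v| and |v - x| are distances from a multiple b z to
    K_infinity, both at least 1/q. *)
Lemma elat_ab_far N z x : Sreg N 1 (val z) -> Kinf x -> ab x <= q%:R^-1 ->
  ab (elat (val z) x) = ab x.
Proof.
move=> Sz xK x1; have [k hk] := qpow_large F (ab x * q%:R ^+ (N + 1)).
rewrite (elat_ab Sz (leqnn k) (leqnn k) hk).
have [_ _ _ E _] := fspace_L (Sreg_lin Sz) k k.
rewrite -[EL _ _ _ _]/((Lbox (val z) k k).2 x) E absM ab_prod big_seq_cond big1 ?mulr1 //.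
move=> v /andP[/mem_Lbox[a [b [_ _ ev]]] v0].
have -> : ab (1 - x / v) = ab (v - x) / ab v by rewrite -abf_div; congr ab; field.
have vn : ab v != 0 by rewrite ab_eq0.
suff -> : ab (v - x) = ab v by rewrite mulfV.
have [h|h] := ltP (ab x) (ab v); first exact: abB_l.
have b0 : b != 0.
  apply: contraTneq h => b0; rewrite ev b0 rmorph0 mul0r addr0 -ltNge.
  apply: le_lt_trans x1 _; apply: (@lt_le_trans _ _ 1); first by rewrite invf_lt1 ?qR_gt0 // qR_gt1.
  by apply: ab_inA_ge1; apply: contra v0 => /eqP a0; rewrite ev a0 b0 rmorph0 mul0r addr0.
have ge y : Kinf y -> q%:R^-1 <= ab (inA b * val z - y).
  move=> yK; have bn : inA b != 0 by rewrite inA_eq0.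
  have -> : inA b * val z - y = inA b * (val z - y / inA b) by field.
  have [_ /(_ (y / inA b))] := Sz; rewrite expr1 => hz.
  rewrite absM -[leLHS]mul1r; apply: ler_pM; rewrite ?invr_ge0 ?ab_inA_ge1 ?(ltW (qR_gt0 F R)) //.
  by apply: hz; apply: KinfM => //; apply: KinfV; exact: Kinf_inA.
have e1 : v - x = inA b * val z - (x - inA a) by rewrite ev; ring.
have e2 : v = inA b * val z - (- inA a) by rewrite ev; ring.
have g1 : q%:R^-1 <= ab (v - x) by rewrite e1; apply: ge; apply: KinfB => //; exact: Kinf_inA.
have g2 : q%:R^-1 <= ab v by rewrite {1}e2; apply: ge; rewrite -rmorphN; exact: Kinf_inA.
apply/eqP; rewrite eq_le; apply/andP; split.
  by apply: abB_le => //; exact: le_trans x1 g2.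
by apply: le_trans h (le_trans x1 g1).
Qed.

End LatticeFunctions.

(** * The u-expansion of e_z *)

Section Expansion.
Variables (F : finFieldType) (R : realType) (C : cinf F R).
Local Notation ab := (@absC F R C).
Local Notation q := (#|F|).
Local Notation A := {poly F}.
Local Notation inA := (@embA F R C).
Local Notation Om := (Omega C).
Local Notation eA := (@eA F R C).
Local Notation "a ~> l" := (cvg_to ab a l) (at level 70).

Lemma bnd_prod_near1 (I : eqType) (s : seq I) (P : pred I) (x : I -> fps C) (e r : R) : 0 <= r -> 0 <= e -> e <= 1 ->
  (forall i, i \in s -> P i -> bnd e r (x i)) -> bnd e r (\prod_(i <- s | P i) (1 - x i) - 1).
Proof.
move=> r0 e0 e1 h; rewrite big_seq_cond.
elim/big_rec: _ => [|i y /andP[si Pi] IH]; first by rewrite subrr; exact: bnd0.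
have -> : (1 - x i) * y - 1 = (y - 1) - (x i * (y - 1) + x i) by ring.
apply: bndB => //; apply: bndD; last exact: h.
apply: (bnd_leM r0) (bndM e0 e0 r0 (h i si Pi) IH).
by rewrite -[leRHS]mulr1 ler_wpM2l.
Qed.

Lemma leq_qexp n : (n.*2 <= q ^ n)%N.
Proof.
case: n => // n; rewrite expnS -muln2 mulnC; apply: leq_mul; first exact: card_F_gt1.
by rewrite ltn_expl // card_F_gt1.
Qed.

Variable pi : C.
Hypothesis hpi : carlitz_period pi.
Local Notation u := (@u F R C pi).

Lemma eA_Om (b : A) (z : Om) : b != 0 -> eA (inA b * val z) != 0.
Proof.
move=> b0; apply/eqP => /eA_eq0[a e]; have := @lin_neq0 _ _ _ b (- a) z.
rewrite rmorphN -e subrr eqxx => h; suff : false by []; apply: h.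
by rewrite xpair_eqE (negbTE b0).
Qed.

Lemma eA_Om1 (z : Om) : eA (val z) != 0.
Proof. by rewrite -[val z]mul1r -(rmorph1 inA); apply: eA_Om; exact: oner_neq0. Qed.

(** H is the product over b != 0 of 1 - pi e_A(zeta) u(b z), each u(b z) being a series in u by
    [u_poly]. The inverse radius q B depends on zeta only through the bound B. *)
Lemma elat_expansion (B : R) zeta : 1 <= B -> ab (pi * eA zeta) <= B ->
  exists H : fps C, [/\ bnd 1 (q%:R * B) H, coef H 0 = 1 &
    forall z : Om, ab (u (val z)) * (q%:R * B) < 1 ->
      elat (val z) zeta = eA zeta * fps_eval H (u (val z))].
Proof.
move=> B1 hB; have [U hU] := u_poly hpi.
have q0 := qR_gt0 F R; have q1 := qR_gt1 F R; have B0 : 0 < B by apply: lt_le_trans B1.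
set r := q%:R * B; have qr : q%:R <= r by rewrite ler_peMr // ltW.
have r0 : 0 <= r by apply: le_trans qr; exact: ltW.
pose X (b : A) := if b == 0 then 0 else fps_const (pi * eA zeta) * U b.
have hX (b : A) : b != 0 -> bnd (B / q%:R ^+ (q ^ (size b).-1)) r (X b).
  move=> b0; have [h _ _] := hU b b0; rewrite /X (negbTE b0).
  apply: bnd_le (ltW q0) _ _ qr (bndM (abs_ge0 _) _ (ltW q0) (bnd_const _ (ltW q0)) h).
  - by rewrite mulr_ge0 ?abs_ge0 // invr_ge0 exprn_ge0 // ltW.
  - by rewrite ler_wpM2r // invr_ge0 exprn_ge0 // ltW.
  - by rewrite invr_ge0 exprn_ge0 // ltW.
have hX0 (b : A) : b != 0 -> coef (X b) 0 = 0.
  by move=> b0; have [_ h _] := hU b b0; rewrite /X (negbTE b0) coef_constM h mulr0.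
have hX1 (b : A) : b != 0 -> bnd 1 r (1 - X b).
  move=> b0; apply: bndB; first exact: bnd1.
  case=> [|n]; first by rewrite hX0 // ab0 mulr1.
  have [h _ _] := hU b b0; rewrite /X (negbTE b0) coef_constM absM mul1r.
  apply: (@le_trans _ _ (B * q%:R ^+ n.+1)).
    apply: ler_pM; rewrite ?abs_ge0 //; apply: le_trans (h n.+1) _.
    by rewrite ler_piMl ?exprn_ge0 ?(ltW q0) // qV_le1.
  rewrite /r exprMn mulrC ler_wpM2l ?exprn_ge0 ?(ltW q0) //.
  by rewrite -[leLHS]expr1; apply: ler_weXn2l.
pose G n := \prod_(b <- polys F n | b != 0) (1 - X b).
have bG n : bnd 1 r (G n) by apply: bnd_prod.
have cG n := cvf_bnd (bG n).
have sub n : {subset polys F n <= polys F n.+1}.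
  by move=> a; rewrite !mem_polys => h; rewrite (leq_trans h).
have GS n : G n.+1 - G n = G n * (\prod_(b <- polys F n.+1 | b \notin polys F n) (1 - X b) - 1).
  rewrite mulrBr mulr1; congr (_ - _); rewrite /G.
  rewrite (bigID (fun b => b \in polys F n)); congr (_ * _).
    rewrite -big_filter -[RHS]big_filter; apply: perm_big; apply: uniq_perm => [||b]; [by rewrite filter_uniq // polys_uniq | by rewrite filter_uniq // polys_uniq |].
    rewrite !mem_filter; apply/idP/idP => [/andP[/andP[-> ->] _] //|/andP[-> h]].
    by rewrite h sub.
  apply: eq_bigl => b; have [h|h] := boolP (b \in polys F n); rewrite ?andbF // andbT.
  by apply: contraNneq h => ->; rewrite mem_polys size_poly0.
have tail n (e : R) : B / q%:R ^+ (q ^ n) <= e -> e <= 1 -> bnd e r (G n.+1 - G n).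
  move=> he e1; have e0 : 0 <= e.
    by apply: le_trans he; rewrite divr_ge0 ?(ltW B0) // exprn_ge0 // ltW.
  rewrite GS -[e]mul1r; apply: bndM => //; apply: bnd_prod_near1 => // b.
  rewrite !mem_polys -ltnNge => sb nb; apply: bnd_leM he _ => //.
  have b0 : b != 0 by rewrite -size_poly_gt0 (leq_trans _ nb).
  have := hX b b0; suff -> : (size b).-1 = n by [].
  by apply/eqP; rewrite eqn_leq -ltnS prednK ?sb ?size_poly_gt0 //=; move: nb; case: (size b).
have small (e : R) : 0 < e -> exists n0, forall n, (n0 <= n)%N -> B / q%:R ^+ (q ^ n) <= e.
  move=> e0; have [n0 h] := qpow_small F (divr_gt0 e0 B0); exists n0 => n nn.
  rewrite mulrC -ler_pdivlMr //; apply: le_trans (ltW h); apply: qV_le.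
  by rewrite (leq_trans nn) // ltnW // ltn_expl // card_F_gt1.
have [||n|H cH hH] := fps_lim (G := G) r0.
- exact: cG.
- move=> e e0; have [|n0 h] := small (Num.min e 1); first by rewrite lt_min e0 ltr01.
  exists n0 => n nn; apply: (@bnd_leM _ _ _ (Num.min e 1)) => //; first by rewrite ge_min lexx.
  by apply: tail; [exact: h | rewrite ge_min lexx orbT].
- by apply: cvfD => //; apply: cvfN.
exists H; split.
- have [n0 h] := hH 1 ltr01; rewrite -(subrK (G n0) H); apply: bndD => //; exact: h.
- apply/eqP; rewrite -subr_eq0; apply/eqP/ab_le_eps => e e0; have [n0 /(_ n0 (leqnn _)) /(_ 0%N)] := hH e e0.
  rewrite expr0 mulr1 fcoefB; suff -> : coef (G n0) 0 = 1 by [].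
  rewrite /G; elim/big_rec: _ => [|b y b0 IH]; first by rewrite -(rmorph1 (@fps_const C)) coef_const.
  by rewrite fcoefM0 fcoefB hX0 // IH subr0 mulr1 -(rmorph1 (@fps_const C)) coef_const.
move=> z zr; have L := limZ (eA zeta) (fps_lim_eval r0 zr cG cH hH).
have [N [M Sz]] := Sreg_ex z.
have [n1 hn1] := qpow_large F (ab zeta * q%:R ^+ (N + M)).
apply/eqP; rewrite -subr_eq0; apply/eqP/ab_le_eps => e e0.
have D0 : 0 < 1 + ab (elat (val z) zeta) * (ab zeta * q%:R ^+ (N + M)).
  by rewrite ltr_wpDr // !mulr_ge0 ?abs_ge0 // exprn_ge0 // ltW.
have [n2 hn2] := qpow_small F (divr_gt0 e0 D0).
rewrite -abN opprB; apply: (lim_near_le (N := maxn n1 n2)) L => n; rewrite geq_max => /andP[n1n n2n].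
have uq : ab (u (val z)) * q%:R < 1.
  by apply: le_lt_trans zr; rewrite ler_wpM2l ?abs_ge0.
have -> : fps_eval (G n) (u (val z)) =
    \prod_(b <- polys F n | b != 0) (1 - eA zeta / eA (inA b * val z)).
  have cX b : cvf r (1 - X b).
    have [->|b0] := eqVneq b 0; last exact: cvf_bnd (hX1 b b0).
    by rewrite /X eqxx subr0; exact: cvf1.
  rewrite /G -big_filter (eval_prod _ r0 zr cX).1 -[RHS]big_filter.
  rewrite !big_seq; apply: eq_bigr => b; rewrite mem_filter => /andP[b0 _].
  have [h _ hu] := hU b b0; have cU := cvf_le (ltW q0) qr (cvf_bnd h).
  rewrite /X (negbTE b0) (evalB r0 zr (cvf1 C r0)); last by apply: cvfM => //; exact: cvf_const.
  rewrite (evalM r0 zr (cvf_const _ r0) cU) eval1 eval_const -hu ?eA_Om1 // (uE hpi).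
  by congr (_ - _); rewrite -mulf_div divff ?mul1r // (pi_neq0 hpi).
rewrite -abN opprB; apply: le_trans (elat_eA Sz _) _.
  exact: lt_le_trans hn1 (qX_le _ _ n1n).
rewrite mulrA; apply: (@le_trans _ _ ((1 + ab (elat (val z) zeta) * (ab zeta * q%:R ^+ (N + M))) * q%:R ^- n2)).
  apply: ler_pM; rewrite ?mulr_ge0 ?abs_ge0 ?invr_ge0 ?exprn_ge0 ?(ltW q0) //.
    by rewrite ler_wpDl.
  exact: qV_le.
by rewrite mulrC -ler_pdivlMr // ltW.
Qed.
End Expansion.

Opaque elat.

(** * The substitution of t for theta *)

Section Bar.
Variables (F : finFieldType) (R : realType) (C : cinf F R).
Local Notation inA := (@embA F R C).
Local Notation bar := (@bar F R C).

Lemma barD a b : bar (a + b) = bar a + bar b. Proof. by rewrite /bar !rmorphD. Qed.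
Lemma barN a : bar (- a) = - bar a. Proof. by rewrite /bar !rmorphN. Qed.
Lemma barM a b : bar (a * b) = bar a * bar b. Proof. by rewrite /bar !rmorphM. Qed.
Lemma barX a n : bar (a ^+ n) = bar a ^+ n. Proof. by rewrite /bar !rmorphXn. Qed.
Lemma bar0 : bar 0 = 0. Proof. by rewrite /bar !rmorph0. Qed.
Lemma bar1 : bar 1 = 1. Proof. by rewrite /bar !rmorph1. Qed.
Lemma bar_C (c : F) : bar c%:P = fps_const (inA c%:P).
Proof. by rewrite /bar map_polyC. Qed.
Lemma bar_X : bar 'X = fX C.
Proof. by rewrite /bar map_polyX. Qed.
End Bar.

(** * Transformation laws of s_1, s_2, g and Delta *)

Section Laws.
Variables (F : finFieldType) (R : realType) (C : cinf F R).
Local Notation ab := (@absC F R C).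
Local Notation q := (#|F|).
Local Notation A := {poly F}.
Local Notation inA := (@embA F R C).
Local Notation theta := (@theta F R C).
Local Notation Kinf := (@Kinf F R C).
Local Notation Om := (Omega C).
Local Notation Sreg := (@Sreg F R C).
Local Notation bar := (@bar F R C).
Local Notation s1 := (@s1 F R C).
Local Notation s2 := (@s2 F R C).
Local Notation EA := (@EA F R C).
Local Notation twist := (@twist F R C).
Local Notation GL := (@GL2A F).
Local Notation "c '%:K'" := (inA c%:P) (at level 2, format "c '%:K'").
Local Notation "a ~> l" := (cvg_to ab a l) (at level 70).
Implicit Types (z : Om).

(** The Anderson generating function of x, with s_1 and s_2 as the cases x = z and x = 1. *)
Definition lser z x : fps C := Fps (fun i => elat (val z) (x / theta ^+ i.+1)).

Lemma lser_D z x y : lser z (x + y) = lser z x + lser z y.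
Proof. by apply: fpsP => i; rewrite fcoefD -Om_elat_D -mulrDl. Qed.

(** For x in the lattice the term e_z(x) pushed out by the shift vanishes, so multiplication by t
    amounts to x -> theta x. Thus a(t) acts on these series as a(theta) acts on periods
    ([lser_bar]). *)
Lemma lser_X z (a b : A) : fX C * lser z (inA a + inA b * val z) =
  lser z (theta * (inA a + inA b * val z)).
Proof.
apply: fpsP => -[|i]; rewrite -[fX C]expr1 coefXnM //=.
  rewrite expr1 mulrC mulKf ?theta_neq0 //.
  by apply/esym/Om_elat_eq0; exists a, b.
rewrite subn1 /=; congr elat; rewrite [theta ^+ i.+2]exprS invfM mulrACA divff ?mul1r //.
exact: theta_neq0.
Qed.

Lemma lser_bar z (c a b : A) : bar c * lser z (inA a + inA b * val z) =
  lser z (inA c * (inA a + inA b * val z)).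
Proof.
elim/poly_ind: c a b => [|p c IH] a b.
  rewrite bar0 rmorph0 !mul0r; apply: fpsP => i; rewrite fcoef0 /= mul0r.
  by apply/esym/Om_elat_eq0; exists 0, 0; rewrite !rmorph0 mul0r addr0.
rewrite barD barM bar_X bar_C rmorphD rmorphM -[inA 'X]/theta !mulrDl (lser_D z (inA p * theta * _)); congr (_ + _).
  rewrite -mulrA lser_X -mulrA.
  have -> : theta * (inA a + inA b * val z) = inA ('X * a) + inA ('X * b) * val z.
    by rewrite !rmorphM -[inA 'X]/theta; ring.
  exact: IH.
by apply: fpsP => i; rewrite coef_constM /= -(mulrA c%:K) Om_elat_Z.
Qed.

Lemma s1E z : s1 z = lser z (val z). Proof. by []. Qed.
Lemma s2E z : s2 z = lser z 1. Proof. by []. Qed.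

Lemma lser_lin z (a b : A) : bar a * s1 z + bar b * s2 z = lser z (inA a * val z + inA b).
Proof.
have := lser_bar z a 0 1; have := lser_bar z b 1 0.
rewrite rmorph0 rmorph1 !mul0r !addr0 add0r !mul1r mulr1 -s1E -s2E => -> ->.
by rewrite lser_D.
Qed.

Lemma lser_mob g z x : GL g -> lser (mob g z) x = fps_const (J g z)^-1 * lser z (J g z * x).
Proof.
by move=> gG; apply: fpsP => i; rewrite coef_constM /= elat_mob // (mulrA (J g z)).
Qed.

Lemma s1_mob g z : GL g -> s1 (mob g z) =
  fps_const (J g z)^-1 * (bar (g 0 0) * s1 z + bar (g 0 1) * s2 z).
Proof.
move=> gG; rewrite s1E lser_mob // lser_lin mobE // mulrCA divff ?mulr1 //.
exact: J_neq0.
Qed.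

Lemma s2_mob_lin g z : GL g -> s2 (mob g z) =
  fps_const (J g z)^-1 * (bar (g 1 0) * s1 z + bar (g 1 1) * s2 z).
Proof. by move=> gG; rewrite s2E lser_mob // lser_lin mulr1. Qed.

Lemma s2_coef0 z : coef (s2 z) 0 != 0.
Proof.
rewrite /= expr1 div1r; apply: elat_Kinf_neq0; rewrite ?invr_eq0 ?theta_neq0 //.
  by apply: KinfV; exact: Kinf_inA.
by rewrite abV ab_theta invf_lt1 ?qR_gt0 // qR_gt1.
Qed.

Lemma s2_unit z : s2 z \is a GRing.unit.
Proof. by rewrite fps_unitE s2_coef0. Qed.

Lemma bJE g z : bJ g z * s2 z = bar (g 1 0) * s1 z + bar (g 1 1) * s2 z.
Proof. by rewrite /bJ mulrDl -mulrA divrK ?s2_unit. Qed.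

Lemma s2_mob g z : GL g -> s2 (mob g z) = fps_const (J g z)^-1 * (bJ g z * s2 z).
Proof. by move=> gG; rewrite bJE s2_mob_lin. Qed.

Lemma bJ_unit g z : GL g -> bJ g z \is a GRing.unit.
Proof.
move=> gG; have := s2_unit (mob g z); rewrite s2_mob // !unitrM.
by case/and3P.
Qed.

Lemma J_unit g z : GL g -> fps_const (J g z) \is a GRing.unit.
Proof. by move=> gG; rewrite fps_const_unit // J_neq0. Qed.

Lemma bJ_cocycle g d z : GL g -> GL d -> bJ (g *m d) z = bJ g (mob d z) * bJ d z.
Proof.
move=> gG dG; have h := s2_mob z (GL_mul gG dG).
rewrite mob_mul // s2_mob // s2_mob // J_cocycle // invfM rmorphM in h.
have U : fps_const (J g (mob d z))^-1 * fps_const (J d z)^-1 \is a GRing.unit.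
  by rewrite unitrM !fps_constV !unitrV !J_unit.
apply: (mulIr (s2_unit z)); apply: (mulrI U); rewrite -h; ring.
Qed.

Lemma ab_wron x y : x != 0 -> ab (x * y ^+ q - x ^+ q * y) =
  ab x ^+ q * ab y * \prod_(c : F | c != 0) (ab (y - c%:K * x) / ab x).
Proof.
move=> x0; have -> : x * y ^+ q - x ^+ q * y = - (x ^+ q * y * (1 - (y / x) ^+ q.-1)).
  have e (k : C) : k ^+ q = k * k ^+ q.-1 by rewrite -exprS prednK ?qpos.
  have xn : x ^+ q.-1 != 0 by rewrite expf_neq0.
  rewrite expr_div_n !e; move: (x ^+ q.-1) (y ^+ q.-1) xn => xq yq xn; by field.
rewrite abN -prod_units !absM ab_prod abX; congr (_ * _).
apply: eq_bigr => c c0; rewrite -abf_div.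
have cn : c%:K != 0 by rewrite inA_eq0 polyC_eq0.
have -> : 1 - y / x / c%:K = - ((y - c%:K * x) / x) / c%:K by field; rewrite cn x0.
by rewrite (absM (- ((y - c%:K * x) / x))) abN abV ab_const // invr1 mulr1.
Qed.

Lemma wron_neq0 x y : x != 0 -> (forall c : F, y != c%:K * x) -> x * y ^+ q - x ^+ q * y != 0.
Proof.
move=> x0 h; have y0 : y != 0 by have := h 0; rewrite polyC0 rmorph0 mul0r.
rewrite -ab_eq0 ab_wron // !mulf_neq0 ?expf_neq0 ?ab_eq0 //.
by apply/prodf_neq0 => c _; apply: mulf_neq0; rewrite ?invr_eq0 ab_eq0 // subr_eq0.
Qed.

Local Notation x1 z := (elat (val z) theta^-1).
Local Notation x2 z := (elat (val z) (theta ^- 2)).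
Local Notation zeta c := (theta ^- 2 - c%:K * theta^-1).

Lemma zetaP (c : F) : [/\ Kinf (zeta c), zeta c != 0 & ab (zeta c) <= q%:R^-1].
Proof.
have tK : Kinf theta by exact: Kinf_inA.
have aV : ab theta^-1 = q%:R^-1 by rewrite abV ab_theta.
have a2 : ab (theta ^- 2) < q%:R^-1.
  by rewrite abV ab_thetaX ltf_pV2 ?posrE ?qX_gt0 ?qR_gt0 // expr2 ltr_pMl ?qR_gt0 // qR_gt1.
split; first by apply: KinfB; [apply/KinfV/KinfX | apply: KinfM; [exact: Kinf_inA | exact: KinfV]].
  have [->|c0] := eqVneq c 0; first by rewrite polyC0 rmorph0 mul0r subr0 invr_eq0 thetaX_neq0.
  rewrite -ab_gt0 abB_r; first by rewrite absM ab_const // mul1r ab_gt0 invr_eq0 theta_neq0.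
  by rewrite absM ab_const // mul1r aV.
apply: abB_le; first exact: ltW.
rewrite absM aV -[leRHS]mul1r; apply: ler_wpM2r; rewrite ?ab_const_le1 //.
by rewrite invr_ge0 ltW // qR_gt0.
Qed.

Lemma zeta_lt1 (x : C) : ab x <= q%:R^-1 -> ab x < 1.
Proof. by move/le_lt_trans; apply; rewrite invf_lt1 ?qR_gt0 // qR_gt1. Qed.

Lemma x1_neq0 z : x1 z != 0.
Proof.
apply: elat_Kinf_neq0; rewrite ?invr_eq0 ?theta_neq0 //; first by apply: KinfV; exact: Kinf_inA.
by apply: zeta_lt1; rewrite abV ab_theta.
Qed.

Lemma x2B z (c : F) : elat (val z) (zeta c) = x2 z - c%:K * x1 z.
Proof.
by rewrite Om_elat_D -mulNr -rmorphN -polyCN Om_elat_Z polyCN rmorphN mulNr.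
Qed.

(** The Moore determinant of e_z(1/theta) and e_z(1/theta^2). Its q-th power is the determinant of
    the linear system for g and Delta obtained from Phi_z(theta) at these two points ([G_wr],
    [D_wr]). *)
Definition wr z := x1 z * x2 z ^+ q - x1 z ^+ q * x2 z.

Lemma wr_neq0 z : wr z != 0.
Proof.
apply: wron_neq0 => [|c]; first exact: x1_neq0.
rewrite -subr_eq0 -x2B; have [h1 h2 h3] := zetaP c.
by apply: elat_Kinf_neq0 => //; exact: zeta_lt1.
Qed.

(** Each factor of the finite product is a quotient of values at b z - x and b z, and the former is
    bounded below since b z keeps its distance from K_infinity. *)
Lemma elat_lower N M x : Kinf x -> x != 0 -> ab x < 1 ->
  exists2 d : R, 0 < d & forall z, Sreg N M (val z) -> d <= ab (elat (val z) x).
Proof.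
move=> xK x0 x1; have q0 := qR_gt0 F R.
have [k hk] := qpow_large F (ab x * q%:R ^+ (N + M)).
have EK : 0 < ab (EA k x).
  rewrite (lt_le_trans (y := ab x)) ?ab_gt0 //; apply: EA_ge => a.
  have [->|a0] := eqVneq a 0; first by rewrite rmorph0 subr0.
  by rewrite abB_r; [apply: ltW; apply: lt_le_trans x1 _; exact: ab_inA_ge1 | apply: lt_le_trans x1 _; exact: ab_inA_ge1].
have hB (b : A) : exists D : R, 0 < D /\ forall z, Sreg N M (val z) -> ab (EA k (inA b * val z)) <= D.
  have [|D D0 h] := @appr_bounded _ _ _ N M (fun z => EA k (inA b * val z)); last by exists D.
  by apply: appr_EA; apply: apprM; [exact: appr_cst | exact: appr_val].
have [D hD] := choice hB.
exists (ab (EA k x) * \prod_(b <- polys F k | b != 0) (q%:R ^- (N + M) / D b)).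
  rewrite mulr_gt0 //; apply: prodr_gt0 => b _; rewrite divr_gt0 ?qV_gt0 //.
  by case: (hD b).
move=> z Sz; rewrite (elat_ab Sz (leqnn k) (leqnn k) hk) (EL_EA (Sreg_lin Sz)) absM.
rewrite ler_wpM2l ?abs_ge0 // ab_prod; apply: ler_prod => b b0; have [D0 /(_ z Sz) hz] := hD b.
have El := EA_lower k Sz b0; have E0 : 0 < ab (EA k (inA b * val z)) by exact: lt_le_trans (qV_gt0 _ _ _) El.
rewrite divr_ge0 ?(ltW D0) ?(ltW (qV_gt0 _ _ _)) //=.
have -> : ab (1 - EA k x / EA k (inA b * val z)) = ab (EA k (inA b * val z - x)) / ab (EA k (inA b * val z)).
  rewrite -abf_div EA_D EA_N; congr ab; field.
  by rewrite -ab_gt0.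
apply: ler_pM; rewrite ?(ltW (qV_gt0 _ _ _)) ?invr_ge0 ?(ltW D0) //; last by rewrite lef_pV2 ?posrE.
apply: EA_ge => a; have bn : inA b != 0 by rewrite inA_eq0.
have -> : inA b * val z - x - inA a = inA b * (val z - (x + inA a) / inA b) by field.
have [_ hS] := Sz; rewrite absM -[leLHS]mul1r; apply: ler_pM; rewrite ?(ltW (qV_gt0 _ _ _)) ?ab_inA_ge1 //.
by apply: le_trans (hS _ _); [apply: qV_le; rewrite leq_addl | apply: KinfM; [apply: KinfD => //; exact: Kinf_inA | apply: KinfV; exact: Kinf_inA]].
Qed.

Lemma wr_lower N M : exists2 d : R, 0 < d & forall z, Sreg N M (val z) -> d <= ab (wr z).
Proof.
have tK : Kinf theta by exact: Kinf_inA.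
have [|||d1 d10 h1] := @elat_lower N M theta^-1; first exact: KinfV.
- by rewrite invr_eq0 theta_neq0.
- by apply: zeta_lt1; rewrite abV ab_theta.
have hc' (c : F) : exists d : R, 0 < d /\ forall z, Sreg N M (val z) -> d <= ab (elat (val z) (zeta c)).
  by have [k1 k2 k3] := zetaP c; have [//|//||d d0 h] := @elat_lower N M (zeta c); [exact: zeta_lt1 | exists d].
have [d hd] := choice hc'.
have [B B0 hB] := appr_bounded (appr_elat (appr_cst N M theta^-1)).
exists (d1 ^+ q * d 0 * \prod_(c : F | c != 0) (d c / B)).
  rewrite !mulr_gt0 ?exprn_gt0 //; first by case: (hd 0).
  by apply: prodr_gt0 => c _; rewrite divr_gt0 //; case: (hd c).
move=> z Sz; rewrite ab_wron ?x1_neq0 //.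
have d0p c : 0 <= d c by apply: ltW; case: (hd c).
apply: ler_pM.
- by rewrite !mulr_ge0 ?exprn_ge0 // ltW.
- by apply: prodr_ge0 => c _; rewrite divr_ge0 // ltW.
- apply: ler_pM; rewrite ?exprn_ge0 ?(ltW d10) //.
    by rewrite lerXn2r ?nnegrE ?abs_ge0 ?(ltW d10) // h1.
  by have [_ /(_ z Sz)] := hd 0; rewrite x2B polyC0 rmorph0 mul0r subr0.
apply: ler_prod => c c0; rewrite divr_ge0 ?(ltW B0) //=.
have [_ /(_ z Sz)] := hd c; rewrite x2B => hc.
apply: ler_pM => //; first by rewrite invr_ge0 ltW.
by rewrite lef_pV2 ?posrE ?ab_gt0 ?x1_neq0 // hB.
Qed.

Variable pi : C.
Hypothesis hpi : carlitz_period pi.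
Variables g Delta : Om -> C.
Hypothesis hgD : drinfeld_module_coeffs pi g Delta.
Local Notation G z := (pi ^+ q.-1 * g z).
Local Notation D z := (pi ^+ (q ^ 2).-1 * Delta z).

Lemma gD_eq z zeta : elat (val z) (theta * zeta) = theta * elat (val z) zeta +
  G z * elat (val z) zeta ^+ q + D z * (elat (val z) zeta ^+ q) ^+ q.
Proof. by rewrite hgD -exprM mulnn. Qed.

Lemma gD_x1 z : theta * x1 z + G z * x1 z ^+ q + D z * (x1 z ^+ q) ^+ q = 0.
Proof.
rewrite -gD_eq mulfV ?theta_neq0 //; apply/Om_elat_eq0.
by exists 1, 0; rewrite rmorph1 rmorph0 mul0r addr0.
Qed.

Lemma gD_x2 z : theta * x2 z + G z * x2 z ^+ q + D z * (x2 z ^+ q) ^+ q = x1 z.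
Proof.
by rewrite -gD_eq; congr elat; field; exact: theta_neq0.
Qed.

Lemma frob_wr (x y : C) : (x * y ^+ q - x ^+ q * y) ^+ q =
  x ^+ q * (y ^+ q) ^+ q - (x ^+ q) ^+ q * y ^+ q.
Proof. by have := frobB 1 (x * y ^+ q) (x ^+ q * y); rewrite expn1 !exprMn. Qed.

Lemma wrX z : wr z ^+ q = x1 z ^+ q * (x2 z ^+ q) ^+ q - (x1 z ^+ q) ^+ q * x2 z ^+ q.
Proof. exact: frob_wr. Qed.

Lemma G_wr z : G z = (- (theta * x1 z * (x2 z ^+ q) ^+ q) -
  (x1 z - theta * x2 z) * (x1 z ^+ q) ^+ q) / wr z ^+ q.
Proof.
apply: (canRL (mulfK _)); first by rewrite expf_neq0 // wr_neq0.
rewrite wrX -[in X in _ - (X - _) * _](gD_x2 z).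
have /eqP := gD_x1 z; rewrite -addrA addr_eq0 => /eqP ->; ring.
Qed.

Lemma D_wr z : D z = (theta * x1 z * x2 z ^+ q + (x1 z - theta * x2 z) * x1 z ^+ q) / wr z ^+ q.
Proof.
apply: (canRL (mulfK _)); first by rewrite expf_neq0 // wr_neq0.
rewrite wrX -[in X in _ + (X - _) * _](gD_x2 z).
have /eqP := gD_x1 z; rewrite -addrA addr_eq0 => /eqP ->; ring.
Qed.

Lemma gD_appr N M : appr (Sreg N M) g /\ appr (Sreg N M) Delta.
Proof.
have p0 k : pi ^+ k != 0 by rewrite expf_neq0 // (pi_neq0 hpi).
have a1 : appr (Sreg N M) (fun z => x1 z) by apply: appr_elat; exact: appr_cst.
have a2 : appr (Sreg N M) (fun z => x2 z) by apply: appr_elat; exact: appr_cst.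
have aw : appr (Sreg N M) wr.
  by apply: apprB; apply: apprM => //; exact: apprX.
have [d d0 hd] := wr_lower N M.
have awV : appr (Sreg N M) (fun z => (wr z ^+ q)^-1).
  apply: (apprV (exprn_gt0 q d0)) => [z Sz|]; last exact: apprX.
  by rewrite abX lerXn2r ?nnegrE ?abs_ge0 ?(ltW d0) // hd.
split.
  apply: (@appr_ext _ _ _ _ _ (fun z => (pi ^+ q.-1)^-1 * ((- (theta * x1 z * (x2 z ^+ q) ^+ q) -
    (x1 z - theta * x2 z) * (x1 z ^+ q) ^+ q) / wr z ^+ q))).
    by move=> z _; rewrite -G_wr mulKf.
  apply/appr_scale/apprM => //; apply: apprB; [apply: apprN|]; apply: apprM;
    by repeat first [exact: a1 | exact: a2 | apply: appr_scale | apply: apprX | apply: apprB].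
apply: (@appr_ext _ _ _ _ _ (fun z => (pi ^+ (q ^ 2).-1)^-1 * ((theta * x1 z * x2 z ^+ q + (x1 z - theta * x2 z) * x1 z ^+ q) / wr z ^+ q))).
  by move=> z _; rewrite -D_wr mulKf.
apply/appr_scale/apprM => //; apply: apprD; apply: apprM;
  by repeat first [exact: a1 | exact: a2 | apply: appr_scale | apply: apprX | apply: apprB].
Qed.

Lemma lin2 (a b y1 y2 : C) : y1 * y2 ^+ q - y1 ^+ q * y2 != 0 ->
  a * y1 ^+ q + b * (y1 ^+ q) ^+ q = 0 -> a * y2 ^+ q + b * (y2 ^+ q) ^+ q = 0 -> a = 0 /\ b = 0.
Proof.
move=> w0 h1 h2; have W : y1 ^+ q * (y2 ^+ q) ^+ q - (y1 ^+ q) ^+ q * y2 ^+ q != 0.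
  by rewrite -frob_wr expf_neq0.
split; apply: (mulIf W); rewrite mul0r.
  transitivity ((a * y1 ^+ q + b * (y1 ^+ q) ^+ q) * (y2 ^+ q) ^+ q -
    (a * y2 ^+ q + b * (y2 ^+ q) ^+ q) * (y1 ^+ q) ^+ q); first by ring.
  by rewrite h1 h2 !mul0r subr0.
transitivity ((a * y2 ^+ q + b * (y2 ^+ q) ^+ q) * y1 ^+ q -
    (a * y1 ^+ q + b * (y1 ^+ q) ^+ q) * y2 ^+ q); first by ring.
by rewrite h1 h2 !mul0r subr0.
Qed.

(** The exponential at the transformed point is a rescaled e_z, so the two Drinfeld modules are
    conjugate; [lin2] compares coefficients from their values at two points with nonzero Moore
    determinant. *)
Lemma gD_mob gam z : GL gam -> g (mob gam z) = J gam z ^+ q.-1 * g z /\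
  Delta (mob gam z) = J gam z ^+ (q ^ 2).-1 * Delta z.
Proof.
move=> gG; have J0 := J_neq0 z gG; have p0 k : pi ^+ k != 0 by rewrite expf_neq0 // (pi_neq0 hpi).
set j := J gam z in J0 *; set z' := mob gam z.
have q2 : (0 < q ^ 2)%N by rewrite expn_gt0 qpos.
pose a := G z' / j ^+ q - j^-1 * G z; pose b := D z' / (j ^+ q) ^+ q - j^-1 * D z.
have key x : a * elat (val z) x ^+ q + b * (elat (val z) x ^+ q) ^+ q = 0.
  have := gD_eq z' (x / j); rewrite !elat_mob // -/j.
  have -> : j * (theta * (x / j)) = theta * x by field.
  have -> : j * (x / j) = x by field.
  rewrite (gD_eq z x) /a /b; move: (elat (val z) x) (G z') (G z) (D z') (D z) => y G1 G0 D1 D0 h.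
  rewrite !exprMn !exprVn in h.
  transitivity (theta * (j^-1 * y) + G1 * ((j ^+ q)^-1 * y ^+ q) +
      D1 * (((j ^+ q) ^+ q)^-1 * (y ^+ q) ^+ q) - j^-1 * (theta * y + G0 * y ^+ q + D0 * (y ^+ q) ^+ q)).
    by ring.
  by rewrite -h subrr.
have [] := lin2 (wr_neq0 z) (key _) (key _).
move=> /eqP; rewrite subr_eq0 => /eqP ha /eqP; rewrite subr_eq0 => /eqP hb; split.
  apply: (mulfI (p0 q.-1)); rewrite -[LHS](divfK (expf_neq0 q J0)) ha.
  have e : j ^+ q = j * j ^+ q.-1 by rewrite -exprS prednK ?qpos.
  by rewrite e; field.
apply: (mulfI (p0 (q ^ 2).-1)); rewrite -[LHS](divfK (expf_neq0 q (expf_neq0 q J0))) hb.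
have e : j ^+ (q ^ 2) = j * j ^+ (q ^ 2).-1 by rewrite -exprS prednK.
by rewrite -exprM mulnn e; field.
Qed.

(** If Delta z = 0, the torsion points e_z(1/theta) and e_z(z/theta) are both zeros of theta X + G
    X^q, so their Moore determinant vanishes, although they are independent over F. *)
Lemma Delta_neq0 z : Delta z != 0.
Proof.
apply/eqP => D0; have tK : Kinf theta by exact: Kinf_inA.
pose y1 := elat (val z) theta^-1; pose y2 := elat (val z) (val z / theta).
have e1 : theta * y1 + G z * y1 ^+ q = 0 by have := gD_x1 z; rewrite D0 mulr0 mul0r addr0.
have e2 : theta * y2 + G z * y2 ^+ q = 0.
  have := gD_eq z (val z / theta); rewrite D0 mulr0 mul0r addr0 => <-.
  rewrite mulrC divfK ?theta_neq0 //; apply/Om_elat_eq0.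
  by exists 0, 1; rewrite rmorph1 rmorph0 mul1r add0r.
have : y1 * y2 ^+ q - y1 ^+ q * y2 != 0.
  apply: wron_neq0 => [|c]; first exact: x1_neq0.
  rewrite -subr_eq0 -mulNr -rmorphN -polyCN -Om_elat_Z -Om_elat_D.
  have -> : val z / theta + inA (- c)%:P / theta = (inA 1 * val z + inA (- c)%:P) / theta.
    by rewrite rmorph1 mul1r mulrDl.
  apply: elat_div_neq0; rewrite ?size_polyC_leq1 ?size_poly1 //.
  by rewrite xpair_eqE oner_eq0.
apply/negP; rewrite negbK; apply/eqP; apply: (mulfI (theta_neq0 C)); rewrite mulr0.
transitivity ((theta * y1 + G z * y1 ^+ q) * y2 ^+ q - (theta * y2 + G z * y2 ^+ q) * y1 ^+ q); first by ring.
by rewrite e1 e2 !mul0r subrr.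
Qed.

(** Phi_z(theta) applied coefficientwise is multiplication by t: the Frobenius difference equation
    of s_1 and s_2. *)
Lemma lser_gD z (a b : A) : let s := lser z (inA a + inA b * val z) in
  fps_const theta * s + fps_const (G z) * twist 1 s + fps_const (D z) * twist 2 s = fX C * s.
Proof.
move=> s; rewrite /s lser_X; apply: fpsP => i; rewrite !fcoefD !coef_constM.
set x := inA a + _; rewrite -[RHS]/(elat (val z) (theta * x / theta ^+ i.+1)).
rewrite -[coef (lser z x) i]/(elat (val z) (x / theta ^+ i.+1)).
rewrite -[coef (twist 1 _) i]/(elat (val z) (x / theta ^+ i.+1) ^+ (q ^ 1)) expn1.
rewrite -[coef (twist 2 _) i]/(elat (val z) (x / theta ^+ i.+1) ^+ (q ^ 2)) -mulnn exprM.
by rewrite -gD_eq mulrA.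
Qed.
End Laws.

(** * Expansions of g and Delta, and the sum behind the false Eisenstein series *)

Section Forms.
Variables (F : finFieldType) (R : realType) (C : cinf F R).
Local Notation ab := (@absC F R C).
Local Notation q := (#|F|).
Local Notation A := {poly F}.
Local Notation inA := (@embA F R C).
Local Notation theta := (@theta F R C).
Local Notation Om := (Omega C).
Local Notation Sreg := (@Sreg F R C).
Local Notation eA := (@eA F R C).
Local Notation EA := (@EA F R C).
Local Notation "c '%:K'" := (inA c%:P) (at level 2, format "c '%:K'").
Local Notation "a ~> l" := (cvg_to ab a l) (at level 70).
Implicit Types (z : Om).
Variable pi : C.
Hypothesis hpi : carlitz_period pi.
Local Notation u := (@u F R C pi).

Lemma ab_eA_theta_pow i : ab (eA (theta ^- i.+1)) = q%:R ^- i.+1.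
Proof.
rewrite eA_small abV ab_thetaX //.
by rewrite invf_lt1 ?qX_gt0 // exprn_egt1 // qR_gt1.
Qed.

(** A single inverse radius q |pi| serves all i because |e_A(theta^-(i+1))| <= 1; this uniformity
    makes s_2 a double series in t and u. *)
Lemma elat_series : exists S : nat -> fps C, forall i,
  [/\ bnd (q%:R ^- i.+1) (q%:R * ab pi) (S i), coef (S i) 0 = eA (theta ^- i.+1) &
  forall z, ab (u (val z)) * (q%:R * ab pi) < 1 ->
    elat (val z) (theta ^- i.+1) = fps_eval (S i) (u (val z))].
Proof.
have p1 := ltW (ab_pi_gt1 hpi); have r0 : 0 <= q%:R * ab pi by rewrite mulr_ge0 ?abs_ge0 ?ler0n.
suff h i : exists S : fps C, [/\ bnd (q%:R ^- i.+1) (q%:R * ab pi) S, coef S 0 = eA (theta ^- i.+1) &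
  forall z, ab (u (val z)) * (q%:R * ab pi) < 1 ->
    elat (val z) (theta ^- i.+1) = fps_eval S (u (val z))].
  by have [S hS] := choice h; exists S.
have [|H [b1 b2 b3]] := elat_expansion hpi (B := ab pi) (zeta := theta ^- i.+1) p1.
  by rewrite absM ab_eA_theta_pow ler_piMr ?abs_ge0 // qV_le1.
exists (fps_const (eA (theta ^- i.+1)) * H); split.
- have := bndM (abs_ge0 _) ler01 r0 (bnd_const (eA (theta ^- i.+1)) r0) b1.
  by rewrite ab_eA_theta_pow mulr1.
- by rewrite coef_constM b2 mulr1.
move=> z zr; rewrite (b3 z zr) (evalM r0 zr (cvf_const _ r0) (cvf_bnd b1)).
by rewrite eval_const.
Qed.

(** Carries convergence and value together, so that a polynomial expression is evaluated in one
    pass. *)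
Definition ev (r : R) (t : C) f v := cvf r f /\ fps_eval f t = v.

Section Ev.
Variables (r : R) (t : C).
Hypotheses (r0 : 0 <= r) (tr : ab t * r < 1).

Lemma evC c : ev r t (fps_const c) c.
Proof. by split; [exact: cvf_const | exact: eval_const]. Qed.
Lemma evD f g v w : ev r t f v -> ev r t g w -> ev r t (f + g) (v + w).
Proof. by move=> [cf <-] [cg <-]; split; [exact: cvfD | exact: (evalD r0)]. Qed.
Lemma evN f v : ev r t f v -> ev r t (- f) (- v).
Proof. by move=> [cf <-]; split; [exact: cvfN | exact: (evalN r0)]. Qed.
Lemma evM f g v w : ev r t f v -> ev r t g w -> ev r t (f * g) (v * w).
Proof. by move=> [cf <-] [cg <-]; split; [exact: cvfM | exact: (evalM r0)]. Qed.
Lemma evX f v k : ev r t f v -> ev r t (f ^+ k) (v ^+ k).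
Proof. by move=> [cf <-]; split; [exact: cvfX | exact: (evalX _ r0)]. Qed.
Lemma evV f v : ev r t f v -> coef f 0 != 0 -> cvf r f^-1 -> ev r t f^-1 v^-1.
Proof.
move=> [cf <-] f0 cV; split=> //.
have e : fps_eval f t * fps_eval f^-1 t = 1.
  by rewrite -(evalM r0 tr cf cV) divrr ?eval1 // fps_unitE.
have fn : fps_eval f t != 0 by apply: contra_eq_neq e => ->; rewrite mul0r eq_sym oner_eq0.
by apply: (mulfI fn); rewrite e mulfV.
Qed.

Lemma ev_wr f g v w k : ev r t f v -> ev r t g w ->
  ev r t ((f * g ^+ k - f ^+ k * g) ^+ k) ((v * w ^+ k - v ^+ k * w) ^+ k).
Proof.
move=> hf hg; apply/evX/evD; first by apply: evM => //; exact: evX.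
by apply/evN/evM => //; exact: evX.
Qed.
Lemma ev_N1 f g v w c k : ev r t f v -> ev r t g w ->
  ev r t (- (fps_const c * f * (g ^+ k) ^+ k) - (f - fps_const c * g) * (f ^+ k) ^+ k)
    (- (c * v * (w ^+ k) ^+ k) - (v - c * w) * (v ^+ k) ^+ k).
Proof.
move=> hf hg; have hc := evC c; apply: evD; apply: evN; apply: evM.
- exact: evM.
- by apply/evX/evX.
- by apply: evD => //; apply/evN/evM.
- by apply/evX/evX.
Qed.
Lemma ev_N2 f g v w c k : ev r t f v -> ev r t g w ->
  ev r t (fps_const c * f * g ^+ k + (f - fps_const c * g) * f ^+ k)
    (c * v * w ^+ k + (v - c * w) * v ^+ k).
Proof.
move=> hf hg; have hc := evC c; apply: evD; apply: evM.
- exact: evM.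
- exact: evX.
- by apply: evD => //; apply/evN/evM.
- exact: evX.
Qed.
End Ev.

Lemma ev0 (r : R) f : cvf r f -> ev r 0 f (coef f 0).
Proof. by split=> //; exact: eval_at0. Qed.

Lemma ev_coef0 (r : R) f v : ev r 0 f v -> coef f 0 = v.
Proof. by move=> [_ <-]; rewrite eval_at0. Qed.

Section GDelta.
Variables g Delta : Om -> C.
Hypothesis hgD : drinfeld_module_coeffs pi g Delta.

(** Substitute the expansions of e_z(1/theta) and e_z(1/theta^2) into [G_wr] and [D_wr]. The
    constant terms satisfy the Carlitz equations [E1] and [E2], which give g the value 1 and Delta
    the value 0 at u = 0. *)
Lemma gD_series : exists Gs, exists Ds : fps C, exists2 r : R, 0 < r &
  [/\ cvf r Gs, cvf r Ds, coef Gs 0 = 1, coef Ds 0 = 0 & forall z, ab (u (val z)) * r < 1 ->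
    g z = fps_eval Gs (u (val z)) /\ Delta z = fps_eval Ds (u (val z))].
Proof.
have [S hS] := elat_series; have p1 := ab_pi_gt1 hpi.
have [b1 c1 e1] := hS 0%N; have [b2 c2 e2] := hS 1%N.
have r0 : 0 < q%:R * ab pi by rewrite mulr_gt0 ?qR_gt0 // (lt_trans ltr01).
have r0' := ltW r0; set r := q%:R * ab pi in b1 e1 b2 e2 r0 r0'.
set X1 := S 0%N in b1 c1 e1; set X2 := S 1%N in b2 c2 e2.
have C1 := cvf_bnd b1; have C2 := cvf_bnd b2; rewrite expr1 in c1 e1.
set y1 := eA theta^-1 in c1; set y2 := eA (theta ^- 2) in c2.
have t0 : ab 0 * r < 1 by rewrite ab0 mul0r.
have h1 : ev r 0 X1 y1 by rewrite -c1; exact: ev0.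
have h2 : ev r 0 X2 y2 by rewrite -c2; exact: ev0.
have hW := ev_wr r0' t0 q h1 h2; have hN1 := ev_N1 r0' t0 theta q h1 h2.
have hN2 := ev_N2 r0' t0 theta q h1 h2.
have tr0 z : ab (u (val z)) * r < 1 -> ev r (u (val z)) X1 (elat (val z) theta^-1) /\
    ev r (u (val z)) X2 (elat (val z) (theta ^- 2)).
  by move=> zr; split; split; rewrite // ?e1 ?e2.
have gW z zr := ev_wr r0' zr q (tr0 z zr).1 (tr0 z zr).2.
have gN1 z zr := ev_N1 r0' zr theta q (tr0 z zr).1 (tr0 z zr).2.
have gN2 z zr := ev_N2 r0' zr theta q (tr0 z zr).1 (tr0 z zr).2.
move: (_ ^+ q) hW gW => W hW gW; move: (- _ - _) hN1 gN1 => N1 hN1 gN1.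
move: (_ * _ * _ + _) hN2 gN2 => N2 hN2 gN2.
have y10 : y1 != 0 by rewrite -ab_gt0 ab_eA_theta invr_gt0 qR_gt0.
have w0 : y1 * y2 ^+ q - y1 ^+ q * y2 != 0.
  apply: wron_neq0 => // c; rewrite -subr_eq0 -eA_Z -eA_B.
  have [k1 k2 k3] := zetaP C c; rewrite -ab_gt0 eA_small ?ab_gt0 //.
  exact: zeta_lt1.
have wq : (y1 * y2 ^+ q - y1 ^+ q * y2) ^+ q != 0 by rewrite expf_neq0.
have cW0 := ev_coef0 hW; have W0 : coef W 0 != 0 by rewrite cW0.
have E1 : theta * y1 + pi ^+ q.-1 * y1 ^+ q = 0.
  rewrite -eA_carlitz // mulfV ?theta_neq0 // -(rmorph1 inA); exact: eA_inA.
have E2 : theta * y2 + pi ^+ q.-1 * y2 ^+ q = y1.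
  by rewrite -eA_carlitz //; congr eA; field; exact: theta_neq0.
have E1' : theta * y1 = - (pi ^+ q.-1 * y1 ^+ q) by apply/eqP; rewrite -addr_eq0 E1.
have E2' : y1 - theta * y2 = pi ^+ q.-1 * y2 ^+ q by rewrite -{1}E2 addrC addKr.
have [r' rr' cWV] := cvfV r0' hW.1 W0.
have r'0 : 0 < r' by exact: lt_le_trans rr'.
have r'' := ltW r'0.
have p0 k : pi ^+ k != 0 by rewrite expf_neq0 // (pi_neq0 hpi).
have up t f v : ev r t f v -> ev r' t f v by move=> [cf fv]; split=> //; exact: cvf_le cf.
have fin t f v w c : ab t * r' < 1 -> ev r t f v -> ev r t W w ->
    ev r' t (fps_const c * (f * W^-1)) (c * (v / w)).
  move=> tr hf hw; apply: evM => //; first exact: evC.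
  by apply: evM => //; [exact: up | apply: evV => //; exact: up].
have t0' : ab 0 * r' < 1 by rewrite ab0 mul0r.
exists (fps_const (pi ^+ q.-1)^-1 * (N1 * W^-1)), (fps_const (pi ^+ (q ^ 2).-1)^-1 * (N2 * W^-1)), r' => //.
have fG := fin 0 _ _ _ (pi ^+ q.-1)^-1 t0' hN1 hW.
have fD := fin 0 _ _ _ (pi ^+ (q ^ 2).-1)^-1 t0' hN2 hW.
split; [exact: fG.1 | exact: fD.1 | rewrite (ev_coef0 fG) | rewrite (ev_coef0 fD) |].
- rewrite E1' E2'; have -> : - (- (pi ^+ q.-1 * y1 ^+ q) * (y2 ^+ q) ^+ q) - pi ^+ q.-1 * y2 ^+ q * (y1 ^+ q) ^+ q =
    pi ^+ q.-1 * ((y1 * y2 ^+ q - y1 ^+ q * y2) ^+ q) by rewrite frob_wr; ring.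
  by rewrite mulfK // mulVf.
- rewrite E1' E2'; have -> : - (pi ^+ q.-1 * y1 ^+ q) * y2 ^+ q + pi ^+ q.-1 * y2 ^+ q * y1 ^+ q = 0 by ring.
  by rewrite mul0r mulr0.
move=> z zr'; have zr : ab (u (val z)) * r < 1.
  by apply: le_lt_trans zr'; rewrite ler_wpM2l ?abs_ge0.
rewrite (fin _ _ _ _ _ zr' (gN1 z zr) (gW z zr)).2 (fin _ _ _ _ _ zr' (gN2 z zr) (gW z zr)).2.
by rewrite -(G_wr hgD) -(D_wr hgD) !mulKf.
Qed.

End GDelta.

Lemma poly_inf (K : idomainType) (p : {poly K}) (f : nat -> K) : injective f ->
  (forall i, root p (f i)) -> p = 0.
Proof.
move=> fi h; apply/eqP; apply: contraT => p0.
have := @max_poly_roots _ p (map f (iota 0 (size p))) p0.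
rewrite size_map size_iota ltnn; apply.
  by apply/allP => x /mapP[i _ ->].
by rewrite map_inj_uniq ?iota_uniq.
Qed.

Lemma thetaX_inj : injective (fun i => theta ^+ i).
Proof.
move=> i j; rewrite -!rmorphXn => /inA_inj /(congr1 (fun p : A => size p)).
by rewrite !size_polyXn => -[].
Qed.

Lemma q_natC : q%:R = 0 :> C.
Proof.
have [p pC pq] := q_pchar_nat C; apply/eqP; rewrite -(dvdn_pcharf pC).
have /(pnatPpi pq) : pdiv q \in \pi(q) by rewrite pi_pdiv card_F_gt1.
by rewrite inE => /eqP <-; exact: pdiv_dvd.
Qed.

Fixpoint EApoly n : {poly C} := if n is m.+1 then
  EApoly m - ((EA m (theta ^+ m)) ^+ q.-1)^-1 *: EApoly m ^+ q else 'X.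

Lemma EApolyE n x : (EApoly n).[x] = EA n x.
Proof.
elim: n x => [|n IH] x; first by rewrite hornerX.
by rewrite /= hornerD hornerN hornerZ horner_exp !IH mulrC.
Qed.

Lemma EApoly_deriv n : (EApoly n)^`() = 1.
Proof.
elim: n => [|n IH]; first by rewrite derivX.
rewrite /= derivB derivZ IH deriv_exp -mulr_natr.
have -> : (q%:R : {poly C}) = 0 by rewrite -polyC_natr q_natC.
by rewrite mulr0 scaler0 subr0.
Qed.

(** The logarithmic derivative of a polynomial whose derivative is 1, with the sign of a changed by
    symmetry. *)
Lemma EA_inv n x : EA n x != 0 -> (EA n x)^-1 = \sum_(a <- polys F n) (x + inA a)^-1.
Proof.
move=> x0.
pose P (s : seq A) : {poly C} := \prod_(a <- s | a != 0) (1 - (inA a)^-1 *: 'X).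
have PE s y : (P s).[y] = \prod_(a <- s | a != 0) (1 - y / inA a).
  rewrite /P horner_prod; apply: eq_bigr => a _.
  by rewrite hornerD hornerN hornerZ hornerX hornerC mulrC.
have EP : EApoly n = 'X * P (polys F n).
  apply/eqP; rewrite -subr_eq0; apply/eqP/(poly_inf thetaX_inj) => i.
  by rewrite /root hornerD hornerN hornerM hornerX EApolyE PE EA_prod subrr.
have xn : x != 0 by apply: contraNneq x0 => ->; rewrite EA_prod mul0r.
have an a : a \in polys F n -> a != 0 -> 1 - x / inA a != 0.
  move=> an a0; apply: contra x0 => /eqP e.
  rewrite EA_prod mulf_eq0; apply/orP; right; rewrite prodf_seq_eq0; apply/hasP; exists a => //.
  by rewrite a0 e eqxx.
have LD (s : seq A) : {subset s <= polys F n} ->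
    (P s)^`().[x] = (P s).[x] * \sum_(a <- s | a != 0) (x - inA a)^-1.
  elim: s => [|a s IH] h; first by rewrite /P !big_nil derivC horner0 mulr0.
  have hs : {subset s <= polys F n} by move=> b bs; apply: h; rewrite inE bs orbT.
  have an' := an a (h a (mem_head _ _)).
  rewrite /P !big_cons; case: ifP => a0; last exact: IH.
  rewrite -/(P s) derivM hornerD !hornerM (IH hs) derivB derivZ derivX derivC sub0r.
  rewrite hornerN hornerZ !hornerC hornerD hornerN hornerZ hornerX hornerC.
  have := an' a0; rewrite mulrC => e.
  have ai : inA a != 0 by rewrite inA_eq0 a0.
  have xa : x - inA a != 0.
    by apply: contra e => /eqP /subr0_eq ->; rewrite mulVf // subrr.
  rewrite mulrDr; move: ((P s).[x]) (\sum_(j <- s | j != 0) (x - inA j)^-1) => y w.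
  by field; rewrite xa ai.
have := congr1 (fun p : {poly C} => p^`().[x]) EP.
rewrite EApoly_deriv hornerC derivM derivX mul1r hornerD hornerM hornerX LD // => h.
have Pn : (P (polys F n)).[x] != 0.
  by apply: contra x0 => /eqP e; rewrite -EApolyE EP hornerM e mulr0.
have -> : \sum_(a <- polys F n) (x + inA a)^-1 = x^-1 + \sum_(a <- polys F n | a != 0) (x - inA a)^-1.
  have -> : \sum_(a <- polys F n) (x + inA a)^-1 = \sum_(a <- polys F n) (x - inA a)^-1.
    have pm : perm_eq (polys F n) (map -%R (polys F n)).
      apply: uniq_perm => [||a]; [exact: polys_uniq | by rewrite map_inj_uniq ?polys_uniq //; exact: oppr_inj |].
      by rewrite -[a in RHS]opprK mem_map ?mem_polys ?size_polyN //; exact: oppr_inj.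
    by rewrite (perm_big _ pm) big_map; apply: eq_bigr => a _; rewrite rmorphN.
  rewrite (bigD1_seq 0) ?polys_uniq ?mem_polys ?size_poly0 //= rmorph0 subr0; congr (_ + _).
rewrite -EApolyE EP hornerM hornerX -[LHS]mul1r h; field.
by rewrite xn Pn.
Qed.

Lemma sum_polys_cst n (x : C) : (0 < n)%N -> \sum_(a <- polys F n) x = 0.
Proof.
case: n => // n _; rewrite big_allpairs_dep big1_seq // => a _.
by rewrite big_enum sumr_const -mulr_natr q_natC mulr0.
Qed.

(** Both the outer sum and the exponential are truncated, so that the two summations can be
    exchanged. *)
Definition U2 n m x := \sum_(b <- polys F n | b != 0) inA b / EA m (inA b * x).

Lemma EA_Om_neq0 n (b : A) z : b != 0 -> EA n (inA b * val z) != 0.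
Proof.
move=> b0; have [N [M Sz]] := Sreg_ex z.
by rewrite -ab_gt0; apply: lt_le_trans (EA_lower n Sz b0); exact: qV_gt0.
Qed.

(** Expand by [EA_inv] and exchange the sums. The terms with b = 0 give - z, and elsewhere a z / (a
    + b z) = z - b z^2 / (a + b z), where the constant z cancels on summing over a multiple of q
    polynomials. *)
Lemma U2_inv n m z : (0 < n)%N -> (0 < m)%N ->
  U2 n m (val z)^-1 = - val z - val z ^+ 2 * U2 m n (val z).
Proof.
move=> n0 m0; have z0 := val_neq0 z.
have lin (a b : A) : a != 0 -> inA a + inA b * val z != 0.
  move=> a0; rewrite addrC; apply: lin_neq0; by rewrite xpair_eqE (negbTE a0) andbF.
have linb (a b : A) : b != 0 -> inA a + inA b * val z != 0.
  move=> a0; rewrite addrC; apply: lin_neq0; by rewrite xpair_eqE (negbTE a0).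
transitivity (\sum_(a <- polys F n | a != 0) \sum_(b <- polys F m) inA a * val z / (inA a + inA b * val z)).
  apply: eq_bigr => a a0; have Ez : EA m (inA a * (val z)^-1) != 0.
    by rewrite -val_S; exact: EA_Om_neq0.
  rewrite EA_inv // mulr_sumr; apply: eq_bigr => b _.
  have := lin a b a0 => h; have -> : inA a * (val z)^-1 + inA b = (inA a + inA b * val z) / val z by field.
  by rewrite invf_div mulrA.
rewrite exchange_big (bigD1_seq 0) ?polys_uniq ?mem_polys ?size_poly0 //; congr (_ + _).
  rewrite (eq_bigr (fun=> val z)); last first.
    by move=> a a0; rewrite rmorph0 mul0r addr0 mulrAC mulfV ?mul1r // inA_eq0.
  apply/eqP; rewrite -addr_eq0 addrC; apply/eqP.
  rewrite -[RHS](sum_polys_cst (val z) n0).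
  by rewrite [RHS](bigD1_seq 0) ?polys_uniq ?mem_polys ?size_poly0.
rewrite /U2 mulr_sumr -sumrN; apply: eq_bigr => b b0.
transitivity (\sum_(a <- polys F n) (val z - inA b * val z ^+ 2 / (inA b * val z + inA a))).
  rewrite [RHS](bigD1_seq 0) ?polys_uniq ?mem_polys ?size_poly0 //.
  have bn : inA b != 0 by rewrite inA_eq0.
  rewrite -[LHS]add0r; congr (_ + _).
    by rewrite rmorph0 addr0; apply/esym; field; rewrite bn z0.
  apply: eq_bigr => a a0; have := lin a b a0 => h; rewrite [inA b * _ + _]addrC.
  by field.
rewrite big_split sum_polys_cst // sumrN -mulr_sumr -EA_inv ?EA_Om_neq0 //=.
by rewrite add0r -mulrA mulrCA mulrA.
Qed.

Section Bounds.
Variables N M : nat.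
Local Notation S := (Sreg N M).
Local Notation K := (N + M)%N.
Local Notation B := (q%:R ^+ (K * q) : R).

(** The estimate is uniform in the truncation m: by the q-th power in [EA_geX] and q >= 2 the terms
    decay like 1/|b|. *)
Lemma EA_term_small m (b : A) z : S (val z) -> (0 < m)%N -> b != 0 ->
  ab (inA b / EA m (inA b * val z)) <= B / ab (inA b).
Proof.
move=> Sz m0 b0; have q0 := qR_gt0 F R; have bn : 0 < ab (inA b) by rewrite ab_gt0 inA_eq0.
have b1 := @ab_inA_ge1 _ _ C _ b0.
have r0 : 0 < q%:R ^- K * ab (inA b) by rewrite mulr_gt0 ?qV_gt0.
have h := EA_geX m0 (ltW r0) (fun a => Sreg_mul_ge a Sz b0).
have E0 : 0 < ab (EA m (inA b * val z)) by apply: lt_le_trans h; rewrite exprn_gt0.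
rewrite abf_div ler_pdivrMr // mulrAC ler_pdivlMr //.
apply: (@le_trans _ _ (B * (q%:R ^- K * ab (inA b)) ^+ q)); last by rewrite ler_wpM2l // exprn_ge0 // ltW.
rewrite exprMn exprVn -exprM mulrA mulfV ?mul1r ?gt_eqF ?qX_gt0 // -expr2.
by apply: ler_weXn2l => //; exact: card_F_gt1.
Qed.

Lemma eA_term_small (b : A) z : S (val z) -> b != 0 ->
  ab (inA b / eA (inA b * val z)) <= B / ab (inA b).
Proof.
move=> Sz b0; apply: (lim_le_ab (N := 1%N)) (limZ (inA b) (limV (eA_Om z b0) (eA_lim _))) => m m0.
exact: EA_term_small.
Qed.

Definition V1 n x := \sum_(b <- polys F n | b != 0) inA b / eA (inA b * x).

Lemma sum_tail (f : A -> C) k n (e : R) : 0 <= e -> (k <= n)%N ->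
  (forall b : A, b != 0 -> (k < size b)%N -> ab (f b) <= e) ->
  ab (\sum_(b <- polys F n | b != 0) f b - \sum_(b <- polys F k | b != 0) f b) <= e.
Proof.
move=> e0 kn h.
have sub : {subset polys F k <= polys F n} by move=> b; rewrite !mem_polys => /leq_trans; apply.
rewrite big_mkcond [X in _ - X]big_mkcond (sum_sub_uniq _ (polys_uniq F k) (polys_uniq F n) sub) addrC addKr.
apply: ab_sum_le => // b; rewrite mem_polys -ltnNge => sb.
by case: ifP => b0; [exact: h | rewrite ab0].
Qed.

Lemma V1_near z k n : S (val z) -> (k <= n)%N ->
  ab (V1 n (val z) - V1 k (val z)) <= B / q%:R ^+ k.
Proof.
move=> Sz kn; apply: sum_tail => // [|b b0 sb]; first by rewrite divr_ge0 ?exprn_ge0 ?ler0n.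
apply: le_trans (eA_term_small Sz b0) _; rewrite ler_wpM2l ?exprn_ge0 ?ler0n //.
by rewrite lef_pV2 ?posrE ?qX_gt0 ?ab_gt0 ?inA_eq0 // leNgt ab_inA_lt -ltnNge.
Qed.

Lemma U2_near z k n m : S (val z) -> (0 < m)%N -> (k <= n)%N ->
  ab (U2 n m (val z) - U2 k m (val z)) <= B / q%:R ^+ k.
Proof.
move=> Sz m0 kn; apply: sum_tail => // [|b b0 sb]; first by rewrite divr_ge0 ?exprn_ge0 ?ler0n.
apply: le_trans (EA_term_small Sz m0 b0) _; rewrite ler_wpM2l ?exprn_ge0 ?ler0n //.
by rewrite lef_pV2 ?posrE ?qX_gt0 ?ab_gt0 ?inA_eq0 // leNgt ab_inA_lt -ltnNge.
Qed.

End Bounds.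

Lemma V1_ex z : exists l, (fun n => V1 n (val z)) ~> l.
Proof.
have [N [M Sz]] := Sreg_ex z; apply: lim_cauchy => e e0.
have [k hk] := qpow_small F (divr_gt0 e0 (qX_gt0 F R ((N + M) * q))).
exists k => n kn; apply: le_lt_trans (V1_near Sz (leqnSn n)) _.
rewrite mulrC -ltr_pdivlMr ?qX_gt0 //; apply: le_lt_trans hk; exact: qV_le.
Qed.

(** The sum over b != 0 of b / e_A(b z), which is - pi E ([E_Vlim]). *)
Definition Vlim z := xget 0 [set l | (fun n => V1 n (val z)) ~> l].

Lemma Vlim_lim z : (fun n => V1 n (val z)) ~> Vlim z.
Proof. by rewrite /Vlim; have [l hl] := V1_ex z; case: xgetP => [y _ //|/(_ l)]. Qed.

Lemma Vlim_near N M z k : Sreg N M (val z) ->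
  ab (Vlim z - V1 k (val z)) <= q%:R ^+ ((N + M) * q) / q%:R ^+ k.
Proof. by move=> Sz; apply: (lim_near_le (N := k)) (Vlim_lim z) => n; exact: V1_near. Qed.

(** Tails being uniform in m, the diagonal limit equals the iterated one. The diagonal is symmetric
    in the two truncations, as the inversion formula requires. *)
Lemma U2_lim z : (fun n => U2 n n (val z)) ~> Vlim z.
Proof.
have [N [M Sz]] := Sreg_ex z; apply/cvgP => e e0.
have [k hk] := qpow_small F (divr_gt0 e0 (qX_gt0 F R ((N + M) * q))).
have L : (fun m => U2 k m (val z)) ~> V1 k (val z).
  rewrite /U2 /V1.
  have h (b : A) : (fun m => if b == 0 then 0 else inA b / EA m (inA b * val z)) ~>
      if b == 0 then 0 else inA b / eA (inA b * val z).
    case: eqVneq => [_|b0]; first exact: lim_cst.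
    exact: limZ (limV (eA_Om z b0) (eA_lim _)).
  rewrite big_mkcond; under eq_bigr do rewrite if_neg.
  apply: (lim_ext (N := 0%N)) (lim_sum (polys F k) h) => m _.
  by rewrite [RHS]big_mkcond; apply: eq_bigr => b _; rewrite if_neg.
move/cvgP: L => /(_ e e0)[m0 hm].
exists (maxn k.+1 m0) => n; rewrite geq_max => /andP[kn mn].
have e1 : q%:R ^+ ((N + M) * q) / q%:R ^+ k < e by rewrite mulrC -ltr_pdivlMr ?qX_gt0.
rewrite -(subrKA (U2 k n (val z))); apply: abD_lt.
  by apply: le_lt_trans (U2_near Sz _ (ltnW kn)) _ => //; exact: leq_trans kn.
rewrite -(subrKA (V1 k (val z))); apply: abD_lt; first exact: hm.
by rewrite ab_subC; apply: le_lt_trans (Vlim_near k Sz) _.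
Qed.

Lemma Vlim_S z : Vlim (mob (@Smx F) z) = - val z - val z ^+ 2 * Vlim z.
Proof.
apply: (lim_uniq (U2_lim _)).
apply: (lim_ext (N := 1%N)) (limB (lim_cst (- val z)) (limZ (val z ^+ 2) (U2_lim z))) => n n0.
by rewrite val_S U2_inv.
Qed.

Lemma Vlim_T a z : Vlim (mob (Tmx a) z) = Vlim z.
Proof.
apply: (lim_uniq (Vlim_lim _)); apply: (lim_ext (N := 0%N)) (Vlim_lim z) => n _.
by apply: eq_bigr => b _; rewrite val_T mulrDr -rmorphM eA_D eA_inA addr0.
Qed.

Lemma Vlim_D (c d : F) z : c != 0 -> d != 0 -> Vlim (mob (Dmx c d) z) = inA d%:P / inA c%:P * Vlim z.
Proof.
move=> c0 d0; apply: (lim_uniq (Vlim_lim _)); apply: (lim_ext (N := 0%N)) (limZ _ (Vlim_lim z)) => n _.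
rewrite /V1 mulr_sumr; apply: eq_bigr => b b0.
have cn : c%:K != 0 by rewrite inA_eq0 polyC_eq0.
have dn : d%:K != 0 by rewrite inA_eq0 polyC_eq0.
have -> : inA b * val (mob (Dmx c d) z) = (c / d)%:K * (inA b * val z).
  rewrite val_D //; suff -> : (c / d)%:K = c%:K / d%:K by ring.
  by apply: (canRL (mulfK dn)); rewrite -rmorphM -polyCM divfK.
rewrite eA_Z; have -> : (c / d)%:K = c%:K / d%:K.
  by apply: (canRL (mulfK dn)); rewrite -rmorphM -polyCM divfK.
by have en := eA_Om z b0; field; rewrite en dn cn.
Qed.
End Forms.

(** * Generation of GL_2(A) *)

Section Generators.
Variable F : finFieldType.
Local Notation A := {poly F}.
Local Notation GL := (@GL2A F).

Lemma mx2P (g g' : 'M[A]_2) : g 0 0 = g' 0 0 -> g 0 1 = g' 0 1 -> g 1 0 = g' 1 0 ->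
  g 1 1 = g' 1 1 -> g = g'.
Proof.
move=> h00 h01 h10 h11; apply/matrixP => i j.
have I2 (k : 'I_2) : k = 0 \/ k = 1.
  by case: k => [[|[|k]]] // p; [left|right]; exact: val_inj.
by case: (I2 i) => ->; case: (I2 j) => ->.
Qed.

(** The Euclidean algorithm on the first column: reduce g 0 0 modulo g 1 0 and swap the rows, which
    lowers the degree of the lower left entry. *)
Lemma GL_ind (P : 'M[A]_2 -> Prop) : (forall a, P (Tmx a)) -> P (@Smx F) ->
  (forall c d : F, c != 0 -> d != 0 -> P (Dmx c d)) ->
  (forall g d, GL g -> GL d -> P g -> P d -> P (g *m d)) -> forall g, GL g -> P g.
Proof.
move=> PT PS PD PM g; have [n] := ubnP (size (g 1 0)).
elim: n g => // n IH g; rewrite ltnS => sn gG.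
have [c0|c0] := eqVneq (g 1 0) 0.
  have [c cn] := GL_det gG; rewrite det_mx22 c0 mulr0 subr0 => e.
  have e0 : g 0 0 * g 1 1 != 0 by rewrite e polyC_eq0.
  have [a0 d0] : g 0 0 != 0 /\ g 1 1 != 0 by apply/andP; rewrite -negb_or -mulf_eq0.
  have s1 : size (g 0 0) == 1%N /\ size (g 1 1) == 1%N.
    have := congr1 (fun p : A => size p) e; rewrite size_mul // size_polyC cn.
    move: a0 d0; rewrite -!size_poly_gt0.
    by case: (size (g 0 0)) => // -[|m]; case: (size (g 1 1)) => // -[|k] // _ _; rewrite ?addSn ?addnS.
  have [/size_poly1P[c1 c10 e1] /size_poly1P[c2 c20 e2]] := s1.
  have -> : g = Tmx (c2^-1 *: g 0 1) *m Dmx c1 c2.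
    apply: mx2P; rewrite !mulmx22 !mx2E ?c0 ?e1 ?e2 ?mulr0 ?mul0r ?mul1r ?addr0 ?add0r //.
    by rewrite mulrC mul_polyC scalerA mulfV // scale1r.
  by apply: PM; [exact: GL_T | exact: GL_D | exact: PT | exact: PD].
set k := g 0 0 %/ g 1 0.
pose g' := mx2 (g 1 0) (g 1 1) (g 0 0 %% g 1 0) (g 0 1 - k * g 1 1).
have e : g = Tmx k *m (@Smx F *m g').
  apply: mx2P; rewrite !mulmx22 !mx2E ?mul0r ?mul1r ?addr0 ?add0r //.
    by rewrite addrC -divp_eq.
  by rewrite subrK.
have gG' : GL g'.
  have [c cn] := GL_det gG; rewrite det_mx22 => dE.
  apply: (@det_GL _ _ (- c)); rewrite ?oppr_eq0 // polyCN -dE det_mx2.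
  have {2}-> : g 0 0 = k * g 1 0 + g 0 0 %% g 1 0 by exact: divp_eq.
  by ring.
rewrite e; apply: (PM) => //; [exact: GL_T | by apply: GL_mul; [exact: GL_S|] |].
apply: (PM) => //; first exact: GL_S.
apply: IH => //; rewrite mx2E; by apply: leq_trans sn; rewrite ltn_modp.
Qed.

End Generators.

(** * The false Eisenstein series *)

Section FalseEisenstein.
Variables (F : finFieldType) (R : realType) (C : cinf F R).
Local Notation ab := (@absC F R C).
Local Notation q := (#|F|).
Local Notation A := {poly F}.
Local Notation inA := (@embA F R C).
Local Notation Om := (Omega C).
Local Notation Sreg := (@Sreg F R C).
Local Notation eA := (@eA F R C).
Local Notation EA := (@EA F R C).
Local Notation Vlim := (@Vlim F R C).
Local Notation V1 := (@V1 F R C).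
Local Notation GL := (@GL2A F).
Local Notation "c '%:K'" := (inA c%:P) (at level 2, format "c '%:K'").
Local Notation "a ~> l" := (cvg_to ab a l) (at level 70).
Implicit Types (z : Om).

Lemma L_cocycle g d z : GL g -> GL d ->
  L (g *m d) z = L d z + inA (\det d) / J d z ^+ 2 * L g (mob d z).
Proof.
move=> gG dG; have := J_neq0 z dG; have := J_neq0 (mob d z) gG.
rewrite /L J_cocycle // /J mobE // mulmx22 det_mx22 !rmorphD !rmorphM rmorphN !rmorphM /J.
move: (val z) (inA (g 1 0)) (inA (g 1 1)) (inA (d 0 0)) (inA (d 0 1)) (inA (d 1 0)) (inA (d 1 1)).
move=> w c c' a0 b0 c0 d0 h1 h2.
have h3 : c * (a0 * w + b0) + c' * (c0 * w + d0) != 0.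
  rewrite (_ : _ + _ = (c * ((a0 * w + b0) / (c0 * w + d0)) + c') * (c0 * w + d0)); first by rewrite mulf_neq0.
  by field.
by field; rewrite h2 h3.
Qed.

(** The law is stable under products by the cocycle relation of L, so the generators suffice. *)
Lemma Vlim_mob g z : GL g ->
  Vlim (mob g z) = (inA (\det g))^-1 * J g z ^+ 2 * (Vlim z + L g z).
Proof.
move=> gG; move: g gG z; apply: GL_ind.
- by move=> a z; rewrite Vlim_T det_Tmx J_T /L mx2E rmorph0 mul0r addr0 rmorph1 invr1 expr1n !mul1r.
- move=> z; rewrite Vlim_S det_Smx J_S /L mx2E J_S rmorphN rmorph1 invrN1.
  by have := val_neq0 z; move: (val z) => w w0; field.
- move=> c d c0 d0 z; rewrite Vlim_D // det_Dmx J_D /L mx2E rmorph0 mul0r addr0 polyCM rmorphM.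
  have cn : c%:K != 0 by rewrite inA_eq0 polyC_eq0.
  have dn : d%:K != 0 by rewrite inA_eq0 polyC_eq0.
  by field; rewrite cn dn.
move=> g d gG dG Pg Pd z; rewrite mob_mul // Pg Pd L_cocycle // J_cocycle // det_mulmx rmorphM.
have := J_neq0 z dG; have := J_neq0 (mob d z) gG.
have := inA_det_neq0 C gG; have := inA_det_neq0 C dG.
move: (inA (\det g)) (inA (\det d)) (J d z) (J g (mob d z)) (L d z) (L g (mob d z)) (Vlim z).
by move=> x1 x2 x3 x4 x5 x6 x7 n1 n2 n3 n4; field; rewrite n1 n2 n4.
Qed.

Section Appr.
Variables N M : nat.
Local Notation S := (Sreg N M).

Lemma appr_eA (f : Om -> C) : appr S f -> appr S (fun z => eA (f z)).
Proof.
move=> hf; have [B B0 hB] := appr_bounded hf.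
have [k0 hk0] := qpow_large F B.
have [D D0 hD] := appr_bounded (appr_EA k0 hf).
apply: appr_lim => e e0.
have [k1 hk1] := qpow_small F (divr_gt0 e0 (mulr_gt0 D0 B0)).
pose k := maxn k0 k1; exists (fun z => EA k (f z)); split; first exact: appr_EA.
move=> z Sz; have lt m : (k0 <= m)%N -> ab (f z) < q%:R ^+ m.
  by move=> km; apply: le_lt_trans (hB z Sz) (lt_le_trans hk0 (qX_le _ _ km)).
apply: le_lt_trans (eA_near_id (lt _ (leq_maxl k0 k1))) _.
rewrite (EA_ab (leq_maxl k0 k1) (lt _ (leqnn _))).
apply: (@le_lt_trans _ _ (D * B * q%:R ^- k1)).
  rewrite mulrA; apply: ler_pM; rewrite ?mulr_ge0 ?abs_ge0 ?invr_ge0 ?exprn_ge0 ?(ltW (qR_gt0 F R)) //.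
    by rewrite ler_pM ?abs_ge0 ?hD ?hB.
  exact/qV_le/leq_maxr.
by rewrite mulrC -ltr_pdivlMr // mulr_gt0.
Qed.

Lemma appr_Vlim : appr S Vlim.
Proof.
apply: appr_lim => e e0.
have [k hk] := qpow_small F (divr_gt0 e0 (qX_gt0 F R ((N + M) * q))).
exists (fun z => V1 k (val z)); split.
  rewrite /V1; apply: appr_sum => b b0; apply: appr_scale.
  apply: (apprV (qV_gt0 F R (N + M))) => [z Sz|].
    apply: eA_ge => [|a]; first exact: qV_gt0.
    apply: le_trans (Sreg_mul_ge a Sz b0).
    by rewrite ler_peMr ?(ltW (qV_gt0 _ _ _)) // ab_inA_ge1.
  by apply: appr_eA; apply: apprM; [exact: appr_cst | exact: appr_val].
move=> z Sz; apply: le_lt_trans (Vlim_near k Sz) _.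
by rewrite mulrC -ltr_pdivlMr ?qX_gt0.
Qed.
End Appr.

(** A nonzero polynomial is c a with a monic, the term does not depend on c, and the q - 1 choices
    of c count as -1 in C. *)
Lemma V1_monic n z : V1 n (val z) =
  - \sum_(a <- polys F n | a \is monic) inA a / eA (inA a * val z).
Proof.
have pm : perm_eq [seq a <- polys F n | a != 0]
    [seq c%:P * a | c <- [seq c <- enum F | c != 0], a <- [seq a <- polys F n | a \is monic]].
  apply: uniq_perm.
  - by rewrite filter_uniq // polys_uniq.
  - apply: allpairs_uniq => [||[c a] [d b]]; [by apply: filter_uniq; exact: enum_uniq | by rewrite filter_uniq // polys_uniq |].
    move=> /allpairsP[[c1 a1] /= []]; rewrite !mem_filter => /andP[c0 _] /andP[am _] [-> ->].
    move=> /allpairsP[[d1 b1] /= []]; rewrite !mem_filter => /andP[d0 _] /andP[bm _] [-> ->] /= e.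
    have ecd : c1 = d1.
      have := congr1 lead_coef e; rewrite !lead_coefM !lead_coefC.
      by rewrite (monicP am) (monicP bm) !mulr1.
    congr (_, _) => //; move: e; rewrite ecd; apply: mulfI; by rewrite polyC_eq0.
  move=> a; rewrite mem_filter; apply/andP/allpairsP => [[a0 an]|[[c b] /= []]].
    have l0 : lead_coef a != 0 by rewrite lead_coef_eq0.
    exists (lead_coef a, (lead_coef a)^-1 *: a); split => /=.
    - by rewrite mem_filter l0 mem_enum.
    - rewrite mem_filter mem_polys size_scale ?invr_eq0 // -mem_polys an andbT.
      by rewrite monicE lead_coefZ mulVf.
    - by rewrite mul_polyC scalerA mulfV // scale1r.
  rewrite !mem_filter => /andP[c0 _] /andP[bm bn] ->; split.
    by rewrite mulf_neq0 ?polyC_eq0 // monic_neq0.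
  by rewrite mul_polyC mem_polys size_scale // -mem_polys.
rewrite /V1 -big_filter (perm_big _ pm) big_allpairs_dep.
transitivity (\sum_(c <- [seq c <- enum F | c != 0]) \sum_(a <- polys F n | a \is monic) inA a / eA (inA a * val z)).
  rewrite !big_seq; apply: eq_bigr => c; rewrite mem_filter => /andP[c0 _].
  rewrite big_filter; apply: eq_bigr => a am.
  have cn : c%:K != 0 by rewrite inA_eq0 polyC_eq0.
  have en := eA_Om z (monic_neq0 am).
  by rewrite rmorphM -(mulrA c%:K _ (val z)) eA_Z; field; rewrite en cn.
rewrite big_filter big_enum_cond sumr_const -mulr_natr.
have -> : (#|(fun i : F => i != 0)|%:R : C) = -1.
  rewrite (_ : #|_| = q.-1); last by rewrite -(cardC1 (0 : F)); apply: eq_card => c; rewrite !inE.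
  apply/eqP; rewrite -addr_eq0 -(natrD _ _ 1) addn1 prednK ?qpos //.
  by rewrite q_natC.
by rewrite mulrN1.
Qed.

Variable pi : C.
Hypothesis hpi : carlitz_period pi.
Local Notation u := (@u F R C pi).
Local Notation Mon := [set a : A | a \is monic].

Lemma E_Vlim z : false_eisenstein pi z = - (pi^-1 * Vlim z).
Proof.
have p0 := pi_neq0 hpi.
pose f (a : A) := inA a * u (inA a * val z).
have fE a : f a = pi^-1 * (inA a / eA (inA a * val z)).
  by rewrite /f (uE hpi) invfM mulrCA.
pose Jn n : {fset Mon} := [fset l in pmap insub (polys F n)]%fset.
have mJ n (l : Mon) : (l \in Jn n) = (size (val l) <= n)%N.
  by rewrite in_fset mem_pmap_sub mem_polys.
have sJ n : \sum_(l <- Jn n) f (val l) = \sum_(a <- polys F n | a \is monic) f a.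
  rewrite -(big_map (fun l : Mon => val l) xpredT f) -[RHS]big_filter.
  apply: perm_big; apply: uniq_perm.
  - by rewrite map_inj_uniq ?fset_uniq //; exact: val_inj.
  - by rewrite filter_uniq // polys_uniq.
  move=> a; rewrite mem_filter; apply/mapP/andP => [[l lJ ->]|[am an]].
    by split; [exact: set_mem (valP l) | rewrite mem_polys -mJ].
  have aM : a \in Mon by exact/mem_set.
  by exists (exist _ a aM); rewrite // mJ -mem_polys.
have [N [M Sz]] := Sreg_ex z.
set B : R := q%:R ^+ ((N + M) * q).
have B0 : 0 < B by exact: qX_gt0.
have small n (l : Mon) : l \notin Jn n -> ab (f (val l)) <= B / q%:R ^+ n.
  rewrite mJ -ltnNge => nl; have lm : val l \is monic by exact: set_mem (valP l).
  have l0 := monic_neq0 lm.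
  rewrite fE absM abV; apply: (@le_trans _ _ (B / ab (inA (val l)))).
    rewrite -[leRHS]mul1r; apply: ler_pM; rewrite ?invr_ge0 ?abs_ge0 ?eA_term_small //.
    by rewrite invf_le1 ?ab_gt0 // ltW // ab_pi_gt1.
  rewrite ler_pM2l // lef_pV2 ?posrE ?qX_gt0 ?ab_gt0 ?inA_eq0 //.
  by rewrite leNgt ab_inA_lt -ltnNge.
have [|n|l [h1 h2]] := @net_ex _ _ C Mon (fun K => \sum_(l <- K) f (val l)) Jn.
- move=> e e0; have [k hk] := qpow_small F (divr_gt0 e0 B0); exists k => n kn K /fsubsetP sub.
  rewrite (sum_sub_uniq _ (fset_uniq (Jn n)) (fset_uniq K) sub) addrC addKr.
  apply: (@le_lt_trans _ _ (B / q%:R ^+ n)).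
    by apply: ab_sum_le => [|i]; [rewrite divr_ge0 ?(ltW B0) // exprn_ge0 // ler0n | exact: small].
  by rewrite mulrC -ltr_pdivlMr //; apply: le_lt_trans hk; exact: qV_le.
- by apply/fsubsetP => l; rewrite !mJ => h; rewrite (leq_trans h).
have -> : false_eisenstein pi z = l.
  by rewrite /false_eisenstein /usum; case: xgetP => [y _ hy|/(_ l)//]; exact: net_uniq hy h1.
apply: (lim_uniq h2).
apply: (lim_ext (N := 0%N)) (limN (limZ pi^-1 (Vlim_lim z))) => n _.
rewrite sJ V1_monic mulrN opprK mulr_sumr; apply: eq_bigr => a _.
by rewrite fE.
Qed.

Lemma E_series : exists2 Es : fps C, cvf q%:R Es & forall z, ab (u (val z)) * q%:R < 1 ->
  false_eisenstein pi z = fps_eval Es (u (val z)).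
Proof.
have [U hU] := u_poly hpi; have q0 := qR_gt0 F R; have q0' := ltW q0.
pose X (b : A) := if b == 0 then 0 else fps_const (inA b) * U b.
have hX n (b : A) : (n < size b)%N -> bnd (q%:R ^- n) q%:R (X b).
  move=> nb; have b0 : b != 0 by rewrite -size_poly_gt0 (leq_trans _ nb).
  have [h _ _] := hU b b0; rewrite /X (negbTE b0).
  apply: bnd_leM q0' _ (bndM (abs_ge0 _) _ q0' (bnd_const (inA b) q0') h); last first.
    by rewrite invr_ge0 exprn_ge0.
  have nd : (n <= (size b).-1)%N by rewrite -ltnS prednK // size_poly_gt0.
  rewrite abs_embA // ler_pdivrMr ?qX_gt0 //.
  apply: (@le_trans _ _ (q%:R ^- (size b).-1 * q%:R ^+ (q ^ (size b).-1))).
    rewrite mulrC ler_pdivlMr ?qX_gt0 // -exprD addnn; apply: qX_le; exact: leq_qexp.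
  by rewrite ler_wpM2r ?exprn_ge0 //; exact: qV_le.
have cX b : cvf q%:R (X b).
  have [->|b0] := eqVneq b 0; first by rewrite /X eqxx; exact: cvf0.
  by apply: cvf_bnd (hX 0%N b _); rewrite size_poly_gt0.
pose G n := \sum_(b <- polys F n) X b.
have cG n : cvf q%:R (G n) by apply: cvf_sum.
have sub n : {subset polys F n <= polys F n.+1}.
  by move=> a; rewrite !mem_polys => h; rewrite (leq_trans h).
have tail n : bnd (q%:R ^- n) q%:R (G n.+1 - G n).
  rewrite /G (sum_sub_uniq _ (polys_uniq F n) (polys_uniq F n.+1) (sub n)) addrC addKr.
  apply: bnd_sum => // [|b]; first by rewrite invr_ge0 exprn_ge0.
  by rewrite mem_polys -ltnNge; exact: hX.
have [||n|H cH hH] := fps_lim (G := G) q0'.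
- exact: cG.
- move=> e e0; have [k hk] := qpow_small F e0; exists k => n kn.
  by apply: bnd_leM q0' _ (tail n); apply: ltW; apply: le_lt_trans hk; exact: qV_le.
- exact: cvf_bnd (tail n).
exists (- H) => [|z zr]; first exact: cvfN.
rewrite (evalN q0' zr cH) E_Vlim; congr (- _).
apply: (lim_uniq _ (fps_lim_eval q0' zr cG cH hH)).
apply: (lim_ext (N := 0%N)) (limZ pi^-1 (Vlim_lim z)) => n _.
rewrite /G (eval_sum _ q0' zr) // /V1 mulr_sumr big_mkcond; apply: eq_bigr => b _.
rewrite /X; case: eqVneq => [_|b0]; first by rewrite eval0.
have [h _ hu] := hU b b0.
rewrite (evalM q0' zr (cvf_const _ q0') (cvf_bnd h)) eval_const -hu ?eA_Om1 // (uE hpi).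
by rewrite invfM mulrCA.
Qed.

End FalseEisenstein.

(** * Regular functions and their expansions *)

Section Regular.
Variables (F : finFieldType) (R : realType) (C : cinf F R).
Local Notation ab := (@absC F R C).
Local Notation q := (#|F|).
Local Notation theta := (@theta F R C).
Local Notation Om := (Omega C).
Local Notation Sreg := (@Sreg F R C).
Local Notation Tpos := (@Tpos F R C).
Local Notation s2 := (@s2 F R C).
Local Notation "a ~> l" := (cvg_to ab a l) (at level 70).
Implicit Types (z : Om) (f : Om -> fps C) (c d : fps (fps C)).
Variable pi : C.
Hypothesis hpi : carlitz_period pi.
Local Notation u := (@u F R C pi).
Local Notation regular := (@regular F R C pi).

Definition dc t c : fps C := Fps (fun m => fps_eval (coef c m) t).
Definition dbnd (B rho : R) c := forall m, bnd (B * rho ^+ m) rho (coef c m).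

Section Dc.
Variables (rho : R) (t : C).
Hypotheses (r0 : 0 <= rho) (tr : ab t * rho < 1).

Lemma dbnd_cvf B c m : dbnd B rho c -> cvf rho (coef c m).
Proof. by move=> h; exact: cvf_bnd (h m). Qed.

Lemma dc_cvf B c : dbnd B rho c -> cvf rho (dc t c).
Proof. by move=> h; apply: (@cvf_bnd _ _ _ B) => m; exact: (ab_eval r0 tr (h m)). Qed.

Lemma dcD B B' c d : dbnd B rho c -> dbnd B' rho d -> dc t (c + d) = dc t c + dc t d.
Proof.
move=> hc hd; apply: fpsP => m; rewrite fcoefD /= (evalD r0 tr) //.
  exact: dbnd_cvf hc.
exact: dbnd_cvf hd.
Qed.

Lemma dcM B B' c d : dbnd B rho c -> dbnd B' rho d -> dc t (c * d) = dc t c * dc t d.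
Proof.
move=> hc hd; apply: fpsP => m; rewrite fcoefM.
rewrite -[LHS]/(fps_eval (\sum_(i < m.+1) coef c i * coef d (m - i)) t).
have h (i : 'I_m.+1) : cvf rho (coef c i * coef d (m - i)).
  by apply: cvfM => //; [exact: dbnd_cvf hc | exact: dbnd_cvf hd].
rewrite (eval_sum _ r0 tr) //; apply: eq_bigr => i _.
by rewrite (evalM r0 tr); [|exact: dbnd_cvf hc|exact: dbnd_cvf hd].
Qed.
End Dc.

Lemma dbnd_le B B' (r r' : R) c : 0 <= r -> 0 <= B -> B <= B' -> r <= r' -> dbnd B r c -> dbnd B' r' c.
Proof.
move=> r0 B0 BB rr h m.
have h1 : r ^+ m <= r' ^+ m by rewrite lerXn2r ?nnegrE // (le_trans r0).
have h2 := exprn_ge0 m r0.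
exact: bnd_le r0 (mulr_ge0 B0 h2) (ler_pM B0 h2 BB h1) rr (h m).
Qed.

Lemma dbndD B B' (r : R) c d : 0 <= r -> 0 <= B -> 0 <= B' -> dbnd B r c -> dbnd B' r d -> dbnd (B + B') r (c + d).
Proof.
move=> r0 B0 B'0 hc hd m; have h := exprn_ge0 m r0.
have h1 : B * r ^+ m <= (B + B') * r ^+ m by apply: ler_wpM2r h _ _ _; rewrite lerDl.
have h2 : B' * r ^+ m <= (B + B') * r ^+ m by apply: ler_wpM2r h _ _ _; rewrite lerDr.
by apply: bndD; [exact: bnd_leM r0 h1 (hc m) | exact: bnd_leM r0 h2 (hd m)].
Qed.

Lemma dbndM B B' (r : R) c d : 0 <= r -> 0 <= B -> 0 <= B' -> dbnd B r c -> dbnd B' r d -> dbnd (B * B') r (c * d).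
Proof.
move=> r0 B0 B'0 hc hd m; rewrite fcoefM; apply: bnd_sum => // [|i _].
  by rewrite !mulr_ge0 ?exprn_ge0.
have im : (i <= m)%N by rewrite -ltnS.
have hp k (X : R) : 0 <= X -> 0 <= X * r ^+ k by move=> X0; rewrite mulr_ge0 ?exprn_ge0.
have := bndM (hp i _ B0) (hp (m - i)%N _ B'0) r0 (hc i) (hd (m - i)%N).
by rewrite mulrACA -exprD subnKC.
Qed.

(* xp c f: f is regular and has the u-expansion with coefficients c_m in C[[t]]. *)
Definition xp c f := exists rho, exists2 B : R, 0 < rho /\ 0 <= B &
  [/\ forall z, cvf rho (f z),
      forall t, ab t * rho < 1 -> forall N M, appr (Sreg N M) (fun z => fps_eval (f z) t),
      forall z a, f (translate z a) = f z,
      dbnd B rho c &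
      forall z t, ab (u (val z)) * rho < 1 -> ab t * rho < 1 ->
        fps_eval (f z) t = fps_eval (dc t c) (u (val z))].

Lemma mul_lt1 (x r r' : R) : 0 <= x -> r <= r' -> x * r' < 1 -> x * r < 1.
Proof. by move=> x0 rr; apply: le_lt_trans; rewrite ler_wpM2l. Qed.

Lemma xp_common c d f g : xp c f -> xp d g -> exists rho, exists2 B : R, 0 < rho /\ 0 <= B &
  [/\ [/\ forall z, cvf rho (f z), forall z, cvf rho (g z), dbnd B rho c & dbnd B rho d],
      forall t, ab t * rho < 1 -> forall N M, appr (Sreg N M) (fun z => fps_eval (f z) t) /\
         appr (Sreg N M) (fun z => fps_eval (g z) t),
      forall z a, f (translate z a) = f z /\ g (translate z a) = g z &
      forall z t, ab (u (val z)) * rho < 1 -> ab t * rho < 1 ->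
        fps_eval (f z) t = fps_eval (dc t c) (u (val z)) /\
        fps_eval (g z) t = fps_eval (dc t d) (u (val z))].
Proof.
move=> [r [B [r0 B0] [f1 f2 f3 f4 f5]]] [r' [B' [r'0 B'0] [g1 g2 g3 g4 g5]]].
exists (Num.max r r'), (Num.max B B'); first by rewrite lt_max le_max r0 B0.
have m1 x : 0 <= x -> x * Num.max r r' < 1 -> x * r < 1.
  by move=> x0; apply: mul_lt1 => //; rewrite le_max lexx.
have m2 x : 0 <= x -> x * Num.max r r' < 1 -> x * r' < 1.
  by move=> x0; apply: mul_lt1 => //; rewrite le_max lexx orbT.
split.
- split=> [z|z||].
  + by apply: cvf_le (f1 z); rewrite ?le_max ?lexx // ltW.
  + by apply: cvf_le (g1 z); rewrite ?le_max ?lexx ?orbT // ltW.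
  + by apply: dbnd_le f4; rewrite ?le_max ?lexx // ltW.
  + by apply: dbnd_le g4; rewrite ?le_max ?lexx ?orbT // ltW.
- by move=> t tr N M; split; [apply: f2; exact: m1 (abs_ge0 _) tr | apply: g2; exact: m2 (abs_ge0 _) tr].
- by move=> z a; rewrite f3 g3.
by move=> z t zr tr; rewrite f5 ?g5 //; rewrite ?(m1 _ (abs_ge0 _) zr) ?(m2 _ (abs_ge0 _) zr) ?(m1 _ (abs_ge0 _) tr) ?(m2 _ (abs_ge0 _) tr).
Qed.

Lemma xpD c d f g : xp c f -> xp d g -> xp (c + d) (fun z => f z + g z).
Proof.
move=> hf hg; have [r [B [r0 B0] [[f1 g1 f4 g4] f2 f3 f5]]] := xp_common hf hg.
have r0' := ltW r0; exists r, (B + B); first by rewrite addr_ge0.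
split=> [z|t tr N M|z a||z t zr tr].
- exact: cvfD.
- have [h1 h2] := f2 t tr N M; apply: appr_ext (apprD h1 h2) => z _.
  by rewrite (evalD r0' tr (f1 z) (g1 z)).
- by have [-> ->] := f3 z a.
- exact: dbndD.
rewrite (evalD r0' tr (f1 z) (g1 z)) (dcD r0' tr f4 g4).
rewrite (evalD r0' zr (dc_cvf r0' tr f4) (dc_cvf r0' tr g4)).
by have [-> ->] := f5 z t zr tr.
Qed.

Lemma xpM c d f g : xp c f -> xp d g -> xp (c * d) (fun z => f z * g z).
Proof.
move=> hf hg; have [r [B [r0 B0] [[f1 g1 f4 g4] f2 f3 f5]]] := xp_common hf hg.
have r0' := ltW r0; exists r, (B * B); first by rewrite mulr_ge0.
split=> [z|t tr N M|z a||z t zr tr].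
- exact: cvfM.
- have [h1 h2] := f2 t tr N M; apply: appr_ext (apprM h1 h2) => z _.
  by rewrite (evalM r0' tr (f1 z) (g1 z)).
- by have [-> ->] := f3 z a.
- exact: dbndM.
rewrite (evalM r0' tr (f1 z) (g1 z)) (dcM r0' tr f4 g4).
rewrite (evalM r0' zr (dc_cvf r0' tr f4) (dc_cvf r0' tr g4)).
by have [-> ->] := f5 z t zr tr.
Qed.

Lemma xp_const T : Tpos T -> xp (fps_const T) (fun=> T).
Proof.
move=> /TposP[r r0 [B B0 hB]]; exists (1 + r), B; first by rewrite ltr_wpDr.
have r1 : 0 <= 1 + r by rewrite addr_ge0.
have hT : bnd B (1 + r) T by apply: bnd_le hB; rewrite // lerDr.
split=> [z|t tr N M|z a|m|z t zr tr].
- exact: cvf_bnd hT.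
- exact: appr_cst.
- by [].
- rewrite coef_const; case: ifP => [/eqP ->|_]; first by rewrite expr0 mulr1.
  by apply: bnd0; rewrite // mulr_ge0 ?exprn_ge0.
have -> : dc t (fps_const T) = fps_const (fps_eval T t).
  by apply: fpsP => m; rewrite coef_const /= coefC; case: ifP; rewrite ?eval0.
by rewrite eval_const.
Qed.

Lemma xp_ext c f g : (forall z, f z = g z) -> xp c f -> xp c g.
Proof. by move=> e; have -> : f = g by apply: funext. Qed.

Lemma xp_regular c f : xp c f -> regular f.
Proof.
move=> [r [B [r0 B0] [f1 f2 f3 f4 f5]]]; have r0' := ltW r0.
have lt t : ab t < r^-1 -> ab t * r < 1 by rewrite -ltr_pdivlMr // div1r.
split=> //.
- exists r^-1; rewrite ?invr_gt0 // => z t /lt tr.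
  by exists (fps_eval (f z) t); exact: series_cvf r0' tr (f1 z).
- by exists r^-1; rewrite ?invr_gt0 // => t /lt tr; apply/rigidP; exact: f2.
exists r^-1; rewrite ?invr_gt0 //; exists (fun n m => coef (coef c m) n) => z t /lt zr /lt tr.
by rewrite f5 //; have := dfun_usum r0' tr zr f4.
Qed.

(** At one point where t and u(z) are both nonzero the terms of the double expansion are bounded,
    which gives geometric bounds on all coefficients. *)
Lemma regular_xp f : regular f -> exists c, xp c f.
Proof.
move=> [[r1 r10 h1] [r2 r20 h2] h3 [r3 r30 [c hc]]].
have [t t0] : exists2 t : C, t != 0 & ab t < Num.min r1 (Num.min r2 r3).
  by apply: ab_ex_small; rewrite !lt_min r10 r20.
rewrite !lt_min => /andP[t1 /andP[t2 t3]].
have [z zr] := u_small hpi r30.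
have [M M0 hM] := usum_bounded (hc z t zr t3).
have t0' : 0 < ab t by rewrite ab_gt0.
have u0 : 0 < ab (u (val z)) by rewrite ab_gt0 (u_neq0 hpi).
pose r := Num.max (ab t)^-1 (Num.max (ab (u (val z)))^-1 r3^-1).
have rt : (ab t)^-1 <= r by rewrite le_max lexx.
have ru : (ab (u (val z)))^-1 <= r by rewrite !le_max lexx orbT.
have rr : r3^-1 <= r by rewrite !le_max lexx !orbT.
have r0 : 0 < r by apply: lt_le_trans rt; rewrite invr_gt0.
have lt (x : C) : ab x * r < 1 -> ab x < ab t /\ ab x < r3.
  rewrite -ltr_pdivlMr // div1r => xr; split; apply: lt_le_trans xr _.
    by rewrite -[leRHS]invrK lef_pV2 ?posrE ?invr_gt0.
  by rewrite -[leRHS]invrK lef_pV2 ?posrE ?invr_gt0.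
pose d : fps (fps C) := Fps (fun m => Fps (fun n => c n m)).
have hd : dbnd M r d.
  move=> m n; have := hM (n, m) => /=; rewrite !absM !abX -!ler_pdivlMr ?exprn_gt0 // => h.
  apply: le_trans h _; rewrite -!exprVn -!mulrA ler_pM2l //.
  by apply: ler_pM; rewrite ?exprn_ge0 ?invr_ge0 ?abs_ge0 // lerXn2r ?nnegrE ?invr_ge0 ?abs_ge0 // ltW.
exists d, r, M; first by rewrite (ltW M0).
split=> // [y|s sr N' M'|y s yr sr].
- have [s hs] := h1 y t t1; apply: cvf_le rt (series_cvf_radius t0 hs).
  by rewrite invr_ge0 abs_ge0.
- by have [st _] := lt s sr; have /rigidP := h2 s (lt_trans st t2); apply.
have [_ y3] := lt _ yr; have [_ s3] := lt _ sr.
exact: net_uniq (hc y s y3 s3) (dfun_usum (ltW r0) sr yr hd).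
Qed.

(** u takes arbitrarily small nonzero values, so the identity theorem applies in u for each small t,
    and then in t. *)
Lemma xp_uniq c f : xp c f -> (forall z, f z = 0) -> c = 0.
Proof.
move=> [r [B [r0 B0] [f1 f2 f3 f4 f5]]] hf; have r0' := ltW r0.
apply: fpsP => m; rewrite fcoef0.
apply: (eval_ident_disc r0' (dbnd_cvf m f4)); exists r^-1; rewrite ?invr_gt0 // => t.
move=> ht; have tr : ab t * r < 1 by rewrite -ltr_pdivlMr // div1r.
suff /(congr1 (fun g => coef g m)) : dc t c = 0 by [].
apply: (eval_ident r0' (dc_cvf r0' tr f4)) => e e0.
have [|z] := @u_small _ _ _ _ hpi (Num.min e r^-1); first by rewrite lt_min e0 invr_gt0.
rewrite lt_min => /andP[ze zr]; exists (u (val z)); split=> //; first exact: u_neq0.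
rewrite -f5 // ?hf ?eval0 //; by rewrite -ltr_pdivlMr // div1r.
Qed.

Lemma xp_cl (phi : Om -> C) (G : fps C) (r : R) : 0 < r -> cvf r G ->
  (forall N M, appr (Sreg N M) phi) -> (forall z a, phi (translate z a) = phi z) ->
  (forall z, ab (u (val z)) * r < 1 -> phi z = fps_eval G (u (val z))) ->
  xp (Fps (fun m => fps_const (coef G m))) (fun z => fps_const (phi z)).
Proof.
move=> r0 [B B0 hG] hr ht he; have r0' := ltW r0; exists r, B => //; split=> [z|t tr N M|z a|m|z t zr tr].
- exact: cvf_const.
- by apply: appr_ext (hr N M) => z _; rewrite eval_const.
- by rewrite ht.
- by move=> n; apply: le_trans (bnd_const _ r0' n) _; rewrite ler_wpM2r ?exprn_ge0.
rewrite eval_const he //; congr fps_eval; apply: fpsP => m.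
by rewrite /= eval_const.
Qed.

(** The data list the coefficients of t^i as series in u, while [xp] wants the transposed array;
    both have the same unordered double sum. The cases k = 0 and k = 1 serve s_2 and its twist. *)
Lemma xp_family (k : nat) (S : nat -> fps C) (r : R) : 1 <= r ->
  (forall i, bnd 1 r (S i)) ->
  (forall i z, ab (u (val z)) * r < 1 -> elat (val z) (theta ^- i.+1) ^+ (q ^ k) = fps_eval (S i) (u (val z))) ->
  xp (Fps (fun m => Fps (fun i => coef (S i) m))) (fun z => twist k (s2 z)).
Proof.
move=> r1 hS he; have r0 : 0 < r by exact: lt_le_trans r1.
have r0' := ltW r0; have q0 := qR_gt0 F R; have q1 := qR_gt1 F R.
have cE z i : coef (twist k (s2 z)) i = elat (val z) (theta ^- i.+1) ^+ (q ^ k) by rewrite /= div1r.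
(* For i large compared with the affinoid, |e_z(theta^-(i+1))| is the absolute value of its
   argument, so only finitely many coefficients need a separate bound. *)
have small N M z i : Sreg N M (val z) -> (N + M < i.+1)%N -> ab (coef (twist k (s2 z)) i) <= 1.
  move=> Sz h; rewrite cE abX (elat_ab_small Sz); last first.
    by rewrite abV ab_thetaX ltr_pdivrMl ?qX_gt0 // mulr1 ltr_eXn2l.
  rewrite abV ab_thetaX exprn_ile1 ?invr_ge0 ?exprn_ge0 ?(ltW q0) // qV_le1 //.
have bd N M : exists2 B : R, 0 < B & forall z, Sreg N M (val z) -> bnd B 1 (twist k (s2 z)).
  have h i : exists B : R, 0 < B /\ forall z, Sreg N M (val z) -> ab (elat (val z) (theta ^- i.+1) ^+ (q ^ k)) <= B.
    have [B B0 hB] := appr_bounded (appr_elat (appr_cst N M (theta ^- i.+1))).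
    exists (B ^+ (q ^ k)); rewrite exprn_gt0 //; split=> // z Sz.
    by rewrite abX lerXn2r ?nnegrE ?abs_ge0 ?(ltW B0) // hB.
  have [B hB] := choice h; exists (1 + \sum_(i < N + M) B i).
    by rewrite ltr_wpDr // sumr_ge0 // => i _; apply: ltW; case: (hB i).
  move=> z Sz i; rewrite expr1n mulr1.
  have [iK|Ki] := ltnP i (N + M).
    rewrite (bigD1 (Ordinal iK)) //= -[leLHS]/(ab (coef (twist k (s2 z)) i)) cE.
    have [B0 /(_ z Sz) h1] := hB i.
    have h2 : 0 <= \sum_(j < N + M | j != Ordinal iK) B j by apply: sumr_ge0 => j _; apply: ltW; case: (hB j).
    by apply: le_trans h1 _; rewrite addrCA lerDl addr_ge0.
  apply: le_trans (small N M z i Sz _) _ => //.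
  by rewrite lerDl; apply: sumr_ge0 => j _; apply: ltW; case: (hB j).
have cv z : cvf r (twist k (s2 z)).
  by have [N [M Sz]] := Sreg_ex z; have [B B0 hB] := bd N M; apply: cvf_le r1 (cvf_bnd (hB z Sz)).
have cl : dbnd 1 r (Fps (fun m => Fps (fun i => coef (S i) m))).
  move=> m i; rewrite mul1r; apply: le_trans (hS i m) _; rewrite mul1r ler_peMr ?exprn_ge0 //.
  exact: exprn_ege1.
exists r, 1 => //; split=> [//|t tr N M|z a|//|z t zr tr].
- have [B B0 hB] := bd N M.
  have t1 : ab t * 1 < 1 by apply: mul_lt1 r1 tr; exact: abs_ge0.
  apply: appr_lim => e e0; rewrite mulr1 in t1.
  have [n hn] := geo_null (abs_ge0 t) t1 (divr_gt0 e0 B0).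
  exists (fun z => \sum_(i < n) elat (val z) (theta ^- i.+1) ^+ (q ^ k) * t ^+ i); split.
    apply: appr_sum => i _; apply: apprM; last exact: appr_cst.
    by apply: apprX; apply: appr_elat; exact: appr_cst.
  move=> z Sz; have ser := series_bnd ler01 _ (hB z Sz).
  have t1' : ab t * 1 < 1 by rewrite mulr1.
  have hle i : (n <= i)%N -> ab (coef (twist k (s2 z)) i * t ^+ i) <= B * ab t ^+ n.
    move=> ni; rewrite absM abX; have := hB z Sz i; rewrite expr1n mulr1 => h.
    by apply: ler_pM; rewrite ?abs_ge0 ?exprn_ge0 ?abs_ge0 // ler_wiXn2l ?abs_ge0 // ltW.
  have := series_tail _ hle (ser t t1'); rewrite mulr_ge0 ?exprn_ge0 ?abs_ge0 ?(ltW B0) // => /(_ isT) h.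
  rewrite (eq_bigr (fun i : 'I_n => coef (twist k (s2 z)) i * t ^+ i)); last by move=> i _; rewrite cE.
  by apply: le_lt_trans h _; rewrite mulrC -ltr_pdivlMr // hn.
- rewrite translateE; congr twist; rewrite s2_mob ?J_T ?invr1 ?rmorph1 ?mul1r; last exact: GL_T.
  by rewrite /bJ !mx2E bar0 bar1 mul0r add0r mul1r.
have h1 := @dfun_usum _ _ C 1 r (fun i => S i) (u (val z)) t r0' zr tr _.
have h2 := dfun_usum r0' tr zr cl.
have -> : fps_eval (twist k (s2 z)) t = dfun S (u (val z)) t.
  rewrite /dfun; congr fps_eval; apply: fpsP => i.
  by rewrite cE he.
have {}h1 : usum_to ab (fun nm : nat * nat => coef (S nm.2) nm.1 * u (val z) ^+ nm.1 * t ^+ nm.2) (dfun S (u (val z)) t).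
  apply: h1 => i; apply: bnd_leM r0' _ (hS i); rewrite mul1r; exact: exprn_ege1.
apply: (net_uniq _ h2) => e e0; have [J0 hJ] := h1 e e0.
exists [fset (p.2, p.1) | p in J0]%fset => J /fsubsetP sub.
have := hJ [fset (p.2, p.1) | p in J]%fset.
rewrite (_ : \sum_(i <- [fset (p.2, p.1) | p in J]%fset) _ = \sum_(i <- J) coef (coef (Fps (fun m => Fps (fun i => coef (S i) m))) i.2) i.1 * t ^+ i.1 * u (val z) ^+ i.2).
  apply; apply/fsubsetP => p pJ; apply/imfsetP; exists (p.2, p.1); last by case: p pJ.
  by apply: sub; apply/imfsetP; exists p.
rewrite big_imfset /=; last by move=> [a b] [a' b'] _ _ [-> ->].
by apply: eq_bigr => p _; rewrite mulrAC.
Qed.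

End Regular.

(** * Orders of vanishing, and powers of the units of F *)

Section Orders.
Variable K : fieldType.
Implicit Types c d : fps (fps K).

Definition ordge k c := forall i, (i < k)%N -> coef c i = 0.

Lemma ordgeM a b c d : ordge a c -> ordge b d ->
  ordge (a + b) (c * d) /\ coef (c * d) (a + b) = coef c a * coef d b.
Proof.
move=> hc hd; split=> [i iab|].
  rewrite fcoefM big1 // => j _; have [ja|aj] := ltnP j a; first by rewrite hc // mul0r.
  by rewrite hd ?mulr0 //; have := ltn_ord j; lia.
have lt : (a < (a + b).+1)%N by lia.
rewrite fcoefM (bigD1 (Ordinal lt)) //= addKn big1 ?addr0 // => j ja.
have [ja'|aj] := ltnP j a; first by rewrite hc // mul0r.
rewrite hd ?mulr0 //; have : (a < j)%N by rewrite ltn_neqAle aj andbT eq_sym.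
have := ltn_ord j; lia.
Qed.

Lemma ordge0 c : ordge 0 c. Proof. by []. Qed.

Lemma coef0_exp c k : coef (c ^+ k) 0 = coef c 0 ^+ k.
Proof.
elim: k => [|k IH]; last by rewrite !exprS fcoefM0 IH.
by rewrite !expr0 -(rmorph1 (@fps_const (fps K))) coef_const.
Qed.

Lemma ordgeX c k : ordge 1 c -> ordge k (c ^+ k) /\ coef (c ^+ k) k = coef c 1 ^+ k.
Proof.
move=> hc; elim: k => [|k [IH1 IH2]]; first by rewrite coef0_exp !expr0.
by rewrite !exprS -IH2 -add1n; exact: ordgeM.
Qed.

End Orders.

Section UnitPowers.
Variable F : finFieldType.
Local Notation q := (#|F|).

Lemma unit_pow (x : F) : x != 0 -> x ^+ q.-1 = 1.
Proof.
move=> x0; apply: (mulfI x0); rewrite -exprS prednK ?mulr1 ?expf_card //.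
exact: qpos.
Qed.

Lemma unit_pow_mod (x : F) k : x != 0 -> x ^+ (k %% q.-1) = x ^+ k.
Proof.
by move=> x0; rewrite {2}(divn_eq k q.-1) exprD mulnC exprM unit_pow // expr1n mul1r.
Qed.

(** Otherwise X^d - 1 with 0 < d < q - 1 would have q - 1 roots. *)
Lemma unit_pow_eq k m : (forall x : F, x != 0 -> x ^+ k = x ^+ m) -> k = m %[mod q.-1].
Proof.
wlog km : k m / (m <= k)%N.
  move=> H h; case: (leqP m k) => mk; first exact: H.
  by apply/esym/H => [|x x0]; [exact: ltnW | rewrite h].
move=> h; rewrite -(subnKC km); set e := (k - m)%N.
have he (x : F) : x != 0 -> x ^+ (e %% q.-1) = 1.
  move=> x0; rewrite unit_pow_mod //; apply: (mulfI (expf_neq0 m x0)).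
  by rewrite mulr1 -exprD subnKC // h.
suff : (e %% q.-1 = 0)%N by move=> e0; rewrite -modnDmr e0 addn0.
apply/eqP; apply: contraT; rewrite -lt0n => d0; set d := (e %% q.-1)%N in he d0.
have p0 : ('X^d - 1%:P : {poly F}) != 0 by rewrite -size_poly_gt0 size_XnsubC.
have := max_poly_roots p0 (rs := [seq x <- enum F | x != 0]).
rewrite size_XnsubC // filter_uniq ?enum_uniq // => H.
have /H : all (root ('X^d - 1%:P)) [seq x <- enum F | x != 0].
  apply/allP => x; rewrite mem_filter => /andP[x0 _].
  by rewrite /root hornerD hornerN hornerXn hornerC he // subrr.
move=> /(_ isT); rewrite ltnS leqNgt => /negP; case.
have -> : size [seq x <- enum F | x != 0] = q.-1.
  rewrite -(cardC1 (0 : F)) cardE; apply: perm_size; apply: uniq_perm.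
  - by rewrite filter_uniq // enum_uniq.
  - exact: enum_uniq.
  by move=> x; rewrite mem_filter !mem_enum andbT !inE.
by rewrite ltn_mod q1_gt0.
Qed.

End UnitPowers.

(** * Depth 0: vanishing, and congruences for order and weight *)

Section DepthZero.
Variables (F : finFieldType) (R : realType) (C : cinf F R).
Local Notation ab := (@absC F R C).
Local Notation q := (#|F|).
Local Notation A := {poly F}.
Local Notation inA := (@embA F R C).
Local Notation theta := (@theta F R C).
Local Notation Om := (Omega C).
Local Notation Sreg := (@Sreg F R C).
Local Notation vtx n := (vertex 0 (theta ^+ n)).
Local Notation eA := (@eA F R C).
Local Notation Tpos := (@Tpos F R C).
Local Notation s2 := (@s2 F R C).
Local Notation GL := (@GL2A F).
Local Notation "c '%:K'" := (inA c%:P) (at level 2, format "c '%:K'").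
Implicit Types (z : Om) (f : Om -> fps C) (c d : fps (fps C)).

(** The type is a natural number so that types add without reduction; only its class modulo q - 1
    matters ([auto_mod]). *)
Definition auto (mu nu : int) (m : nat) (gam : 'M[A]_2) z : fps C :=
  fps_const (inA (\det gam) ^- m) * fps_const (J gam z ^ mu) * bJ gam z ^ nu.

Definition law mu nu m f := forall gam z, GL gam -> f (mob gam z) = auto mu nu m gam z * f z.

Lemma auto_unit mu nu m gam z : GL gam -> auto mu nu m gam z \is a GRing.unit.
Proof.
move=> gG; rewrite /auto !unitrM !fps_const_unit ?invr_eq0 ?expf_neq0 ?inA_det_neq0 //=.
  by rewrite unitrXz // bJ_unit.
by rewrite expfz_neq0 // J_neq0.
Qed.

Lemma autoM mu nu m mu' nu' m' gam z : GL gam ->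
  auto mu nu m gam z * auto mu' nu' m' gam z = auto (mu + mu') (nu + nu') (m + m') gam z.
Proof.
move=> gG; rewrite /auto exprD invfM rmorphM expfzDr ?J_neq0 // rmorphM exprzDr ?bJ_unit //.
ring.
Qed.

Lemma auto_mod mu nu m m' gam z : GL gam -> m = m' %[mod q.-1] -> auto mu nu m gam z = auto mu nu m' gam z.
Proof.
move=> gG e; rewrite /auto; have [x x0 ->] := GL_det gG.
have e1 k : inA x%:P ^+ k = inA (x ^+ k)%:P by rewrite polyC_exp rmorphXn.
by rewrite !e1 -(unit_pow_mod m x0) e unit_pow_mod.
Qed.

Lemma lawM mu nu m mu' nu' m' f g : law mu nu m f -> law mu' nu' m' g ->
  law (mu + mu') (nu + nu') (m + m') (fun z => f z * g z).
Proof.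
by move=> hf hg gam z gG; rewrite hf // hg // -autoM // mulrACA.
Qed.

Lemma lawD mu nu m f g : law mu nu m f -> law mu nu m g -> law mu nu m (fun z => f z + g z).
Proof. by move=> hf hg gam z gG; rewrite hf // hg // mulrDr. Qed.

Lemma law_scale mu nu m f T : law mu nu m f -> law mu nu m (fun z => T * f z).
Proof. by move=> hf gam z gG; rewrite hf // mulrCA. Qed.

Lemma law1 : law 0 0 0 (fun=> 1).
Proof.
by move=> gam z gG; rewrite /auto expr0 invr1 !expr0z !rmorph1 !mulr1.
Qed.

Lemma lawX mu nu m f k : law mu nu m f -> law (mu *+ k) (nu *+ k) (m * k) (fun z => f z ^+ k).
Proof.
move=> hf; elim: k => [|k IH]; first by rewrite !mulr0n muln0; exact: law1.
by rewrite !mulrS mulnS => gam z gG; rewrite !exprS; exact: (lawM hf IH) _ _ gG.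
Qed.

Lemma law_mod mu nu m m' f : m = m' %[mod q.-1] -> law mu nu m f -> law mu nu m' f.
Proof. by move=> e hf gam z gG; rewrite hf // (auto_mod _ _ _ gG e). Qed.

Lemma law_s2 : law (-1) 1 0 s2.
Proof.
move=> gam z gG; rewrite s2_mob // /auto expr0 invr1 rmorph1 mul1r expr1z exprN1 mulrA.
by [].
Qed.

(** By [elat_ab_far] the coefficients have absolute value q^-(i+1), so the constant one
    dominates. *)
Lemma s2_far N z t : Sreg N 1 (val z) -> ab t < 1 -> ab (fps_eval (s2 z) t) = q%:R^-1.
Proof.
move=> Sz t1; have q0 := qR_gt0 F R; have q1 := qR_gt1 F R.
have cE i : ab (coef (s2 z) i) = q%:R ^- i.+1.
  rewrite -[coef _ i]/(elat (val z) (1 / theta ^+ i.+1)) div1r (elat_ab_far Sz).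
  - by rewrite abV ab_thetaX.
  - by apply/KinfV/KinfX; exact: Kinf_inA.
  - by rewrite abV ab_thetaX; exact: (qV_le F R (ltn0Sn i)).
pose x := coef (s2 z) 0; have xE : ab x = q%:R^-1 by rewrite cE.
have hb : bnd (q%:R ^- 2) 1 (s2 z - fps_const x).
  move=> i; rewrite expr1n mulr1 fcoefB coef_const; case: i => [|i]; first by rewrite subrr ab0 invr_ge0 exprn_ge0 // ltW.
  by rewrite subr0 cE; exact: (qV_le F R (_ : 2 <= i.+2)%N).
have t1' : ab t * 1 < 1 by rewrite mulr1.
have := ab_eval ler01 t1' hb; have e : s2 z = (s2 z - fps_const x) + fps_const x by rewrite subrK.
move=> hle; rewrite {}[in LHS]e (evalD ler01 t1' (cvf_bnd hb) (cvf_const _ ler01)) eval_const abD_r ?xE //.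
apply: le_lt_trans hle _; rewrite ltf_pV2 ?posrE ?qX_gt0 // expr2 ltr_pMl //.
Qed.

Lemma eval_order (r B : R) (G : fps C) k v : 0 < r -> ab v * r < 1 -> bnd B r G ->
  (forall i, (i < k)%N -> coef G i = 0) -> ab (fps_eval G v) <= B * r ^+ k * ab v ^+ k.
Proof.
move=> r0 vr hG h0; rewrite (fX_div h0).
have hb : bnd (B * r ^+ k) r (Fps (fun i => coef G (i + k))).
  by move=> i; rewrite -mulrA -exprD addnC; exact: hG.
rewrite (eval_fXM _ r0 vr (cvf_bnd hb)) absM abX mulrC ler_wpM2r ?exprn_ge0 ?abs_ge0 //.
exact: ab_eval (ltW r0) vr hb.
Qed.

Variable pi : C.
Hypothesis hpi : carlitz_period pi.
Local Notation u := (@u F R C pi).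
Local Notation xp := (@xp F R C pi).

Lemma xp_s2_ex : exists2 cs, xp cs s2 & coef cs 0 = Fps (fun i => eA (theta ^- i.+1)).
Proof.
have [S hS] := elat_series hpi; set r := q%:R * ab pi in hS.
have r1 : 1 <= r by rewrite /r; apply: mulr_ege1; apply: ltW; [exact: qR_gt1 | exact: ab_pi_gt1].
exists (Fps (fun m => Fps (fun i => coef (S i) m))); last first.
  by apply: fpsP => i /=; have [_ -> _] := hS i.
apply: (xp_ext (f := fun z => twist 0 (s2 z))).
  by move=> z; apply: fpsP => i /=; rewrite expn0 expr1.
apply: (xp_family r1) => [i|i z zr]; have [h1 _ h3] := hS i.
  apply: bnd_leM _ _ h1; first exact: le_trans ler01 r1.
  exact: qV_le1.
by rewrite expn0 expr1 h3.
Qed.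

Lemma sigma_Tpos : Tpos (Fps (fun i => eA (theta ^- i.+1))).
Proof.
apply: (@Tpos_cvf _ _ _ 1) => //; apply: (@cvf_bnd _ _ _ 1) => i.
by rewrite /= ab_eA_theta_pow expr1n mulr1 qV_le1.
Qed.

Lemma sigma_coef0 : coef (Fps (fun i => eA (theta ^- i.+1))) 0 != 0.
Proof. by rewrite -ab_gt0 /= ab_eA_theta_pow qV_gt0. Qed.

(** The division-free form of the statement that f / s_2^nu has weight mu + nu in J alone, the
    powers of bJ cancelling. *)
Lemma law_quot mu (nu : nat) m f gam z : law mu nu m f -> GL gam ->
  f (mob gam z) * s2 z ^+ nu =
  fps_const (inA (\det gam) ^- m * J gam z ^ (mu + nu)) * f z * s2 (mob gam z) ^+ nu.
Proof.
move=> lf gG; rewrite (lf gam z gG) (lawX nu law_s2 z gG).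
have -> : fps_const (inA (\det gam) ^- m * J gam z ^ (mu + nu)) = auto (mu + nu) 0 m gam z.
  by rewrite /auto expr0z mulr1 rmorphM.
have -> : auto mu nu m gam z = auto (mu + nu) 0 m gam z * auto (-1 *+ nu) (1 *+ nu) (0 * nu) gam z.
  by rewrite autoM // mul0n addn0 add0r mulNrn natz addrK.
by ring.
Qed.

Lemma quot_eq (a a' X Y Y' : R) : Y != 0 -> Y' != 0 -> a' * Y = 1 * X * a * Y' ->
  a' / Y' = X * (a / Y).
Proof.
move=> Y0 Y0' h; apply: (mulIf Y0'); rewrite divfK //; apply: (mulIf Y0); rewrite h.
by field.
Qed.

Lemma dc_ord (t : C) c k : ordge k c -> forall i, (i < k)%N -> coef (dc t c) i = 0.
Proof.
move=> ok i ik; have e := @eval0 _ _ C t.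
by etransitivity; [|exact: e]; rewrite -[coef _ i]/(fps_eval (coef c i) t) ok.
Qed.

(** At a fixed small t the quotient f / s_2^nu satisfies the hypotheses of [vanishing] with weight
    mu + nu, its decay coming from the order k and the bound [u_vtx]. Letting t vary over a disc
    shows that the series f z is 0. *)
Lemma vanish0 mu (nu : nat) m k c f : xp c f -> law mu nu m f -> ordge k c ->
  mu + nu < (k * q.+1)%:Z -> forall z, f z = 0.
Proof.
move=> xf lf ok wk; have [cs xs _] := xp_s2_ex; have q0 := qR_gt0 F R.
suff hfund z : fund (val z) -> f z = 0.
  move=> z; have [gam gG /hfund] := fund_reduce z; rewrite lf // => h.
  by apply: (mulrI (auto_unit mu nu m z gG)); rewrite h mulr0.
move=> fz; have [r [B [r0 B0] [[f1 g1 f4 g4] f2 f3 f5]]] := xp_common xf xs.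
have r0' := ltW r0; apply: (eval_ident_disc r0' (f1 z)).
exists (Num.min r^-1 1); rewrite ?lt_min ?invr_gt0 ?r0 ?ltr01 // => t; rewrite lt_min => /andP[tr t1].
have {}tr : ab t * r < 1 by rewrite -ltr_pdivlMr // div1r.
pose psi y := fps_eval (f y) t / fps_eval (s2 y) t ^+ nu.
have s2n N y : Sreg N 1 (val y) -> fps_eval (s2 y) t != 0.
  by move=> Sy; rewrite -ab_gt0 (s2_far Sy t1) invr_gt0.
have far_ex y : far y -> exists N, Sreg N 1 (val y).
  move=> fy; have [N hN] := qpow_large F (ab (val y)); exists N; split; first exact: ltW.
  by move=> x xK; rewrite expr1; exact: fy.
have pE v : ab (psi v) = ab (fps_eval (f v) t) / ab (fps_eval (s2 v) t) ^+ nu by rewrite abf_div abX.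
have psiM : ab_modular (mu + nu) psi.
  move=> gam y gG fy fy'; have [N Sy] := far_ex y fy; have [N' Sy'] := far_ex _ fy'.
  rewrite !pE.
  have E := congr1 (fun G => ab (fps_eval G t)) (law_quot y lf gG).
  have e1 : fps_eval (f (mob gam y) * s2 y ^+ nu) t = fps_eval (f (mob gam y)) t * fps_eval (s2 y) t ^+ nu.
    by rewrite (evalM r0' tr (f1 _) (cvfX _ r0' (g1 _))) (evalX _ r0' tr (g1 _)).
  have e2 x : fps_eval (fps_const x * f y * s2 (mob gam y) ^+ nu) t =
      x * fps_eval (f y) t * fps_eval (s2 (mob gam y)) t ^+ nu.
    rewrite (evalM r0' tr (cvfM r0' (cvf_const _ r0') (f1 _)) (cvfX _ r0' (g1 _))) (evalX _ r0' tr (g1 _)).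
    by rewrite (evalM r0' tr (cvf_const _ r0') (f1 _)) eval_const.
  have {e1 e2}E : ab (fps_eval (f (mob gam y)) t * fps_eval (s2 y) t ^+ nu) =
      ab (inA (\det gam) ^- m * J gam y ^ (mu + nu) * fps_eval (f y) t * fps_eval (s2 (mob gam y)) t ^+ nu).
    by rewrite -e1 -e2.
  have n1 : ab (fps_eval (s2 y) t) ^+ nu != 0 by rewrite expf_neq0 // ab_eq0 (s2n N y Sy).
  have n2 : ab (fps_eval (s2 (mob gam y)) t) ^+ nu != 0 by rewrite expf_neq0 // ab_eq0 (s2n N' _ Sy').
  have ed := ab_inA_det C gG.
  move: (fps_eval (f (mob gam y)) t) (fps_eval (s2 y) t) (fps_eval (f y) t) (fps_eval (s2 (mob gam y)) t) E n1 n2.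
  move: (J gam y) (inA (\det gam)) ed => j dt ed F1 S0 F0 S1 E n1 n2.
  apply: quot_eq n1 n2 _; move: E; rewrite !absM !abX abV abX ed expr1n invr1 => ->.
  by case: (mu + nu) => k'; rewrite ?NegzE -?exprnN ?abV ?abX // -!exprnP abX.
have psiA N : appr (Sreg N 1) psi.
  have [h1 h2] := f2 t tr N 1%N; apply: apprM => //.
  have d0 : 0 < (q%:R^-1 : R) ^+ nu by rewrite exprn_gt0 // invr_gt0.
  apply: (apprV d0); last exact: apprX.
  by move=> y Sy; rewrite abX (s2_far Sy t1).
have [N0 hN0] := qpow_large F r.
have V := @vanishing _ _ _ (mu + nu) psi psiM psiA k (B * r ^+ k / (q%:R^-1) ^+ nu) N0 wk.
have /V /(_ z fz) : forall n, (N0 <= n)%N -> forall y : Om, vtx n (val y) ->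
    ab (psi y) <= B * r ^+ k / q%:R^-1 ^+ nu / q%:R ^+ (k * sq F n).
  move=> n Nn y vy; have Sy := vtx_Sreg (leqnn n) vy.
  have uy := u_vtx hpi vy.
  have ur : ab (u (val y)) * r < 1.
    apply: (@le_lt_trans _ _ (q%:R ^- sq F n * r)); first by rewrite ler_wpM2r.
    rewrite ltr_pdivrMl ?qX_gt0 // mulr1; apply: lt_le_trans hN0 _; apply: qX_le.
    by rewrite (leq_trans Nn) // sq_ge.
  rewrite pE (s2_far Sy t1); have [-> _] := f5 y t ur tr.
  rewrite mulrAC ler_pM2r ?invr_gt0 ?exprn_gt0 ?invr_gt0 //.
  have bdc : bnd B r (dc t c) by move=> i; exact: ab_eval r0' tr (f4 i).
  apply: le_trans (eval_order r0 ur bdc (dc_ord t ok)) _.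
  rewrite ler_wpM2l ?mulr_ge0 ?exprn_ge0 // mulnC exprM -exprVn lerXn2r ?nnegrE ?abs_ge0 ?invr_ge0 ?exprn_ge0 ?(ltW q0) //.
move=> /eqP; rewrite mulf_eq0 invr_eq0 expf_eq0 => /orP[/eqP //|/andP[_ /eqP e]].
have [N Sz] := far_ex z (fund_far fz).
by have := s2n N z Sz; rewrite e eqxx.
Qed.

Lemma bJ_D (x y : F) z : bJ (Dmx x y) z = fps_const y%:K.
Proof. by rewrite /bJ !mx2E bar0 mul0r add0r bar_C. Qed.

(** The matrix diag(x, 1) multiplies u by x^-1 and f by x^-m, so a nonzero coefficient of u^k forces
    x^-k = x^-m for all nonzero x in F. *)
Lemma order_type mu nu m c f k : xp c f -> law mu nu m f -> coef c k != 0 -> k = m %[mod q.-1].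
Proof.
move=> [r [B [r0 B0] [f1 f2 f3 f4 f5]]] lf ck; have r0' := ltW r0.
apply: unit_pow_eq => x x0; apply/eqP; apply: contraT => xkm.
have xn : x%:K != 0 by rewrite inA_eq0 polyC_eq0.
suff : coef c k = 0 by move=> e; rewrite e eqxx in ck.
apply: (eval_ident_disc r0' (dbnd_cvf k f4)); exists r^-1; rewrite ?invr_gt0 // => t tr.
have {}tr : ab t * r < 1 by rewrite -ltr_pdivlMr // div1r.
pose G := dc t c; have bG : bnd B r G by move=> i; exact: ab_eval r0' tr (f4 i).
pose G' : fps C := Fps (fun j => (x%:K)^-1 ^+ j * coef G j).
have bG' : bnd B r G'.
  by move=> j; rewrite /= absM abX abV ab_const // invr1 expr1n mul1r; exact: bG.
have eG' v : fps_eval G' v = fps_eval G ((x%:K)^-1 * v).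
  rewrite /fps_eval; congr series_lim; apply: funext => j /=.
  by rewrite exprMn; ring.
pose D := G' - fps_const ((x%:K) ^- m) * G.
have D0 : D = 0.
  have cD : cvf r D by apply: cvfD; [exact: r0'|exact: cvf_bnd bG'|apply: cvfN; apply: cvfM => //; [exact: cvf_const|exact: cvf_bnd bG]].
  apply: (eval_ident r0' cD) => e e0.
  have [|z] := @u_small _ _ _ _ hpi (Num.min e r^-1); first by rewrite lt_min e0 invr_gt0.
  rewrite lt_min => /andP[ze zr]; exists (u (val z)); split=> //; first exact: u_neq0.
  have {}zr : ab (u (val z)) * r < 1 by rewrite -ltr_pdivlMr // div1r.
  rewrite (evalB r0' zr (cvf_bnd bG')); last by apply: cvfM => //; [exact: cvf_const|exact: cvf_bnd bG].
  rewrite (evalM r0' zr (cvf_const _ r0') (cvf_bnd bG)) eval_const eG'.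
  have gG : GL (Dmx x 1) by apply: GL_D; rewrite ?oner_eq0.
  have uz : u (val (mob (Dmx x 1) z)) = (x%:K)^-1 * u (val z).
    by rewrite val_D ?oner_eq0 // rmorph1 divr1 !(uE hpi) eA_Z mulrCA invfM.
  have zr' : ab (u (val (mob (Dmx x 1) z))) * r < 1 by rewrite uz absM abV ab_const // invr1 mul1r.
  rewrite -uz -!f5 // lf // /auto bJ_D J_D det_Dmx mulr1 polyC1 rmorph1 exp1rz rmorph1 exp1rz !mulr1.
  by rewrite (evalM r0' tr (cvf_const _ r0') (f1 z)) eval_const subrr.
have := congr1 (fun g => coef g k) D0; rewrite fcoefB coef_constM fcoef0 /= -mulrBl => /eqP.
rewrite mulf_eq0 => /orP[|/eqP //]; rewrite subr_eq0 exprVn (inj_eq invr_inj) -!rmorphXn => /eqP/inA_inj.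
by move=> /polyC_inj e; rewrite e eqxx in xkm.
Qed.

(** Scalar matrices act trivially on Omega, so their automorphy factor x^(w - 2m) is 1. *)
Lemma weight_type mu (nu : nat) m f (w : nat) : law mu nu m f -> mu + nu = w%:Z -> (exists z, f z != 0) ->
  w = (m + m)%N %[mod q.-1].
Proof.
move=> lf ew [z fz]; apply: unit_pow_eq => x x0.
have xn : x%:K != 0 by rewrite inA_eq0 polyC_eq0.
have gG : GL (Dmx x x) by exact: GL_D.
have mz : mob (Dmx x x) z = z by apply: Om_inj; rewrite val_D // mulrAC mulfV ?mul1r.
have := lf _ z gG; rewrite mz /auto bJ_D J_D det_Dmx.
rewrite -[fps_const _ ^ nu]/(fps_const _ ^+ nu) => h.
have : fps_const (inA (x * x)%:P ^- m * x%:K ^ mu * x%:K ^+ nu) = 1.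
  by apply: (mulIf fz); rewrite mul1r !(rmorphM (@fps_const C)) (rmorphXn (@fps_const C)) -h.
rewrite -(rmorph1 (@fps_const C)) => /fps_const_inj; rewrite -mulrA.
rewrite -[x%:K ^+ nu]/(x%:K ^ nu) -expfzDr // ew -exprnP polyCM rmorphM exprMn -exprD => e.
apply: polyC_inj; apply: (@inA_inj _ _ C); rewrite !polyC_exp !rmorphXn.
by apply: (mulfI (invr_neq0 (expf_neq0 (m + m) xn))); rewrite e mulVf // expf_neq0.
Qed.

End DepthZero.

(** * Depth 0 forms as polynomials in g, h and s_2 *)

Section Structure0.
Variables (F : finFieldType) (R : realType) (C : cinf F R).
Local Notation ab := (@absC F R C).
Local Notation q := (#|F|).
Local Notation inA := (@embA F R C).
Local Notation Om := (Omega C).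
Local Notation Tpos := (@Tpos F R C).
Local Notation s2 := (@s2 F R C).
Local Notation GL := (@GL2A F).
Local Notation "c '%:K'" := (inA c%:P) (at level 2, format "c '%:K'").
Implicit Types (z : Om) (f : Om -> fps C) (c d : fps (fps C)).

Variable pi : C.
Hypothesis hpi : carlitz_period pi.
Variables g Delta h : Om -> C.
Hypothesis hgD : drinfeld_module_coeffs pi g Delta.
Hypothesis hh : is_h pi h.
Local Notation u := (@u F R C pi).
Local Notation xp := (@xp F R C pi).
Local Notation cg := (fun z => fps_const (g z)).
Local Notation ch := (fun z => fps_const (h z)).

Lemma q2E : q.-2.+1 = q.-1. Proof. by have := card_F_gt1 F; lia. Qed.

Lemma law_T f mu nu m : law mu nu m f -> forall z a, f (translate z a) = f z.
Proof.
move=> lf z a; rewrite translateE (lf _ z (GL_T a)) /auto det_Tmx rmorph1 expr1n invr1 J_T exp1rz !rmorph1 !mul1r.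
by rewrite /bJ !mx2E bar0 bar1 mul0r add0r exp1rz mul1r.
Qed.

Lemma law_classical (phi : Om -> C) (w m : nat) :
  (forall gam z, GL gam -> phi (mob gam z) = J gam z ^+ w * inA (\det gam) ^- m * phi z) ->
  law w 0 m (fun z => fps_const (phi z)).
Proof.
move=> H gam z gG; rewrite (H gam z gG) /auto expr0z mulr1 -exprnP !(rmorphM (@fps_const C)).
by rewrite [_ * fps_const (inA _ ^- m)]mulrC.
Qed.

Lemma law_g : law q.-1 0 0 cg.
Proof.
apply: law_classical => gam z gG; rewrite expr0 invr1 mulr1.
by have [] := gD_mob hpi hgD z gG.
Qed.

Lemma law_Delta : law (q ^ 2).-1 0 0 (fun z => fps_const (Delta z)).
Proof.
apply: law_classical => gam z gG; rewrite expr0 invr1 mulr1.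
by have [] := gD_mob hpi hgD z gG.
Qed.

Lemma law_h : law q.+1 0 1 ch.
Proof.
have [[_ hl _ _] _] := hh.
apply: (law_mod (m := inZp 1 : 'I_(q.-2.+1))); first by rewrite /= q2E modn_mod.
by apply: law_classical => gam z gG; exact: hl.
Qed.

Lemma classical_T (phi : Om -> C) w m : law w 0 m (fun z => fps_const (phi z)) ->
  forall z a, phi (translate z a) = phi z.
Proof. by move=> lf z a; apply: fps_const_inj; exact: (law_T lf z a). Qed.

Lemma xp_g : exists2 c, xp c cg & coef c 0 = 1.
Proof.
have [Gs [Ds [r r0 [c1 c2 c3 c4 he]]]] := gD_series hpi hgD.
exists (Fps (fun m => fps_const (coef Gs m))); last by rewrite /= c3 rmorph1.
apply: (xp_cl r0 c1) => [N M||z zr]; [by case: (gD_appr hpi hgD N M) | exact: classical_T law_g | by case: (he z zr)].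
Qed.

Lemma xp_Delta : exists2 c, xp c (fun z => fps_const (Delta z)) & ordge 1 c.
Proof.
have [Gs [Ds [r r0 [c1 c2 c3 c4 he]]]] := gD_series hpi hgD.
exists (Fps (fun m => fps_const (coef Ds m))); last by case=> // _; rewrite /= c4 rmorph0.
apply: (xp_cl r0 c2) => [N M||z zr]; [by case: (gD_appr hpi hgD N M) | exact: classical_T law_Delta | by case: (he z zr)].
Qed.

Lemma xp_h : exists2 c, xp c ch & ordge 1 c /\ coef c 1 = fps_const (-1).
Proof.
have [[hr hl ht _] [c [[r r0 he] c0 c1]]] := hh.
have [z1 z1r] := u_small hpi r0.
have u1 := u_neq0 hpi z1; have u1' : 0 < ab (u (val z1)) by rewrite ab_gt0.
have cv := series_cvf_radius (f := Fps c) u1 (he z1 z1r).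
exists (Fps (fun m => fps_const (c m))); last first.
  by split=> [[|i] // _|]; rewrite /= ?c0 ?c1 ?rmorph0.
have r1 : 0 < (ab (u (val z1)))^-1 by rewrite invr_gt0.
apply: (xp_cl r1 cv) => // [|z zr]; first exact/rigidP.
have zr' : ab (u (val z)) < r.
  by apply: lt_trans z1r; move: zr; rewrite ltr_pdivrMr // mul1r.
by rewrite /fps_eval (series_limE (he z zr')).
Qed.

Definition mon (nu a k : nat) z : fps C := s2 z ^+ nu * fps_const (g z) ^+ a * fps_const (h z) ^+ k.

Lemma xpX c f k : xp c f -> xp (c ^+ k) (fun z => f z ^+ k).
Proof.
move=> xf; elim: k => [|k IH].
  have := xp_const pi (Tpos1 C); rewrite rmorph1 expr0; exact: xp_ext.
rewrite exprS; by apply: xp_ext (xpM xf IH) => z; rewrite exprS.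
Qed.

Lemma law_eq mu mu' nu nu' m m' f : mu = mu' -> nu = nu' -> m = m' ->
  law mu nu m f -> law mu' nu' m' f.
Proof. by move=> -> -> ->. Qed.

Lemma law_mon nu a k : law (- nu%:Z + (a * q.-1 + k * q.+1)%N%:Z) nu k (mon nu a k).
Proof.
have h1 := lawM (lawM (lawX nu (@law_s2 F R C)) (lawX a law_g)) (lawX k law_h).
apply: (law_eq _ _ _ h1).
- by rewrite PoszD !PoszM addrA mulNrn natz -(mulr_natl q.-1%:Z) -(mulr_natl q.+1%:Z) !natz.
- by rewrite !mul0rn !addr0 natz.
- by rewrite !mul0n !add0n mul1n.
Qed.

(** The coefficient of u^k is removed by a multiple of s_2^nu g^a h^k, whose expansion starts at u^k
    with a unit coefficient. The exponent a exists by the congruences of [order_type] and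
    [weight_type]; after n steps [vanish0] applies. *)
Lemma elim n : forall k c f mu (nu : nat) m, xp c f -> law mu nu m f -> ordge k c ->
  mu + nu < ((k + n) * q.+1)%N%:Z ->
  exists s : seq (nat * nat * fps C),
    (forall p, p \in s -> [/\ Tpos p.2, (k <= p.1.2)%N, p.1.2 = m %[mod q.-1] &
      mu + nu = (p.1.1 * q.-1 + p.1.2 * q.+1)%N%:Z]) /\
    forall z, f z = \sum_(p <- s) p.2 * mon nu p.1.1 p.1.2 z.
Proof.
elim: n => [|n IH] k c f mu nu m xf lf ok wk.
  exists [::]; split=> // z; rewrite big_nil; apply: (vanish0 hpi xf lf ok); by rewrite addn0 in wk.
have ok1 c' : ordge k c' -> coef c' k = 0 -> ordge k.+1 c'.
  by move=> o e i; rewrite ltnS leq_eqVlt => /orP[/eqP -> //|]; exact: o.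
have [ck|ck] := eqVneq (coef c k) 0.
  have [|s [hs he]] := IH k.+1 c f mu nu m xf lf (ok1 _ ok ck); first by rewrite addSnnS.
  by exists s; split=> // p /hs[h1 h2 h3 h4]; split=> //; exact: ltnW.
have [wk'|kw] := ltP (mu + nu) (k * q.+1)%N%:Z.
  by exists [::]; split=> // z; rewrite big_nil; exact: (vanish0 hpi xf lf ok).
have [w ew] : exists w : nat, mu + nu = w%:Z.
  by exists (absz (mu + nu)); rewrite gez0_abs // (le_trans _ kw).
have fne : exists z, f z != 0.
  apply: contrapT => H; have c0 : c = 0.
    by apply: (xp_uniq hpi xf) => z; apply/eqP; apply: contrapT => /negP fz; apply: H; exists z.
  by rewrite c0 eqxx in ck.
have km := order_type hpi xf lf ck.
have w2 := weight_type lf ew fne.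
rewrite ew lez_nat in kw.
have [a ea] : exists a, w = (a * q.-1 + k * q.+1)%N.
  have d : (q.-1 %| w - k * q.+1)%N.
    rewrite -eqn_mod_dvd // w2; have -> : (k * q.+1 = k * q.-1 + (k + k))%N by rewrite -{1}(prednK (qpos F)); ring.
    by rewrite modnMDl -modnDm -km modnDm.
  by exists ((w - k * q.+1) %/ q.-1)%N; rewrite divnK ?subnK.
have [cs xs s0] := xp_s2_ex hpi; have [cG xg g0] := xp_g; have [cH xh [h1 h2]] := xp_h.
set sigma := Fps _ in s0; have sT : Tpos sigma by exact: sigma_Tpos.
have sn : coef sigma 0 != 0 by exact: sigma_coef0.
have su : sigma ^+ nu \is a GRing.unit by rewrite unitrX // fps_unitE.
(* The monomial starts with (-1)^k sigma^nu u^k, since h = - u + ..., g = 1 + ... and s_2 = sigma +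
   ...; T is the quotient of c_k by that coefficient. *)
pose T := fps_const ((-1) ^+ k) * coef c k * (sigma ^-1) ^+ nu.
have TT : Tpos T.
  apply: TposM; last by apply/TposX/TposV.
  apply: TposM; first exact: Tpos_const.
  by have [r [B [r0 _] [_ _ _ f4 _]]] := xf; exact: Tpos_cvf (ltW r0) (dbnd_cvf k f4).
pose P := cs ^+ nu * cG ^+ a * cH ^+ k.
have xP : xp P (mon nu a k) by exact: xpM (xpM (xpX nu xs) (xpX a xg)) (xpX k xh).
have [oP eP] : ordge k P /\ coef P k = sigma ^+ nu * fps_const ((-1) ^+ k).
  have [o1 e1] := ordgeX k h1.
  have [o2 e2] := ordgeM (@ordge0 _ (cs ^+ nu * cG ^+ a)) o1.
  by rewrite add0n in o2 e2; rewrite e2 e1 h2 fcoefM0 !coef0_exp s0 g0 expr1n mulr1 rmorphXn.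
pose c' := c + fps_const (- T) * P.
pose f' z := f z + (- T) * mon nu a k z.
have xf' : xp c' f' by exact: xpD xf (xpM (xp_const pi (TposN TT)) xP).
have lf' : law mu nu m f'.
  apply: lawD => //; apply: law_scale; apply: (law_mod km).
  have -> : mu = - nu%:Z + (a * q.-1 + k * q.+1)%N%:Z by rewrite -ea -ew addrC addrK.
  exact: law_mon.
have ok' : ordge k.+1 c'.
  apply: ok1 => [i ik|]; rewrite fcoefD coef_constM.
    by rewrite ok // oP // mulr0 addr0.
  rewrite eP /T exprVn; apply/eqP; rewrite addr_eq0 mulNr opprK; apply/eqP.
  have -> : fps_const ((-1) ^+ k) * coef c k * (sigma ^+ nu)^-1 * (sigma ^+ nu * fps_const ((-1) ^+ k)) =
      fps_const ((-1) ^+ k) * fps_const ((-1) ^+ k) * coef c k * ((sigma ^+ nu)^-1 * sigma ^+ nu) by ring.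
  by rewrite mulVr // mulr1 -rmorphM -exprD -signr_odd addnn odd_double expr0 rmorph1 mul1r.
have [|s [hs he]] := IH k.+1 c' f' mu nu m xf' lf' ok'; first by rewrite addSnnS.
exists ((a, k, T) :: s); split=> [p|z].
  rewrite inE => /orP[/eqP ->|/hs[h3 h4 h5 h6]]; last by split=> //; exact: ltnW.
  by split; rewrite //= -ea.
rewrite big_cons -he /f' /=; ring.
Qed.

(** Delta has weight q^2 - 1, type 0 and vanishes at infinity, so in g^a h^k the exponent k is a
    positive multiple of q - 1, and the weight leaves only h^(q-1). *)
Lemma Delta_h : exists2 kappa : C, kappa != 0 & forall z, Delta z = kappa * h z ^+ q.-1.
Proof.
have [c xc oc] := xp_Delta; have q1 := card_F_gt1 F; have q2 : (0 < q ^ 2)%N by rewrite expn_gt0 qpos.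
have [|s [hs he]] := @elim (q ^ 2) 1 c _ _ 0 0 xc law_Delta oc.
  by rewrite addr0 ltz_nat; have := leq_pmulr (1 + q ^ 2)%N (ltn0Sn q); lia.
pose kappa := \sum_(p <- s) coef p.2 0.
have E z : Delta z = kappa * h z ^+ q.-1.
  have := congr1 (fun G => coef G 0) (he z); rewrite coef_const eqxx => ->.
  rewrite fcoef_sum mulr_suml; apply: eq_big_seq => p ps; have [_ p1 p2 p3] := hs p ps.
  have [j ej] : exists j, p.1.2 = (j * q.-1)%N by apply/dvdnP; rewrite /dvdn p2 mod0n.
  have e2 : ((q ^ 2).-1 = q.-1 * q.+1)%N.
    have gen m : ((m.+1 ^ 2).-1 = m * m.+2)%N by rewrite -mulnn mulSn addSn /= -mulnS.
    by have := gen q.-1; rewrite prednK ?qpos.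
  move: p3; rewrite addr0 e2 => -[] e3; have q0 := q1_gt0 F.
  have e4 : (q.+1 = p.1.1 + j * q.+1)%N.
    by apply/eqP; rewrite -(eqn_pmul2l q0) mulnDr; apply/eqP; rewrite e3 ej; ring.
  have j1 : j = 1%N by move: p1; rewrite ej; case: j e4 ej => [|[|j]] // e4 _ _; rewrite !mulSn in e4; lia.
  have a0 : p.1.1 = 0%N by move: e4; rewrite j1; lia.
  by rewrite /mon a0 ej j1 mul1n !expr0 !mul1r fcoefM0 -rmorphXn coef_const.
exists kappa => //; apply/eqP => k0; have [z _] := u_small hpi (@ltr01 R).
by have := Delta_neq0 hgD z; rewrite E k0 mul0r eqxx.
Qed.

End Structure0.

(** * The Frobenius twist, and invariant functions with finitely many values *)

Section Twist.
Variables (F : finFieldType) (R : realType) (C : cinf F R).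
Local Notation ab := (@absC F R C).
Local Notation q := (#|F|).
Local Notation theta := (@theta F R C).
Local Notation tw := (@twist F R C 1).
Local Notation bar := (@bar F R C).

Lemma frob_sum I (r : seq I) (f : I -> C) : (\sum_(i <- r) f i) ^+ (q ^ 1) = \sum_(i <- r) f i ^+ (q ^ 1).
Proof.
elim: r => [|i r IH]; last by rewrite !big_cons frobD IH.
by rewrite !big_nil expn1 expr0n gtn_eqF ?qpos.
Qed.

Lemma twD f g : tw (f + g) = tw f + tw g.
Proof. by apply: fpsP => i; rewrite fcoefD; exact: frobD. Qed.

Lemma twM f g : tw (f * g) = tw f * tw g.
Proof.
apply: fpsP => n; rewrite fcoefM -[LHS]/((\sum_(i < n.+1) coef f i * coef g (n - i)) ^+ (q ^ 1)).
by rewrite frob_sum; apply: eq_bigr => i _; rewrite exprMn.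
Qed.

Lemma tw_const c : tw (fps_const c) = fps_const (c ^+ q).
Proof.
apply: fpsP => n; rewrite -[LHS]/(coef (fps_const c) n ^+ (q ^ 1)) !coef_const expn1.
by case: ifP => // _; rewrite expr0n gtn_eqF ?qpos.
Qed.

Lemma tw1 : tw 1 = 1.
Proof. by rewrite -(rmorph1 (@fps_const C)) tw_const expr1n. Qed.

Lemma tw_bar a : tw (bar a) = bar a.
Proof.
apply: fpsP => n; rewrite -[LHS]/(coef (bar a) n ^+ (q ^ 1)) /bar /= coef_map /= expn1.
exact: constX.
Qed.

Lemma tw2 f : tw (tw f) = twist 2 f.
Proof. by apply: fpsP => n /=; rewrite -exprM -expnD. Qed.

Lemma twV f : f \is a GRing.unit -> tw f^-1 = (tw f)^-1.
Proof.
move=> fu; have e : tw f * tw f^-1 = 1 by rewrite -twM divrr // tw1.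
have fu' : tw f \is a GRing.unit by rewrite fps_unitE expf_neq0 // -fps_unitE.
by apply: (mulrI fu'); rewrite e divrr.
Qed.

Lemma root_sep (s : seq C) : exists2 e : R, 0 < e & forall x, x \in s -> x != 0 -> e <= ab x.
Proof.
elim: s => [|y s [e e0 IH]]; first by exists 1.
have [->|y0] := eqVneq y 0.
  by exists e => // x; rewrite inE => /orP[/eqP ->|/IH //]; rewrite eqxx.
exists (Num.min e (ab y)); first by rewrite lt_min e0 ab_gt0.
move=> x; rewrite inE => /orP[/eqP -> _|xs x0]; first by rewrite ge_min lexx orbT.
by rewrite ge_min IH.
Qed.

Local Notation Om := (Omega C).
Local Notation Sreg := (@Sreg F R C).
Local Notation GL := (@GL2A F).

(* The reduction of f on the vertex 0 is constant because f has finitely many values. *)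
Lemma finite_valued_const (f : Om -> C) (s : seq C) : (forall N M, appr (Sreg N M) f) ->
  (forall gam z, GL gam -> f (mob gam z) = f z) -> (forall z, f z \in s) ->
  exists r, forall z, f z = r.
Proof.
move=> fA fM fs.
have [e e0 he] := root_sep [seq x - y | x <- s, y <- s].
have sep x y : x \in s -> y \in s -> ab (x - y) < e -> x = y.
  move=> xs ys xy; apply/eqP; rewrite -subr_eq0; apply: contraLR xy => n0.
  by rewrite -leNgt; apply: he => //; apply/allpairsP; exists (x, y).
have [P [Q [Q0 hPQ]]] := fA 1%N 1%N e e0.
(* The value r = f z' is known only once z' is chosen, so z' has to maximise |P/Q - x| for all x in
   s; at x = r this maximum is below e. *)
have [z' vz' hz'] := generic_max [seq P - r *: Q | r <- s] (ltnSn 0) Q0.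
have Sz' := vtx_Sreg (leqnSn 0) vz'.
pose r := f (toOm Sz'); exists r.
have evPQ x z : Sreg 1 1 z -> (P - x *: Q).[z] / Q.[z] = P.[z] / Q.[z] - x.
  by move=> Sz; rewrite hornerD hornerN hornerZ mulrBl mulfK // Q0.
have h0 (z : Om) : vertex 0 (theta ^+ 0) (val z) -> f z = r.
  move=> vz; have Sz := vtx_Sreg (leqnSn 0) vz; apply: sep; rewrite ?fs //.
  rewrite -(subrKA (P.[val z] / Q.[val z])); apply: abD_lt; first exact: hPQ.
  rewrite -evPQ //; apply: le_lt_trans (hz' _ _ _ vz) _; first by apply: map_f; exact: fs.
  by rewrite evPQ // ab_subC; exact: hPQ (toOm Sz') Sz'.
pose f' z := f z - r.
have f'M : ab_modular 0 f' by move=> gam z gG _ _; rewrite expr0z mul1r /f' fM.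
have f'A N : appr (Sreg N 1) f' by apply: apprB => //; exact: appr_cst.
have z0 (z : Om) : vertex 0 (theta ^+ 0) (val z) -> f' z = 0 by move=> /h0 e1; rewrite /f' e1 subrr.
move=> z; have [gam gG /(zero_propagate f'M f'A z0) /eqP] := fund_reduce z.
by rewrite subr_eq0 fM // => /eqP.
Qed.

End Twist.

(** * The Legendre relation and the law of bE *)

Section Legendre.
Variables (F : finFieldType) (R : realType) (C : cinf F R).
Local Notation ab := (@absC F R C).
Local Notation q := (#|F|).
Local Notation A := {poly F}.
Local Notation inA := (@embA F R C).
Local Notation theta := (@theta F R C).
Local Notation Om := (Omega C).
Local Notation Sreg := (@Sreg F R C).
Local Notation Tpos := (@Tpos F R C).
Local Notation s1 := (@s1 F R C).
Local Notation s2 := (@s2 F R C).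
Local Notation GL := (@GL2A F).
Local Notation tw := (@twist F R C 1).
Local Notation bar := (@bar F R C).
Implicit Types (z : Om).

(** The Moore determinant of s_1 and s_2. Its automorphy factor is the inverse of that of h
    ([wron_mob], [h_mob]), so h times it is invariant. *)
Definition wron z := s1 z * tw (s2 z) - tw (s1 z) * s2 z.

Lemma bar_det (gam : 'M[A]_2) : GL gam -> bar (\det gam) = fps_const (inA (\det gam)).
Proof. by move=> /GL_det[c _ ->]; rewrite bar_C. Qed.

Lemma wron_mob gam z : GL gam -> wron (mob gam z) =
  fps_const ((J gam z)^-1 * (J gam z)^-1 ^+ q * inA (\det gam)) * wron z.
Proof.
move=> gG; rewrite /wron (s1_mob z gG) (s2_mob_lin z gG) !twM !twD !twM !tw_bar !tw_const.
have eb : bar (\det gam) = bar (gam 0 0) * bar (gam 1 1) - bar (gam 0 1) * bar (gam 1 0).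
  by rewrite det_mx22 -!barM barD barN.
have -> : fps_const ((J gam z)^-1 * (J gam z)^-1 ^+ q * inA (\det gam)) =
    fps_const (J gam z)^-1 * fps_const ((J gam z)^-1 ^+ q) * bar (\det gam).
  by rewrite (bar_det gG) -!rmorphM.
rewrite eb.
move: (fps_const _) (fps_const _) (bar _) (bar _) (bar _) (bar _) => *; ring.
Qed.

Variable pi : C.
Hypothesis hpi : carlitz_period pi.
Local Notation sCar := (@sCar F R C pi).
Local Notation tmt := (fX C - fps_const theta).

Lemma sCar_coef i : coef sCar i = pi * eA (theta ^- i.+1).
Proof. by rewrite -(eCar_pi hpi). Qed.

Lemma sCar_Tpos : Tpos sCar.
Proof.
apply: (@Tpos_cvf _ _ _ 1) => //; apply: (@cvf_bnd _ _ _ (ab pi)) => i.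
by rewrite sCar_coef absM ab_eA_theta_pow expr1n mulr1 ler_piMr ?abs_ge0 // qV_le1.
Qed.

Lemma sCar0 : coef sCar 0 != 0.
Proof.
rewrite sCar_coef mulf_neq0 ?(pi_neq0 hpi) // -ab_gt0 ab_eA_theta_pow.
exact: qV_gt0.
Qed.

Lemma sCar_unit : sCar \is a GRing.unit. Proof. by rewrite fps_unitE sCar0. Qed.

Lemma tmt_unit : tmt \is a GRing.unit.
Proof.
rewrite fps_unitE fcoefB coef_const eqxx -[fX C]expr1 coef_fXn sub0r oppr_eq0.
exact: theta_neq0.
Qed.

Lemma tmt_Tpos : Tpos tmt.
Proof. by apply: TposB; [exact: Tpos_fX | exact: Tpos_const]. Qed.

(** The Carlitz equation coefficient by coefficient; the shift at the lowest index is correct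
    because the Carlitz exponential vanishes at pi. *)
Lemma tw_sCar : tw sCar = tmt * sCar.
Proof.
apply: fpsP => i; rewrite mulrBl fcoefB coef_constM -[LHS]/(coef sCar i ^+ (q ^ 1)) expn1.
have E : eCar (pi / theta ^+ i.+1) ^+ q = eCar (theta * (pi / theta ^+ i.+1)) - theta * eCar (pi / theta ^+ i.+1).
  by rewrite eCar_scale addrAC subrr add0r.
rewrite -[coef sCar i]/(eCar (pi / theta ^+ i.+1)) E; congr (_ - _).
rewrite -[fX C]expr1 coefXnM; case: i E => [|i] _ /=.
  rewrite expr1 mulrC divfK ?theta_neq0 // -[pi]mulr1 (eCar_pi hpi) -(rmorph1 inA) eA_inA.
  by rewrite mulr0.
rewrite subn1 /=; congr eCar; rewrite [theta ^+ i.+2]exprS; field.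
by rewrite theta_neq0 thetaX_neq0.
Qed.

Variables g Delta h : Om -> C.
Hypothesis hgD : drinfeld_module_coeffs pi g Delta.
Hypothesis hh : is_h pi h.

Definition legendre z := fps_const (h z) * wron z / sCar.

Lemma h_mob gam z : GL gam -> h (mob gam z) = J gam z ^+ q.+1 * (inA (\det gam))^-1 * h z.
Proof.
move=> gG; have H : law q.+1 0 1 (fun z => fps_const (h z)) := law_h hh.
have := H gam z gG; rewrite /auto expr0z mulr1 expr1 -exprnP -!rmorphM => /fps_const_inj ->.
by rewrite [_^-1 * _]mulrC.
Qed.

Lemma legendre_mob gam z : GL gam -> legendre (mob gam z) = legendre z.
Proof.
move=> gG; rewrite /legendre wron_mob // h_mob //; congr (_ / _).
rewrite mulrA -(rmorphM (@fps_const C)); congr (fps_const _ * _).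
have j0 := J_neq0 z gG; have d0 := inA_det_neq0 C gG.
rewrite exprVn exprS; field.
by rewrite j0 d0 expf_neq0.
Qed.

(** After twisting, the second twists of s_1 and s_2 are eliminated by [lser_gD], and the terms with
    g cancel. *)
Lemma wron_tw z :
  fps_const (pi ^+ (q ^ 2).-1 * Delta z) * tw (wron z) = - (tmt * wron z).
Proof.
have e1 := lser_gD hgD z 0 1; have e2 := lser_gD hgD z 1 0.
move: e1 e2; rewrite rmorph0 rmorph1 add0r mul1r mul0r addr0 -s1E -s2E => e1 e2.
rewrite /wron -[X in tw X]addrC.
have -> : tw (- (tw (s1 z) * s2 z) + s1 z * tw (s2 z)) = tw (s1 z) * twist 2 (s2 z) - twist 2 (s1 z) * tw (s2 z).
  rewrite twD twM tw2 -mulN1r twM twM tw2 -(rmorphN1 (@fps_const C)) tw_const.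
  have -> : (-1 : C) ^+ q = -1.
    by have := frobB 1 0 (1 : C); rewrite expn1 sub0r expr1n expr0n gtn_eqF ?qpos // sub0r.
  by rewrite rmorphN1; ring.
have d1 : fps_const (pi ^+ (q ^ 2).-1 * Delta z) * twist 2 (s1 z) = fX C * s1 z - fps_const theta * s1 z - fps_const (pi ^+ q.-1 * g z) * tw (s1 z).
  by rewrite -e1; ring.
have d2 : fps_const (pi ^+ (q ^ 2).-1 * Delta z) * twist 2 (s2 z) = fX C * s2 z - fps_const theta * s2 z - fps_const (pi ^+ q.-1 * g z) * tw (s2 z).
  by rewrite -e2; ring.
rewrite mulrBr [X in X - _]mulrCA d2 [X in _ - X]mulrA d1; ring.
Qed.

Lemma wron_neq0z z : coef (wron z) 0 != 0.
Proof.
rewrite fcoefB !fcoefM0.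
rewrite -[coef (tw (s2 z)) 0]/(coef (s2 z) 0 ^+ (q ^ 1)) -[coef (tw (s1 z)) 0]/(coef (s1 z) 0 ^+ (q ^ 1)) expn1.
rewrite -[coef (s1 z) 0]/(elat (val z) (val z / theta ^+ 1)) -[coef (s2 z) 0]/(elat (val z) (1 / theta ^+ 1)).
rewrite expr1 div1r -oppr_eq0.
have e (x y : C) : - (x * y ^+ q - x ^+ q * y) = y * x ^+ q - y ^+ q * x by ring.
rewrite e; apply: wron_neq0 => [|c]; first exact: x1_neq0.
rewrite -subr_eq0 -mulNr -rmorphN -polyCN -Om_elat_Z -Om_elat_D.
have -> : val z / theta + inA (- c)%:P / theta = (inA 1 * val z + inA (- c)%:P) / theta.
  by rewrite rmorph1 mul1r mulrDl.
apply: elat_div_neq0; rewrite ?size_polyC_leq1 ?size_poly1 //.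
by rewrite xpair_eqE oner_eq0.
Qed.

Section Constancy.
Variable kappa : C.
Hypotheses (k0 : kappa != 0) (eD : forall z, Delta z = kappa * h z ^+ q.-1).

Lemma h_neq0 z : h z != 0.
Proof.
apply/eqP => h0; have := Delta_neq0 hgD z; rewrite eD h0 expr0n gtn_eqF ?q1_gt0 // mulr0.
by rewrite eqxx.
Qed.

Local Notation alpha := (- (pi ^+ (q ^ 2).-1 * kappa)^-1).

Lemma legendre_tw z : tw (legendre z) = fps_const alpha * legendre z.
Proof.
have p0 k : pi ^+ k != 0 by rewrite expf_neq0 // (pi_neq0 hpi).
have h0 := h_neq0 z; have hq k : h z ^+ k != 0 by rewrite expf_neq0.
have D0 : pi ^+ (q ^ 2).-1 * Delta z != 0 by rewrite eD !mulf_neq0.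
rewrite /legendre !twM twV ?sCar_unit // tw_sCar tw_const invrM ?tmt_unit ?sCar_unit //.
have -> : tw (wron z) = fps_const (pi ^+ (q ^ 2).-1 * Delta z)^-1 * - (tmt * wron z).
  rewrite -wron_tw mulrA -rmorphM mulVf // rmorph1 mul1r //.
have -> : fps_const (h z ^+ q) * (fps_const (pi ^+ (q ^ 2).-1 * Delta z)^-1 * - (tmt * wron z)) * (sCar^-1 * tmt^-1) =
   - (fps_const (h z ^+ q) * fps_const (pi ^+ (q ^ 2).-1 * Delta z)^-1) * (wron z * sCar^-1) * (tmt * tmt^-1) by ring.
rewrite divrr ?tmt_unit // mulr1 -rmorphM -rmorphN -[fps_const (h z) * _ / _]mulrA [RHS]mulrA -rmorphM.
congr (fps_const _ * _); rewrite eD -{1}(prednK (qpos F)) exprS; field.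
by rewrite k0 p0 hq.
Qed.

Lemma coef_appr (e f : Om -> fps C) N M : (forall i, appr (Sreg N M) (fun z => coef (e z) i)) ->
  (forall i, appr (Sreg N M) (fun z => coef (f z) i)) ->
  forall i, appr (Sreg N M) (fun z => coef (e z * f z) i).
Proof.
move=> hf hg i; apply: (@appr_ext _ _ _ _ _ (fun z => \sum_(j < i.+1) coef (e z) j * coef (f z) (i - j))) => //.
by apply: appr_sum => j _; apply: apprM.
Qed.

Lemma legendre_appr N M i : appr (Sreg N M) (fun z => coef (legendre z) i).
Proof.
have [[/rigidP hr _ _ _] _] := hh.
have a1 j : appr (Sreg N M) (fun z => coef (s1 z) j).
  by apply: appr_elat; apply: apprM; [exact: appr_val | exact: appr_cst].
have a2 j : appr (Sreg N M) (fun z => coef (s2 z) j) by apply: appr_elat; exact: appr_cst.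
have tA (f : Om -> fps C) : (forall j, appr (Sreg N M) (fun z => coef (f z) j)) ->
    forall j, appr (Sreg N M) (fun z => coef (tw (f z)) j).
  by move=> hf j; exact: apprX.
apply: coef_appr => [|j]; last exact: appr_cst.
apply: coef_appr => j.
  apply: (@appr_ext _ _ _ _ _ (fun z => if j == 0%N then h z else 0)).
    by move=> z _; rewrite coef_const.
  by case: (j == 0%N); [exact: hr | exact: appr_cst].
by apply: apprB; apply: coef_appr => //; exact: tA.
Qed.

(** Each coefficient is invariant under GL_2(A) and satisfies x^q = alpha x, so it takes finitely
    many values and [finite_valued_const] applies. The same equation bounds the coefficients, which
    puts X in T_>0. *)
Lemma legendre_const : exists2 X : fps C, Tpos X & coef X 0 != 0 /\ forall z, legendre z = X.
Proof.
have E z i : coef (legendre z) i ^+ q = alpha * coef (legendre z) i.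
  by have := congr1 (fun f => coef f i) (legendre_tw z); rewrite coef_constM /= expn1.
have q1 := card_F_gt1 F.
have [rs hrs] := @C_split _ _ C ('X^q - alpha *: 'X).
have rsP x : x ^+ q = alpha * x -> x \in rs.
  move=> xq; have p0 : 'X^q - alpha *: 'X != 0 :> {poly C}.
    apply/eqP => /(congr1 (fun p : {poly C} => p`_q)); rewrite coefB coefXn eqxx coefZ coefX coef0.
    by rewrite gtn_eqF // mulr0 subr0 => /eqP; rewrite oner_eq0.
  have : root ('X^q - alpha *: 'X) x by rewrite /root hornerD hornerN hornerXn hornerZ hornerX xq subrr.
  rewrite hrs rootZ ?lead_coef_eq0 // root_prod_XsubC //.
have hX' i : exists r, forall z, coef (legendre z) i = r.
  apply: (finite_valued_const (s := rs)) => [N M|gam z gG|z]; [exact: legendre_appr | by rewrite legendre_mob | exact: rsP].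
have [X hX] := choice hX'; have eX z : legendre z = Fps X by apply: fpsP => i; rewrite hX.
have [z0 _] := u_small hpi (@ltr01 R).
exists (Fps X); last split=> //.
  apply: (@Tpos_cvf _ _ _ 1) => //; apply: (@cvf_bnd _ _ _ (1 + ab alpha)) => i.
  rewrite expr1n mulr1 -(eX z0) leNgt; apply/negP => lt.
  have x1 : 1 < ab (coef (legendre z0) i) by apply: le_lt_trans lt; rewrite lerDl abs_ge0.
  have xa : ab alpha < ab (coef (legendre z0) i) by apply: le_lt_trans lt; rewrite lerDr.
  have := congr1 ab (E z0 i); rewrite absM abX -{1}(prednK (qpos F)) exprSr => /(mulIf _) e.
  have {}e : ab (coef (legendre z0) i) ^+ q.-1 = ab alpha by apply: e; rewrite gt_eqF // (lt_trans ltr01).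
  move: xa; rewrite -e ltNge -{1}[ab (coef _ _)]expr1 ler_weXn2l // ?q1_gt0 // ltW //.
rewrite -(eX z0) /legendre !fcoefM0 coef_const eqxx coef0V !mulf_neq0 ?invr_eq0 ?h_neq0 ?sCar0 //.
exact: wron_neq0z.
Qed.

Local Notation bE := (bE pi h Delta).
Local Notation kap := (pi ^+ q / kappa).

Lemma bE_eq z : bE z = fps_const (kap * h z) * tw (s2 z) / (tmt * sCar).
Proof.
have h0 := h_neq0 z; have hq k : h z ^+ k != 0 by rewrite expf_neq0.
rewrite -[bE z]/(tw (fps_const (pi * h z) * s2 z / sCar) / fps_const (Delta z)).
rewrite !twM twV ?sCar_unit // tw_sCar tw_const -fps_constV mulrAC [X in X / _]mulrAC -rmorphM.
congr (fps_const _ * _ / _); rewrite eD exprMn -{2}(prednK (qpos F)) exprS; field.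
by rewrite k0 hq.
Qed.

(** Writing c tw(s_1) + d tw(s_2) as bJ tw(s_2) - c wron / s_2 splits off the automorphy factor, and
    the Legendre relation turns the determinant [wron] into the constant X. *)
Lemma bE_mob X gam z : (forall z, legendre z = X) -> GL gam ->
  bE (mob gam z) = auto 1 1 1 gam z * (bE z + fps_const kap * X * bL gam z).
Proof.
move=> eX gG; have j0 := J_neq0 z gG; have d0 := inA_det_neq0 C gG.
have ju := J_unit z gG; have su := s2_unit z; have bu := bJ_unit z gG.
rewrite !bE_eq h_mob // s2_mob_lin // twM tw_const twD !twM !tw_bar -(eX z) /legendre /wron.
have -> : bL gam z = - (bar (gam 1 0) * (tmt^-1 * ((bJ gam z)^-1 * (s2 z)^-1))).
  rewrite /bL -bJE; have -> : fps_of_poly (theta%:P - 'X) = - tmt.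
    by rewrite rmorphB opprB.
  rewrite mulNr invrN mulrN invrM ?unitrM ?tmt_unit ?bu ?su // invrM //.
  by congr (- (_ * _)); rewrite mulrC [(s2 z)^-1 * _]mulrC.
have eJ : bJ gam z = (bar (gam 1 0) * s1 z + bar (gam 1 1) * s2 z) / s2 z.
  by rewrite -bJE mulrK.
have -> : fps_const (kap * (J gam z ^+ q.+1 * (inA (\det gam))^-1 * h z)) * (fps_const ((J gam z)^-1 ^+ q) *
    (bar (gam 1 0) * tw (s1 z) + bar (gam 1 1) * tw (s2 z))) =
    fps_const (inA (\det gam))^-1 * fps_const (J gam z) * (fps_const (kap * h z)) * (bar (gam 1 0) * tw (s1 z) + bar (gam 1 1) * tw (s2 z)).
  rewrite mulrA -!rmorphM; congr (fps_const _ * _); rewrite exprVn exprS; field.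
  by rewrite k0 d0 expf_neq0.
rewrite /auto expr1 !expr1z invrM ?tmt_unit ?sCar_unit //.
have ek : fps_const (kap * h z) = fps_const kap * fps_const (h z) by rewrite rmorphM.
rewrite ek.
have su1 := divrr su; have bu1 := divrr bu; have tu1 := divrr tmt_unit.
move: eJ su1 bu1; move: (bJ gam z)^-1 (s2 z)^-1 => bi si.
move: (bJ gam z) (fps_const (inA _)^-1) (fps_const (J gam z)) (fps_const kap) (fps_const (h z)) => b dd jj kk hh'.
move: (bar (gam 1 0)) (bar (gam 1 1)) (s1 z) (s2 z) (tw (s1 z)) (tw (s2 z)) (sCar^-1) (tmt^-1) => c d' x1 x2 y1 y2 sc ti eb e1 e2.
rewrite eb.
transitivity (dd * jj * (kk * hh') * (c * y1 + d' * y2) * (sc * ti)); first by ring.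
transitivity (dd * jj * ((c * x1 + d' * x2) * si) * (kk * hh' * y2 * (sc * ti)) -
  dd * jj * (b * bi) * (kk * (hh' * (x1 * y2 - y1 * x2) * sc)) * c * ti * si); last by rewrite eb; ring.
rewrite e2 mulr1.
transitivity (dd * jj * (kk * hh') * (c * y1 * (x2 * si) + d' * y2 * (x2 * si)) * (sc * ti)); last by ring.
by rewrite e1 !mulr1.
Qed.

End Constancy.
End Legendre.

(** * Linear independence of automorphy factors *)

Section Density.
Variables (F : finFieldType) (R : realType) (C : cinf F R).
Local Notation q := (#|F|).
Local Notation A := {poly F}.
Local Notation inA := (@embA F R C).
Local Notation bar := (@bar F R C).
Local Notation D := (fps C).

Lemma fX_inj : injective (fun i => fX C ^+ i).
Proof.
move=> i j /(congr1 (fun f => coef f i)); rewrite !coef_fXn eqxx.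
by case: eqP => // _ /eqP; rewrite oner_eq0.
Qed.

Lemma poly_zeros (K : idomainType) n (a : nat -> K) (f : nat -> K) : injective f ->
  (forall i, \sum_(k < n) a k * f i ^+ k = 0) -> forall k, (k < n)%N -> a k = 0.
Proof.
move=> fi h k kn; have p0 : \poly_(k < n) a k = 0.
  by apply: (poly_inf fi) => i; rewrite /root horner_poly h.
by have := congr1 (fun p : {poly K} => p`_k) p0; rewrite coef_poly kn coef0.
Qed.

(* A relation for e in A is a relation in two independent variables: modulo t^N, the value
   e(t) is fixed by e mod X^N whereas e(theta) still takes infinitely many values. *)
Lemma dens2 n (P : nat -> nat -> D) (x0 x1 : C) (y0 y1 : D) : x1 != 0 -> y1 != 0 ->
  (forall e : A, e != 0 -> \sum_(a < n) \sum_(b < n)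
    P a b * fps_const (x0 + x1 * inA e) ^+ a * (y0 + y1 * bar e) ^+ b = 0) ->
  forall a b, (a < n)%N -> (b < n)%N -> P a b = 0.
Proof.
move=> x10 y10 h a b an bn.
apply: (poly_zeros (a := P a) (n := n) (f := fun i => y0 + y1 * fX C ^+ i)) => //.
  by move=> i j /addrI /(mulfI y10) /fX_inj.
move=> i; pose y := y0 + y1 * fX C ^+ i; pose r a := \sum_(k < n) P a k * y ^+ k.
rewrite -[LHS]/(r a); apply: fpsP => k; rewrite fcoef0.
pose N := maxn k i; pose e j : A := 'X^i + 'X^(N.+1) * 'X^j.
have e0 j : e j != 0.
  apply/eqP => /(congr1 (fun p : A => p`_i)); rewrite /e coefD coefXn eqxx poly.coefXnM coef0.
  by rewrite (_ : (i < N.+1)%N) ?addr0 => [/eqP|]; rewrite ?oner_eq0 // ltnS leq_maxr.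
apply: (poly_zeros (a := fun a => coef (r a) k) (n := n) (f := fun j => x0 + x1 * inA (e j))) => //.
  move=> j j' /addrI /(mulfI x10) /inA_inj /addrI.
  have X0 : 'X^(N.+1) != 0 :> A by rewrite -size_poly_gt0 size_polyXn.
  by move=> /(mulfI X0) /(congr1 (fun p : A => size p)); rewrite !size_polyXn => -[].
move=> j; have := congr1 (fun f => coef f k) (h (e j) (e0 j)).
rewrite fcoef0 fcoef_sum => E; rewrite -[RHS]E; apply: eq_bigr => a' _.
pose x := x0 + x1 * inA (e j); pose y' := y0 + y1 * bar (e j).
have -> : \sum_(b0 < n) P a' b0 * fps_const x ^+ a' * y' ^+ b0 =
    fps_const (x ^+ a') * (r a' + fX C ^+ N.+1 * (\sum_(b0 < n) P a' b0 * (y1 * fX C ^+ j * \sum_(l < b0) y' ^+ (b0.-1 - l) * y ^+ l))).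
  rewrite rmorphXn /r mulrDr !mulr_sumr -big_split; apply: eq_bigr => b0 _.
  have -> : y' ^+ b0 = y ^+ b0 + (y' - y) * \sum_(l < b0) y' ^+ (b0.-1 - l) * y ^+ l.
    by rewrite -subrXX addrC subrK.
  have -> : y' - y = fX C ^+ N.+1 * (y1 * fX C ^+ j).
    rewrite /y' /y /e barD barM !barX !bar_X; ring.
  by rewrite /=; ring.
rewrite coef_constM mulrC fcoefD coefXnM (_ : (k < N.+1)%N) ?addr0 //.
by rewrite ltnS leq_maxl.
Qed.

(** In the applications the outer variable stands for L and the inner one for bL. *)
Definition ev2 (P : {poly {poly D}}) (x y : D) := (P.[x%:P]).[y].
Definition tens (U V : {poly D}) : {poly {poly D}} := map_poly polyC U * V%:P.

Lemma ev2D P Q x y : ev2 (P + Q) x y = ev2 P x y + ev2 Q x y.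
Proof. by rewrite /ev2 !hornerD. Qed.
Lemma ev2N P x y : ev2 (- P) x y = - ev2 P x y.
Proof. by rewrite /ev2 !hornerN. Qed.
Lemma ev2M P Q x y : ev2 (P * Q) x y = ev2 P x y * ev2 Q x y.
Proof. by rewrite /ev2 !hornerM. Qed.
Lemma ev2C c x y : ev2 c%:P%:P x y = c.
Proof. by rewrite /ev2 !hornerC. Qed.
Lemma ev2_sum I (r : seq I) (Q : pred I) (P : I -> {poly {poly D}}) x y :
  ev2 (\sum_(i <- r | Q i) P i) x y = \sum_(i <- r | Q i) ev2 (P i) x y.
Proof. by rewrite /ev2 !horner_sum. Qed.
Lemma ev2_tens U V x y : ev2 (tens U V) x y = U.[x] * V.[y].
Proof. by rewrite /ev2 /tens hornerM hornerC horner_map hornerM hornerC. Qed.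
Lemma coef_tens U V i j : (tens U V)`_i`_j = U`_i * V`_j.
Proof. by rewrite /tens coefMC coef_map coefCM. Qed.

Lemma ev2_box n (P : {poly {poly D}}) (x y : D) : (forall i j, ~~ ((i < n) && (j < n))%N -> P`_i`_j = 0) ->
  ev2 P x y = \sum_(i < n) \sum_(j < n) P`_i`_j * x ^+ i * y ^+ j.
Proof.
move=> h; have s1 : (size P <= n)%N.
  apply/leq_sizeP => i ni; apply/polyP => j; rewrite coef0 h // negb_and.
  by rewrite -leqNgt ni.
have s2 i : (size (P`_i)%R <= n)%N.
  by apply/leq_sizeP => j nj; rewrite h // negb_and -!leqNgt nj orbT.
rewrite /ev2 (horner_coef_wide _ s1) horner_sum; apply: eq_bigr => i _.
rewrite hornerM -rmorphXn hornerC (horner_coef_wide _ (s2 i)) mulr_suml.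
by apply: eq_bigr => j _; rewrite mulrAC.
Qed.

Lemma ev2_bound (P : {poly {poly D}}) : exists n, forall i j, ~~ ((i < n) && (j < n))%N -> P`_i`_j = 0.
Proof.
pose n := (maxn (size P) (\max_(i < size P) size (P`_i)%R)).
exists n => i j; rewrite negb_and -!leqNgt => h.
have [iP|Pi] := ltnP i (size P); last by rewrite (nth_default _ Pi) coef0.
move: h; rewrite leqNgt (leq_trans iP (leq_maxl _ _)) /= => nj.
apply: nth_default; apply: leq_trans nj; rewrite leq_max; apply/orP; right.
exact: (leq_bigmax (Ordinal iP)).
Qed.

Lemma sum_delta (V : nmodType) n k (G : nat -> V) : (k < n)%N ->
  \sum_(a < n) (if k == a then G a else 0) = G k.
Proof.
move=> kn; rewrite (bigD1 (Ordinal kn)) //= eqxx big1 ?addr0 // => a ak.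
by case: eqP => // e; move: ak; rewrite -val_eqE /= -e eqxx.
Qed.

(** Brings a finite family of monomials, possibly with repeated exponents, to the box form that
    [dens2] takes. *)
Lemma box_sum (T : eqType) (r : seq T) n (al be : T -> nat) (G : T -> D) (x y : D) :
  (forall t, t \in r -> (al t < n)%N /\ (be t < n)%N) ->
  \sum_(a < n) \sum_(b < n) (\sum_(t <- r) if (al t == a) && (be t == b) then G t else 0) * x ^+ a * y ^+ b =
  \sum_(t <- r) G t * x ^+ al t * y ^+ be t.
Proof.
move=> h; under eq_bigr => a _ do under eq_bigr => b _ do rewrite !mulr_suml.
under eq_bigr => a _ do rewrite exchange_big.
rewrite exchange_big !big_seq; apply: eq_bigr => t tr; have [ha hb] := h t tr.
rewrite -(sum_delta (fun a => G t * x ^+ a * y ^+ be t) ha); apply: eq_bigr => a _.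
case: (al t == a) => /=; last by rewrite big1 // => b _; rewrite !mul0r.
rewrite -(sum_delta (fun b => G t * x ^+ a * y ^+ b) hb); apply: eq_bigr => b _.
by case: ifP => // _; rewrite !mul0r.
Qed.

(** As a polynomial in x^-1 of degree below q - 1 the sum has the q - 1 roots given by the nonzero
    elements of F. *)
Lemma type_sep (T : Type) (s : seq T) (ty : T -> typeZ F) (V : T -> D) :
  (forall x : F, x != 0 -> \sum_(k <- s) fps_const (inA x%:P ^- ty k) * V k = 0) ->
  forall m, \sum_(k <- s | ty k == m) V k = 0.
Proof.
move=> h m; pose p : {poly D} := \sum_(k <- s) V k *: 'X^(ty k).
have sp : (size p <= q.-1)%N.
  apply/leq_sizeP => j qj; rewrite /p coef_sum big1 // => k _; rewrite coefZ coefXn.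
  have lt : (ty k < q.-1)%N by move: (ltn_ord (ty k)); rewrite [X in (_ < X)%N]q2E.
  by rewrite gtn_eqF ?mulr0 // (leq_trans lt qj).
have p0 : p = 0.
  apply/eqP; apply: contraT => pn.
  have := max_poly_roots pn (rs := [seq fps_const (inA x%:P)^-1 | x <- enum F & x != 0]).
  rewrite size_map.
  have -> : size [seq x <- enum F | x != 0] = q.-1.
    rewrite -(cardC1 (0 : F)) cardE; apply: perm_size; apply: uniq_perm.
    - by apply: filter_uniq; exact: enum_uniq.
    - exact: enum_uniq.
    by move=> x; rewrite mem_filter !mem_enum andbT !inE.
  move=> H; have := leq_trans (H _ _) sp; rewrite ltnn; apply.
    apply/allP => y /mapP[x]; rewrite mem_filter => /andP[x0 _] -> {y}.
    have E := h x x0; rewrite /root horner_sum; apply/eqP; rewrite -[RHS]E; apply: eq_bigr => k _.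
    by rewrite hornerZ hornerXn mulrC -exprVn (rmorphXn (@fps_const C)).
  rewrite map_inj_uniq; first by apply: filter_uniq; exact: enum_uniq.
  by move=> x y /fps_const_inj /invr_inj /inA_inj /polyC_inj.
have := congr1 (fun P : {poly D} => P`_m) p0; rewrite coef0 /p coef_sum => E; rewrite -[RHS]E {E}.
rewrite [LHS]big_mkcond; apply: eq_bigr => k _; rewrite coefZ coefXn -val_eqE eq_sym.
by case: eqP; rewrite ?mulr1 ?mulr0.
Qed.

Local Notation Om := (Omega C).
Local Notation GL := (@GL2A F).
Local Notation wt := (int * int * typeZ F)%type.
Implicit Types (z : Om).

(** For fixed c the factors J and bJ are affine in e(theta) and e(t), while the determinant x varies
    freely and separates types. *)
Definition gmx (x : F) (c e : A) := mx2 x%:P (x%:P * e) c (c * e + 1).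

Lemma gmxP x c e z : x != 0 -> [/\ GL (gmx x c e), inA (\det (gmx x c e)) = inA x%:P,
  J (gmx x c e) z = (1 + inA c * val z) + inA c * inA e &
  bJ (gmx x c e) z = (1 + bar c * (s1 z / s2 z)) + bar c * bar e].
Proof.
move=> x0; have d : \det (gmx x c e) = x%:P by rewrite det_mx2; ring.
split; first exact: det_GL x0 d.
- by rewrite d.
- by rewrite /J !mx2E rmorphD rmorphM rmorph1; ring.
- by rewrite /bJ !mx2E barD barM bar1; ring.
Qed.

Lemma bLE gam z : GL gam ->
  bL gam z = bar (gam 1 0) * (fps_of_poly ((theta C)%:P - 'X) * s2 z)^-1 * (bJ gam z)^-1.
Proof.
move=> gG; rewrite /bL -bJE; have bu := bJ_unit z gG; have su := s2_unit z.
have tu : fps_of_poly ((theta C)%:P - 'X) \is a GRing.unit.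
  by rewrite fps_unitE /= coefB coefC coefX subr0 theta_neq0.
rewrite !invrM ?unitrM ?tu ?bu ?su //; ring.
Qed.

(** Three separations: of types by [type_sep]; of the powers of J and bJ, for fixed c, by [dens2] in
    e; and of the powers of c(theta) and c(t), which come from L and bL, by [dens2] in c. Negative
    exponents are cleared by a power of J bJ. *)
Lemma indep z (s : seq wt) (P : wt -> {poly {poly D}}) : uniq s ->
  (forall gam, GL gam -> \sum_(k <- s) auto k.1.1 k.1.2 k.2 gam z *
     ev2 (P k) (fps_const (L gam z)) (bL gam z) = 0) ->
  forall k, k \in s -> P k = 0.
Proof.
move=> us h k0 k0s.
pose w := fps_of_poly ((theta C)%:P - 'X) * s2 z.
have wu : w \is a GRing.unit.
  by rewrite unitrM s2_unit andbT fps_unitE /= coefB coefC coefX subr0 theta_neq0.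
have [nP hnP] := choice (fun k => ev2_bound (P k)).
pose n := \max_(k <- s) nP k.
have hn k : k \in s -> forall i j, ~~ ((i < n) && (j < n))%N -> (P k)`_i`_j = 0.
  move=> ks i j hij; apply: hnP; apply: contra hij => /andP[h1 h2].
  have le : (nP k <= n)%N by exact: (leq_bigmax_seq k).
  by rewrite (leq_trans h1 le) (leq_trans h2 le).
pose N0 := (\max_(k <- s) (absz k.1.1 + absz k.1.2))%N.
have hN k : k \in s -> (absz k.1.1 + absz k.1.2 <= N0)%N.
  by move=> ks; exact: (leq_bigmax_seq (F := fun k => (absz k.1.1 + absz k.1.2)%N)).
(* B exceeds what the weights and the denominators of L^i and bL^j can subtract, so [al] and [be]
   are true natural exponents, below M. *)
pose B := (N0 + n)%N; pose M := (2 * B).+1.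
pose al (t : wt * (nat * nat)) := absz (B%:Z + t.1.1.1 - t.2.1%:Z)%R.
pose be (t : wt * (nat * nat)) := absz (B%:Z + t.1.1.2 - t.2.2%:Z)%R.
pose r := [seq (k, ij) | k <- [seq k <- s | k.2 == k0.2], ij <- [seq (i, j) | i <- iota 0 n, j <- iota 0 n]].
have rP t : t \in r -> [/\ t.1 \in s, t.1.2 = k0.2, (t.2.1 < n)%N & (t.2.2 < n)%N].
  move=> /allpairsP[[k ij] /= [ks hij ->]] /=; move: ks; rewrite mem_filter => /andP[/eqP k2 ks].
  by move: hij => /allpairsP[[i j] /= [+ + ->]]; rewrite !mem_iota.
have alP t : t \in r -> (al t)%:Z = B%:Z + t.1.1.1 - t.2.1%:Z /\ (be t)%:Z = B%:Z + t.1.1.2 - t.2.2%:Z.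
  move=> /rP[/hN]; rewrite /al /be /B; move: (t.1.1.1) (t.1.1.2) (t.2.1) (t.2.2) => a b i j; lia.
have alM t : t \in r -> (al t < M)%N /\ (be t < M)%N.
  move=> /rP[/hN]; rewrite /al /be /M /B; move: (t.1.1.1) (t.1.1.2) (t.2.1) (t.2.2) => a b i j; lia.
pose pc (t : wt * (nat * nat)) := (P t.1)`_t.2.1`_t.2.2 * w^-1 ^+ t.2.2.
have key (c e : A) : c != 0 -> e != 0 -> \sum_(t <- r) pc t * fps_const (inA c) ^+ t.2.1 * bar c ^+ t.2.2 *
   fps_const ((1 + inA c * val z) + inA c * inA e) ^+ al t * ((1 + bar c * (s1 z / s2 z)) + bar c * bar e) ^+ be t = 0.
  move=> c0 e0.
  have := type_sep (s := s) (ty := fun k => k.2)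
    (V := fun k => fps_const (J (gmx 1 c e) z ^ k.1.1) * bJ (gmx 1 c e) z ^ k.1.2 *
       ev2 (P k) (fps_const (L (gmx 1 c e) z)) (bL (gmx 1 c e) z)).
  have [g1 d1 J1 bJ1] := gmxP c e z (oner_neq0 F).
  have H : forall x : F, x != 0 -> \sum_(k <- s) fps_const (inA x%:P ^- k.2) *
     (fps_const (J (gmx 1 c e) z ^ k.1.1) * bJ (gmx 1 c e) z ^ k.1.2 *
       ev2 (P k) (fps_const (L (gmx 1 c e) z)) (bL (gmx 1 c e) z)) = 0.
    move=> x x0; have [gx dx Jx bJx] := gmxP c e z x0.
    have E := h _ gx; rewrite -[RHS]E; apply: eq_bigr => k _.
    rewrite /auto dx !(bLE z gx) !(bLE z g1) /L Jx bJx J1 bJ1 !mx2E; ring.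
  move=> /(_ H k0.2) {H} HH.
  set j := 1 + inA c * val z + inA c * inA e in J1 *.
  set bj := 1 + bar c * (s1 z / s2 z) + bar c * bar e in bJ1 *.
  have j0 : j != 0 by rewrite -J1; exact: J_neq0 g1.
  have bu : bj \is a GRing.unit by rewrite -bJ1; exact: bJ_unit g1.
  have HB := congr1 (fun x => fps_const j ^+ B * bj ^+ B * x) HH.
  rewrite mulr0 mulr_sumr in HB; rewrite -[RHS]HB {HB HH}.
  rewrite /r big_allpairs_dep big_filter; rewrite big_seq_cond [RHS]big_seq_cond.
  apply: eq_bigr => k /andP[ks kt].
  rewrite J1 bJ1 (bLE z g1) /L J1 bJ1 !mx2E (ev2_box _ _ (hn k ks)) !mulr_sumr.
  rewrite big_allpairs_dep -{1}(subn0 n) big_mkord; apply: eq_bigr => i _.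
  rewrite !mulr_sumr -{1}(subn0 n) big_mkord; apply: eq_bigr => l _.
  have tr : (k, (i : nat, l : nat)) \in r.
    apply/allpairsP; exists (k, (i : nat, l : nat)); split => //=; first by rewrite mem_filter kt.
    by apply/allpairsP; exists (i : nat, l : nat); rewrite /= !mem_iota !ltn_ord.
  have [ea eb] := alP _ tr; rewrite /= in ea eb.
  have e1 : fps_const j ^+ al (k, (i : nat, l : nat)) = fps_const j ^+ B * fps_const (j ^ k.1.1) * fps_const (j ^- i).
    rewrite -!rmorphXn -!rmorphM; congr fps_const.
    by rewrite -[LHS]/(j ^ (al (k, (i : nat, l : nat)))%:Z) ea !expfzDr // -exprnN.
  have e2 : bj ^+ be (k, (i : nat, l : nat)) = bj ^+ B * bj ^ k.1.2 * bj ^- l.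
    by rewrite -[LHS]/(bj ^ (be (k, (i : nat, l : nat)))%:Z) eb !exprzDr // -exprnN.
  rewrite e1 e2 /pc /= (rmorphM (@fps_const C)) -!exprVn !exprMn !rmorphXn -/w; ring.
have Q0 (c : A) : c != 0 -> forall a b, (a < M)%N -> (b < M)%N ->
   \sum_(t <- r) (if (al t == a) && (be t == b) then pc t * fps_const (inA c) ^+ t.2.1 * bar c ^+ t.2.2 else 0) = 0.
  move=> c0 a b aM bM.
  have cn : inA c != 0 by rewrite inA_eq0.
  have bn : bar c != 0.
    apply: contra c0 => /eqP b0; apply/eqP/polyP => i; rewrite coef0.
    have := congr1 (fun f => coef f i) b0; rewrite /bar /= coef_map /= => /eqP.
    by rewrite inA_eq0 polyC_eq0 => /eqP.
  apply: (@dens2 M (fun a b => \sum_(t <- r) (if (al t == a) && (be t == b) then pc t * fps_const (inA c) ^+ t.2.1 * bar c ^+ t.2.2 else 0)) (1 + inA c * val z) _ (1 + bar c * (s1 z / s2 z)) _ cn bn _ a b aM bM).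
  move=> e e0; rewrite -[RHS](key c e c0 e0).
  have := box_sum (fun t => pc t * fps_const (inA c) ^+ t.2.1 * bar c ^+ t.2.2)
    (fps_const (1 + inA c * val z + inA c * inA e)) (1 + bar c * (s1 z / s2 z) + bar c * bar e) alM.
  by move=> E; refine (eq_trans _ E).
have pc0 a b i j : (a < M)%N -> (b < M)%N -> (i < n)%N -> (j < n)%N ->
   \sum_(t <- r) (if (t.2.1 == i) && (t.2.2 == j) then (if (al t == a) && (be t == b) then pc t else 0) else 0) = 0.
  move=> aM bM; apply: (@dens2 n (fun i j => \sum_(t <- r) (if (t.2.1 == i) && (t.2.2 == j) then (if (al t == a) && (be t == b) then pc t else 0) else 0)) 0 1 0 1); rewrite ?oner_neq0 // => c c0.
  rewrite add0r mul1r add0r mul1r -[RHS](Q0 c c0 a b aM bM).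
  rewrite (@box_sum _ r n (fun t => t.2.1) (fun t => t.2.2) (fun t => if (al t == a) && (be t == b) then pc t else 0)); last first.
    by move=> t /rP[].
  by apply: eq_bigr => t _; case: ifP => // _; rewrite !mul0r.
have ur : uniq r.
  apply: allpairs_uniq => [||[? ?] [? ?] _ _ [-> ->]] //; first exact: filter_uniq.
  by apply: allpairs_uniq => [||[? ?] [? ?] _ _ [-> ->]] //; exact: iota_uniq.
apply/polyP => i; rewrite coef0; apply/polyP => j; rewrite coef0.
have [hij|] := boolP ((i < n) && (j < n))%N; last exact: hn.
have /andP[ilt jlt] := hij.
pose t0 : wt * (nat * nat) := (k0, (i, j)).
have t0r : t0 \in r.
  apply/allpairsP; exists t0; split => //=; first by rewrite mem_filter eqxx.
  by apply/allpairsP; exists (i, j); rewrite /= !mem_iota.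
have [a0M b0M] := alM _ t0r; have := pc0 _ _ _ _ a0M b0M ilt jlt.
rewrite (bigD1_seq t0) //= !eqxx /= big1_seq ?addr0 => [/eqP|t /andP[tt0 tr]].
  by rewrite mulf_eq0 => /orP[/eqP //|]; rewrite expf_eq0 => /andP[_ /eqP w0]; have := wu; rewrite -unitrV w0 unitr0.
case: ifP => // /andP[/eqP ti /eqP tj]; case: ifP => // /andP[/eqP ta /eqP tb].
case/negP: tt0; apply/eqP.
have [h1 h2] := alP _ tr; have [h3 h4] := alP _ t0r; have [_ kt _ _] := rP _ tr.
rewrite ta h3 /= ti in h1; rewrite tb h4 /= tj in h2.
have {}h1 : k0.1.1 = t.1.1.1 by move: h1; move: (k0.1.1) (t.1.1.1) => x y; lia.
have {}h2 : k0.1.2 = t.1.1.2 by move: h2; move: (k0.1.2) (t.1.1.2) => x y; lia.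
rewrite /t0; move: h1 h2 kt ti tj; case: (t) => [[[a b] c] [i' j']]; case: (k0) => [[a' b'] c'] /=.
by move=> -> -> -> -> ->.
Qed.
End Density.

(** * Quasi-modular laws and their top coefficients *)

Section QuasiModular.
Variables (F : finFieldType) (R : realType) (C : cinf F R).
Local Notation q := (#|F|).
Local Notation inA := (@embA F R C).
Local Notation bar := (@bar F R C).
Local Notation theta := (@theta F R C).
Local Notation D := (fps C).
Local Notation Om := (Omega C).
Local Notation s2 := (@s2 F R C).
Local Notation GL := (@GL2A F).
Implicit Types (z : Om) (f : Om -> D) (P : Om -> {poly {poly D}}).

Lemma auto1 gam z : auto 0 0 0 gam z = 1.
Proof. by rewrite /auto !expr0z expr0 invr1 !rmorph1 !mul1r. Qed.

Lemma autoX mu nu m k gam z : GL gam ->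
  auto mu nu m gam z ^+ k = auto (mu *+ k) (nu *+ k) (m * k) gam z.
Proof.
move=> gG; elim: k => [|k IH]; first by rewrite muln0 !mulr0n auto1 expr0.
by rewrite exprS IH autoM // !mulrS mulnS.
Qed.

Lemma auto_cocycle mu nu m gam del z : GL gam -> GL del ->
  auto mu nu m (gam *m del) z = auto mu nu m gam (mob del z) * auto mu nu m del z.
Proof.
move=> gG dG; rewrite /auto J_cocycle // bJ_cocycle // det_mulmx (rmorphM (@embA F R C)).
rewrite exprMn invfM expfzMl exprzMl ?bJ_unit // !(rmorphM (@fps_const C)).
have ac (a b c d e f : D) : a * b * (c * d) * (e * f) = a * c * e * (b * d * f) by ring.
exact: ac.
Qed.

Definition tau z := fps_of_poly (theta%:P - 'X) * s2 z.
Lemma tau_unit z : tau z \is a GRing.unit.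
Proof. by rewrite unitrM s2_unit andbT fps_unitE /= coefB coefC coefX subr0 theta_neq0. Qed.

Lemma frac_split (V : comUnitRingType) (x b p B d c t j : V) :
  b \is a GRing.unit -> B \is a GRing.unit -> t \is a GRing.unit -> j \is a GRing.unit ->
  x * b = p * (B * b) + d * c ->
  x * t^-1 * (B * b)^-1 = p * t^-1 * b^-1 + d * j^-1 / b * (c * (j^-1 * b * t)^-1 * B^-1).
Proof.
move=> bu Bu tu ju key; rewrite !invrM ?unitrM ?unitrV ?bu ?ju //= invrK.
have [eb eB ej] := And3 (mulrV bu) (mulrV Bu) (mulrV ju).
transitivity (x * b * (t^-1 * b^-1 * b^-1 * B^-1)).
  by rewrite -[in LHS](mulr1 x) -{1}eb; move: t^-1 b^-1 B^-1 => *; ring.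
rewrite key; move: eb eB ej; move: t^-1 b^-1 B^-1 j^-1 => ti bi Bi ji eb eB ej.
transitivity (p * ti * bi * (B * Bi) * (b * bi) + d * c * (ti * bi * bi * Bi)); first by ring.
rewrite eb eB !mulr1; congr (_ + _).
transitivity (d * c * (ti * bi * bi * Bi) * (j * ji)); first by rewrite ej mulr1.
by ring.
Qed.

(** The shape is that of [L_cocycle], with a multiplier of weight (-1, -1) in place of (-2, 0). *)
Lemma bL_cocycle gam del z : GL gam -> GL del -> bL (gam *m del) z =
  bL del z + fps_const (inA (\det del) / J del z) / bJ del z * bL gam (mob del z).
Proof.
move=> gG dG; have gdG := GL_mul gG dG.
rewrite !bLE // -/(tau z) -/(tau (mob del z)) bJ_cocycle //.
have bu := bJ_unit z dG; have bu' := bJ_unit (mob del z) gG.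
have su := s2_unit z; have ju := J_unit z dG.
have -> : tau (mob del z) = fps_const (J del z)^-1 * bJ del z * tau z.
  by rewrite /tau s2_mob //; ring.
have e1 : bJ del z * s2 z = bar (del 1 0) * s1 z + bar (del 1 1) * s2 z by rewrite bJE.
have eg : bJ gam (mob del z) * bJ del z * s2 z = bar ((gam *m del) 1 0) * s1 z + bar ((gam *m del) 1 1) * s2 z.
  by rewrite -bJ_cocycle // bJE.
have key : bar ((gam *m del) 1 0) * bJ del z =
    bar (del 1 0) * (bJ gam (mob del z) * bJ del z) + bar (\det del) * bar (gam 1 0).
  apply: (mulIr su); rewrite -mulrA e1.
  rewrite [RHS](_ : _ = bar (del 1 0) * (bJ gam (mob del z) * bJ del z * s2 z) + bar (\det del) * bar (gam 1 0) * s2 z); last by ring.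
  rewrite eg !mulmx22 det_mx22.
  rewrite !barD !barM barN !barM; ring.
rewrite (bar_det C dG) in key; rewrite !(rmorphM (@fps_const C)) !fps_constV.
have := frac_split bu bu' (tau_unit z) ju key; rewrite -!fps_constV; exact.
Qed.

Lemma lincoef (x y : D) i a : (i <= a)%N ->
  ((x *: 'X + y%:P) ^+ i)`_a = if i == a then x ^+ a else 0.
Proof.
elim: i a => [|i IH] [|a] ia //; first by rewrite expr0 coef1.
  by rewrite expr0 coef1.
rewrite exprS mulrDl coefD -scalerAl coefZ coefXM coefCM /= (IH a ia) (IH a.+1 (leqW (ia : (i <= a)%N))).
rewrite (ltn_eqF (ia : (i < a.+1)%N)) mulr0 addr0.
by have [E|ne] := eqVneq i a; [rewrite E !eqxx exprS | rewrite ?eqSS ?(negPf ne) mulr0].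
Qed.

(** In total degree a + b >= l only the term i = a, j = b contributes, the affine shifts y and y'
    lowering the degree. *)
Lemma tens_top l (c : nat -> nat -> D) (x y x' y' : D) a b :
  (forall i j, (l < i + j)%N -> c i j = 0) -> (l <= a + b)%N ->
  (\sum_(i < l.+1) \sum_(j < l.+1) (c i j)%:P%:P *
     tens ((x *: 'X + y%:P) ^+ i) ((x' *: 'X + y'%:P) ^+ j))`_a`_b = c a b * (x ^+ a * x' ^+ b).
Proof.
move=> h lab.
have t i j : ((c i j)%:P%:P * tens ((x *: 'X + y%:P) ^+ i) ((x' *: 'X + y'%:P) ^+ j))`_a`_b =
    if a == i then (if b == j then c i j * (x ^+ i * x' ^+ j) else 0) else 0.
  rewrite !coefCM coef_tens; have [l1|l1] := ltnP l (i + j).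
    by rewrite h // !mul0r; do 2 case: ifP => //.
  case: (ltngtP i a) => [ia|ia|ia]; last rewrite ia in l1 *.
  - by rewrite lincoef 1?ltnW // (ltn_eqF ia) mul0r mulr0.
  - have jb : (j < b)%N by lia.
    by rewrite (lincoef _ _ (ltnW jb)) (ltn_eqF jb) !mulr0.
  case: (ltngtP j b) => [jb|jb|->].
  - by rewrite (lincoef _ _ (ltnW jb)) (ltn_eqF jb) !mulr0.
  - by have : false by lia.
  by rewrite !lincoef // !eqxx.
rewrite coef_sum coef_sum; under eq_bigr => i _ do rewrite coef_sum coef_sum.
under eq_bigr => i _ do under eq_bigr => j _ do rewrite t.
have [al|al] := ltnP a l.+1; last first.
  rewrite h ?mul0r; last by lia.
  by rewrite big1 // => i _; rewrite big1 // => j _; rewrite gtn_eqF // (leq_trans (ltn_ord i)).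
have [bl|bl] := ltnP b l.+1; last first.
  rewrite h ?mul0r; last by lia.
  rewrite big1 // => i _; rewrite big1 // => j _.
  by rewrite [b == j]gtn_eqF ?if_same // (leq_trans (ltn_ord j)).
rewrite -(sum_delta (fun i => c i b * (x ^+ i * x' ^+ b)) al); apply: eq_bigr => i _.
case: (a == i); last by rewrite big1.
by rewrite (sum_delta (fun j => c i j * (x ^+ i * x' ^+ j)) bl).
Qed.

(** Gathers the functions f_ij into one polynomial in L and bL, so that sums and products of forms
    are sums and products of polynomials. *)
Definition qlaw mu nu m P f := forall gam z, GL gam ->
  f (mob gam z) = auto mu nu m gam z * ev2 (P z) (fps_const (L gam z)) (bL gam z).

Lemma L1 z : L 1%:M z = 0.
Proof. by rewrite /L !mxE /= rmorph0 mul0r. Qed.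
Lemma bL1 z : bL 1%:M z = 0.
Proof. by rewrite /bL !mxE /= bar0 mul0r. Qed.
Lemma auto_1 mu nu m z : auto mu nu m 1%:M z = 1.
Proof.
rewrite /auto det1 rmorph1 expr1n invr1 J1 /bJ !mxE /= bar0 bar1 mul0r add0r.
by rewrite !exp1rz !rmorph1 !mul1r.
Qed.

Lemma qlaw_val mu nu m P f z : qlaw mu nu m P f -> f z = (P z)`_0`_0.
Proof.
move=> /(_ 1%:M z (GL1 F)); rewrite mob1 auto_1 mul1r L1 bL1 rmorph0 => ->.
by rewrite /ev2 !horner_coef0.
Qed.

Lemma qlaw_law mu nu m f : law mu nu m f <-> qlaw mu nu m (fun z => (f z)%:P%:P) f.
Proof. by split=> h gam z gG; rewrite h // ev2C. Qed.

Lemma qlawD mu nu m P P' f f' : qlaw mu nu m P f -> qlaw mu nu m P' f' ->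
  qlaw mu nu m (fun z => P z + P' z) (fun z => f z + f' z).
Proof. by move=> h h' gam z gG; rewrite h // h' // ev2D mulrDr. Qed.

Lemma qlawM mu nu m P f mu' nu' m' P' f' : qlaw mu nu m P f -> qlaw mu' nu' m' P' f' ->
  qlaw (mu + mu') (nu + nu') (m + m') (fun z => P z * P' z) (fun z => f z * f' z).
Proof. by move=> h h' gam z gG; rewrite h // h' // ev2M -autoM //; ring. Qed.

Lemma qlaw_eq mu nu m P f mu' nu' m' P' f' : mu = mu' -> nu = nu' -> m = m' %[mod q.-1] ->
  (forall z, f z = f' z) -> (forall z, P z = P' z) -> qlaw mu nu m P f -> qlaw mu' nu' m' P' f'.
Proof. by move=> -> -> e ef eP h gam z gG; rewrite -ef -eP h // (auto_mod _ _ _ gG e). Qed.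

Lemma auto_eq mu nu m mu' nu' m' gam z : mu = mu' -> nu = nu' -> m = m' ->
  auto mu nu m gam z = auto mu' nu' m' gam z.
Proof. by move=> -> -> ->. Qed.

(** Expand f at a product of two matrices in two ways. By the cocycle relations and [indep], P at
    the transformed point is P z after affine substitutions in L and bL, whose translations do not
    affect the top degree. *)
Lemma top_law mu nu m P f l : qlaw mu nu m P f ->
  (forall z i j, (l < i + j)%N -> (P z)`_i`_j = 0) ->
  forall a b, (l <= a + b)%N -> law (mu - (a + a + b)%N%:Z) (nu - b%:Z) (m + (a + b) * q.-2) (fun z => (P z)`_a`_b).
Proof.
move=> h hP a b lab del z dG.
pose al := auto (-2) 0 q.-2 del z; pose be := auto (-1) (-1) q.-2 del z.
(* [auto] contains only negative powers of the determinant; as the determinant is a nonzero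
   constant, its first power is its power - (q - 2). *)
have det_pow : fps_const (inA (\det del) ^- q.-2) = fps_const (inA (\det del)).
  have [c c0 ->] := GL_det dG.
  congr fps_const; apply: mulr1_eq; rewrite mulrC -exprS -rmorphXn -polyC_exp q2E unit_pow //.
  by rewrite !rmorph1.
have alE : al = fps_const (inA (\det del) / J del z ^+ 2).
  by rewrite /al /auto expr0z mulr1 det_pow -rmorphM -exprnN.
have beE : be = fps_const (inA (\det del) / J del z) / bJ del z.
  by rewrite /be /auto det_pow !exprN1 -rmorphM.
pose Q := \sum_(i < l.+1) \sum_(j < l.+1) ((P z)`_i`_j)%:P%:P *
  tens ((al *: 'X + (fps_const (L del z))%:P) ^+ i) ((be *: 'X + (bL del z)%:P) ^+ j).
have E : P (mob del z) = (auto mu nu m del z)%:P%:P * Q.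
  apply/subr0_eq; pose m0 : typeZ F := inZp m.
  apply: (@indep _ _ _ (mob del z) [:: (mu, nu, m0)] (fun=> P (mob del z) - (auto mu nu m del z)%:P%:P * Q) _ _ (mu, nu, m0)); rewrite ?inE ?eqxx // => gam gG.
  rewrite big_seq1; set a1 := auto _ _ _ _ _.
  have -> : a1 = auto mu nu m gam (mob del z) by apply: auto_mod gG _; rewrite /m0 /= q2E modn_mod.
  move=> {a1}; have E1 := h gam (mob del z) gG; rewrite -(mob_mul z gG dG) (h _ z (GL_mul gG dG)) in E1.
  rewrite (auto_cocycle _ _ _ z gG dG) -mulrA in E1.
  rewrite ev2D ev2N mulrDr mulrN -E1 -mulrN -mulrDr ev2M ev2C -mulrN -mulrDr; apply/eqP.
  rewrite mulf_eq0; apply/orP; right; rewrite mulf_eq0; apply/orP; right; rewrite subr_eq0; apply/eqP.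
  have hb i j : ~~ ((i < l.+1) && (j < l.+1))%N -> (P z)`_i`_j = 0.
    by rewrite negb_and -!leqNgt => /orP[] lt; apply: hP; lia.
  rewrite (ev2_box _ _ hb) /Q ev2_sum; apply: eq_bigr => i _; rewrite ev2_sum; apply: eq_bigr => j _.
  rewrite ev2M ev2C ev2_tens !horner_exp !hornerD !hornerZ !hornerX !hornerC -mulrA.
  have EL : fps_const (L (gam *m del) z) = al * fps_const (L gam (mob del z)) + fps_const (L del z).
    by rewrite alE -(rmorphM (@fps_const C)) -(rmorphD (@fps_const C)) (L_cocycle z gG dG) addrC.
  have EbL : bL (gam *m del) z = be * bL gam (mob del z) + bL del z.
    by rewrite (bL_cocycle z gG dG) -beE addrC.
  by rewrite EL EbL.
rewrite E coefCM coefCM (tens_top _ _ _ _ (hP z) lab) /al /be !(autoX _ _ _ _ z dG) (autoM _ _ _ _ _ _ z dG) mulrCA (autoM _ _ _ _ _ _ z dG) mulrC.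
apply: (congr1 (fun x => x * (P z)`_a`_b)); apply: auto_eq.
- rewrite -(mulr_natr (-2)) -(mulr_natr (-1)) !natz; lia.
- rewrite -(mulr_natr 0) -(mulr_natr (-1)) !natz; lia.
by rewrite -mulnDr mulnC.
Qed.

End QuasiModular.

(** * Depth reduction and the grading *)

Section Structure.
Variables (F : finFieldType) (R : realType) (C : cinf F R).
Local Notation q := (#|F|).
Local Notation D := (fps C).
Local Notation Om := (Omega C).
Local Notation Tpos := (@Tpos F R C).
Local Notation GL := (@GL2A F).
Local Notation wt := (int * int * typeZ F)%type.
Local Notation fct := (Om -> D).
Local Notation subalg := (@subalgebra F R C).
Local Notation gen := (@generated F R C).
Implicit Types (z : Om) (f : fct) (P : Om -> {poly {poly D}}) (B S : set fct).

Lemma gen_alg S : subalg (gen S).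
Proof.
split=> [c hc|f g hf hg|f g hf hg] B hB; have [[h1 h2 h3] _] := hB.
- exact: h1.
- exact: h2 (hf B hB) (hg B hB).
exact: h3 (hf B hB) (hg B hB).
Qed.
Lemma gen_in S : S `<=` gen S.
Proof. by move=> f Sf B [_]; exact. Qed.
Lemma gen_le S B : subalg B -> S `<=` B -> gen S `<=` B.
Proof. by move=> hB SB f; apply. Qed.

Lemma alg_sum B I (r : seq I) (Q : pred I) (f : I -> fct) : subalg B -> (forall i, Q i -> B (f i)) ->
  B (fun z => \sum_(i <- r | Q i) f i z).
Proof.
move=> [h1 h2 _] h; elim: r => [|i r IH].
  by rewrite [X in B X](_ : _ = (fun=> 0)); [exact: h1 (Tpos0 C) | apply: funext => z; rewrite big_nil].
case Qi: (Q i); last by rewrite [X in B X](_ : _ = (fun z => \sum_(i <- r | Q i) f i z)) //; apply: funext => z; rewrite big_cons Qi.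
rewrite [X in B X](_ : _ = (f i + fun z => \sum_(i <- r | Q i) f i z)); first exact: h2 (h i Qi) IH.
by apply: funext => z; rewrite big_cons Qi.
Qed.

Lemma algX B f k : subalg B -> B f -> B (fun z => f z ^+ k).
Proof.
move=> [h1 _ h3] hf; elim: k => [|k IH].
  by rewrite [X in B X](_ : _ = (fun=> 1)); [exact: h1 (Tpos1 C) | apply: funext => z; rewrite expr0].
rewrite [X in B X](_ : _ = (f * fun z => f z ^+ k)); first exact: h3.
by apply: funext => z; rewrite exprS.
Qed.

Lemma algM B f g : subalg B -> B f -> B g -> B (fun z => f z * g z).
Proof. by move=> [_ _ h] hf hg; exact: (h f g). Qed.
Lemma algD B f g : subalg B -> B f -> B g -> B (fun z => f z + g z).
Proof. by move=> [_ h _] hf hg; exact: (h f g). Qed.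
Lemma algT B T f : subalg B -> Tpos T -> B f -> B (fun z => T * f z).
Proof. by move=> hB hT hf; apply: (algM hB _ hf); case: hB => h _ _; exact: h. Qed.

Lemma tensX (U V : {poly D}) i j : tens (U ^+ i) (V ^+ j) = tens U 1 ^+ i * tens 1 V ^+ j.
Proof. by rewrite /tens !rmorphXn /= !rmorph1 mulr1 mul1r. Qed.

Lemma qlawX mu nu m P f k : qlaw mu nu m P f ->
  qlaw (mu *+ k) (nu *+ k) (m * k) (fun z => P z ^+ k) (fun z => f z ^+ k).
Proof.
move=> h gam z gG; rewrite (h _ _ gG) exprMn (autoX _ _ _ _ _ gG).
by rewrite /ev2 !horner_exp.
Qed.

Lemma qlawB mu nu m P f P' f' : qlaw mu nu m P f -> qlaw mu nu m P' f' ->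
  qlaw mu nu m (fun z => P z - P' z) (fun z => f z - f' z).
Proof. by move=> h h' gam z gG; rewrite (h _ _ gG) (h' _ _ gG) ev2D ev2N mulrBr. Qed.

Lemma qlaw_sum mu nu m I (r : seq I) (Q : pred I) (P : I -> Om -> {poly {poly D}}) (f : I -> fct) :
  (forall i, qlaw mu nu m (P i) (f i)) ->
  qlaw mu nu m (fun z => \sum_(i <- r | Q i) P i z) (fun z => \sum_(i <- r | Q i) f i z).
Proof.
move=> h gam z gG; rewrite ev2_sum mulr_sumr; apply: eq_bigr => i _; exact: h.
Qed.

Variable pi : C.
Hypothesis hpi : carlitz_period pi.
Local Notation xp := (@xp F R C pi).
Local Notation almost := (@almost_A_quasi_modular F R C pi).
Local Notation Mcal := (@Mcal F R C pi).
Local Notation Mtilde := (@Mtilde F R C pi).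

Definition hasxp f := exists c, xp c f.
Definition hasxpB P := forall i j, hasxp (fun z => (P z)`_i`_j).

Lemma hasxp_ext f f' : (forall z, f z = f' z) -> hasxp f -> hasxp f'.
Proof. by move=> e [c h]; exists c; exact: xp_ext h. Qed.
Lemma hasxpD f f' : hasxp f -> hasxp f' -> hasxp (fun z => f z + f' z).
Proof. by move=> [c h] [c' h']; exists (c + c'); exact: xpD. Qed.
Lemma hasxpM f f' : hasxp f -> hasxp f' -> hasxp (fun z => f z * f' z).
Proof. by move=> [c h] [c' h']; exists (c * c'); exact: xpM. Qed.
Lemma hasxpT T : Tpos T -> hasxp (fun=> T).
Proof. by move=> hT; exists (fps_const T); exact: xp_const. Qed.
Lemma hasxpB_sub f f' : hasxp f -> hasxp f' -> hasxp (fun z => f z - f' z).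
Proof.
move=> h h'; have := hasxpD h (hasxpM (hasxpT (TposN (Tpos1 C))) h').
by apply: hasxp_ext => z; rewrite mulN1r.
Qed.
Lemma hasxp_sum I (r : seq I) (Q : pred I) (f : I -> fct) : (forall i, hasxp (f i)) ->
  hasxp (fun z => \sum_(i <- r | Q i) f i z).
Proof.
move=> h; elim: r => [|i r IH].
  by apply: hasxp_ext (hasxpT (Tpos0 C)) => z; rewrite big_nil.
case Qi: (Q i); last by apply: hasxp_ext IH => z; rewrite big_cons Qi.
by apply: hasxp_ext (hasxpD (h i) IH) => z; rewrite big_cons Qi.
Qed.

Lemma hasxpBM P P' : hasxpB P -> hasxpB P' -> hasxpB (fun z => P z * P' z).
Proof.
move=> h h' i j; apply: (hasxp_ext (f := fun z => \sum_(a < i.+1) \sum_(b < j.+1) (P z)`_a`_b * (P' z)`_(i - a)`_(j - b))).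
  by move=> z; rewrite coefM coef_sum; apply: eq_bigr => a _; rewrite coefM.
by do 2 apply: hasxp_sum => ?; exact: hasxpM.
Qed.
Lemma hasxpBC f : hasxp f -> hasxpB (fun z => (f z)%:P%:P).
Proof.
move=> h i j; have h0 := hasxpT (Tpos0 C).
case: i => [|i]; last by apply: hasxp_ext h0 => z; rewrite coefC coef0.
by case: j => [|j]; [apply: hasxp_ext h | apply: hasxp_ext h0] => z; rewrite !coefC.
Qed.
Lemma hasxpBX P k : hasxpB P -> hasxpB (fun z => P z ^+ k).
Proof.
move=> h; elim: k => [|k IH].
  by move=> i j; apply: hasxp_ext (hasxpBC (hasxpT (Tpos1 C)) i j) => z; rewrite expr0.
by move=> i j; apply: hasxp_ext (hasxpBM h IH i j) => z; rewrite exprS.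
Qed.

(** The working form of [almost_A_quasi_modular]: the coefficients form a polynomial, regularity is
    the existence of an expansion, and the type is a natural number ([almost_QM], [QM_almost]). *)
Definition QM mu nu m l f := exists P, [/\ qlaw mu nu m P f,
  forall z i j, (l < i + j)%N -> (P z)`_i`_j = 0 & hasxpB P].

Lemma QM_eq mu nu m l f mu' nu' m' f' : mu = mu' -> nu = nu' -> m = m' %[mod q.-1] ->
  (forall z, f z = f' z) -> QM mu nu m l f -> QM mu' nu' m' l f'.
Proof. by move=> e1 e2 e3 e4 [P [h1 h2 h3]]; exists P; split=> //; exact: qlaw_eq h1. Qed.

Lemma almost_QM mu nu m l f : almost mu nu m l f -> QM mu nu m l f.
Proof.
move=> [_ [fij [hr hl]]].
pose P z : {poly {poly D}} := \poly_(i < l.+1) \poly_(j < l.+1) (if (i + j <= l)%N then fij i j z else 0).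
have PE z i j : (P z)`_i`_j = if (i + j <= l)%N then fij i j z else 0.
  rewrite /P coef_poly ltnS; case: (leqP i l) => il; last by rewrite coef0 leqNgt (leq_trans il (leq_addr _ _)).
  rewrite coef_poly ltnS; case: (leqP j l) => jl //; by rewrite leqNgt (leq_trans jl (leq_addl _ _)).
exists P; split=> [gam z gG|z i j lij|i j].
- rewrite (hl _ _ gG) /auto; congr (_ * _); rewrite (ev2_box (n := l.+1)); last first.
    by move=> i j; rewrite negb_and -!leqNgt PE => h; case: ifP => // h'; move: h h'; lia.
  apply: eq_bigr => i _; rewrite big_mkcond; apply: eq_bigr => j _; rewrite PE.
  by case: ifP => _; rewrite ?rmorphXn ?mul0r.
- by rewrite PE leqNgt lij.
case: (leqP (i + j) l) => [h|h].
  by apply: hasxp_ext (regular_xp hpi (hr i j h)) => z; rewrite PE h.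
by apply: hasxp_ext (hasxpT (Tpos0 C)) => z; rewrite PE leqNgt h.
Qed.

Lemma QM_val mu nu m l f : QM mu nu m l f -> hasxp f.
Proof. by move=> [P [h1 _ h3]]; apply: hasxp_ext (h3 0%N 0%N) => z; rewrite (qlaw_val z h1). Qed.

Lemma QM_almost mu nu m l f : QM mu nu m l f -> almost mu nu (inZp m) l f.
Proof.
move=> H; have [P [h1 h2 h3]] := H; split; first by have [c hc] := QM_val H; exact: xp_regular hc.
exists (fun i j z => (P z)`_i`_j); split=> [i j _|gam z gG]; first by have [c hc] := h3 i j; exact: xp_regular hc.
rewrite (h1 _ _ gG) (auto_mod _ _ _ gG (m' := inZp m : typeZ F)); last by rewrite /= q2E modn_mod.
rewrite /auto; congr (_ * _); rewrite (ev2_box (n := l.+1)); last first.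
  by move=> i j; rewrite negb_and -!leqNgt => h; apply: h2; move: h; lia.
apply: eq_bigr => i _; rewrite [RHS]big_mkcond; apply: eq_bigr => j _.
by case: ifP => [_|/negbT]; rewrite ?rmorphXn // -ltnNge => /h2 ->; rewrite !mul0r.
Qed.

Lemma QM_le mu nu m l l' f : (l <= l')%N -> QM mu nu m l f -> QM mu nu m l' f.
Proof.
move=> ll [P [h1 h2 h3]]; exists P; split=> // z i j lij; apply: h2; exact: leq_ltn_trans lij.
Qed.

Lemma QM_D mu nu m l f f' : QM mu nu m l f -> QM mu nu m l f' -> QM mu nu m l (fun z => f z + f' z).
Proof.
move=> [P [h1 h2 h3]] [P' [h1' h2' h3']]; exists (fun z => P z + P' z); split; first exact: qlawD.
  by move=> z i j lij; rewrite !coefD h2 // h2' // addr0.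
by move=> i j; apply: hasxp_ext (hasxpD (h3 i j) (h3' i j)) => z; rewrite !coefD.
Qed.

Lemma QM_M mu nu m l f mu' nu' m' l' f' : QM mu nu m l f -> QM mu' nu' m' l' f' ->
  QM (mu + mu') (nu + nu') (m + m') (l + l') (fun z => f z * f' z).
Proof.
move=> [P [h1 h2 h3]] [P' [h1' h2' h3']]; exists (fun z => P z * P' z); split; first exact: qlawM.
  move=> z i j lij; rewrite coefM coef_sum big1 // => a _; rewrite coefM big1 // => b _.
  have [lab|lab] := ltnP l (a + b); first by rewrite h2 // mul0r.
  rewrite h2' ?mulr0 //; have := ltn_ord a; have := ltn_ord b; lia.
exact: hasxpBM.
Qed.

Lemma QM0 mu nu m f : law mu nu m f -> hasxp f -> QM mu nu m 0 f.
Proof.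
move=> hl hx; exists (fun z => (f z)%:P%:P); split; [exact/qlaw_law | | exact: hasxpBC].
by move=> z [|i] [|j] // _; rewrite !coefC ?coef0.
Qed.

Lemma QM0_law mu nu m f : QM mu nu m 0 f -> law mu nu m f.
Proof.
move=> [P [h1 h2 h3]]; have := top_law h1 h2 (a := 0) (b := 0) isT => H gam z gG.
have := H gam z gG; rewrite -!(qlaw_val _ h1) => ->; congr (_ * _).
by apply: auto_eq; rewrite ?subr0 // mul0n addn0.
Qed.

Lemma law0 mu nu m : law mu nu m (fun=> 0 : D).
Proof. by move=> gam z _; rewrite mulr0. Qed.

Variables (E1 b1 : fct).
Hypotheses (E1_mob : forall gam z, GL gam -> E1 (mob gam z) = auto 2 0 1 gam z * (E1 z + fps_const (L gam z)))
  (b1_mob : forall gam z, GL gam -> b1 (mob gam z) = auto 1 1 1 gam z * (b1 z + bL gam z))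
  (E1_xp : hasxp E1) (b1_xp : hasxp b1).

(** E1 and b1 are normalised so that L and bL enter their laws with coefficient 1, which makes these
    polynomials monic of degree 1. *)
Definition PE z := tens (1 *: 'X + (E1 z)%:P) 1.
Definition Pb z := tens 1 (1 *: 'X + (b1 z)%:P).

Lemma ev2_lin1 (c x y : D) : ev2 (tens (1 *: 'X + c%:P) 1) x y = c + x.
Proof. by rewrite ev2_tens -polyC1 hornerD hornerZ hornerX !hornerC mul1r mulr1 addrC. Qed.
Lemma ev2_lin2 (c x y : D) : ev2 (tens 1 (1 *: 'X + c%:P)) x y = c + y.
Proof. by rewrite ev2_tens -polyC1 hornerD hornerZ hornerX !hornerC !mul1r addrC. Qed.

Lemma qlaw_E1 : qlaw 2 0 1 PE E1.
Proof. by move=> gam z gG; rewrite (E1_mob _ gG) ev2_lin1. Qed.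
Lemma qlaw_b1 : qlaw 1 1 1 Pb b1.
Proof. by move=> gam z gG; rewrite (b1_mob _ gG) ev2_lin2. Qed.

Lemma hasxp_lin f i : hasxp f -> hasxp (fun z => (1 *: 'X + (f z)%:P)`_i).
Proof.
move=> h; case: i => [|i].
  by apply: hasxp_ext h => z; rewrite coefD coefZ coefX coefC mulr0 add0r.
apply: hasxp_ext (hasxpT (T := (i == 0%N)%:R) _) => [z|].
  by rewrite coefD coefZ coefX coefC addr0 mul1r.
by case: (i == 0%N); [exact: Tpos1 | exact: Tpos0].
Qed.
Lemma hasxp_nat (k : nat) : hasxp (fun=> k%:R).
Proof. by apply: hasxpT; rewrite -(rmorph_nat (@fps_const C)); exact: Tpos_const. Qed.

Lemma hasxpB_PE : hasxpB PE.
Proof.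
move=> i j; apply: hasxp_ext (hasxpM (hasxp_lin i E1_xp) (hasxp_nat (j == 0%N))) => z.
by rewrite coef_tens coef1.
Qed.
Lemma hasxpB_Pb : hasxpB Pb.
Proof.
move=> i j; apply: hasxp_ext (hasxpM (hasxp_nat (i == 0%N)) (hasxp_lin j b1_xp)) => z.
by rewrite coef_tens coef1.
Qed.

Lemma lin_coef0 (x : D) i : (1 < i)%N -> (1 *: 'X + x%:P)`_i = 0.
Proof. by case: i => [|[|i]] // _; rewrite coefD coefZ coefX coefC mulr0 addr0. Qed.

Lemma QM_E1 : QM 2 0 1 1 E1.
Proof.
exists PE; split; [exact: qlaw_E1 | | exact: hasxpB_PE] => z i [|j] ij; rewrite coef_tens coef1 ?mulr0 //.
by rewrite lin_coef0 ?mul0r // -(addn0 i).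
Qed.
Lemma QM_b1 : QM 1 1 1 1 b1.
Proof.
exists Pb; split; [exact: qlaw_b1 | | exact: hasxpB_Pb] => z [|i] j ij; rewrite coef_tens coef1 ?mul0r //.
by rewrite lin_coef0 ?mulr0.
Qed.

(* Subtracting the top coefficients times E^i bE^j lowers the depth. *)
Lemma depth_reduce mu nu m l f : QM mu nu m l.+1 f ->
  exists (c : nat -> nat -> fct) (f' : fct), [/\ QM mu nu m l f',
    forall i j, exists mu' nu' m', QM mu' nu' m' 0 (c i j) &
    forall z, f z = f' z + \sum_(i < l.+2) \sum_(j < l.+2) c i j z * (E1 z ^+ i * b1 z ^+ j)].
Proof.
move=> [P [h1 h2 h3]].
pose c i j z := if (i + j == l.+1)%N then (P z)`_i`_j else 0.
have cl i j : law (mu - (i + i + j)%N%:Z) (nu - j%:Z) (m + (i + j) * q.-2) (c i j).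
  rewrite /c; case: eqP => [e|_]; last exact: law0.
  by apply: (top_law h1 h2); rewrite e.
have cx i j : hasxp (c i j).
  by rewrite /c; case: eqP => _; [exact: h3 | exact: hasxpT (Tpos0 C)].
pose Q z := \sum_(i < l.+2) \sum_(j < l.+2) (c i j z)%:P%:P *
  tens ((1 *: 'X + (E1 z)%:P) ^+ i) ((1 *: 'X + (b1 z)%:P) ^+ j).
pose f1 z := \sum_(i < l.+2) \sum_(j < l.+2) c i j z * (E1 z ^+ i * b1 z ^+ j).
have Ql : qlaw mu nu m Q f1.
  apply: qlaw_sum => i; apply: qlaw_sum => j.
  have H := qlawM ((qlaw_law _ _ _ _).1 (cl i j)) (qlawM (qlawX i qlaw_E1) (qlawX j qlaw_b1)).
  apply: (qlaw_eq _ _ _ _ _ H) => [||||z].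
  - rewrite -(mulr_natr 2) -(mulr_natr 1) !natz; lia.
  - rewrite -(mulr_natr 0) -(mulr_natr 1) !natz; lia.
  - have -> : (m + (i + j) * q.-2 + (1 * i + 1 * j) = (i + j) * q.-1 + m)%N.
      have := card_F_gt1 F; move: (#|F|) => [|[|Q']] //= _; nia.
    by rewrite modnMDl.
  - by [].
  by rewrite tensX.
exists c, (fun z => f z - f1 z); split=> [|i j|z]; last by rewrite subrK.
  exists (fun z => P z - Q z); split; first exact: qlawB.
    move=> z a b lab; have Hc i j : (l.+1 < i + j)%N -> c i j z = 0 by move=> lij; rewrite /c gtn_eqF.
    rewrite !coefB /Q (tens_top (c := fun i j => c i j z) _ _ _ _ Hc lab).
    rewrite !expr1n !mulr1 /c; case: eqP => [_|ne]; first by rewrite subrr.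
    by rewrite h2 ?subr0 //; lia.
  move=> a b; have HQ : hasxp (fun z => (Q z)`_a`_b).
    apply: (hasxp_ext (f := fun z => \sum_(i < l.+2) \sum_(j < l.+2) ((c i j z)%:P%:P * (PE z ^+ i * Pb z ^+ j))`_a`_b)).
      by move=> z; rewrite /Q !coef_sum; apply: eq_bigr => i _; rewrite !coef_sum; apply: eq_bigr => j _; rewrite tensX.
    apply: hasxp_sum => i; apply: hasxp_sum => j.
    by apply: (hasxpBM (hasxpBC (cx i j)) (hasxpBM (hasxpBX i hasxpB_PE) (hasxpBX j hasxpB_Pb))).
  by apply: hasxp_ext (hasxpB_sub (h3 a b) HQ) => z; rewrite !coefB.
by exists (mu - (i + i + j)%N%:Z), (nu - j%:Z), (m + (i + j) * q.-2)%N; exact: QM0.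
Qed.

Lemma QM_Mcal mu nu m f : QM mu nu m 0 f -> Mcal f.
Proof. by move=> h; apply: gen_in; exists mu, nu, (inZp m); exact: QM_almost. Qed.

Lemma QM_gen B mu nu m l f : subalg B -> Mcal `<=` B -> B E1 -> B b1 -> QM mu nu m l f -> B f.
Proof.
move=> hB MB BE Bb; elim: l f => [|l IH] f; first by move/QM_Mcal/MB.
move=> /depth_reduce[c [f' [h1 h2 h3]]].
rewrite (_ : f = fun z => f' z + \sum_(i < l.+2) \sum_(j < l.+2) c i j z * (E1 z ^+ i * b1 z ^+ j)); last exact: funext.
apply: (algD hB (IH _ h1)); apply: (alg_sum _ hB) => i _; apply: (alg_sum _ hB) => j _.
apply: (algM hB); first by have [a [b [d /QM_Mcal/MB]]] := h2 i j.
by apply: (algM hB); exact: algX.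
Qed.

Lemma Mtilde_le B : subalg B -> Mcal `<=` B -> B E1 -> B b1 -> Mtilde `<=` B.
Proof.
move=> hB MB BE Bb; apply: gen_le => // f [mu [nu [m [l /almost_QM]]]]; exact: QM_gen.
Qed.

Local Notation piece := (@weight_type_piece F R C pi).

Lemma pieceP k f : piece k f <-> exists l, QM k.1.1 k.1.2 k.2 l f.
Proof.
split=> [[l /almost_QM h]|[l /QM_almost h]]; exists l => //.
by rewrite (_ : k.2 = inZp k.2) // valZpK.
Qed.

Lemma pieceT T : Tpos T -> piece 0 (fun=> T).
Proof.
move=> hT; apply/pieceP; exists 0%N; apply: QM0 (hasxpT hT) => gam z gG.
by rewrite /= auto1 mul1r.
Qed.

Lemma pieceD k f f' : piece k f -> piece k f' -> piece k (f + f').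
Proof.
move=> /pieceP[l h] /pieceP[l' h']; apply/pieceP; exists (l + l')%N.
exact: QM_D (QM_le (leq_addr _ _) h) (QM_le (leq_addl _ _) h').
Qed.

Lemma pieceM k k' f f' : piece k f -> piece k' f' -> piece (k + k') (f * f').
Proof.
move=> /pieceP[l h] /pieceP[l' h']; apply/pieceP; exists (l + l')%N.
by apply: (QM_eq _ _ _ _ (QM_M h h')) => //; rewrite /= [X in _ = (_ %% X)%N %[mod _]](q2E F) modn_mod.
Qed.

Lemma piece0 k : piece k 0.
Proof.
apply/pieceP; exists 0%N; apply: QM0; first exact: law0.
exact: hasxpT (Tpos0 C).
Qed.

Lemma piece_sum k I (r : seq I) (Q : pred I) (f : I -> fct) : (forall i, Q i -> piece k (f i)) ->
  piece k (\sum_(i <- r | Q i) f i).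
Proof.
by move=> h; elim/big_ind: _ => //; [exact: piece0 | move=> *; exact: pieceD].
Qed.

Lemma graded_Mtilde : graded_by piece Mtilde.
Proof.
split.
- by move=> k f [l h]; apply: gen_in; exists k.1.1, k.1.2, k.2, l.
- exact: pieceT.
- exact: pieceD.
- exact: pieceM.
split; last first.
  move=> s phi us hphi h0 k ks; apply: funext => z.
  have [l hl] := choice (fun k => (pieceP k (phi k)).1 (hphi k)).
  have [P hP] := choice hl.
  have -> : phi k z = (P k z)`_0`_0 by have [h _ _] := hP k; exact: qlaw_val h.
  rewrite (@indep _ _ _ z s (fun k => P k z) us _ k ks) ?coef0 // => gam gG.
  have := congr1 (fun f : fct => f (mob gam z)) h0; rewrite fct_sumE => E; rewrite -[RHS]E.
  by apply: eq_bigr => k' _; have [h _ _] := hP k'; rewrite (h _ _ gG).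
(* Sums indexed by an arbitrary finite type make closure under products immediate; components of
   equal weight and type are merged afterwards by [BP]. *)
pose B : set fct := fun f => exists (I : finType) (k : I -> wt) (p : I -> fct),
  (forall i, piece (k i) (p i)) /\ f = \sum_i p i.
have BP f : B f -> exists (s : seq wt) (phi : wt -> fct), (forall k, piece k (phi k)) /\ f = \sum_(k <- s) phi k.
  move=> [I [k [p [hp ->]]]].
  exists (undup [seq k i | i <- enum I]), (fun k0 => \sum_(i | k i == k0) p i); split.
    by move=> k0; apply: piece_sum => i /eqP <-; exact: hp.
  rewrite (exchange_big_dep predT) //=; apply: eq_bigr => i _.
  have ir : k i \in undup [seq k i | i <- enum I] by rewrite mem_undup map_f ?mem_enum.
  rewrite big_mkcond (bigD1_seq _ ir (undup_uniq _)) //= eqxx big1_seq ?addr0 // => k0 /andP[ne _].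
  by rewrite eq_sym (negPf ne).
move=> f /(gen_le (B := B)) H; apply/BP/H => {f H}.
  split=> [T hT|f g [I [k [p [hp ->]]]] [I' [k' [p' [hp' ->]]]]|f g [I [k [p [hp ->]]]] [I' [k' [p' [hp' ->]]]]].
  - exists unit, (fun=> 0), (fun=> fun=> T); split=> [_|]; first exact: pieceT.
    by rewrite (big_pred1 tt) // => -[].
  - exists (I + I')%type, (fun i => match i with inl i => k i | inr i => k' i end),
      (fun i => match i with inl i => p i | inr i => p' i end); split; first by case.
    by rewrite big_sumType.
  exists (I * I')%type, (fun i => k i.1 + k' i.2), (fun i => p i.1 * p' i.2); split; first by move=> i; exact: pieceM.
  by rewrite big_distrlr /= pair_bigA.
move=> f [mu [nu [m [l h]]]]; exists unit, (fun=> (mu, nu, m)), (fun=> f); split=> [_|]; first by exists l.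
by rewrite (big_pred1 tt) // => -[].
Qed.
End Structure.

(** * The generators g, h, s_2, E and bE *)

Section Concrete.
Variables (F : finFieldType) (R : realType) (C : cinf F R).
Local Notation ab := (@absC F R C).
Local Notation q := (#|F|).
Local Notation inA := (@embA F R C).
Local Notation theta := (@theta F R C).
Local Notation D := (fps C).
Local Notation Om := (Omega C).
Local Notation Tpos := (@Tpos F R C).
Local Notation s2 := (@s2 F R C).
Local Notation GL := (@GL2A F).
Local Notation tw := (@twist F R C 1).
Local Notation wt := (int * int * typeZ F)%type.
Local Notation fct := (Om -> D).
Local Notation subalg := (@subalgebra F R C).
Local Notation gen := (@generated F R C).
Implicit Types (z : Om) (f : fct) (B S : set fct).
Variable pi : C.
Hypothesis hpi : carlitz_period pi.
Variables g Delta h : Om -> C.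
Hypothesis hgD : drinfeld_module_coeffs pi g Delta.
Hypothesis hh : is_h pi h.
Local Notation xp := (@xp F R C pi).
Local Notation hasxp := (@hasxp F R C pi).
Local Notation Mcal := (@Mcal F R C pi).
Local Notation cg := (fun z => fps_const (g z)).
Local Notation ch := (fun z => fps_const (h z)).
Local Notation s2V := (fun z => (s2 z)^-1).

Lemma law_QM_Mcal mu nu m f : law mu nu m f -> hasxp f -> Mcal f.
Proof. by move=> hl hx; exact: (QM_Mcal (QM0 hl hx)). Qed.

Lemma gens_Mcal : gen [set cg; ch; s2] `<=` Mcal.
Proof.
apply: gen_le; first exact: gen_alg.
move=> _ [[->|->]|->].
- by apply: (law_QM_Mcal (law_g hpi hgD)); have [c hc _] := xp_g hpi hgD; exists c.
- by apply: (law_QM_Mcal (law_h hh)); have [c hc _] := xp_h hpi hh; exists c.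
by apply: (law_QM_Mcal (@law_s2 F R C)); have [c hc _] := xp_s2_ex hpi; exists c.
Qed.

Lemma law_gen B mu (nu : nat) m c f : subalg B -> B cg -> B ch -> B s2 ->
  xp c f -> law mu nu m f -> B f.
Proof.
move=> hB Bg Bh Bs hx hl.
have [||s [hs e]] := elim hpi hgD hh (n := (absz (mu + nu)).+1) (k := 0) hx hl.
- by [].
- by have := card_F_gt1 F; move: (mu + nu) (#|F|) => x Q; nia.
rewrite (_ : f = fun z => \sum_(p <- s | p \in s) p.2 * mon g h nu p.1.1 p.1.2 z); last first.
  by apply: funext => z; rewrite e big_seq.
apply: (alg_sum _ hB) => p /hs[hT _ _ _]; apply: (algT hB hT).
by apply: (algM hB); [apply: (algM hB) |]; exact: algX.
Qed.

(** If nu is negative, a power of s_2 makes it nonnegative, and undoing the multiplication is where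
    the inverse of s_2 enters. *)
Lemma Mcal_gens B : subalg B -> B cg -> B ch -> B s2 -> B s2V -> Mcal `<=` B.
Proof.
move=> hB Bg Bh Bs Bv; apply: gen_le => // f [mu [nu [m /(almost_QM hpi) H]]].
have hl := QM0_law H; have [c hc] := QM_val H.
case: nu hl {H} => n hl; first exact: law_gen hc hl.
have [cs hs _] := xp_s2_ex hpi.
have l1 : law ((-1) *+ n.+1 + mu) 0%N (0 * n.+1 + m) (fun z => s2 z ^+ n.+1 * f z).
  have := lawM (lawX n.+1 (@law_s2 F R C)) hl; apply: law_eq => //.
  by rewrite NegzE -(mulr_natr 1) natz; lia.
have Bf := law_gen hB Bg Bh Bs (xpM (xpX _ hs) hc) l1.
rewrite (_ : f = fun z => (s2 z)^-1 ^+ n.+1 * (s2 z ^+ n.+1 * f z)).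
  by apply: (algM hB) => //; exact: (algX _ hB Bv).
by apply: funext => z; rewrite mulrA -exprMn mulVr ?s2_unit // expr1n mul1r.
Qed.

(** This is - pi E ([E1_cE]). *)
Definition E1 z : D := fps_const (Vlim z).
Lemma E1_mob gam z : GL gam -> E1 (mob gam z) = auto 2 0 1 gam z * (E1 z + fps_const (L gam z)).
Proof.
move=> gG; rewrite /E1 (Vlim_mob _ gG) /auto expr0z mulr1 -(rmorphD (@fps_const C)).
by rewrite -!(rmorphM (@fps_const C)).
Qed.

Lemma cE_E1 z : fps_const (false_eisenstein pi z) = fps_const (- pi^-1) * E1 z.
Proof. by rewrite (E_Vlim hpi) /E1 -(rmorphM (@fps_const C)) mulNr. Qed.
Lemma E1_cE z : E1 z = fps_const (- pi) * fps_const (false_eisenstein pi z).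
Proof. by rewrite cE_E1 mulrA -(rmorphM (@fps_const C)) mulrNN divff ?pi_neq0 // mul1r. Qed.

Lemma E1_xp : hasxp E1.
Proof.
have q0 := qR_gt0 F R; have [Es hEs hE] := E_series hpi.
have h1 : cvf q%:R (fps_const (- pi) * Es) by exact: (cvfM (ltW q0) (cvf_const _ (ltW q0)) hEs).
exists (Fps (fun m => fps_const (coef (fps_const (- pi) * Es) m))).
apply: (xp_cl q0 h1) => [N M|z a|z zr]; first exact: appr_Vlim.
  rewrite translateE (Vlim_mob _ (GL_T a)) det_Tmx rmorph1 J_T expr1n invr1 !mul1r.
  by rewrite /L !mx2E rmorph0 mul0r addr0.
rewrite (evalM (ltW q0) zr (cvf_const _ (ltW q0)) hEs) eval_const -hE // (E_Vlim hpi).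
by rewrite mulrNN mulrA divff ?pi_neq0 // mul1r.
Qed.

Section WithKappa.
Variables (kappa : C) (X : D).
Hypotheses (k0 : kappa != 0) (hD : forall z, Delta z = kappa * h z ^+ q.-1)
  (hX : Tpos X) (X0 : coef X 0 != 0) (hXl : forall z, legendre pi h z = X).
Local Notation bE := (bE pi h Delta).
Local Notation kap := (pi ^+ q / kappa).

(** bE rescaled by the constant found in [bE_mob], a unit of T_>0 because X has nonzero constant
    term. *)
Definition b1 z : D := (fps_const kap * X)^-1 * bE z.

Lemma kap_neq0 : kap != 0.
Proof. by rewrite mulf_neq0 ?invr_eq0 // expf_neq0 // pi_neq0. Qed.

Lemma kX_unit : fps_const kap * X \is a GRing.unit.
Proof. by rewrite fps_unitE coef_constM mulf_neq0 // kap_neq0. Qed.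

Lemma kX_Tpos : Tpos (fps_const kap * X).
Proof. by apply: TposM => //; exact: Tpos_const. Qed.

Lemma bE_b1 z : bE z = fps_const kap * X * b1 z.
Proof. by rewrite /b1 mulrA divrr ?mul1r // kX_unit. Qed.

Lemma b1_mob gam z : GL gam -> b1 (mob gam z) = auto 1 1 1 gam z * (b1 z + bL gam z).
Proof.
move=> gG; rewrite {1}/b1 (bE_mob hpi hgD hh k0 hD z hXl gG) bE_b1 -mulrDr mulrCA; congr (_ * _).
by rewrite mulrA mulVr ?kX_unit // mul1r.
Qed.

Lemma tw_s2_xp : hasxp (fun z => tw (s2 z)).
Proof.
have [S hS] := elat_series hpi; set r := q%:R * ab pi in hS.
have r1 : 1 <= r by rewrite /r; apply: mulr_ege1; apply: ltW; [exact: qR_gt1 | exact: ab_pi_gt1].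
have r0 : 0 <= r by exact: le_trans ler01 r1.
have S1 i : bnd 1 r (S i) by have [h1 _ _] := hS i; apply: bnd_leM r0 _ h1; exact: qV_le1.
exists (Fps (fun m => Fps (fun i => coef (S i ^+ (q ^ 1)) m))).
apply: (xp_family (S := fun i => S i ^+ (q ^ 1)) r1) => [i|i z zr]; have [h1 _ h3] := hS i; first exact: bndX.
by rewrite (h3 z zr) (evalX _ r0 zr (cvf_bnd (S1 i))).
Qed.

Lemma b1_xp : hasxp b1.
Proof.
have TV : Tpos ((fps_const kap * X)^-1).
  by apply: (TposV kX_Tpos); rewrite -fps_unitE kX_unit.
have TW : Tpos (((fX C - fps_const theta) * sCar pi)^-1).
  apply: TposV; first by apply: TposM; [exact: tmt_Tpos | exact: sCar_Tpos].
  by rewrite -fps_unitE unitrM tmt_unit sCar_unit.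
have [ch' hch _] := xp_h hpi hh.
have H := hasxpM (hasxpT pi (TposM TV TW)) (hasxpM (hasxpT pi (Tpos_const kap)) (hasxpM (ex_intro (fun c => xp c ch) _ hch) tw_s2_xp)).
apply: hasxp_ext H => z; rewrite /b1 (bE_eq hpi hgD k0 hD) (rmorphM (@fps_const C) _ (h z)).
have ac (a b c d e : D) : a * b * (c * (d * e)) = a * (c * d * e * b) by ring.
exact: ac.
Qed.

Lemma sum_part (V : nmodType) (T K : eqType) (r : seq T) (k : T -> K) (G : T -> V) :
  \sum_(k0 <- undup [seq k t | t <- r]) \sum_(t <- r | k t == k0) G t = \sum_(t <- r) G t.
Proof.
rewrite (exchange_big_dep predT) //= !big_seq; apply: eq_bigr => t tr.
have ir : k t \in undup [seq k i | i <- r] by rewrite mem_undup map_f.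
rewrite big_mkcond (bigD1_seq _ ir (undup_uniq _)) //= eqxx big1_seq ?addr0 // => k1 /andP[ne _].
by rewrite eq_sym (negPf ne).
Qed.

Lemma xp_sum I (r : seq I) (c : I -> fps D) (f : I -> fct) : (forall t, xp (c t) (f t)) ->
  xp (\sum_(t <- r) c t) (fun z => \sum_(t <- r) f t z).
Proof.
move=> H; elim: r => [|t r IH].
  rewrite big_nil -(rmorph0 (@fps_const D)).
  by apply: xp_ext (xp_const pi (Tpos0 C)) => z; rewrite big_nil.
by rewrite big_cons; apply: xp_ext (xpD (H t) IH) => z; rewrite big_cons.
Qed.

(* Order at infinity separates the monomials of a given weight, the leading coefficients being units
   at t = 0. *)
Lemma mon_indep (T : eqType) (r : seq T) (c : T -> D) (e2 e3 e4 : T -> nat) : uniq r ->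
  (forall t, Tpos (c t)) -> {in r &, injective e3} ->
  (forall z, \sum_(t <- r) c t * (fps_const (g z) ^+ e2 t * fps_const (h z) ^+ e3 t * s2 z ^+ e4 t) = 0) ->
  forall t, t \in r -> c t = 0.
Proof.
move=> ur hc inj H; have [Cg xg g0] := xp_g hpi hgD; have [Ch xh [h0 h1]] := xp_h hpi hh.
have [Cs xs s0] := xp_s2_ex hpi.
pose cc t := fps_const (c t) * (Cg ^+ e2 t * Ch ^+ e3 t * Cs ^+ e4 t).
have xcc t : xp (cc t) (fun z => c t * (fps_const (g z) ^+ e2 t * fps_const (h z) ^+ e3 t * s2 z ^+ e4 t)).
  by apply: xpM (xp_const pi (hc t)) _; apply: xpM (xpX _ xs); exact: xpM (xpX _ xg) (xpX _ xh).
have S0 := xp_uniq hpi (xp_sum r xcc) H.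
have occ t : ordge (e3 t) (cc t) /\ coef (cc t) (e3 t) = c t * (coef (Ch ^+ e3 t) (e3 t) * coef Cs 0 ^+ e4 t).
  have [o1 v1] := ordgeX (e3 t) h0.
  have [o2 v2] := ordgeM (ordge0 (Cg ^+ e2 t)) o1.
  have [o3 v3] := ordgeM o2 (ordge0 (Cs ^+ e4 t)).
  have [o4 v4] := ordgeM (ordge0 (fps_const (c t))) o3.
  rewrite !add0n addn0 in o4 v4 v3 v2.
  by rewrite v4 v3 v2 coef_const eqxx !coef0_exp g0 expr1n mul1r.
move=> t tr; have [n] := ubnP (e3 t); elim: n t tr => // n IH t tr tn.
have := congr1 (fun f : fps D => coef f (e3 t)) S0; rewrite fcoef_sum (bigD1_seq t) // big1_seq ?addr0.
  have [_ ->] := occ t; rewrite fcoef0 => E0.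
  have /eqP : c t * (coef (Ch ^+ e3 t) (e3 t) * coef Cs 0 ^+ e4 t) + 0 = 0 by exact: E0.
  rewrite addr0 mulf_eq0 => /orP[/eqP //|].
  have [_ ->] := ordgeX (e3 t) h0; rewrite h1 mulf_eq0 expf_eq0 => /orP[/andP[_]|].
    by rewrite -(rmorph0 (@fps_const C)) (inj_eq (@fps_const_inj C)) oppr_eq0 oner_eq0.
  rewrite expf_eq0 s0 => /andP[_ /eqP E].
  by have := sigma_coef0 C; rewrite E fcoef0 eqxx.
move=> t' /andP[tt t'r]; have [lt|lt|E] := ltngtP (e3 t') (e3 t).
- by rewrite /cc (IH t') ?rmorph0 ?mul0r ?fcoef0 //; exact: leq_trans lt tn.
- by have [o _] := occ t'; exact: o.
by case/eqP: tt; apply: inj.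
Qed.

Lemma mulrn_int (x : int) k : x *+ k = x * k%:Z.
Proof. by rewrite -mulr_natr natz. Qed.

Local Notation PE := (PE E1).
Local Notation Pb := (Pb b1).

(** [indep] separates weights and types, and [dens2] separates the powers of E1 and b1 as if they
    were free variables. With these fixed, the weight determines the exponents of s_2 and g from
    that of h, so [mon_indep] applies. *)
Lemma mono_indep (T : eqType) (r : seq T) (c : T -> D) (e0 e1 e2 e3 e4 : T -> nat) : uniq r ->
  (forall t, Tpos (c t)) ->
  (forall t t', t \in r -> t' \in r -> e0 t = e0 t' -> e1 t = e1 t' -> e2 t = e2 t' ->
     e3 t = e3 t' -> e4 t = e4 t' -> t = t') ->
  (forall z, \sum_(t <- r) c t * (E1 z ^+ e0 t * b1 z ^+ e1 t *
     (fps_const (g z) ^+ e2 t * fps_const (h z) ^+ e3 t * s2 z ^+ e4 t)) = 0) ->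
  forall t, t \in r -> c t = 0.
Proof.
move=> ur hc inj H t0 t0r.
pose G t z := fps_const (g z) ^+ e2 t * fps_const (h z) ^+ e3 t * s2 z ^+ e4 t.
pose kz t : int := (2 * e0 t + e1 t + q.-1 * e2 t + q.+1 * e3 t)%N%:Z - (e4 t)%:Z.
pose k t : wt := (kz t, (e1 t + e4 t)%N%:Z, inZp (e0 t + e1 t + e3 t)%N).
pose Pt t z := (c t * G t z)%:P%:P * (PE z ^+ e0 t * Pb z ^+ e1 t).
pose f t z := c t * G t z * (E1 z ^+ e0 t * b1 z ^+ e1 t).
have ql t : qlaw (k t).1.1 (k t).1.2 (k t).2 (Pt t) (f t).
  have lG := law_scale (c t) (lawM (lawM (lawX (e2 t) (law_g hpi hgD)) (lawX (e3 t) (law_h hh))) (lawX (e4 t) (@law_s2 F R C))).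
  have H1 := qlawM ((qlaw_law _ _ _ _).1 lG) (qlawM (qlawX (e0 t) (qlaw_E1 E1_mob)) (qlawX (e1 t) (qlaw_b1 b1_mob))).
  apply: (qlaw_eq _ _ _ _ _ H1) => //=.
  - by rewrite /kz !mulrn_int; move: (q.-1) (q.+1) => Q Q'; lia.
  - by rewrite !mulrn_int; lia.
  rewrite [X in _ = (_ %% X)%N %[mod _]](q2E F) modn_mod; congr (_ %% _)%N; lia.
pose n := (\max_(t <- r) (e0 t + e1 t)).+1.
have en t : t \in r -> (e0 t < n)%N /\ (e1 t < n)%N.
  move=> tr; have : (e0 t + e1 t < n)%N by rewrite ltnS; exact: (leq_bigmax_seq (F := fun t => (e0 t + e1 t)%N)).
  by lia.
pose r1 := [seq t <- r | [&& k t == k t0, e0 t == e0 t0 & e1 t == e1 t0]].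
apply: (@mon_indep T r1 c e2 e3 e4) => //; last first.
- by rewrite mem_filter !eqxx.
- move=> z; pose s := undup [seq k t | t <- r].
  have Pk0 : \sum_(t <- r | k t == k t0) Pt t z = 0.
    apply: (@indep _ _ _ z s (fun k0 => \sum_(t <- r | k t == k0) Pt t z)); first exact: undup_uniq.
      move=> gam gG; have E := H (mob gam z); rewrite -[RHS]E -(sum_part r k).
      apply: eq_bigr => k1 _; rewrite ev2_sum mulr_sumr; apply: eq_bigr => t /eqP <-.
      by rewrite -(ql t gam z gG) /f /G mulrAC -mulrA mulrC; ring.
    by rewrite mem_undup map_f.
  have [a0 b0] := en _ t0r.
  have := @dens2 F R C n (fun a b => \sum_(t <- r) (if (e0 t == a) && (e1 t == b) then (if k t == k t0 then c t * G t z else 0) else 0)) 0 1 0 1 (oner_neq0 _) (oner_neq0 _) _ _ _ a0 b0.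
  move=> dn; rewrite big_filter big_mkcond; have E := dn _; rewrite -[RHS]E => {E}.
    apply: eq_bigr => t _; case: (k t == k t0) => /=; last by rewrite if_same.
    by [].
  move=> e _; rewrite add0r mul1r add0r mul1r.
  rewrite (@box_sum F R C T r n e0 e1 (fun t => if k t == k t0 then c t * G t z else 0)); last exact: en.
  (* Evaluation at L = e(theta) - E1 and bL = e(t) - b1 turns the two linear polynomials into
     e(theta) and e(t), as [dens2] requires. *)
  have := congr1 (fun P => ev2 P (fps_const (inA e) - E1 z) (bar C e - b1 z)) Pk0.
  rewrite ev2_sum /ev2 !horner0 => E; rewrite -[RHS]E [RHS]big_mkcond; apply: eq_bigr => t _.
  case: (k t == k t0); last by rewrite !mul0r.
  rewrite -/(ev2 _ _ _) /Pt !ev2M ev2C.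
  have evX (P : {poly {poly D}}) x y m : ev2 (P ^+ m) x y = ev2 P x y ^+ m by rewrite /ev2 !horner_exp.
  by rewrite !evX /PE /Pb ev2_lin1 ev2_lin2 !subrKC mulrA.
- move=> t t'; rewrite !mem_filter => /andP[/and3P[/eqP kt /eqP a0 /eqP a1] tr] /andP[/and3P[/eqP kt' /eqP a0' /eqP a1'] t'r] a3.
  have kk : k t = k t' by rewrite kt kt'.
  have kk2 : (e1 t + e4 t)%N%:Z = (e1 t' + e4 t')%N%:Z by have := congr1 (fun k : wt => k.1.2) kk.
  have a4 : e4 t = e4 t' by move: kk2; rewrite a1 a1'; lia.
  have kk1 : kz t = kz t' by have := congr1 (fun k : wt => k.1.1) kk.
  have a2 : e2 t = e2 t'.
    move: kk1; rewrite /kz a0 a0' a1 a1' a3 a4; have := card_F_gt1 F; move: (#|F|) => [|[|Q]] //= _; nia.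
  by apply: inj => //; rewrite ?a0 ?a0' ?a1 ?a1'.
exact: filter_uniq.
Qed.

End WithKappa.
End Concrete.

(** * Counting monomials: the upper bound for dimensions *)

Section LinearDependence.
Variables (F : finFieldType) (R : realType) (C : cinf F R).
Local Notation D := (fps C).
Local Notation Tpos := (@Tpos F R C).

(** Gaussian elimination by cross-multiplication with a nonzero pivot of column 0; without divisions
    the coefficients stay in T_>0. *)
Lemma lin_dep N : forall M (A : 'I_M -> 'I_N -> D), (N < M)%N -> (forall i j, Tpos (A i j)) ->
  exists l : 'I_M -> D, [/\ forall i, Tpos (l i), exists i, l i != 0 &
    forall j, \sum_i l i * A i j = 0].
Proof.
elim: N => [|N IH] [|M] A // NM hA.
  exists (fun=> 1); split=> [_||[]//]; first exact: Tpos1.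
  by exists ord0; exact: oner_neq0.
have [[p Ap]|none] := pselect (exists p, A p ord0 != 0).
  pose B i j := A p ord0 * A (lift p i) (lift ord0 j) - A (lift p i) ord0 * A p (lift ord0 j).
  have [|mu [h1 [i0 h2] h3]] := IH M B NM; first by move=> i j; apply: TposB; exact: TposM.
  pose l i := if unlift p i is Some j then A p ord0 * mu j else - \sum_j mu j * A (lift p j) ord0.
  have lp : l p = - \sum_j mu j * A (lift p j) ord0 by rewrite /l unlift_none.
  have ll i : l (lift p i) = A p ord0 * mu i by rewrite /l liftK.
  exists l; split=> [i||j].
  - rewrite /l; case: (unlift p i) => [j|]; first exact: TposM.
    by apply/TposN/Tpos_sum => j _; exact: TposM.
  - by exists (lift p i0); rewrite ll mulf_neq0.
  rewrite (bigD1_ord p) // (eq_bigr (fun i => A p ord0 * mu i * A (lift p i) j)) => [|i _]; last by rewrite ll.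
  rewrite lp; suff key : - (\sum_j mu j * A (lift p j) ord0) * A p j + \sum_(i < M) A p ord0 * mu i * A (lift p i) j = 0 by exact: key.
  rewrite mulNr mulr_suml -sumrN -big_split /=.
  case: (unliftP ord0 j) => [j' ->|->]; last by rewrite big1 // => i _; ring.
  by have E := h3 j'; rewrite -[RHS]E; apply: eq_bigr => i _; rewrite /B; ring.
have A0 p : A p ord0 = 0 by apply/eqP; apply: contraT => Ap; case: none; exists p.
have [|mu [h1 [i0 h2] h3]] := IH M (fun i j => A (lift ord0 i) (lift ord0 j)) NM; first by move=> i j.
pose l i := if unlift ord0 i is Some j then mu j else 0.
have lp : l ord0 = 0 by rewrite /l unlift_none.
have ll i : l (lift ord0 i) = mu i by rewrite /l liftK.
exists l; split=> [i||j].
- by rewrite /l; case: (unlift ord0 i) => [j|]; [exact: h1 | exact: Tpos0].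
- by exists (lift ord0 i0); rewrite ll.
case: (unliftP ord0 j) => [j' ->|->]; last by rewrite big1 // => i _; rewrite A0 mulr0.
suff key : \sum_(i < M) l (lift ord0 i) * A (lift ord0 i) (lift ord0 j') = 0.
  by rewrite (bigD1_ord ord0) // lp mul0r; exact: (etrans (add0r _) key).
have E := h3 j'; rewrite -[RHS]E.
by apply: eq_bigr => i _; rewrite ll.
Qed.

Lemma lin_depF (T1 T2 : finType) (A : T1 -> T2 -> D) : (#|T2| < #|T1|)%N -> (forall i j, Tpos (A i j)) ->
  exists l : T1 -> D, [/\ forall i, Tpos (l i), exists i, l i != 0 &
    forall j, \sum_i l i * A i j = 0].
Proof.
move=> lt hA; have [//|l [h1 [i0 h2] h3]] := lin_dep (A := fun i j => A (enum_val i) (enum_val j)) lt.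
exists (fun i => l (enum_rank i)); split=> [i||j]; first exact: h1.
  by exists (enum_val i0); rewrite enum_valK.
have E := h3 (enum_rank j); rewrite -[RHS]E [RHS](reindex (@enum_rank T1)); last exact: onW_bij (enum_rank_bij T1).
by apply: eq_bigr => i _; rewrite !enum_rankK.
Qed.

Lemma leq_exp2 m n e : (m <= n)%N -> (m ^ e <= n ^ e)%N.
Proof. by move=> mn; elim: e => // e IH; rewrite !expnS leq_mul. Qed.

Local Notation Om := (Omega C).
Local Notation fct := (Om -> D).
Local Notation s2 := (@s2 F R C).
Variables (d : nat) (y : 'I_d -> fct) (i0 : 'I_d).
Hypothesis y0 : forall z, y i0 z = s2 z.
Local Notation expo := {ffun 'I_d -> nat}.
Implicit Types (z : Om) (e : expo) (f : fct).

Definition monom e z := \prod_i y i z ^+ e i.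
Definition eadd e e' : expo := [ffun i => e i + e' i]%N.
Definition eone i k : expo := [ffun j => if j == i then k else 0%N].

Lemma monom_add e e' z : monom (eadd e e') z = monom e z * monom e' z.
Proof. by rewrite /monom -big_split; apply: eq_bigr => i _; rewrite ffunE exprD. Qed.
Lemma monom_one i k z : monom (eone i k) z = y i z ^+ k.
Proof.
rewrite /monom (bigD1 i) //= ffunE eqxx big1 ?mulr1 // => j ji.
by rewrite ffunE (negPf ji) expr0.
Qed.

(** N records the power of s_2 in the denominator and M the size of the exponents; both add under
    products. *)
Definition sp N M f := exists r : seq (D * expo),
  (forall p, p \in r -> Tpos p.1 /\ forall i, (p.2 i <= M)%N) /\
  forall z, s2 z ^+ N * f z = \sum_(p <- r) p.1 * monom p.2 z.

Lemma sp_one T e N M f : Tpos T -> (forall i, (e i <= M)%N) ->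
  (forall z, s2 z ^+ N * f z = T * monom e z) -> sp N M f.
Proof.
move=> hT he h; exists [:: (T, e)]; split=> [p|z]; last by rewrite big_seq1.
by rewrite inE => /eqP ->.
Qed.

Lemma sp_le N M N' M' f : (N <= N')%N -> (M + (N' - N) <= M')%N -> sp N M f -> sp N' M' f.
Proof.
move=> NN MM [r [h1 h2]]; set k := (N' - N)%N in MM.
exists [seq (p.1, eadd p.2 (eone i0 k)) | p <- r]; split=> [_ /mapP[p /h1[hT he] ->]|z].
  split=> // i; rewrite /= !ffunE; apply: leq_trans MM; apply: leq_add => //; by case: ifP.
rewrite -(subnK NN) -/k exprD -mulrA h2 big_map mulr_sumr; apply: eq_bigr => p _ /=.
by rewrite monom_add monom_one y0 mulrCA [_ * monom _ _]mulrC.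
Qed.

Lemma sp_D N M f f' : sp N M f -> sp N M f' -> sp N M (fun z => f z + f' z).
Proof.
move=> [r [h1 h2]] [r' [h1' h2']]; exists (r ++ r'); split=> [p|z].
  by rewrite mem_cat => /orP[/h1|/h1'].
by rewrite mulrDr h2 h2' big_cat.
Qed.

Lemma sp_M N M f N' M' f' : sp N M f -> sp N' M' f' -> sp (N + N') (M + M') (fun z => f z * f' z).
Proof.
move=> [r [h1 h2]] [r' [h1' h2']].
exists [seq (p.1 * p'.1, eadd p.2 p'.2) | p <- r, p' <- r']; split=> [_ /allpairsP[[p p'] /= [/h1[a b] /h1'[a' b'] ->]]|z].
  by split=> [|i]; [exact: TposM | rewrite ffunE leq_add].
rewrite exprD mulrACA h2 h2' big_distrlr big_allpairs_dep; apply: eq_bigr => p _; apply: eq_bigr => p' _ /=.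
by rewrite monom_add mulrACA.
Qed.

Lemma sp_T T : Tpos T -> sp 0 0 (fun=> T).
Proof.
move=> hT; apply: (sp_one (e := eone i0 0) hT) => [i|z]; first by rewrite ffunE if_same.
by rewrite monom_one !expr0 mulr1 mul1r.
Qed.

Definition spx : set fct := fun f => exists N M, sp N M f.

Lemma spx_alg : subalgebra spx.
Proof.
split=> [T hT|f f' [N [M h]] [N' [M' h']]|f f' [N [M h]] [N' [M' h']]].
- by exists 0%N, 0%N; exact: sp_T.
- exists (N + N')%N, (M + M' + (N + N'))%N.
  by apply: sp_D; [apply: sp_le h | apply: sp_le h']; lia.
by exists (N + N')%N, (M + M')%N; exact: sp_M.
Qed.

Lemma spx_y i : spx (y i).
Proof.
exists 0%N, 1%N; apply: (sp_one (e := eone i 1) (Tpos1 C)) => [j|z]; first by rewrite ffunE; case: ifP.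
by rewrite monom_one expr0 !mul1r.
Qed.

Lemma spx_s2V : spx (fun z => (s2 z)^-1).
Proof.
exists 1%N, 0%N; apply: (sp_one (e := eone i0 0) (Tpos1 C)) => [j|z]; first by rewrite ffunE if_same.
by rewrite monom_one expr0 mulr1 expr1 mulrV // s2_unit.
Qed.

Lemma sp_X N M f k : sp N M f -> sp (N * k) (M * k) (fun z => f z ^+ k).
Proof.
move=> h; elim: k => [|k IH]; first by rewrite !muln0; exact: sp_T (Tpos1 C).
by have := sp_M h IH; rewrite !mulnS; under eq_fun do rewrite -exprS.
Qed.

Lemma sp_prod N M I (r : seq I) (f : I -> fct) (a : I -> nat) : (forall i, sp N M (f i)) ->
  sp (N * \sum_(i <- r) a i) (M * \sum_(i <- r) a i) (fun z => \prod_(i <- r) f i z ^+ a i).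
Proof.
move=> h; elim: r => [|i r IH].
  rewrite big_nil !muln0; have := sp_T (Tpos1 C).
  by congr sp; apply: funext => z; rewrite big_nil.
have := sp_M (sp_X (a i) (h i)) IH; rewrite -!mulnDr big_cons.
by congr sp; apply: funext => z; rewrite big_cons.
Qed.

Import (canonicals) mpoly.

(* With more functions than generators, there are more monomials of large bounded degree in the
   former than in the latter. *)
Lemma dim_le n (f : 'I_n -> fct) : (forall i, spx (f i)) -> alg_independent f -> (n <= d)%N.
Proof.
move=> h hind; rewrite leqNgt; apply/negP => dn.
have [N hN] := choice h; have [M hM] := choice hN.
pose N0 := (\sum_i N i)%N; pose M0 := (\sum_i M i + N0)%N.
have hf i : sp N0 M0 (f i).
  apply: sp_le (hM i); first by rewrite /N0 (bigD1 i) //= leq_addr.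
  by rewrite /M0 (bigD1 i) //= -addnA; apply: leq_add => //; rewrite (leq_trans (leq_subr _ _)) ?leq_addl.
(* After multiplication by a common power of s_2, the K^n products of powers f_i^(a_i) with a_i < K
   lie in the span of (c K + 1)^d <= (c + 1)^d K^d monomials. As n > d, taking K > (c + 1)^d leaves
   fewer monomials than products. *)
pose c := ((M0 + N0) * n)%N; pose K := ((c.+1 ^ d).+1)%N.
have hP (a : {ffun 'I_n -> 'I_K}) : sp (N0 * (n * K)) (c * K) (fun z => \prod_i f i z ^+ a i).
  have Sa : (\sum_i a i <= n * K)%N.
    rewrite -[n in X in (_ <= X)%N](card_ord n) -sum_nat_const; apply: leq_sum => i _; exact: ltnW.
  apply: sp_le (sp_prod (index_enum _) (fun i => nat_of_ord (a i)) hf); first by rewrite leq_mul2l Sa orbT.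
  rewrite /c -mulnA mulnDl leq_add ?leq_mul2l ?Sa ?orbT //; exact: leq_subr.
have [r hr] := choice hP.
pose el (e : {ffun 'I_d -> 'I_(c * K).+1}) : expo := [ffun i => nat_of_ord (e i)].
pose AA (a : {ffun 'I_n -> 'I_K}) (e : {ffun 'I_d -> 'I_(c * K).+1}) := \sum_(p <- r a | (p \in r a) && (p.2 == el e)) p.1.
have AT a (e : {ffun 'I_d -> 'I_(c * K).+1}) : Tpos (AA a e) by apply: Tpos_sum => p /andP[/(hr a).1[]].
have card : (#|{ffun 'I_d -> 'I_(c * K).+1}| < #|{ffun 'I_n -> 'I_K}|)%N.
  rewrite !card_ffun !card_ord; apply: (@leq_trans (K ^ d.+1)); last by rewrite leq_pexp2l.
  apply: (@leq_ltn_trans ((c.+1 * K) ^ d)); first by apply: leq_exp2; rewrite mulSn -add1n leq_add.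
  by rewrite expnMn expnS ltn_pmul2r ?expn_gt0.
have [l [lT [a0 la0] hl]] := lin_depF card AT.
pose mk (a : {ffun 'I_n -> 'I_K}) : mpoly.multinom n := mpoly.Multinom [tuple (a i : nat) | i < n].
have mkE a i : mpoly.fun_of_multinom (mk a) i = a i by exact: (mpoly.mnmE (fun i => a i : nat) i).
have mk_inj : injective mk.
  by move=> a b ab; apply/ffunP => i; apply: val_inj; rewrite /= -!mkE ab.
pose P := \sum_a l a *: mpoly.mpolyX D (mk a).
have mP m : mpoly.mcoeff m P = \sum_a l a * (mk a == m)%:R.
  by rewrite /P raddf_sum; apply: eq_bigr => a _; rewrite /= mpoly.mcoeffZ mpoly.mcoeffX.
have PT m : Tpos (mpoly.mcoeff m P).
  rewrite mP; apply: Tpos_sum => a _; apply: TposM => //.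
  by case: eqP => _; [exact: Tpos1 | exact: Tpos0].
have P0 := hind P PT.
have := congr1 (mpoly.mcoeff (mk a0)) (P0 _).
rewrite mP mpoly.mcoeffC mul0r (bigD1 a0) //= eqxx mulr1 big1 ?addr0; last first.
  by move=> a aa; rewrite (inj_eq mk_inj) (negPf aa) mulr0.
move=> H; have /eqP := la0; apply; apply: H => z.
rewrite /P raddf_sum; apply: (mulrI (unitrX (N0 * (n * K)) (s2_unit z))); rewrite mulr0 mulr_sumr.
transitivity (\sum_a \sum_e l a * AA a e * monom (el e) z).
  apply: eq_bigr => a _; rewrite /= mpoly.mevalZ mpoly.mevalX mulrCA.
  have -> : \prod_(i < n) f i z ^+ mpoly.fun_of_multinom (mk a) i = \prod_i f i z ^+ a i.
    by apply: eq_bigr => i _; rewrite mkE.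
  rewrite ((hr a).2 z) mulr_sumr; under [RHS]eq_bigr => e _ do rewrite -mulrA /AA mulr_suml mulr_sumr.
  rewrite (exchange_big_dep (fun p => p \in r a)) => [|e p _ /andP[]//] /=.
  rewrite big_seq_cond [RHS]big_seq_cond; apply: congr_big => // [p|p]; first by rewrite andbT andbb.
  rewrite andbT => pr; have [_ pb] := (hr a).1 p pr.
  rewrite (big_pred1 [ffun i => inord (p.2 i)]) => [|e].
    by congr (_ * (_ * monom _ _)); apply/ffunP => i; rewrite !ffunE inordK // ltnS.
  rewrite pr /=; apply/eqP/eqP => [->|->]; apply/ffunP => i; rewrite !ffunE ?inordK ?ltnS //.
  by rewrite inord_val.
rewrite exchange_big big1 // => e _; rewrite -mulr_suml.
by have E := hl e; rewrite E mul0r.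
Qed.

End LinearDependence.

(** * The two algebras and their dimensions *)

Section Main.
Variables (F : finFieldType) (R : realType) (C : cinf F R).
Local Notation q := (#|F|).
Local Notation D := (fps C).
Local Notation Om := (Omega C).
Local Notation Tpos := (@Tpos F R C).
Local Notation s2 := (@s2 F R C).
Local Notation fct := (Om -> D).
Local Notation gen := (@generated F R C).
Implicit Types (z : Om) (f : fct) (B S : set fct).
Variable pi : C.
Hypothesis hpi : carlitz_period pi.
Variables g Delta h : Om -> C.
Hypothesis hgD : drinfeld_module_coeffs pi g Delta.
Hypothesis hh : is_h pi h.
Local Notation Mcal := (@Mcal F R C pi).
Local Notation Mtilde := (@Mtilde F R C pi).
Local Notation cg := (fun z => fps_const (g z)).
Local Notation ch := (fun z => fps_const (h z)).
Local Notation cE := (fun z => fps_const (false_eisenstein pi z)).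
Variables (kappa : C) (X : D).
Hypotheses (k0 : kappa != 0) (hD : forall z, Delta z = kappa * h z ^+ q.-1)
  (hX : Tpos X) (X0 : coef X 0 != 0) (hXl : forall z, legendre pi h z = X).
Local Notation bE := (bE pi h Delta).
Local Notation E1 := (@E1 F R C).
Local Notation b1 := (b1 pi Delta h kappa X).
Import (canonicals) mpoly.

Lemma Mcal_Mtilde : Mcal `<=` Mtilde.
Proof.
apply: gen_le; first exact: gen_alg.
by move=> f [mu [nu [m hf]]]; apply: gen_in; exists mu, nu, m, 0%N.
Qed.

Lemma Mtilde_E1 : Mtilde E1.
Proof.
apply: gen_in; exists 2, 0, (inZp 1), 1%N; apply: QM_almost => //.
exact: (QM_E1 (@E1_mob F R C) (E1_xp hpi)).
Qed.
Lemma Mtilde_b1 : Mtilde b1.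
Proof.
apply: gen_in; exists 1, 1, (inZp 1), 1%N; apply: QM_almost => //.
exact: (QM_b1 (b1_mob hpi hgD hh k0 hD X0 hXl) (b1_xp hpi hgD hh k0 hD hX X0)).
Qed.

Lemma Mtilde_gen : Mtilde = gen (Mcal `|` [set cE; bE]).
Proof.
have gA := gen_alg (Mcal `|` [set cE; bE]).
apply/seteqP; split.
  apply: (Mtilde_le hpi (@E1_mob F R C) (b1_mob hpi hgD hh k0 hD X0 hXl) (E1_xp hpi) (b1_xp hpi hgD hh k0 hD hX X0)) => //.
  - by move=> f Mf; apply: gen_in; left.
  - rewrite (_ : E1 = fun z => fps_const (- pi) * cE z); last by apply: funext => z; exact: E1_cE.
    by apply: (algT gA (Tpos_const _)); apply: gen_in; right; left.
  apply: (@algT _ _ _ _ _ bE gA); last by apply: gen_in; right; right.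
  apply: (TposV (kX_Tpos pi kappa hX)); rewrite -fps_unitE; exact: kX_unit.
apply: gen_le; first exact: gen_alg.
move=> f [/Mcal_Mtilde //|[->|->]].
  rewrite (_ : cE = fun z => fps_const (- pi^-1) * E1 z); last by apply: funext => z; exact: cE_E1.
  exact: (algT (gen_alg _) (Tpos_const _) Mtilde_E1).
rewrite (_ : bE = fun z => fps_const (pi ^+ q / kappa) * X * b1 z); last by apply: funext => z; exact: bE_b1.
exact: (algT (gen_alg _) (kX_Tpos pi kappa hX) Mtilde_b1).
Qed.

Definition y5 (i : 'I_5) : fct := nth (fun=> 0) [:: E1; b1; cg; ch; s2] i.
Definition y3 (i : 'I_3) : fct := nth (fun=> 0) [:: cg; ch; s2] i.

Lemma ord_ind (n : nat) (Q : 'I_n.+1 -> Prop) : Q ord0 -> (forall i, Q (lift ord0 i)) -> forall i, Q i.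
Proof. by move=> h0 hl i; case: (unliftP ord0 i) => [j ->|->]. Qed.

Lemma y5_indep : alg_independent y5.
Proof.
move=> P hP H; apply/mpoly.mpolyP => m; rewrite mpoly.mcoeffC mul0r.
have [mP|] := boolP (m \in mpoly.msupp P); last exact: mpoly.memN_msupp_eq0.
pose e (i : 'I_5) m := mpoly.fun_of_multinom m i.
pose o1 : 'I_5 := lift ord0 ord0; pose o2 : 'I_5 := lift ord0 (lift ord0 ord0).
pose o3 : 'I_5 := lift ord0 (lift ord0 (lift ord0 ord0)).
pose o4 : 'I_5 := lift ord0 (lift ord0 (lift ord0 (lift ord0 ord0))).
apply: (mono_indep hpi hgD hh k0 hD X0 hXl (r := mpoly.msupp P) (c := fun m => mpoly.mcoeff m P)
  (e0 := e ord0) (e1 := e o1) (e2 := e o2) (e3 := e o3) (e4 := e o4) _ _ _ _ mP) => //.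
  move=> t t' _ _ h0 h1 h2 h3 h4; apply/mpoly.mnmP.
  by do 5 (apply: ord_ind => //); case.
move=> z; have E := H z; rewrite mpoly.mevalE in E; rewrite -[RHS]E; apply: eq_bigr => t _.
transitivity (mpoly.mcoeff t P * (E1 z ^+ e ord0 t * (b1 z ^+ e o1 t *
  (fps_const (g z) ^+ e o2 t * (fps_const (h z) ^+ e o3 t * s2 z ^+ e o4 t))))).
  have ac (a b c d x y : D) : a * (b * c * (d * x * y)) = a * (b * (c * (d * (x * y)))) by rewrite !mulrA.
  exact: ac.
by rewrite !big_ord_recl big_ord0 mulr1.
Qed.

Lemma y3_indep : alg_independent y3.
Proof.
move=> P hP H; apply/mpoly.mpolyP => m; rewrite mpoly.mcoeffC mul0r.
have [mP|] := boolP (m \in mpoly.msupp P); last exact: mpoly.memN_msupp_eq0.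
pose e (i : 'I_3) m := mpoly.fun_of_multinom m i.
pose o1 : 'I_3 := lift ord0 ord0; pose o2 : 'I_3 := lift ord0 (lift ord0 ord0).
apply: (mono_indep hpi hgD hh k0 hD X0 hXl (r := mpoly.msupp P) (c := fun m => mpoly.mcoeff m P)
  (e0 := fun=> 0%N) (e1 := fun=> 0%N) (e2 := e ord0) (e3 := e o1) (e4 := e o2) _ _ _ _ mP) => //.
  move=> t t' _ _ _ _ h2 h3 h4; apply/mpoly.mnmP.
  by do 3 (apply: ord_ind => //); case.
move=> z; have E := H z; rewrite mpoly.mevalE in E; rewrite -[RHS]E; apply: eq_bigr => t _.
transitivity (mpoly.mcoeff t P * (fps_const (g z) ^+ e ord0 t * (fps_const (h z) ^+ e o1 t * s2 z ^+ e o2 t))).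
  have ac (a b c d : D) : a * (1 * 1 * (b * c * d)) = a * (b * (c * d)) by rewrite !mul1r !mulrA.
  exact: ac.
by rewrite !big_ord_recl big_ord0 mulr1.
Qed.

(** The lower bound comes from the inclusion of g, h, s_2, the upper one from the other inclusion,
    since [spx] admits powers of s_2 as denominators. *)
Lemma dim_Mcal : has_dimension Mcal 3.
Proof.
split.
  exists y3; split; last exact: y3_indep.
  by do 3 (apply: ord_ind; first by apply: (gens_Mcal hpi hgD hh); apply: gen_in; rewrite /y3 /=; do ?[by right | left]); case.
move=> n f hf; apply: (@dim_le F R C 3 y3 ord_max) => // i; apply: (Mcal_gens hpi hgD hh) (hf i).
- exact: (@spx_alg F R C 3 y3 ord_max).
- exact: (@spx_y F R C 3 y3 ord0).
- exact: (@spx_y F R C 3 y3 (lift ord0 ord0)).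
- exact: (@spx_y F R C 3 y3 ord_max).
exact: (@spx_s2V F R C 3 y3 ord_max).
Qed.

Lemma dim_Mtilde : has_dimension Mtilde 5.
Proof.
have hg : gen [set cg; ch; s2] `<=` Mtilde by move=> f /(gens_Mcal hpi hgD hh) /Mcal_Mtilde.
split.
  exists y5; split; last exact: y5_indep.
  apply: ord_ind; first exact: Mtilde_E1.
  apply: ord_ind; first exact: Mtilde_b1.
  by do 3 (apply: ord_ind; first by apply: hg; apply: gen_in; rewrite /y5 /=; do ?[by right | left]); case.
move=> n f hf; apply: (@dim_le F R C 5 y5 ord_max) => // i; have := hf i.
have A5 := @spx_alg F R C 5 y5 ord_max (fun z => erefl).
apply: (Mtilde_le hpi (@E1_mob F R C) (b1_mob hpi hgD hh k0 hD X0 hXl) (E1_xp hpi) (b1_xp hpi hgD hh k0 hD hX X0) A5).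
- apply: (Mcal_gens hpi hgD hh A5).
  + exact: (@spx_y F R C 5 y5 (lift ord0 (lift ord0 ord0))).
  + exact: (@spx_y F R C 5 y5 (lift ord0 (lift ord0 (lift ord0 ord0)))).
  + exact: (@spx_y F R C 5 y5 ord_max).
  exact: (@spx_s2V F R C 5 y5 ord_max).
- exact: (@spx_y F R C 5 y5 ord0).
exact: (@spx_y F R C 5 y5 (lift ord0 ord0)).
Qed.
End Main.

Theorem theorem4p1 (F : finFieldType) (R : realType) (C : cinf F R)
    (pi : C) (hpi : carlitz_period pi)
    (g Delta h : Omega C -> C)
    (hgD : drinfeld_module_coeffs pi g Delta) (hh : is_h pi h) :
  let cg : Omega C -> fps C := fun z => fps_const (g z) in
  let ch : Omega C -> fps C := fun z => fps_const (h z) in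
  let cE : Omega C -> fps C := fun z => fps_const (false_eisenstein pi z) in
  let s2V : Omega C -> fps C := fun z => (s2 z)^-1 in
  graded_by (@weight_type_piece F R C pi) (Mtilde pi) /\
  has_dimension (Mtilde pi) 5 /\
  Mtilde pi = generated (Mcal pi `|` [set cE; bE pi h Delta]) /\
  generated [set cg; ch; @s2 F R C] `<=` Mcal pi /\
  Mcal pi `<=` generated [set cg; ch; @s2 F R C; s2V] /\
  has_dimension (Mcal pi) 3.
Proof.
have [kappa k0 hD] := Delta_h hpi hgD hh.
have [X hX [X0 hXl]] := legendre_const hpi hgD hh k0 hD.
move=> cg ch cE s2V; split; first exact: (graded_Mtilde hpi).
split; first exact: (dim_Mtilde hpi hgD hh k0 hD hX X0 hXl).
split; first exact: (Mtilde_gen hpi hgD hh k0 hD hX X0 hXl).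
split; first exact: (gens_Mcal hpi hgD hh).
split; last exact: (dim_Mcal hpi hgD hh k0 hD X0 hXl).
by apply: (Mcal_gens hpi hgD hh (gen_alg _)); apply: gen_in; do ?[by right | left].
Qed.
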